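(* Let $X$ be a locally compact Hadamard space and let $G$ be a totally disconnected topological group acting continuously, properly and cocompactly by isometries on $X$. Then any amenable subgroup of $G$ has a finite index subgroup which fixes a point in $X \cup \partial_\infty^{\mathrm{fine}} X$. Conversely, given any point $x \in X \cup \partial_\infty^{\mathrm{fine}} X$, the stabilizer $G_x$ is amenable.
   Context: A Hadamard space is a complete $\mathrm{CAT}(0)$ space. The action of $G$ on $X$ is proper if for every compact $C \subset X$ the set $\{g \in G : gC \cap C \neq \varnothing\}$ is compact (in particular $G$ is then locally compact); it is cocompact if $X/G$ is compact. A (not necessarily closed) subgroup of $G$ is amenable if, endowed with the induced topology, every continuous affine action of it on a nonempty compact convex subset of a locally convex Hausdorff topological vector space has a fixed point. For a $\mathrm{CAT}(0)$ space $Y$, $\partial_\infty Y$ denotes the visual boundary (equivalence classes of asymptotic geodesic rays). For $\xi \in \partial_\infty Y$, let $Y^*_\xi$ be the set of geodesic rays of $Y$ pointing towards $\xi$, with the pseudo-distance $d(\rho,\rho') = \inf_{t,t' \geq 0} d(\rho(t),\rho'(t'))$, and let $Y_\xi$ be the metric completion of the quotient of $Y^*_\xi$ identifying rays at distance $0$. The space $Y_\xi$ is a complete $\mathrm{CAT}(0)$ space. Any isometry of $Y$ fixing $\xi$ permutes the rays pointing towards $\xi$ and hence induces an isometry of $Y_\xi$. Define iteratively $X_{\xi_1,\dots,\xi_i} = (X_{\xi_1,\dots,\xi_{i-1}})_{\xi_i}$ for $\xi_1 \in \partial_\infty X$ and $\xi_i \in \partial_\infty X_{\xi_1,\dots,\xi_{i-1}}$.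 The refined visual boundary $\partial_\infty^{\mathrm{fine}} X$ is the set of all finite sequences $(\xi_1,\dots,\xi_k,x)$, $k \geq 1$, with $\xi_1 \in \partial_\infty X$, $\xi_{i+1} \in \partial_\infty X_{\xi_1,\dots,\xi_i}$ for $i=1,\dots,k-1$, and $x \in X_{\xi_1,\dots,\xi_k}$. An element $g \in G$ fixes $(\xi_1,\dots,\xi_k,x)$ if $g$ fixes $\xi_1$, the isometry of $X_{\xi_1}$ induced by $g$ fixes $\xi_2$, and so on, and finally the isometry of $X_{\xi_1,\dots,\xi_k}$ induced by $g$ fixes $x$. The stabilizer $G_x$ of a point of $X \cup \partial_\infty^{\mathrm{fine}} X$ is the subgroup of all elements of $G$ fixing it. *)

(* Defs.v *)
From HB Require Import structures.
From mathcomp Require Import all_boot all_order all_algebra.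
From mathcomp Require Import all_classical reals topology normedtype tvs convex.
From mathcomp Require Import generic_quotient lra ring.

Set Implicit Arguments.
Unset Strict Implicit.
Unset Printing Implicit Defensive.

Import Order.TTheory GRing.Theory Num.Theory.
Import numFieldNormedType.Exports.

Local Open Scope classical_set_scope.
Local Open Scope quotient_scope.
Local Open Scope ring_scope.

Section CAT0.
Context {R : realType}.

Definition euclid_dist (p q : R * R) : R :=
  Num.sqrt ((p.1 - q.1) ^+ 2 + (p.2 - q.2) ^+ 2).

Definition euclid_seg (p q : R * R) (l : R) : R * R :=
  ((1 - l) * p.1 + l * q.1, (1 - l) * p.2 + l * q.2).

Context (Y : metricType R).

(* Only the restriction of c to [0, mdist x y] is relevant. *)
Definition geodesic (c : R -> Y) (x y : Y) : Prop :=
  [/\ c 0 = x, c (mdist x y) = y &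
      forall s t : R, 0 <= s <= mdist x y -> 0 <= t <= mdist x y ->
        mdist (c s) (c t) = `|s - t|].

(* Two points of a geodesic triangle lie on two sides with a common vertex,
   called p here; (p', q', r') is a comparison triangle in the plane. *)
Definition cat0 : Prop :=
  (forall x y, exists c, geodesic c x y) /\
  (forall (p q r : Y) (c c' : R -> Y), geodesic c p q -> geodesic c' p r ->
   forall p' q' r' : R * R,
     euclid_dist p' q' = mdist p q ->
     euclid_dist p' r' = mdist p r ->
     euclid_dist q' r' = mdist q r ->
   forall l m : R, 0 <= l <= 1 -> 0 <= m <= 1 ->
     mdist (c (l * mdist p q)) (c' (m * mdist p r))
     <= euclid_dist (euclid_seg p' q' l) (euclid_seg p' r' m)).

Definition cauchy_seq (u : nat -> Y) : Prop :=
  forall e : R, 0 < e ->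
    exists N, forall m n, (N <= m)%N -> (N <= n)%N -> mdist (u m) (u n) < e.

Definition hadamard : Prop :=
  [/\ inhabited Y, cat0 &
      forall u : nat -> Y, cauchy_seq u -> exists x : Y, u @ \oo --> x].

(* Geodesic rays, as functions whose values at negative times are irrelevant. *)
Definition is_ray : set (R -> Y) :=
  [set rho | forall s t : R, 0 <= s -> 0 <= t -> mdist (rho s) (rho t) = `|s - t|].

Definition ray : Type := is_ray.
HB.instance Definition _ := Choice.on ray.

Definition ray_fun (rho : ray) : R -> Y := val rho.
Coercion ray_fun : ray >-> Funclass.

Definition asymptotic (rho rho' : ray) : Prop :=
  exists K : R, forall t : R, 0 <= t -> mdist (rho t) (rho' t) <= K.

Definition ray_dist (rho rho' : ray) : R :=
  inf [set d | exists t t' : R, [/\ 0 <= t, 0 <= t' & d = mdist (rho t) (rho' t')]].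

Lemma asymptotic_refl : reflexive (fun rho rho' => `[< asymptotic rho rho' >]).
Proof. by move=> rho; apply/asboolP; exists 0 => t _; rewrite mdistxx. Qed.

Lemma asymptotic_sym : symmetric (fun rho rho' => `[< asymptotic rho rho' >]).
Proof.
by move=> rho rho'; apply/asboolP/asboolP => -[K h]; exists K => t /h;
  rewrite metric_sym.
Qed.

Lemma asymptotic_trans :
  transitive (fun rho rho' => `[< asymptotic rho rho' >]).
Proof.
move=> r2 r1 r3 /asboolP[K h] /asboolP[K' h']; apply/asboolP; exists (K + K').
by move=> t t0; rewrite (le_trans (metric_triangle _ (r2 t) _))// lerD ?h ?h'.
Qed.

Canonical asymptotic_equiv :=
  EquivRel _ asymptotic_refl asymptotic_sym asymptotic_trans.

Definition boundary : Type := {eq_quot asymptotic_equiv}.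
HB.instance Definition _ := Quotient.on boundary.
HB.instance Definition _ := Choice.on boundary.

Definition endpoint (rho : ray) : boundary := \pi rho.

Definition rays_to (xi : boundary) : Type := [set rho | endpoint rho = xi].
HB.instance Definition _ xi := Choice.on (rays_to xi).

Definition rays_to_dist (xi : boundary) (rho rho' : rays_to xi) : R :=
  ray_dist (val rho) (val rho').

End CAT0.

Section transverse_distance.
Context {R : realType}.
Implicit Type Y : metricType R.

Lemma euclid_triangle (a b c : R) : 0 <= a -> 0 <= b -> 0 <= c ->
  a <= b + c -> b <= a + c -> c <= a + b ->
  exists p q r : R * R,
    [/\ euclid_dist p q = a, euclid_dist p r = b & euclid_dist q r = c].
Proof.
move=> a0 b0 c0 abc bac cab; have [az|an0] := eqVneq a 0.
  have -> : c = b by lra.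
  rewrite az.
  exists (0, 0), (0, 0), (b, 0); rewrite /euclid_dist /= !subrr !sub0r.
  by rewrite expr0n /= addr0 sqrtr0 sqrrN addr0 sqrtr_sqr ger0_norm.
pose x := (a ^+ 2 + b ^+ 2 - c ^+ 2) / (2 * a).
have ax : 2 * a * x = a ^+ 2 + b ^+ 2 - c ^+ 2 by rewrite /x; field.
have apos : 0 < a by rewrite lt0r an0.
have xb : x <= b by nra.
have bx : - b <= x by nra.
have h : 0 <= b ^+ 2 - x ^+ 2 by nra.
exists (0, 0), (a, 0), (x, Num.sqrt (b ^+ 2 - x ^+ 2)).
rewrite /euclid_dist /= !sub0r !sqrrN sqr_sqrtr // expr0n /= addr0.
rewrite sqrtr_sqr ger0_norm // addrC subrK sqrtr_sqr ger0_norm //; split => //.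
rewrite (_ : (a - x) ^+ 2 + (b ^+ 2 - x ^+ 2) = c ^+ 2); last by nra.
by rewrite sqrtr_sqr ger0_norm.
Qed.

Lemma euclid_dist_seg (p q r : R * R) (l : R) : 0 <= l ->
  euclid_dist (euclid_seg p q l) (euclid_seg p r l) = l * euclid_dist q r.
Proof.
move=> l0; rewrite /euclid_dist /euclid_seg /=.
rewrite -[in RHS](ger0_norm l0) -sqrtr_sqr -sqrtrM ?sqr_ge0 //.
by congr Num.sqrt; ring.
Qed.

Lemma cat0_thales Y (p q r : Y) (c c' : R -> Y) (l : R) : cat0 Y ->
  geodesic c p q -> geodesic c' p r -> 0 <= l <= 1 ->
  mdist (c (l * mdist p q)) (c' (l * mdist p r)) <= l * mdist q r.
Proof.
move=> [_ catY] gc gc' l01.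
have [||||||p' [q' [r' [pq pr qr]]]] :=
  @euclid_triangle (mdist p q) (mdist p r) (mdist q r);
  rewrite ?mdist_ge0 //.
- by rewrite [mdist q r]metric_sym metric_triangle.
- exact: metric_triangle.
- by rewrite [mdist p q]metric_sym metric_triangle.
apply: le_trans (catY _ _ _ _ _ gc gc' _ _ _ pq pr qr _ _ l01 l01) _.
by rewrite euclid_dist_seg ?qr //; case/andP: l01.
Qed.

Lemma geodesic_rev Y (c : R -> Y) (x y : Y) :
  geodesic c x y -> geodesic (fun t => c (mdist x y - t)) y x.
Proof.
move=> [c0 c1 ciso]; split; rewrite ?subr0 // ?[mdist y x]metric_sym ?subrr //.
move=> s t hs ht; rewrite ciso; [|lra|lra].
by rewrite distrC; congr `|_|; ring.
Qed.

Lemma ray_geodesic Y (rho : ray Y) (a T : R) : 0 <= a -> 0 <= T ->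
  mdist (rho a) (rho (a + T)) = T /\
  geodesic (fun t => rho (a + t)) (rho a) (rho (a + T)).
Proof.
move=> a0 T0; have rhoP : is_ray rho by exact: set_valP.
have E : mdist (rho a) (rho (a + T)) = T.
  by rewrite rhoP ?addr_ge0 // opprD addNKr normrN ger0_norm.
split => //; split; rewrite ?addr0 ?E // => s t /andP[s0 _] /andP[t0 _].
by rewrite rhoP ?addr_ge0 //; congr `|_|; ring.
Qed.

(* Asymptotic rays of a CAT(0) space get closer. *)
Lemma asymptotic_decr Y (rho rho' : ray Y) (a b s : R) : cat0 Y ->
  asymptotic rho rho' -> 0 <= a -> 0 <= b -> 0 <= s ->
  mdist (rho (a + s)) (rho' (b + s)) <= mdist (rho a) (rho' b).
Proof.
move=> catY [K hK] a0 b0 s0.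
have ray'P : is_ray rho' by exact: set_valP.
pose B := `|K| + `|a - b|.
have hB T : 0 <= T -> mdist (rho (a + T)) (rho' (b + T)) <= B.
  move=> T0; apply: le_trans (metric_triangle _ (rho' (a + T)) _) _.
  apply: lerD; first by rewrite (le_trans (hK _ _)) ?addr_ge0 // ler_norm.
  by rewrite ray'P ?addr_ge0 // opprD addrACA subrr addr0.
have B0 : 0 <= B by rewrite addr_ge0.
apply/ler_addgt0Pr => e e0.
pose T := s * B / e + s + 1.
have seB : 0 <= s * B / e by rewrite divr_ge0 ?mulr_ge0 // ltW.
have T0 : 0 < T by rewrite /T; lra.
pose l := s / T.
have lT : l * T = s by rewrite /l divfK ?gt_eqF.
have l01 : 0 <= l <= 1.
  by rewrite divr_ge0 ?(ltW T0) //= ler_pdivrMr // mul1r /T; lra.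
have l01' : 0 <= 1 - l <= 1 by lra.
have lB : l * B <= e.
  rewrite /l mulrAC ler_pdivrMr // -ler_pdivrMl // mulrC /T; lra.
have [E g] := ray_geodesic rho a0 (ltW T0).
have [E' g'] := ray_geodesic rho' b0 (ltW T0).
have [geo _] := catY; have [c gc] := geo (rho a) (rho' (b + T)).
have := cat0_thales catY g gc l01; rewrite E lT => h1.
have := cat0_thales catY (geodesic_rev g') (geodesic_rev gc) l01'.
rewrite ![mdist (rho' (b + T)) _]metric_sym E' => h2.
rewrite (_ : b + (T - (1 - l) * T) = b + s) in h2; last by rewrite -lT; ring.
set L := mdist (rho a) (rho' (b + T)) in h1 h2.
rewrite (_ : L - (1 - l) * L = l * L) in h2; last by ring.
rewrite [mdist (rho' _) _]metric_sym [mdist (rho' b) _]metric_sym in h2.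
have := metric_triangle (rho (a + s)) (c (l * L)) (rho' (b + s)).
have := hB _ (ltW T0).
have := mdist_ge0 (rho a) (rho' b).
nra.
Qed.

Let dists Y (rho rho' : ray Y) : set R :=
  [set d | exists t t' : R, [/\ 0 <= t, 0 <= t' & d = mdist (rho t) (rho' t')]].

Let has_inf_dists Y (rho rho' : ray Y) : has_inf (dists rho rho').
Proof.
split; first by exists (mdist (rho 0) (rho' 0)), 0, 0.
by exists 0 => _ [t [t' [_ _ ->]]]; exact: mdist_ge0.
Qed.

Lemma ray_dist_triangle Y (r1 r2 r3 : ray Y) : cat0 Y ->
  asymptotic r1 r2 -> asymptotic r2 r3 ->
  ray_dist r1 r3 <= ray_dist r1 r2 + ray_dist r2 r3.
Proof.
move=> catY as12 as23; apply/ler_addgt0Pr => e e0.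
have e2 : 0 < e / 2 by rewrite divr_gt0.
have [_ [a [b [a0 b0 ->]]] h12] := inf_adherent e2 (has_inf_dists r1 r2).
have [_ [b' [c [b'0 c0 ->]]] h23] := inf_adherent e2 (has_inf_dists r2 r3).
rewrite -/(ray_dist r1 r2) in h12; rewrite -/(ray_dist r2 r3) in h23.
pose m := Num.max b b'.
have bm : 0 <= m - b by rewrite subr_ge0 le_max lexx.
have b'm : 0 <= m - b' by rewrite subr_ge0 le_max lexx orbT.
have := asymptotic_decr catY as12 a0 b0 bm.
have := asymptotic_decr catY as23 b'0 c0 b'm.
rewrite ![_ + (m - _)]addrC !subrK => h h'.
have : ray_dist r1 r3 <= mdist (r1 (m - b + a)) (r3 (m - b' + c)).
  apply: ge_inf; first by case: (has_inf_dists r1 r3).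
  by exists (m - b + a), (m - b' + c); split => //; rewrite addr_ge0.
have := metric_triangle (r1 (m - b + a)) (r2 m) (r3 (m - b' + c)).
lra.
Qed.

Definition pseudo_metric (T : Type) (d : T -> T -> R) : Prop :=
  [/\ forall x, d x x = 0, forall x y, d x y = d y x &
      forall y x z, d x z <= d x y + d y z].

Lemma rays_to_pseudo_metric Y (xi : boundary Y) :
  cat0 Y -> pseudo_metric (@rays_to_dist _ _ xi).
Proof.
move=> catY.
have asy (x y : rays_to xi) : asymptotic (val x) (val y).
  apply/asboolP; have : endpoint (val x) = endpoint (val y).
    by rewrite (set_valP x : endpoint _ = _) (set_valP y : endpoint _ = _).
  by move/eqP; rewrite /endpoint eqmodE.
split=> [x|x y|y x z]; last exact: ray_dist_triangle.
- apply/eqP; rewrite eq_le; apply/andP; split.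
    apply: ge_inf; first by case: (has_inf_dists (val x) (val x)).
    by exists 0, 0; rewrite mdistxx.
  apply: lb_le_inf; first by case: (has_inf_dists (val x) (val x)).
  by move=> _ [t [t' [_ _ ->]]]; exact: mdist_ge0.
- rewrite /rays_to_dist /ray_dist; congr inf; apply/seteqP; split=> _ [t [t' [t0 t'0 ->]]];
    by exists t', t; rewrite metric_sym.
Qed.

End transverse_distance.


Section metric_identification.
Context {R : realType} (T : choiceType) (d : T -> T -> R).
Context (dP : pseudo_metric d).

Let eqd : rel T := fun x y => `[< d x y = 0 >].

Let d_ge0 x y : 0 <= d x y.
Proof.
by case: dP => dxx dC dD; have := dD y x x; rewrite dxx (dC y x); lra.
Qed.

Lemma ident_refl : reflexive eqd.
Proof. by case: dP => dxx _ _ x; apply/asboolP. Qed.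

Lemma ident_sym : symmetric eqd.
Proof. by case: dP => _ dC _ x y; rewrite /eqd dC. Qed.

Lemma ident_trans : transitive eqd.
Proof.
case: dP => _ _ dD y x z /asboolP xy /asboolP yz; apply/asboolP.
by have := dD y x z; have := d_ge0 x z; rewrite xy yz; lra.
Qed.

Canonical ident_equiv := EquivRel _ ident_refl ident_sym ident_trans.

(* The metric space obtained by identifying the points at distance 0. *)
Definition ident : Type := {eq_quot ident_equiv}.
HB.instance Definition _ := Quotient.on ident.
HB.instance Definition _ := Choice.on ident.

Definition ident_dist (A B : ident) : R := d (repr A) (repr B).

Lemma d_repr (x : T) : d (repr (\pi_ident x)) x = 0.
Proof.
have /eqP := reprK (\pi_ident x); rewrite eqmodE => h; exact/asboolP.
Qed.

Lemma ident_distE (x y : T) : ident_dist (\pi x) (\pi y) = d x y.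
Proof.
case: dP => _ dC dD; rewrite /ident_dist.
set x' := repr _; set y' := repr _.
have dx : d x' x = 0 by exact: d_repr.
have dy : d y' y = 0 by exact: d_repr.
have := dD x x' y'; have := dD y x y'; have := dD x' x y; have := dD y' x' y.
by rewrite (dC x x') (dC y y') dx dy; lra.
Qed.

Lemma ident_distxx x : ident_dist x x = 0.
Proof. by case: dP => dxx _ _; exact: dxx. Qed.

Lemma ident_dist_eq0 x y : ident_dist x y = 0 -> x = y.
Proof.
rewrite -(reprK x) -(reprK y) ident_distE => xy.
by apply/eqP; rewrite eqmodE; apply/asboolP.
Qed.

Lemma ident_distC x y : ident_dist x y = ident_dist y x.
Proof. by case: dP => _ dC _; exact: dC. Qed.

Lemma ident_distD y x z : ident_dist x z <= ident_dist x y + ident_dist y z.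
Proof. by case: dP => _ _ dD; exact: dD. Qed.

HB.instance Definition _ := isMetric.Build R ident
  ident_distxx ident_dist_eq0 ident_distC ident_distD.

End metric_identification.

Section completion.
Context {R : realType} (M : metricType R).

Definition cauchy_seqs : Type := [set u : nat -> M | cauchy_seq u].
HB.instance Definition _ := Choice.on cauchy_seqs.

Definition limit_dist (u v : cauchy_seqs) : R :=
  limn (fun n => mdist (val u n) (val v n)).

Lemma cvg_limit_dist (u v : cauchy_seqs) :
  (fun n => mdist (val u n) (val v n)) @ \oo --> limit_dist u v.
Proof.
have [hu hv] := (set_valP u, set_valP v) => /=.
apply/cauchy_cvgP/cauchyP => e e0.
have e2 : 0 < e / 2 by rewrite divr_gt0.
have [N hN] := hu _ e2; have [N' hN'] := hv _ e2.
pose m := maxn N N'; exists (mdist (val u m) (val v m)).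
exists m => // n /= mn; rewrite /ball /=.
have := hN m n (leq_maxl _ _) (leq_trans (leq_maxl _ _) mn).
have := hN' m n (leq_maxr _ _) (leq_trans (leq_maxr _ _) mn).
have := metric_triangle (val u m) (val u n) (val v m).
have := metric_triangle (val u n) (val v n) (val v m).
have := metric_triangle (val u n) (val u m) (val v n).
have := metric_triangle (val u m) (val v m) (val v n).
rewrite (metric_sym (val u n) (val u m)) (metric_sym (val v n) (val v m)).
by move=> *; rewrite ltr_distl; apply/andP; split; lra.
Qed.

Lemma limit_dist_pseudo_metric : pseudo_metric limit_dist.
Proof.
split=> [u|u v|v u w].
- by rewrite /limit_dist; under eq_fun do rewrite mdistxx; rewrite lim_cst.
- by rewrite /limit_dist; under eq_fun do rewrite metric_sym.
- have h := cvgD (@cvg_limit_dist u v) (@cvg_limit_dist v w).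
  apply: (ler_cvg_to (@cvg_limit_dist u w) (h _)).
  by near=> n; exact: metric_triangle.
Unshelve. all: by end_near. Qed.

(* Cauchy sequences, identified when their limit distance is 0. *)
Definition completion : metricType R := ident limit_dist_pseudo_metric.

End completion.

Section isometries.
Context {R : realType}.
Implicit Type Y : metricType R.

Record isometry (Y : metricType R) : Type := Isometry {
  isom_fun :> Y -> Y;
  isom_dist : forall x y, mdist (isom_fun x) (isom_fun y) = mdist x y;
  isom_surj : forall y, exists x, isom_fun x = y }.

Lemma ray_map_subproof Y (f : isometry Y) (rho : ray Y) :
  (fun t => f (rho t)) \in @is_ray _ Y.
Proof.
by apply/mem_set => s t s0 t0; rewrite isom_dist; exact: (set_valP rho).
Qed.

Definition ray_map Y (f : isometry Y) (rho : ray Y) : ray Y :=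
  SigSub (ray_map_subproof f rho).

Definition boundary_map Y (f : isometry Y) (xi : boundary Y) : boundary Y :=
  endpoint (ray_map f (repr xi)).

Lemma endpointP Y (rho rho' : ray Y) :
  endpoint rho = endpoint rho' <-> asymptotic rho rho'.
Proof.
split; first by move/eqP; rewrite eqmodE => /asboolP.
by move=> h; apply/eqP; rewrite eqmodE; apply/asboolP.
Qed.

Lemma asymptotic_ray_map Y (f : isometry Y) (rho rho' : ray Y) :
  asymptotic (ray_map f rho) (ray_map f rho') <-> asymptotic rho rho'.
Proof.
by split=> -[K h]; exists K => t /h; rewrite /ray_fun /= isom_dist.
Qed.

Lemma boundary_map_endpoint Y (f : isometry Y) (rho : ray Y) :
  boundary_map f (endpoint rho) = endpoint (ray_map f rho).
Proof.
apply/endpointP/asymptotic_ray_map/endpointP; exact: reprK.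
Qed.

Section rays_to_map.
Variables (Y : metricType R) (f : isometry Y) (xi : boundary Y).
Hypothesis fxi : boundary_map f xi = xi.

Lemma rays_to_map_subproof (rho : rays_to xi) :
  ray_map f (val rho) \in [set rho | endpoint rho = xi].
Proof.
apply/mem_set => /=; rewrite -boundary_map_endpoint.
by rewrite (set_valP rho : endpoint _ = _).
Qed.

Definition rays_to_map (rho : rays_to xi) : rays_to xi :=
  SigSub (rays_to_map_subproof rho).

Lemma rays_to_map_dist (rho rho' : rays_to xi) :
  rays_to_dist (rays_to_map rho) (rays_to_map rho') = rays_to_dist rho rho'.
Proof.
rewrite /rays_to_dist /ray_dist; congr inf; apply/seteqP.
by split=> _ [t [t' [t0 t'0 ->]]]; exists t, t';
  rewrite /ray_fun /= isom_dist.
Qed.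

Lemma rays_to_map_surj (rho : rays_to xi) : exists s, rays_to_map s = rho.
Proof.
have [s hs] := choice (fun t => isom_surj f (val rho t)).
have rayP : is_ray (val rho : ray Y) by exact: set_valP.
have sP : s \in @is_ray _ Y.
  by apply/mem_set => a b a0 b0; rewrite -(isom_dist f) !hs; exact: rayP.
pose s' : ray Y := SigSub sP.
have fs : ray_map f s' = val rho by apply/val_inj/funext.
have s'P : s' \in [set rho | endpoint rho = xi].
  apply/mem_set => /=; rewrite -[RHS]reprK.
  apply/endpointP/(asymptotic_ray_map f)/endpointP.
  by rewrite fs (set_valP rho : endpoint _ = _) -[LHS]fxi.
by exists (SigSub s'P); apply/val_inj.
Qed.

End rays_to_map.

Section ident_isometry.
Variables (T : choiceType) (d : T -> T -> R) (dP : pseudo_metric d).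
Variable phi : T -> T.
Hypothesis phi_dist : forall x y, d (phi x) (phi y) = d x y.
Hypothesis phi_surj : forall y, exists x, phi x = y.

Definition ident_map (x : ident dP) : ident dP :=
  \pi_(ident dP) (phi (repr x)).

Lemma ident_map_dist x y : mdist (ident_map x) (ident_map y) = mdist x y.
Proof.
rewrite -[LHS]/(ident_dist _ _) ident_distE phi_dist.
by rewrite -[RHS]/(ident_dist _ _).
Qed.

Lemma ident_map_surj y : exists x, ident_map x = y.
Proof.
have [x hx] := phi_surj (repr y); exists (\pi_(ident dP) x).
apply: (@ident_dist_eq0 _ _ _ dP).
by rewrite -[y in LHS]reprK ident_distE -hx phi_dist d_repr.
Qed.

Definition ident_isometry : isometry (ident dP) :=
  Isometry ident_map_dist ident_map_surj.

End ident_isometry.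

Section completion_isometry.
Variables (M : metricType R) (f : isometry M).

Lemma cauchy_map_subproof (u : cauchy_seqs M) :
  (fun n => f (val u n)) \in [set u : nat -> M | cauchy_seq u].
Proof.
apply/mem_set => e /(set_valP u : cauchy_seq _)[N hN].
by exists N => m n Nm Nn; rewrite isom_dist hN.
Qed.

Definition cauchy_map (u : cauchy_seqs M) : cauchy_seqs M :=
  SigSub (cauchy_map_subproof u).

Lemma cauchy_map_dist u v :
  limit_dist (cauchy_map u) (cauchy_map v) = limit_dist u v.
Proof. by rewrite /limit_dist /=; under eq_fun do rewrite isom_dist. Qed.

Lemma cauchy_map_surj v : exists u, cauchy_map u = v.
Proof.
have [u hu] := choice (fun n => isom_surj f (val v n)).
have uP : u \in [set u : nat -> M | cauchy_seq u].
  apply/mem_set => e /(set_valP v : cauchy_seq _)[N hN].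
  by exists N => m n Nm Nn; rewrite -(isom_dist f) !hu hN.
by exists (SigSub uP); apply/val_inj/funext.
Qed.

Definition completion_isometry : isometry (completion M) :=
  ident_isometry (limit_dist_pseudo_metric M) cauchy_map_dist cauchy_map_surj.

End completion_isometry.

End isometries.

Section refined_boundary.
Context {R : realType}.

(* The space Y_xi: ident is the quotient of the rays towards xi. *)
Definition transverse (Y : metricType R) (catY : cat0 Y) (xi : boundary Y) :
    metricType R :=
  completion (ident (rays_to_pseudo_metric xi catY)).

Definition transverse_isometry (Y : metricType R) (catY : cat0 Y)
    (f : isometry Y) (xi : boundary Y) (fxi : boundary_map f xi = xi) :
    isometry (transverse catY xi) :=
  completion_isometry (ident_isometry (rays_to_pseudo_metric xi catY)
    (rays_to_map_dist fxi) (rays_to_map_surj fxi)).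

(* The disjoint union of Y and its refined visual boundary: the sequence
   (xi_1, ..., xi_k, x) is toward _ xi_1 (... (toward _ xi_k (here x))), and
   k = 0 gives the points of Y. The CAT(0) hypothesis in toward makes
   transverse a metric space; it restricts nothing, since the spaces Y_xi of a
   CAT(0) space Y are again CAT(0). *)
Inductive refined_point (Y : metricType R) : Type :=
| here of Y
| toward (catY : cat0 Y) (xi : boundary Y) of refined_point (transverse catY xi).

Fixpoint fixes (Y : metricType R) (f : isometry Y) (p : refined_point Y) :
    Prop :=
  match p with
  | here x => f x = x
  | toward catY xi q =>
      exists fxi : boundary_map f xi = xi, fixes (transverse_isometry catY fxi) q
  end.

End refined_boundary.

HB.mixin Record Group_isTopological G & Group G & Topological G := {
  mulg_continuous : continuous (fun p : G * G => (p.1 * p.2)%g) ;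
  invg_continuous : continuous (fun x : G => x^-1%g)
}.

#[short(type="topologicalGroupType")]
HB.structure Definition TopologicalGroup :=
  {G of Group G & Topological G & Group_isTopological G}.

Section groups.
Context {G : topologicalGroupType}.

Definition is_subgroup (H : set G) : Prop :=
  [/\ H 1%g, forall g h, H g -> H h -> H (g * h)%g &
      forall g, H g -> H g^-1%g].

Definition finite_index (K H : set G) : Prop :=
  finite_set [set [set (h * k)%g | k in K] | h in H].

(* An action of H on K; the values of a outside H and K are irrelevant. *)
Definition affine_action {R : realType} {V : tvsType R} (H : set G) (K : set V)
    (a : G -> V -> V) : Prop :=
  [/\ forall h v, H h -> K v -> K (a h v),
      forall v, K v -> a 1%g v = v,
      forall g h v, H g -> H h -> K v -> a (g * h)%g v = a g (a h v),
      forall h v w (l : R), H h -> K v -> K w -> 0 <= l <= 1 ->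
        a h (l *: v + (1 - l) *: w) = l *: a h v + (1 - l) *: a h w &
      {within H `*` K, continuous (fun p : G * V => a p.1 p.2)}].

(* Library tvsTypes are locally convex. *)
Definition amenable_subgroup (R : realType) (H : set G) : Prop :=
  is_subgroup H /\
  forall (V : tvsType R) (K : set V), hausdorff_space V ->
    K !=set0 -> compact K -> convex_set K ->
    forall a : G -> V -> V, affine_action H K a ->
      exists2 v, K v & forall h, H h -> a h v = v.

End groups.

Section actions.
Context {R : realType}.

Record isometric_action (G : topologicalGroupType) (X : metricType R) : Type :=
  IsometricAction {
    act :> G -> X -> X;
    act1 : forall x, act 1%g x = x;
    actM : forall g h x, act (g * h)%g x = act g (act h x);
    act_dist : forall g x y, mdist (act g x) (act g y) = mdist x y;
    act_continuous : continuous (fun p : G * X => act p.1 p.2) }.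

Context (G : topologicalGroupType) (X : metricType R).
Variable a : isometric_action G X.

Lemma act_surj (g : G) (y : X) : exists x, a g x = y.
Proof. by exists (a g^-1%g y); rewrite -actM mulgV act1. Qed.

Definition act_isometry (g : G) : isometry X :=
  Isometry (act_dist a g) (act_surj g).

Definition stabilizer (p : refined_point X) : set G :=
  [set g | fixes (act_isometry g) p].

Definition proper_action : Prop :=
  forall C : set X, compact C -> compact [set g | (a g @` C) `&` C !=set0].

Let orbit_rel : rel X := fun x y => `[< exists g, a g x = y >].

Lemma orbit_rel_refl : reflexive orbit_rel.
Proof. by move=> x; apply/asboolP; exists 1%g; rewrite act1. Qed.

Lemma orbit_rel_sym : symmetric orbit_rel.
Proof.
by move=> x y; apply/asboolP/asboolP => -[g <-]; exists g^-1%g;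
  rewrite -actM mulVg act1.
Qed.

Lemma orbit_rel_trans : transitive orbit_rel.
Proof.
move=> y x z /asboolP[g <-] /asboolP[h <-]; apply/asboolP.
by exists (h * g)%g; rewrite actM.
Qed.

Canonical orbit_equiv :=
  EquivRel _ orbit_rel_refl orbit_rel_sym orbit_rel_trans.

Definition orbit_space : topologicalType :=
  quotient_topology {eq_quot orbit_equiv}.

Definition cocompact_action : Prop := compact [set: orbit_space].

End actions.

(* Main.v *)
(* Stabilizers: the elements that preserve every horosphere met along a refined
   boundary point form a normal subgroup with abelian quotient, and any finite set
   of them moves some point of X arbitrarily little. As G is totally disconnected
   and acts properly, such a set generates a subgroup of a compact open subgroup,
   over whose small cosets one can average; an approximation argument and the
   Markov-Kakutani theorem then give fixed points of affine actions.

   Amenable subgroups: let H act on a complete CAT(0) space Y of bounded geometry.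
   If H fixes a boundary point, pass to the transverse space; the depth of this
   recursion is bounded by the number of almost orthogonal directions of Y.
   Otherwise there is a minimal closed convex invariant subset, on which, by
   amenability, horofunctions can be averaged to affine ones. The flows of the
   affine functions identify the minimal set with a Euclidean space. Since G is
   totally disconnected, the displacement of the elements of [H, H] has a gap at 0,
   and Bieberbach's argument provides a finite index subgroup acting by
   translations on an invariant flat. Such a subgroup fixes a refined boundary
   point, obtained by removing the directions of the flat one after the other. *)

From HB Require Import structures.
Require Import Defs.
From mathcomp Require Import all_boot all_order all_algebra.
From mathcomp Require Import all_classical reals topology normedtype tvs convex.
From mathcomp Require Import interval_inference generic_quotient lra ring zify.

Set Implicit Arguments.
Unset Strict Implicit.
Unset Printing Implicit Defensive.

Import Order.TTheory GRing.Theory Num.Theory.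
Import numFieldNormedType.Exports.
Import Defs.

Local Open Scope classical_set_scope.
Local Open Scope quotient_scope.
Local Open Scope ring_scope.

(** * Geodesics and the Bruhat-Tits inequality *)

(** A transverse space is a limit of horospheres and need not inherit a proper or cocompact action
    from X. Three weaker properties are carried through the recursion instead: completeness, bounded
    geometry, and [approximable], by which the motion of finitely many points of the transverse
    space is seen in X up to any error. The last one concerns only the elements that preserve every
    horosphere met so far, since the others slide points along the rays. Hence two groups are kept:
    the amenable group H acting on Y, and a subgroup N of it that contains its commutators. The
    displacement gap holds for N alone, and Bieberbach's argument has to work with a gap for
    commutators in place of discreteness.

    CAT(0) is used as the weighted Bruhat-Tits inequality: it speaks of distances only, so it
    survives the limits and the completion that define a transverse space. Affine functions are
    handled through [flows], an identity between squared distances; polarizing it gives an inner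
    product on these functions, and an orthonormal family of maximal size becomes the coordinates of
    the flat. *)

Section euclid.
Context {R : realType}.
Implicit Types p q r : R * R.

Lemma euclid_dist_ge0 p q : 0 <= euclid_dist p q.
Proof. exact: sqrtr_ge0. Qed.

Lemma euclid_dist_sqr p q :
  euclid_dist p q ^+ 2 = (p.1 - q.1) ^+ 2 + (p.2 - q.2) ^+ 2.
Proof. by rewrite sqr_sqrtr// addr_ge0 ?sqr_ge0. Qed.

Lemma euclid_stewart p q z (l : R) :
  euclid_dist z (euclid_seg p q l) ^+ 2 =
  (1 - l) * euclid_dist z p ^+ 2 + l * euclid_dist z q ^+ 2
  - l * (1 - l) * euclid_dist p q ^+ 2.
Proof. by rewrite !euclid_dist_sqr /euclid_seg/=; ring. Qed.

End euclid.

Section stewart.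
Context {R : realType} (Y : metricType R).
Implicit Types (x y z m : Y) (l : R).

(* The weighted Bruhat-Tits inequality: m behaves as the point dividing [x, y]
   in the ratio l would in a Euclidean plane, or better. *)
Definition stewart_pt x y l m : Prop := forall z,
  mdist z m ^+ 2 <= (1 - l) * mdist z x ^+ 2 + l * mdist z y ^+ 2
                    - l * (1 - l) * mdist x y ^+ 2.

(** Equivalent to CAT(0) by [stewart_cat0] and [cat0_stewart]. It mentions neither geodesics nor
    comparison triangles, hence passes to limits, completions and convex subsets. *)
Definition stewart : Prop := forall x y l, 0 <= l <= 1 ->
  exists m, stewart_pt x y l m.

(** Chosen as a total function, with default x; it is meaningful for 0 <= l <= 1 in a CAT(0)
    space. *)
Definition conv x y l : Y := xget x [set m | stewart_pt x y l m].

Lemma ler_of_sqr (u v : R) : 0 <= v -> u ^+ 2 <= v ^+ 2 -> u <= v.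
Proof. by move=> v0 uv; rewrite leNgt; apply/negP => vu; nra. Qed.

Lemma stewart_pt_dist x y l m : 0 <= l <= 1 -> stewart_pt x y l m ->
  mdist x m = l * mdist x y /\ mdist m y = (1 - l) * mdist x y.
Proof.
move=> l01 h; have := h x; have := h y; rewrite !mdistxx (metric_sym y x).
move=> hy hx; have [d0 dm0 dm'0] :
   [/\ 0 <= mdist x y, 0 <= mdist x m & 0 <= mdist m y] by rewrite !mdist_ge0.
have h1 : mdist x m <= l * mdist x y by apply: ler_of_sqr; nra.
have h2 : mdist m y <= (1 - l) * mdist x y.
  by rewrite metric_sym; apply: ler_of_sqr; nra.
by have := metric_triangle x m y; split; lra.
Qed.

(** At z = m' the right-hand side of the inequality is at most 0. *)
Lemma stewart_pt_uniq x y l m m' : 0 <= l <= 1 -> stewart_pt x y l m ->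
  mdist m' x <= l * mdist x y -> mdist m' y <= (1 - l) * mdist x y -> m' = m.
Proof.
move=> l01 h h1 h2; apply: mdist_positivity; apply/eqP.
have := h m'; have := mdist_ge0 x y; have := mdist_ge0 m' x.
have := mdist_ge0 m' y => a0 b0 d0 hm.
rewrite -sqrf_eq0 eq_le sqr_ge0 andbT.
have : mdist m' x ^+ 2 <= (l * mdist x y) ^+ 2.
  by rewrite lerXn2r ?nnegrE//; nra.
have : mdist m' y ^+ 2 <= ((1 - l) * mdist x y) ^+ 2.
  by rewrite lerXn2r ?nnegrE//; nra.
nra.
Qed.

Lemma geodesic_stewart (c : R -> Y) x y l : stewart -> geodesic c x y ->
  0 <= l <= 1 -> stewart_pt x y l (c (l * mdist x y)).
Proof.
move=> hS [c0 c1 ci] l01; have [m hm] := hS x y _ l01.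
have d0 := mdist_ge0 x y.
rewrite (_ : c _ = m)//; apply: (stewart_pt_uniq l01 hm).
  by rewrite -{2}c0 ci; [rewrite subr0 ger0_norm//; nra|nra|nra].
rewrite -{2}c1 ci; [|nra|nra].
by rewrite distrC ger0_norm; nra.
Qed.

(** Points dividing [x, y] in all ratios form a geodesic: the inequality tested at one of them
    bounds its distance to another, and the triangle inequality gives the reverse. Two points on
    sides of a triangle are compared by using the inequality twice, while Stewart's identity makes
    each use an equality in the plane. *)
Lemma stewart_cat0 : stewart -> cat0 Y.
Proof.
move=> hS; split.
  move=> x y; pose m l := if pselect (0 <= l <= 1) is left h then
    projT1 (cid (hS x y l h)) else x.
  have mP l : 0 <= l <= 1 -> stewart_pt x y l (m l).
    by rewrite /m; case: pselect => // h _; case: cid.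
  exists (fun t => m (t / mdist x y)).
  have i01 : 0 <= (0 : R) <= 1 by lra.
  have i11 : 0 <= (1 : R) <= 1 by lra.
  have [xy|xy] := eqVneq x y.
    subst y; rewrite mdistxx; have m0 : m 0 = x.
      have [e _] := stewart_pt_dist i01 (mP _ i01).
      by apply/esym/mdist_positivity; rewrite e mul0r.
    have m0' t : m (t / 0) = x by rewrite invr0 mulr0.
    split; rewrite ?m0'// mdistxx => s t sh th; rewrite !m0' mdistxx.
    by rewrite (_ : s - t = 0) ?normr0//; lra.
  have D0 : 0 < mdist x y by rewrite mdist_gt0.
  split.
  - rewrite mul0r; have [e _] := stewart_pt_dist i01 (mP _ i01).
    by apply/esym/mdist_positivity; rewrite e mul0r.
  - rewrite divff ?gt_eqF//; have [_ e] := stewart_pt_dist i11 (mP _ i11).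
    by apply/mdist_positivity; rewrite e subrr mul0r.
  move=> s t sh th.
  have s01 : 0 <= s / mdist x y <= 1 by rewrite divr_ge0 ?ler_pdivrMr//=; lra.
  have t01 : 0 <= t / mdist x y <= 1 by rewrite divr_ge0 ?ler_pdivrMr//=; lra.
  have [e1 e2] := stewart_pt_dist s01 (mP _ s01).
  have [e1' e2'] := stewart_pt_dist t01 (mP _ t01).
  have := mP _ t01 (m (s / mdist x y)).
  rewrite (metric_sym _ x) e1 e2.
  move: e1 e1'; rewrite !divfK ?gt_eqF// => e1 e1' h.
  have {}h : mdist (m (s / mdist x y)) (m (t / mdist x y)) ^+ 2 <= (s - t) ^+ 2.
    apply: (le_trans h); rewrite le_eqVlt; apply/orP; left; apply/eqP.
    by field; rewrite gt_eqF.
  apply/le_anti/andP; split.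
    by apply: ler_of_sqr; rewrite // real_normK ?num_real.
  have := metric_triangle x (m (s / mdist x y)) (m (t / mdist x y)).
  have := metric_triangle x (m (t / mdist x y)) (m (s / mdist x y)).
  rewrite e1 e1' (metric_sym (m (t / _))) ler_norml => *; apply/andP; split; lra.
move=> p q r c c' gc gc' p' q' r' pq pr qr l m l01 m01.
have hl := geodesic_stewart hS gc l01; have hm := geodesic_stewart hS gc' m01.
set u := c _ in hl *; set v := c' _ in hm *.
apply: ler_of_sqr; first exact: euclid_dist_ge0.
rewrite euclid_stewart.
have -> : forall w, euclid_dist (euclid_seg p' q' l) w ^+ 2 =
    euclid_dist w (euclid_seg p' q' l) ^+ 2.
  by move=> w; rewrite !euclid_dist_sqr; ring.
have -> : forall w, euclid_dist (euclid_seg p' q' l) w ^+ 2 =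
    euclid_dist w (euclid_seg p' q' l) ^+ 2.
  by move=> w; rewrite !euclid_dist_sqr; ring.
rewrite !euclid_stewart.
have es (a b : R * R) : euclid_dist a b ^+ 2 = euclid_dist b a ^+ 2.
  by rewrite !euclid_dist_sqr; ring.
rewrite (es r' p') (es r' q') pq pr qr (_ : euclid_dist p' p' ^+ 2 = 0); last first.
  by rewrite euclid_dist_sqr; ring.
have := hm u; have := hl r; have [] := stewart_pt_dist l01 hl.
rewrite (metric_sym u p) (metric_sym u r) (metric_sym r p) (metric_sym r q).
move=> -> _ h1 h2; nra.
Qed.

(** The comparison is used with the second point at the end z of its side, where Stewart's identity
    computes the planar distance. *)
Lemma cat0_stewart : cat0 Y -> stewart.
Proof.
move=> [geo cat] x y l l01; have [c gc] := geo x y.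
exists (c (l * mdist x y)) => z; have [c' gc'] := geo x z.
have [||||||p' [q' [r' [pq pr qr]]]] :=
  @euclid_triangle R (mdist x y) (mdist x z) (mdist y z);
  rewrite ?mdist_ge0 //.
- by rewrite (metric_sym y) metric_triangle.
- exact: metric_triangle.
- by rewrite (metric_sym x y) metric_triangle.
have h := cat _ _ _ _ _ gc gc' _ _ _ pq pr qr l 1 l01.
have {h} : mdist (c (l * mdist x y)) z <=
    euclid_dist (euclid_seg p' q' l) (euclid_seg p' r' 1).
  move: h; rewrite mul1r; case: gc' => _ -> _; apply; lra.
have -> : euclid_seg p' r' 1 = r'.
  by rewrite /euclid_seg subrr !mul0r !add0r !mul1r; case: r' {qr pr}.
rewrite metric_sym => h.
have : mdist z (c (l * mdist x y)) ^+ 2 <=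
    euclid_dist (euclid_seg p' q' l) r' ^+ 2.
  by rewrite lerXn2r ?nnegrE ?mdist_ge0 ?euclid_dist_ge0.
have -> : euclid_dist (euclid_seg p' q' l) r' ^+ 2 =
    euclid_dist r' (euclid_seg p' q' l) ^+ 2.
  by rewrite !euclid_dist_sqr; ring.
have es (a b : R * R) : euclid_dist a b ^+ 2 = euclid_dist b a ^+ 2.
  by rewrite !euclid_dist_sqr; ring.
rewrite euclid_stewart (es r' p') (es r' q') pq pr qr.
by rewrite (metric_sym z x) (metric_sym z y).
Qed.

End stewart.

Section conv.
Context {R : realType} (Y : metricType R) (hY : cat0 Y).
Implicit Types (x y z : Y) (l m : R).

Lemma convP x y l : 0 <= l <= 1 -> stewart_pt x y l (conv x y l).
Proof.
by move=> l01; rewrite /conv; case: xgetP => // /(_ _) h;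
  have [m /h] := cat0_stewart hY x y l01.
Qed.

Lemma conv_distl x y l : 0 <= l <= 1 -> mdist x (conv x y l) = l * mdist x y.
Proof. by move=> l01; have [] := stewart_pt_dist l01 (convP x y l01). Qed.

Lemma conv_distr x y l : 0 <= l <= 1 ->
  mdist (conv x y l) y = (1 - l) * mdist x y.
Proof. by move=> l01; have [] := stewart_pt_dist l01 (convP x y l01). Qed.

Lemma conv_uniq x y l (m : Y) : 0 <= l <= 1 ->
  mdist x m <= l * mdist x y -> mdist m y <= (1 - l) * mdist x y ->
  m = conv x y l.
Proof.
move=> l01 h1 h2; apply: (stewart_pt_uniq l01 (convP x y l01)) => //.
by rewrite metric_sym.
Qed.

Lemma conv0 x y : conv x y 0 = x.
Proof.
by apply/esym/conv_uniq; rewrite ?mdistxx ?mul0r ?subr0 ?mul1r ?lexx ?ler01//=.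
Qed.

Lemma conv1 x y : conv x y 1 = y.
Proof.
by apply/esym/conv_uniq; rewrite ?mdistxx ?subrr ?mul0r ?mul1r ?lexx ?ler01//=.
Qed.

Lemma convxx x l : 0 <= l <= 1 -> conv x x l = x.
Proof. by move=> l01; apply/esym/conv_uniq; rewrite ?mdistxx ?mulr0. Qed.

Lemma conv_sym x y l : 0 <= l <= 1 -> conv x y l = conv y x (1 - l).
Proof.
move=> l01; apply: conv_uniq; first lra.
  by rewrite metric_sym conv_distr// (metric_sym y x).
by rewrite metric_sym conv_distl// (metric_sym y x); lra.
Qed.

Lemma conv_dist x y l m : 0 <= l <= 1 -> 0 <= m <= 1 ->
  mdist (conv x y l) (conv x y m) = `|l - m| * mdist x y.
Proof.
move=> l01 m01; apply/le_anti/andP; split.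
  apply: ler_of_sqr; first by rewrite mulr_ge0 ?mdist_ge0.
  apply: le_trans (convP x y m01 _) _.
  rewrite conv_distr// (metric_sym _ x) conv_distl//.
  by rewrite !exprMn real_normK ?num_real//; nra.
have := metric_triangle x (conv x y l) (conv x y m).
have := metric_triangle x (conv x y m) (conv x y l).
rewrite !conv_distl// (metric_sym (conv x y m)) => h1 h2.
by have [|] := ger0P (l - m); nra.
Qed.

Lemma conv_geodesic x y :
  geodesic (fun t => conv x y (t / mdist x y)) x y.
Proof.
split; first by rewrite mul0r conv0.
  have [->|xy] := eqVneq x y; first by rewrite mdistxx mul0r conv0.
  by rewrite divff ?conv1// gt_eqF// mdist_gt0.
move=> s t sh th; have [xy|xy] := eqVneq x y.
  move: sh th; rewrite xy mdistxx => sh th; rewrite !invr0 !mulr0 mdistxx.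
  by rewrite (_ : s - t = 0) ?normr0//; lra.
have D0 : 0 < mdist x y by rewrite mdist_gt0.
rewrite conv_dist.
- rewrite -mulrBl normrM [`|_^-1|]ger0_norm ?invr_ge0 ?mdist_ge0//.
  by rewrite divfK// gt_eqF.
- by rewrite divr_ge0 ?ler_pdivrMr//=; lra.
- by rewrite divr_ge0 ?ler_pdivrMr//=; lra.
Qed.

Lemma thales x y z l : 0 <= l <= 1 ->
  mdist (conv x y l) (conv x z l) <= l * mdist y z.
Proof.
move=> l01.
have := cat0_thales hY (conv_geodesic x y) (conv_geodesic x z) l01.
have e u : conv x u (l * mdist x u / mdist x u) = conv x u l.
  have [->|xu] := eqVneq x u; last by rewrite mulfK// gt_eqF// mdist_gt0.
  by rewrite mdistxx mulr0 mul0r !convxx// lexx ler01.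
by rewrite !e.
Qed.

Lemma conv_convex x y x' y' l : 0 <= l <= 1 ->
  mdist (conv x y l) (conv x' y' l) <= (1 - l) * mdist x x' + l * mdist y y'.
Proof.
move=> l01; apply: le_trans (metric_triangle _ (conv x y' l) _) _.
rewrite addrC lerD ?thales//.
rewrite (conv_sym x y')// (conv_sym x' y')//; apply: thales; lra.
Qed.

Lemma conv_conv x y l m : 0 <= l <= 1 -> 0 <= m <= 1 ->
  conv x (conv x y l) m = conv x y (m * l).
Proof.
move=> l01 m01; have ml : 0 <= m * l <= 1 by nra.
have D0 := mdist_ge0 x y.
apply: conv_uniq => //; first by rewrite !conv_distl//; nra.
apply: le_trans (metric_triangle _ (conv x y l) _) _.
by rewrite !conv_distr// conv_distl//; nra.
Qed.

Lemma dist_conv_le x y z l : 0 <= l <= 1 ->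
  mdist z (conv x y l) <= (1 - l) * mdist z x + l * mdist z y.
Proof. by move=> l01; rewrite -{1}(convxx z l01) conv_convex. Qed.

End conv.

(** * Rays *)

Section sequences.
Context {R : realType} (Y : metricType R).

Definition seq_complete : Prop :=
  forall u : nat -> Y, cauchy_seq u -> exists x : Y, u @ \oo --> x.

Lemma cvg_mdistP (u : nat -> Y) (x : Y) : u @ \oo --> x <->
  forall e : R, 0 < e -> exists N, forall n, (N <= n)%N -> mdist (u n) x < e.
Proof.
split=> [/metricType_numDomainType.cvgrPdist_lt h e /h[N _ hN]|h].
  by exists N => n Nn; rewrite metric_sym; exact: hN.
apply/metricType_numDomainType.cvgrPdist_lt => e /h[N hN].
by exists N => // n /= Nn; rewrite metric_sym; exact: hN.
Qed.

Lemma ler_eps (x y : R) : (forall e, 0 < e -> x <= y + e) -> x <= y.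
Proof. by move=> h; apply/ler_addgt0Pr. Qed.

Lemma eventually_all (I : choiceType) (s : seq I) (P : I -> R -> Prop) :
  (forall i, i \in s -> exists T, forall t, T <= t -> P i t) ->
  exists T, forall t, T <= t -> forall i, i \in s -> P i t.
Proof.
elim: s => [|i s IHs] h; first by exists 0.
have [T hT] := h i (mem_head _ _).
have [|T' hT'] := IHs; first by move=> j js; apply: h; rewrite inE js orbT.
exists (Num.max T T') => t; rewrite ge_max => /andP[t1 t2] j.
by rewrite inE => /predU1P[->|js]; [exact: hT|exact: hT'].
Qed.

End sequences.

Section rays.
Context {R : realType} (Y : metricType R) (hY : cat0 Y).
Implicit Types (x y z p : Y) (rho sigma tau : ray Y).

Lemma rayP rho (s t : R) : 0 <= s -> 0 <= t ->
  mdist (rho s) (rho t) = `|s - t|.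
Proof. by move=> s0 t0; apply: (set_valP rho : is_ray _). Qed.

Lemma asymptotic_symP rho sigma : asymptotic rho sigma -> asymptotic sigma rho.
Proof. by move=> [K h]; exists K => t /h; rewrite metric_sym. Qed.

Lemma ray_conv rho (s t l : R) : 0 <= s -> s <= t -> 0 <= l <= 1 ->
  conv (rho s) (rho t) l = rho ((1 - l) * s + l * t).
Proof.
move=> s0 st l01; apply/esym/conv_uniq => //.
  by rewrite !rayP ?(le_trans s0 st)//; [|nra]; rewrite !ler0_norm; nra.
by rewrite !rayP ?(le_trans s0 st)//; [|nra]; rewrite !ler0_norm; nra.
Qed.

Lemma ray_distC rho sigma : ray_dist rho sigma = ray_dist sigma rho.
Proof.
rewrite /ray_dist; congr inf; apply/seteqP; split=> _ [t [t' [t0 t'0 ->]]];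
  by exists t', t; rewrite metric_sym.
Qed.

Lemma ray_dist_le rho sigma (t t' : R) : 0 <= t -> 0 <= t' ->
  ray_dist rho sigma <= mdist (rho t) (sigma t').
Proof.
move=> t0 t'0; apply: ge_inf; last by exists t, t'.
by exists 0 => _ [s [s' [_ _ ->]]]; exact: mdist_ge0.
Qed.

Lemma ray_dist_adherent rho sigma (e : R) : 0 < e -> exists t t',
  [/\ 0 <= t, 0 <= t' & mdist (rho t) (sigma t') < ray_dist rho sigma + e].
Proof.
move=> e0; set A := [set d | exists t t' : R,
  [/\ 0 <= t, 0 <= t' & d = mdist (rho t) (sigma t')]].
have A_inf : has_inf A.
  split; first by exists (mdist (rho 0) (sigma 0)), 0, 0.
  by exists 0 => _ [s [s' [_ _ ->]]]; exact: mdist_ge0.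
by have [_ [t [t' [t0 t'0 ->]]] h] := inf_adherent e0 A_inf; exists t, t'.
Qed.

Lemma ray_dist_ge0 rho sigma : 0 <= ray_dist rho sigma.
Proof.
apply: lb_le_inf; first by exists (mdist (rho 0) (sigma 0)), 0, 0.
by move=> _ [t [t' [_ _ ->]]]; exact: mdist_ge0.
Qed.

(* The limiting ray exists as soon as the directions from x to y n converge;
   both the rays towards a given boundary point and the steepest descent ray of
   a convex function are obtained in this way. *)
Lemma ray_limit x (y : nat -> Y) : seq_complete Y ->
  (forall e : R, 0 < e -> exists N, forall n, (N <= n)%N ->
     `|mdist x (y n) - n%:R| <= e * n%:R) ->
  (forall e : R, 0 < e -> exists N, forall n m, (N <= n)%N -> (n <= m)%N ->
     mdist (y n) (conv x (y m) (n%:R / m%:R)) <= e * n%:R) ->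
  exists rho : ray Y, rho 0 = x /\
    forall r e : R, 0 <= r -> 0 < e -> exists N, forall n, (N <= n)%N ->
      mdist (rho r) (conv x (y n) (r / n%:R)) < e.
Proof.
move=> cY hD hC.
have ratio (r : R) n : 0 <= r -> r < n%:R -> 0 <= r / n%:R <= 1.
  move=> r0 rn; have n0 : 0 < n%:R :> R by rewrite (le_lt_trans r0).
  by rewrite divr_ge0//= ?ler_pdivrMr// ?mul1r ltW.
have big (r : R) N : exists M, (N <= M)%N /\ forall n, (M <= n)%N -> r < n%:R.
  exists (maxn N (Num.truncn `|r|).+1); split; first exact: leq_maxl.
  move=> n; rewrite geq_max => /andP[_ h].
  apply: le_lt_trans (ler_norm _) _; apply: lt_le_trans (truncnS_gt _) _.
  by rewrite ler_nat.
have cau (r : R) : 0 <= r -> cauchy_seq (fun n => conv x (y n) (r / n%:R)).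
  move=> r0 e e0.
  pose d := e / (r + 1) / 2.
  have r1 : 0 < r + 1 by lra.
  have d0 : 0 < d by rewrite /d !divr_gt0.
  have dr : d * r < e.
    have : d * (r + 1) = e / 2 by rewrite /d; field; lra.
    by nra.
  have [N hN] := hC _ d0; have [M [NM hM]] := big r N.
  (* The two points are the images, under contraction towards x by r / n, of [y n] and of the point
     of [x, y m] in ratio n / m; [thales] scales their distance d n down to d r. *)
  have key n m : (M <= n)%N -> (n <= m)%N ->
      mdist (conv x (y n) (r / n%:R)) (conv x (y m) (r / m%:R)) < e.
    move=> Mn nm; have rn := hM _ Mn.
    have n0 : 0 < n%:R :> R by rewrite (le_lt_trans r0).
    have m0 : 0 < m%:R :> R by rewrite (lt_le_trans n0)// ler_nat.
    have nm01 : 0 <= (n%:R / m%:R : R) <= 1.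
      by rewrite divr_ge0//= ler_pdivrMr// mul1r ler_nat.
    have -> : r / m%:R = (r / n%:R) * (n%:R / m%:R).
      by field; rewrite !gt_eqF.
    rewrite -(conv_conv hY _ _ nm01 (ratio _ _ r0 rn)).
    apply: le_lt_trans (thales hY _ _ _ (ratio _ _ r0 rn)) _.
    apply: le_lt_trans dr; rewrite (_ : d * r = r / n%:R * (d * n%:R)).
      apply: ler_wpM2l; first by rewrite divr_ge0// ltW.
      by apply: hN => //; exact: leq_trans Mn.
    by field; rewrite gt_eqF.
  exists M => m n Mm Mn; have [/key|/ltnW/key] := leqP m n; first exact.
  by rewrite metric_sym; exact.
have [f hf] : exists f : R -> Y, forall r, 0 <= r ->
    (fun n => conv x (y n) (r / n%:R)) @ \oo --> f r.
  have /choice[f hf] : forall r, exists z : Y, 0 <= r ->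
      (fun n => conv x (y n) (r / n%:R)) @ \oo --> z.
    move=> r; have [r0|] := boolP (0 <= r); last by exists x.
    by have [z hz] := cY _ (cau r r0); exists z.
  by exists f.
have fE (r e : R) : 0 <= r -> 0 < e -> exists N, forall n, (N <= n)%N ->
    mdist (f r) (conv x (y n) (r / n%:R)) < e.
  move=> r0 e0; have /cvg_mdistP/(_ _ e0)[N hN] := hf r r0.
  by exists N => n /hN; rewrite metric_sym.
have fray : f \in @is_ray _ Y.
  apply/mem_set => s t s0 t0; apply/eqP; rewrite -subr_eq0 -normr_le0.
  apply: ler_eps => e e0; rewrite add0r.
  have e4 : 0 < e / 4 by lra.
  have [N1 h1] := fE s _ s0 e4; have [N2 h2] := fE t _ t0 e4.
  pose d := e / 4 / (`|s - t| + 1).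
  have st1 : 0 < `|s - t| + 1 by rewrite ltr_wpDl.
  have d0 : 0 < d by rewrite divr_gt0.
  have [N3 h3] := hD _ d0.
  have [M [_ hM]] := big (s + t) 0%N.
  pose n := (N1 + N2 + N3 + M)%N.
  have {}h1 : mdist (f s) (conv x (y n) (s / n%:R)) < e / 4.
    by apply: h1; rewrite /n -!addnA leq_addr.
  have {}h2 : mdist (f t) (conv x (y n) (t / n%:R)) < e / 4.
    by apply: h2; rewrite /n (addnC N1) -!addnA leq_addr.
  have {}h3 : `|mdist x (y n) - n%:R| <= d * n%:R.
    by apply: h3; rewrite /n (addnC (N1 + N2)%N) -!addnA leq_addr.
  have stn : s + t < n%:R by apply: hM; rewrite /n leq_addl.
  have n0 : 0 < n%:R :> R by lra.
  have := conv_dist hY x (y n) (l := s / n%:R) (m := t / n%:R).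
  have [sn tn] : s < n%:R /\ t < n%:R by split; lra.
  move=> /(_ (ratio _ _ s0 sn) (ratio _ _ t0 tn)).
  rewrite -mulrBl normrM [`|n%:R^-1|]ger0_norm ?invr_ge0 ?ler0n// => e1.
  have := metric_triangle (f s) (conv x (y n) (s / n%:R)) (f t).
  have := metric_triangle (conv x (y n) (s / n%:R)) (conv x (y n) (t / n%:R)) (f t).
  have := metric_triangle (conv x (y n) (s / n%:R)) (f s) (conv x (y n) (t / n%:R)).
  have := metric_triangle (f s) (f t) (conv x (y n) (t / n%:R)).
  have := metric_sym (f s) (conv x (y n) (s / n%:R)).
  have := metric_sym (f t) (conv x (y n) (t / n%:R)).
  rewrite e1.
  have : `| `|s - t| * n%:R^-1 * mdist x (y n) - `|s - t| | <= e / 4.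
    have -> : `|s - t| * n%:R^-1 * mdist x (y n) - `|s - t| =
        `|s - t| / n%:R * (mdist x (y n) - n%:R) by field; rewrite gt_eqF.
    rewrite normrM ger0_norm ?divr_ge0//.
    apply: (@le_trans _ _ (`|s - t| / n%:R * (d * n%:R))).
      by rewrite ler_wpM2l// divr_ge0.
    have -> : `|s - t| / n%:R * (d * n%:R) = d * `|s - t|.
      by field; rewrite gt_eqF.
    have : d * (`|s - t| + 1) = e / 4 by rewrite /d divfK// gt_eqF.
    by lra.
  rewrite !ler_norml => /andP[a1 a2] *.
  by apply/andP; split; lra.
exists (SigSub fray); split; last exact: fE.
apply: mdist_positivity; apply/eqP; rewrite eq_le mdist_ge0 andbT.
apply: ler_eps => e e0; have [N /(_ _ (leqnn _))] := fE _ _ (lexx 0) e0.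
by rewrite mul0r conv0// add0r => /ltW.
Qed.

(** The segments from p to [rho n] converge. By the Bruhat-Tits inequality, the squared distance
    from [rho n] to the point of [p, rho m] in ratio n / m is at most 4 n K + K^2, which is
    negligible against n^2. *)
Lemma ray_from p rho : seq_complete Y ->
  exists sigma, sigma 0 = p /\ asymptotic sigma rho.
Proof.
move=> cY; pose K := mdist p (rho 0).
have K0 : 0 <= K := mdist_ge0 _ _.
have Dn n : `|mdist p (rho n%:R) - n%:R| <= K.
  have := metric_triangle p (rho 0) (rho n%:R).
  have := metric_triangle (rho 0) p (rho n%:R).
  rewrite rayP ?ler0n// sub0r normrN normr_nat (metric_sym _ p) -/K ler_norml.
  by move=> *; apply/andP; split; lra.
have arch (e : R) : 0 < e -> exists N, (0 < N)%N /\ forall n, (N <= n)%N ->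
    K <= e * n%:R /\ K ^+ 2 <= e * n%:R.
  move=> e0; exists (Num.truncn ((K + K ^+ 2) / e)).+1; split=> // n h.
  have : (K + K ^+ 2) / e <= n%:R.
    by rewrite ltW// (lt_le_trans (truncnS_gt _))// ler_nat.
  rewrite ler_pdivrMr// mulrC; have := sqr_ge0 K; split; lra.
have [||sigma [s0 hs]] := @ray_limit p (fun n => rho n%:R) cY.
- move=> e e0; have [N [_ hN]] := arch _ e0; exists N => n /hN[h _].
  exact: le_trans (Dn n) _.
- move=> e e0; have e4 : 0 < e ^+ 2 / 5 by rewrite divr_gt0// exprn_gt0.
  have [N [N0 hN]] := arch _ e4; exists N => n m Nn nm.
  have n1 : 1 <= n%:R :> R by rewrite ler1n (leq_trans N0).
  have n0 : 0 < n%:R :> R by lra.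
  have nm' : n%:R <= m%:R :> R by rewrite ler_nat.
  have m0 : 0 < m%:R :> R by lra.
  set l := n%:R / m%:R.
  have l01 : 0 <= l <= 1 by rewrite divr_ge0//= ler_pdivrMr// mul1r.
  apply: ler_of_sqr; first by rewrite mulr_ge0 ?ltW.
  apply: le_trans (convP hY _ _ l01 _) _.
  rewrite !rayP ?ler0n// ler0_norm ?subr_le0// (metric_sym (rho _) p).
  have := Dn n; have := Dn m; have [h1 h2] := hN _ Nn.
  have lm : n%:R = l * m%:R by rewrite divfK// gt_eqF.
  set a := mdist p (rho n%:R); set b := mdist p (rho m%:R).
  have a0 : 0 <= a := mdist_ge0 _ _; have b0 : 0 <= b := mdist_ge0 _ _.
  rewrite !ler_norml => /andP[hb1 hb2] /andP[ha1 ha2].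
  have ha : a ^+ 2 <= n%:R ^+ 2 + 2 * n%:R * K + K ^+ 2.
    clear -ha2 a0 n0 K0; nra.
  have hb : m%:R ^+ 2 - 2 * m%:R * K <= b ^+ 2.
    have [mK|mK] := lerP K m%:R; first by clear -mK hb1 b0 m0 K0; nra.
    by have := sqr_ge0 b; clear -mK m0 K0; nra.
  have {ha} : (1 - l) * a ^+ 2 <= (1 - l) * (n%:R ^+ 2 + 2 * n%:R * K + K ^+ 2).
    by rewrite ler_wpM2l//; lra.
  have {hb} : l * (1 - l) * (m%:R ^+ 2 - 2 * m%:R * K) <= l * (1 - l) * b ^+ 2.
    by rewrite ler_wpM2l//; nra.
  have -> : (1 - l) * (n%:R ^+ 2 + 2 * n%:R * K + K ^+ 2) =
     (1 - l) * n%:R ^+ 2 + (1 - l) * (2 * n%:R * K + K ^+ 2) by ring.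
  have -> : l * (1 - l) * (m%:R ^+ 2 - 2 * m%:R * K) =
     l * (1 - l) * m%:R ^+ 2 - (1 - l) * (2 * (l * m%:R) * K) by ring.
  rewrite -lm => hb ha.
  have hid : (1 - l) * n%:R ^+ 2 + l * (- (n%:R - m%:R)) ^+ 2
      - l * (1 - l) * m%:R ^+ 2 = 0 by rewrite [in LHS]lm; ring.
  have h3 : (1 - l) * (2 * n%:R * K + K ^+ 2 + 2 * n%:R * K) <=
     4 * n%:R * K + K ^+ 2.
    rewrite -[leRHS]mul1r (_ : 4 * n%:R * K + K ^+ 2 =
      2 * n%:R * K + K ^+ 2 + 2 * n%:R * K); last by ring.
    by rewrite ler_wpM2r//; [nra|lra].
  have h4 : 4 * n%:R * K + K ^+ 2 <= (e * n%:R) ^+ 2 by nra.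
  lra.
exists sigma; split => //; exists K => t t0; apply: ler_eps => e e0.
have [N hN] := hs t e t0 e0.
have [M hM] : exists M, forall n, (M <= n)%N -> t < n%:R.
  exists (Num.truncn t).+1 => n h.
  by rewrite (lt_le_trans (truncnS_gt _))// ler_nat.
pose n := maxn N M.
have := hN n (leq_maxl _ _); have tn := hM n (leq_maxr _ _).
have n0 : 0 < n%:R :> R by lra.
have l01 : 0 <= t / n%:R <= 1 by rewrite divr_ge0//= ler_pdivrMr//; lra.
have := conv_convex hY p (rho n%:R) (rho 0) (rho n%:R) l01.
rewrite (ray_conv rho (lexx 0) (ltW n0) l01) mulr0 add0r.
rewrite divfK ?gt_eqF// mdistxx mulr0 addr0.
rewrite -/K => h1 h2.
have := metric_triangle (sigma t) (conv p (rho n%:R) (t / n%:R)) (rho t).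
have : (1 - t / n%:R) * K <= K by nra.
lra.
Qed.

End rays.

(** * Busemann functions *)

Lemma ratio01 {R : realType} (t s : R) : 0 <= t -> t <= s -> 0 < s ->
  0 <= t / s <= 1.
Proof.
by move=> t0 ts s0; rewrite divr_ge0 ?(ltW s0)//= ler_pdivrMr// mul1r.
Qed.

Lemma double_sqr_add_le {R : realType} (w d e : R) : 0 <= w -> 0 < d ->
  d <= 1 -> d * (4 * w + e + 4) = e -> 0 < e ->
  2 * (w + d) ^+ 2 <= 2 * w ^+ 2 + e.
Proof. by move=> *; nra. Qed.

Section busemann.
Context {R : realType} (Y : metricType R) (hY : cat0 Y).
Implicit Types (x y z p : Y) (rho sigma tau : ray Y) (b : Y -> R).

(** The usual limit as t tends to infinity, written as an infimum because d(x, rho t) - t is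
    nonincreasing in t. *)
Definition busemann rho x : R :=
  inf [set d | exists2 t : R, 0 <= t & d = mdist x (rho t) - t].

Lemma busemann_has_inf rho x :
  has_inf [set d | exists2 t : R, 0 <= t & d = mdist x (rho t) - t].
Proof.
split; first by exists (mdist x (rho 0) - 0), 0.
exists (- mdist x (rho 0)) => _ [t t0 ->].
have := metric_triangle (rho 0) x (rho t).
rewrite rayP// sub0r normrN ger0_norm// (metric_sym (rho 0) x); lra.
Qed.

Lemma busemann_le rho x t : 0 <= t -> busemann rho x <= mdist x (rho t) - t.
Proof.
by move=> t0; apply: ge_inf; [case: (busemann_has_inf rho x)|exists t].
Qed.

Lemma busemann_adherent rho x (e : R) : 0 < e -> exists T, 0 <= T /\
  forall t, T <= t -> mdist x (rho t) - t < busemann rho x + e.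
Proof.
move=> e0; have [_ [T T0 ->] h] := inf_adherent e0 (busemann_has_inf rho x).
exists T; split=> // t Tt; apply: le_lt_trans h.
have := metric_triangle x (rho T) (rho t).
by rewrite rayP ?(le_trans T0)// ler0_norm; lra.
Qed.

Definition lip1 b : Prop := forall x y, b x <= b y + mdist x y.

Lemma busemann_lip rho : lip1 (busemann rho).
Proof.
move=> x y; rewrite -lerBlDr; apply: lb_le_inf.
  by exists (mdist y (rho 0) - 0), 0.
move=> _ [t t0 ->]; have := busemann_le rho x t0.
by have := metric_triangle x y (rho t); lra.
Qed.

Lemma busemann_self rho t : 0 <= t -> busemann rho (rho t) = - t.
Proof.
move=> t0; apply/le_anti/andP; split.
  by have := busemann_le rho (rho t) t0; rewrite mdistxx sub0r.
apply: lb_le_inf; first by exists (mdist (rho t) (rho 0) - 0), 0.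
move=> _ [s s0 ->]; rewrite rayP//.
by have := ler_norm (s - t); rewrite distrC; lra.
Qed.

Lemma busemann_convex rho x y l : 0 <= l <= 1 ->
  busemann rho (conv x y l) <= (1 - l) * busemann rho x + l * busemann rho y.
Proof.
move=> l01; apply: ler_eps => e e0; have e2 : 0 < e / 2 by lra.
have [T [T0 hT]] := busemann_adherent rho x e2.
have [T' [_ hT']] := busemann_adherent rho y e2.
pose t := Num.max T T'.
have {}hT : mdist x (rho t) - t < busemann rho x + e / 2.
  by apply: hT; rewrite /t le_max lexx.
have {}hT' : mdist y (rho t) - t < busemann rho y + e / 2.
  by apply: hT'; rewrite /t le_max lexx orbT.
have t0 : 0 <= t by rewrite /t le_max T0.
have := busemann_le rho (conv x y l) t0.
have := dist_conv_le hY x y (rho t) l01.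
rewrite !(metric_sym (rho t)); case/andP: l01 => l0 l1.
have : (1 - l) * (mdist x (rho t) - t) <= (1 - l) * (busemann rho x + e / 2).
  by rewrite ler_wpM2l//; lra.
have : l * (mdist y (rho t) - t) <= l * (busemann rho y + e / 2).
  by rewrite ler_wpM2l//; lra.
lra.
Qed.

(* A convex function of slope at least -1 on a half-line that stays within
   bounded distance of -t is exactly -t. *)
Lemma busemann_ray tau rho t : asymptotic rho tau -> 0 <= t ->
  busemann tau (rho t) = busemann tau (rho 0) - t.
Proof.
move=> [K hK] t0; apply/le_anti/andP; split; last first.
  have := busemann_lip tau (rho 0) (rho t).
  by rewrite rayP// sub0r normrN ger0_norm//; lra.
have [->|tn0] := eqVneq t 0; first by rewrite subr0.
have tp : 0 < t by rewrite lt0r tn0.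
set c := busemann tau (rho 0).
apply: ler_eps => e e0.
have K0 : 0 <= K by apply: le_trans (hK 0 (lexx _)); exact: mdist_ge0.
(* Convexity on [0, s] bounds the value at t up to the bounded error K + |c| scaled by t / s, and s
   makes this at most e. *)
pose s := t + t * (K + `|c|) / e.
have Kc : 0 <= K + `|c| by rewrite addr_ge0.
have ts : t <= s by rewrite /s lerDl divr_ge0 ?mulr_ge0// ltW.
have s0 : 0 < s by exact: lt_le_trans ts.
pose l := t / s.
have ls : l * s = t by rewrite /l divfK// gt_eqF.
have l01 : 0 <= l <= 1 by exact: ratio01.
have := busemann_convex tau (rho 0) (rho s) l01.
rewrite (ray_conv hY rho (lexx 0) (ltW s0) l01) mulr0 add0r ls -/c.
have : busemann tau (rho s) <= K - s.
  apply: le_trans (busemann_lip _ _ (tau s)) _.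
  by rewrite (busemann_self tau (ltW s0)); have := hK s (ltW s0); lra.
have le : l * (K + `|c|) <= e.
  have : l * (t * (K + `|c|) / e) <= t.
    by rewrite -[leRHS]ls ler_wpM2l//; [case/andP: l01|rewrite /s; lra].
  rewrite mulrA ler_pdivrMr// mulrCA ler_pM2l//.
have := ler_norm (- c); rewrite normrN.
move: l01 => /andP[l0 l1] hc h2 h3.
have : l * busemann tau (rho s) <= l * (K - s) by rewrite ler_wpM2l.
have : l * (- c) <= l * `|c| by rewrite ler_wpM2l.
lra.
Qed.

(* Reshetnyak's quadrilateral inequality. *)
Lemma quadrilateral x y z p :
  mdist x z ^+ 2 + mdist y p ^+ 2 <=
  mdist x y ^+ 2 + mdist y z ^+ 2 + mdist z p ^+ 2 + mdist p x ^+ 2.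
Proof.
have h01 : 0 <= (2^-1 : R) <= 1 by lra.
have h1 := convP hY x z h01 y; have h2 := convP hY x z h01 p.
have h3 := convP hY y p h01 (conv x z 2^-1).
have := sqr_ge0 (mdist (conv x z 2^-1) (conv y p 2^-1)).
move: h1 h2 h3.
rewrite (metric_sym (conv x z _) y) (metric_sym (conv x z _) p).
rewrite (metric_sym x y) (metric_sym z p); lra.
Qed.

Section aligned.
Variables (b : Y -> R) (rho sigma : ray Y).
Hypothesis b_lip : lip1 b.
Hypothesis b_rho : forall t, 0 <= t -> b (rho t) = b (rho 0) - t.
Hypothesis b_sigma : forall t, 0 <= t -> b (sigma t) = b (sigma 0) - t.
Hypothesis rs : asymptotic rho sigma.

(** The shift c + u of parameters places the point of sigma exactly u below the point of rho with
    respect to b, and [L u] is the limit of their distance. *)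
Let c := b (sigma 0) - b (rho 0).
Let A (u : R) : set R := [set d | exists t t',
  [/\ 0 <= t, 0 <= t', t' - t = c + u & d = mdist (rho t) (sigma t')]].
Let L u := inf (A u).

Let A_inf u : has_inf (A u).
Proof.
split; last by exists 0 => _ [t [t' [_ _ _ ->]]]; exact: mdist_ge0.
exists (mdist (rho `|c + u|) (sigma (`|c + u| + (c + u)))), `|c + u|,
  (`|c + u| + (c + u)); split => //; last by lra.
by have := ler_norm (- (c + u)); rewrite normrN; lra.
Qed.

Let L_le u t t' : 0 <= t -> 0 <= t' -> t' - t = c + u ->
  L u <= mdist (rho t) (sigma t').
Proof.
by move=> t0 t'0 tt'; apply: ge_inf; [case: (A_inf u)|exists t, t'].
Qed.

Let L_adh u (e : R) : 0 < e -> exists T, forall t, T <= t ->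
  [/\ 0 <= t, 0 <= t + (c + u) & mdist (rho t) (sigma (t + (c + u))) < L u + e].
Proof.
move=> e0; have [_ [t [t' [t0 t'0 tt' ->]]] h] := inf_adherent e0 (A_inf u).
exists t => s ts; have st : 0 <= s - t by lra.
split; [lra|lra|]; apply: le_lt_trans h.
have := asymptotic_decr hY rs t0 t'0 st.
by rewrite (_ : t + (s - t) = s) 1?(_ : t' + (s - t) = s + (c + u)); [|lra|lra].
Qed.

Let L_ge u : `|u| <= L u.
Proof.
apply: lb_le_inf; first by case: (A_inf u).
move=> _ [t [t' [t0 t'0 tt' ->]]].
have := b_lip (rho t) (sigma t'); have := b_lip (sigma t') (rho t).
rewrite b_rho// b_sigma// (metric_sym (sigma t')) ler_norml /c in tt' *.
by move=> *; apply/andP; split; lra.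
Qed.

Let g u := L u ^+ 2 - u ^+ 2.

Let g_ge0 u : 0 <= g u.
Proof.
rewrite subr_ge0 -(real_normK (num_real u)) lerXn2r ?nnegrE//.
exact: le_trans (L_ge u).
Qed.

(** Reshetnyak's inequality for the quadrilateral with two sides of length |v| along the rays: the
    other two sides tend to [L u], the diagonals to [L (u + v)] and [L (u - v)]. *)
Let g_concave u v : g (u + v) + g (u - v) <= 2 * g u.
Proof.
suff : L (u + v) ^+ 2 + L (u - v) ^+ 2 <= 2 * L u ^+ 2 + 2 * v ^+ 2.
  by rewrite /g; nra.
have L0 w : 0 <= L w by apply: le_trans (L_ge w).
apply: ler_eps => e e0.
pose d := e / (4 * L u + e + 4).
have D0 : 0 < 4 * L u + e + 4 by have := L0 u; lra.
have d0 : 0 < d by rewrite divr_gt0.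
have d1 : d <= 1 by rewrite ler_pdivrMr//; have := L0 u; lra.
have hd : d * (4 * L u + e + 4) = e by rewrite /d divfK// gt_eqF.
have [T hT] := L_adh u d0.
pose t := Num.max 0 (Num.max T (Num.max (T - v) (- v))).
have [t1 t2 t3 t4] : [/\ T <= t, T - v <= t, 0 <= t & - v <= t].
  by rewrite /t !le_max !lexx !orbT.
have [_ a2 h1] := hT t t1.
have [|a3 a4 h2] := hT (t + v); first lra.
have := quadrilateral (rho t) (rho (t + v)) (sigma (t + v + (c + u)))
  (sigma (t + (c + u))).
rewrite !rayP//.
have := @L_le (u + v) t (t + v + (c + u)) t3 a4.
move=> /(_ ltac:(lra)) h3.
have := @L_le (u - v) (t + v) (t + (c + u)) a3 a2.
move=> /(_ ltac:(lra)) h4.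
have -> : `|t - (t + v)| ^+ 2 = v ^+ 2.
  by rewrite real_normK ?num_real//; ring.
have -> : `|t + v + (c + u) - (t + (c + u))| ^+ 2 = v ^+ 2.
  by rewrite real_normK ?num_real//; ring.
have {}h3 : L (u + v) ^+ 2 <= mdist (rho t) (sigma (t + v + (c + u))) ^+ 2.
  by rewrite lerXn2r ?nnegrE ?mdist_ge0.
have {}h4 : L (u - v) ^+ 2 <= mdist (rho (t + v)) (sigma (t + (c + u))) ^+ 2.
  by rewrite lerXn2r ?nnegrE ?mdist_ge0.
rewrite (metric_sym (sigma (t + (c + u)))).
have : mdist (rho t) (sigma (t + (c + u))) ^+ 2 <= (L u + d) ^+ 2.
  rewrite lerXn2r ?nnegrE ?mdist_ge0//; last exact: ltW.
  by rewrite addr_ge0// ltW.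
have : mdist (rho (t + v)) (sigma (t + v + (c + u))) ^+ 2 <= (L u + d) ^+ 2.
  rewrite lerXn2r ?nnegrE ?mdist_ge0//; last exact: ltW.
  by rewrite addr_ge0// ltW.
have : 2 * (L u + d) ^+ 2 <= 2 * L u ^+ 2 + e.
  exact: double_sqr_add_le.
lra.
Qed.

(* A concave function bounded below on the line is constant. *)
Let g_const u u' : g u = g u'.
Proof.
suff H (x y : R) : g x <= g y by apply/le_anti; rewrite !H.
rewrite leNgt; apply/negP => yx.
pose v := y - x; pose D := g x - g y.
have D0 : 0 < D by rewrite /D subr_gt0.
have step n : g (x + n.+1%:R * v) <= g (x + n%:R * v) - D.
  elim: n => [|n IHn]; first by rewrite mul1r mul0r addr0 /v /D (addrC x) subrK; lra.
  have := g_concave (x + n.+1%:R * v) v.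
  have -> : x + n.+1%:R * v + v = x + n.+2%:R * v.
    by rewrite -(natr1 n.+1); ring.
  have -> : x + n.+1%:R * v - v = x + n%:R * v by rewrite -(natr1 n); ring.
  lra.
have bnd n : g (x + n%:R * v) <= g x - n%:R * D.
  elim: n => [|n IHn]; first by rewrite !mul0r addr0 subr0.
  by have := step n; rewrite -(natr1 n); lra.
pose n := (Num.truncn (g x / D)).+1.
have := bnd n; have := g_ge0 (x + n%:R * v).
have : g x < n%:R * D by rewrite -ltr_pdivrMr// truncnS_gt.
lra.
Qed.

Let L0E : L 0 = ray_dist rho sigma.
Proof.
have L0 w : 0 <= L w by apply: le_trans (L_ge w).
apply/le_anti/andP; split.
  apply: ler_eps => e e0; have [t [t' [t0 t'0 h]]] := ray_dist_adherent rho sigma e0.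
  apply: le_trans (ltW h); apply: le_trans (L_le t0 t'0 (u := t' - t - c) _).
    have := g_const 0 (t' - t - c); rewrite /g expr0n subr0 => e1.
    apply: ler_of_sqr => //; rewrite e1; have := sqr_ge0 (t' - t - c); lra.
  lra.
apply: lb_le_inf; first by case: (A_inf 0).
by move=> _ [t [t' [t0 t'0 _ ->]]]; exact: ray_dist_le.
Qed.

(** Asymptotic rays become parallel lines: Pythagoras holds in the limit, with [ray_dist] as the
    distance of the lines and u as the difference of heights. This is the constancy of g read off at
    0 and u. *)
Lemma aligned_dist u (e : R) : 0 < e -> exists T, forall t, T <= t ->
  [/\ 0 <= t, 0 <= t + (b (sigma 0) - b (rho 0) + u),
    ray_dist rho sigma ^+ 2 + u ^+ 2 <=
      mdist (rho t) (sigma (t + (b (sigma 0) - b (rho 0) + u))) ^+ 2 &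
    mdist (rho t) (sigma (t + (b (sigma 0) - b (rho 0) + u))) <
      Num.sqrt (ray_dist rho sigma ^+ 2 + u ^+ 2) + e].
Proof.
have L0 w : 0 <= L w by apply: le_trans (L_ge w).
have Lu : ray_dist rho sigma ^+ 2 + u ^+ 2 = L u ^+ 2.
  by have := g_const 0 u; rewrite /g expr0n subr0 L0E => ->; ring.
move=> /(L_adh u)[T hT]; exists T => t /hT[t0 t'0 h]; split => //.
  rewrite Lu lerXn2r ?nnegrE ?mdist_ge0//; apply: L_le => //.
  by rewrite /c; ring.
by rewrite Lu sqrtr_sqr ger0_norm.
Qed.

End aligned.

(** The cocycle inequalities in both directions enclose the difference between two constants. These
    agree because sqrt(d^2 + u^2) - u tends to 0 for large u, which is where Pythagoras enters. *)
Lemma busemann_diff rho sigma : asymptotic rho sigma -> forall x y,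
  busemann rho x - busemann sigma x = busemann rho y - busemann sigma y.
Proof.
move=> rs; have sr := asymptotic_symP rs.
have le_cocycle r s x : asymptotic r s ->
    busemann r x <= busemann s x + busemann r (s 0).
  move=> a; apply: ler_eps => e e0.
  have [T [T0 hT]] := busemann_adherent s x e0.
  have := hT T (lexx _); have := busemann_lip r x (s T).
  by rewrite (busemann_ray (asymptotic_symP a))//; lra.
suff h : busemann rho (sigma 0) + busemann sigma (rho 0) <= 0.
  have H x : busemann rho x - busemann sigma x = busemann rho (sigma 0).
    have := le_cocycle _ _ x rs; have := le_cocycle _ _ x sr.
    have := le_cocycle _ _ (sigma 0) sr; rewrite busemann_self//; lra.
  by move=> x y; rewrite !H.
apply: ler_eps => e e0.
set a := busemann rho (sigma 0).
have [w w0 hw] : exists2 w : R, 0 <= w & ray_dist rho sigma ^+ 2 <= w.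
  by exists (ray_dist rho sigma ^+ 2); rewrite ?sqr_ge0.
pose u := (w + 1) / e.
have u0 : 0 < u by rewrite divr_gt0//; lra.
have e2 : 0 < e / 2 by lra.
have rr : asymptotic rho rho by exists 0 => s _; rewrite mdistxx.
have [T hT] := aligned_dist (b := busemann rho) (@busemann_lip rho)
  (fun t t0 => busemann_ray rr t0)
  (fun t t0 => busemann_ray sr t0) rs u e2.
have [t0 t'0 _] := hT T (lexx _); rewrite busemann_self// oppr0 subr0 -/a => h.
have := busemann_le sigma (rho T) t'0.
rewrite (busemann_ray rs)//.
have : Num.sqrt (ray_dist rho sigma ^+ 2 + u ^+ 2) <= u + e / 2.
  rewrite -(ger0_norm (_ : 0 <= u + e / 2)); last by lra.
  rewrite -sqrtr_sqr ler_sqrt ?sqr_ge0//.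
  have : u * e = w + 1 by rewrite /u divfK// gt_eqF.
  by have := sqr_ge0 (e / 2); nra.
rewrite busemann_self// oppr0 subr0 -/a.
lra.
Qed.

End busemann.

(** * Completions and transverse spaces *)

Lemma sqr_cont {R : realType} (b e : R) : 0 <= b -> 0 < e ->
  exists2 d : R, 0 < d & forall a, 0 <= a -> `|a - b| <= d ->
    a ^+ 2 <= b ^+ 2 + e /\ b ^+ 2 <= a ^+ 2 + e.
Proof.
move=> b0 e0; pose d := e / (2 * b + e + 1).
have D0 : 0 < 2 * b + e + 1 by lra.
have d0 : 0 < d by rewrite divr_gt0.
have d1 : d <= 1 by rewrite ler_pdivrMr//; lra.
have hd : d * (2 * b + e + 1) = e by rewrite /d divfK// gt_eqF.
exists d => // a a0; rewrite ler_norml => /andP[h1 h2]; split.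
  have : a ^+ 2 <= (b + d) ^+ 2 by rewrite lerXn2r ?nnegrE//; lra.
  nra.
have [ab|ab] := lerP b a; first by nra.
nra.
Qed.

Section completion_facts.
Context {R : realType} (M : metricType R).

Lemma cst_cauchy_subproof (x : M) :
  (fun=> x) \in [set u : nat -> M | cauchy_seq u].
Proof. by apply/mem_set => e e0; exists 0%N => *; rewrite mdistxx. Qed.

Definition to_completion (x : M) : completion M :=
  \pi_(ident (limit_dist_pseudo_metric M)) (SigSub (cst_cauchy_subproof x)).

Lemma mdist_pi_completion (u v : cauchy_seqs M) :
  mdist (\pi_(ident (limit_dist_pseudo_metric M)) u : completion M)
    (\pi_(ident (limit_dist_pseudo_metric M)) v) = limit_dist u v.
Proof. exact: ident_distE. Qed.

Lemma to_completion_dist x y :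
  mdist (to_completion x) (to_completion y) = mdist x y.
Proof. by rewrite mdist_pi_completion /limit_dist /= lim_cst. Qed.

Lemma limit_dist_le (u v : cauchy_seqs M) (c : R) N :
  (forall n, (N <= n)%N -> mdist (val u n) (val v n) <= c) ->
  limit_dist u v <= c.
Proof.
move=> h; apply: (ler_cvg_to (@cvg_limit_dist _ _ u v) (@cvg_cst _ c _ _ _)).
by exists N.
Qed.

Lemma to_completion_dense (p : completion M) (e : R) : 0 < e ->
  exists x, mdist p (to_completion x) < e.
Proof.
move=> e0; have e2 : 0 < e / 2 by lra.
rewrite -(reprK p); have [N hN] := set_valP (repr p) (e / 2) e2.
exists (val (repr p) N); rewrite mdist_pi_completion.
apply: (@le_lt_trans _ _ (e / 2)); last by lra.
by apply: (@limit_dist_le _ _ _ N) => n Nn /=; apply: ltW; exact: hN.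
Qed.

Lemma completion_complete : seq_complete (completion M).
Proof.
move=> p pC; have gt0 n : 0 < n.+1%:R^-1 :> R by rewrite invr_gt0.
have [x hx] := choice (fun n => to_completion_dense (p n) (gt0 n)).
have small (e : R) : 0 < e -> exists N, forall n, (N <= n)%N -> n.+1%:R^-1 < e.
  move=> e0; exists (Num.truncn e^-1) => n h.
  rewrite invf_plt ?posrE//; apply: lt_le_trans (truncnS_gt _) _.
  by rewrite ler_nat.
have xC : x \in [set u : nat -> M | cauchy_seq u].
  apply/mem_set => e e0; have e3 : 0 < e / 3 by lra.
  have [N1 h1] := pC _ e3; have [N2 h2] := small _ e3.
  exists (maxn N1 N2) => m n; rewrite !geq_max => /andP[m1 m2] /andP[n1 n2].
  rewrite -to_completion_dist.
  apply: le_lt_trans (metric_triangle _ (p m) _) _; rewrite metric_sym.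
  have -> : e = e / 3 + (e / 3 + e / 3) by lra.
  apply: ltrD; first exact: lt_trans (hx m) (h2 _ m2).
  apply: le_lt_trans (metric_triangle _ (p n) _) _.
  by apply: ltrD; [exact: h1|exact: lt_trans (hx n) (h2 _ n2)].
pose u : cauchy_seqs M := SigSub xC.
exists (\pi_(ident (limit_dist_pseudo_metric M)) u).
apply/cvg_mdistP => e e0; have e3 : 0 < e / 3 by lra.
have [N2 h2] := small _ e3.
have [N1 h1] := set_mem xC _ e3.
exists (maxn N1 N2) => n; rewrite geq_max => /andP[n1 n2].
apply: le_lt_trans (metric_triangle _ (to_completion (x n)) _) _.
apply: (@lt_le_trans _ _ (e / 3 + e / 3)); last by lra.
apply: ltr_leD; first exact: lt_trans (hx n) (h2 _ n2).
rewrite mdist_pi_completion; apply: (@limit_dist_le _ _ _ N1) => m Nm /=.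
by apply: ltW; exact: h1.
Qed.

End completion_facts.

Lemma ident_map_pi {R : realType} (T : choiceType) (d : T -> T -> R)
    (dP : pseudo_metric d) (phi : T -> T)
    (phi_dist : forall x y, d (phi x) (phi y) = d x y) (x : T) :
  @ident_map R T d dP phi (\pi_(ident dP) x) = \pi_(ident dP) (phi x).
Proof.
apply: (@ident_dist_eq0 _ _ _ dP).
by rewrite /ident_map ident_distE phi_dist d_repr.
Qed.

Lemma completion_isometry_to {R : realType} (M : metricType R)
    (f : isometry M) (x : M) :
  completion_isometry f (to_completion x) = to_completion (f x).
Proof.
rewrite /to_completion /= ident_map_pi; last exact: cauchy_map_dist.
by congr (\pi_(_) _); apply/val_inj.
Qed.

Lemma mdist_diff_le {R : realType} (Z : metricType R) (u v p q : Z) :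
  `|mdist u p - mdist v q| <= mdist u v + mdist p q.
Proof.
rewrite ler_norml; have := metric_triangle u v p.
have := metric_triangle v q p; have := metric_triangle v u q.
have := metric_triangle u p q; rewrite (metric_sym v u) (metric_sym q p) => *.
by apply/andP; split; lra.
Qed.

(** * The Bruhat-Tits inequality in a limit *)

Section stewart_limit.
Context {R : realType} (Z : metricType R).

(** Tested at x and y, the approximate inequality controls the distances of [m k] to x and y; tested
    at [m k], it then bounds d(m k, m n). So m is Cauchy, and its limit satisfies the inequality on
    the dense set D, hence everywhere. *)
Lemma stewart_seq (D : set Z) (x y : Z) (l : R) (m : nat -> Z) :
  seq_complete Z -> (forall z (e : R), 0 < e -> exists2 w, D w & mdist z w < e) ->
  0 <= l <= 1 -> D x -> D y -> (forall n, D (m n)) ->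
  (forall z, D z -> forall e : R, 0 < e -> exists N, forall n, (N <= n)%N ->
    mdist z (m n) ^+ 2 <= (1 - l) * mdist z x ^+ 2 + l * mdist z y ^+ 2
                    - l * (1 - l) * mdist x y ^+ 2 + e) ->
  exists m', stewart_pt x y l m'.
Proof.
move=> cZ dD l01 Dx Dy Dm h.
have mC : cauchy_seq m.
  move=> e e0; have e8 : 0 < e ^+ 2 / 9 by rewrite divr_gt0// exprn_gt0.
  have [N1 h1] := h _ Dx _ e8; have [N2 h2] := h _ Dy _ e8.
  have key k : (maxn N1 N2 <= k)%N -> exists N, forall n, (N <= n)%N ->
      mdist (m k) (m n) < e / 2.
    rewrite geq_max => /andP[k1 k2]; have [N hN] := h _ (Dm k) _ e8.
    exists N => n /hN; have := h1 k k1; have := h2 k k2.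
    rewrite !mdistxx !(metric_sym _ (m k)) (metric_sym y x) => a1 a2 a3.
    rewrite ltNge; apply/negP => a4.
    have : (e / 2) ^+ 2 <= mdist (m k) (m n) ^+ 2.
      by rewrite lerXn2r ?nnegrE ?mdist_ge0//; lra.
    move: a1 a2 a3; set a := mdist (m k) x; set b := mdist (m k) y.
    set c := mdist x y; set d := mdist _ _ => a1 a2 a3 a5.
    case/andP: l01 => l0 l1.
    have b1 : l * b ^+ 2 <= l * ((1 - l) * c ^+ 2 + l * 0 ^+ 2
        - l * (1 - l) * c ^+ 2 + e ^+ 2 / 9) by rewrite ler_wpM2l//; lra.
    have b2 : (1 - l) * a ^+ 2 <= (1 - l) * ((1 - l) * 0 ^+ 2 + l * c ^+ 2
        - l * (1 - l) * c ^+ 2 + e ^+ 2 / 9) by rewrite ler_wpM2l//; lra.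
    have : 0 < e ^+ 2 by rewrite exprn_gt0.
    nra.
  exists (maxn N1 N2) => k k' /key[N hN] /key[N' hN'].
  have := hN _ (leq_maxl N N'); have := hN' _ (leq_maxr N N').
  have := metric_triangle (m k) (m (maxn N N')) (m k').
  by rewrite (metric_sym (m k') (m _)); lra.
have [m' /cvg_mdistP m'P] := cZ _ mC; exists m' => z.
apply: ler_eps => e e0.
have e4 : 0 < e / 4 by lra.
have [d1 d10 hd1] := sqr_cont (mdist_ge0 z m') e4.
have [d2 d20 hd2] := sqr_cont (mdist_ge0 z x) e4.
have [d3 d30 hd3] := sqr_cont (mdist_ge0 z y) e4.
pose d := Num.min (d1 / 2) (Num.min d2 d3).
have d0 : 0 < d by rewrite !lt_min d20 d30 divr_gt0.
have [w Dw zw] := dD z d d0.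
have dd : [/\ d <= d1 / 2, d <= d2 & d <= d3].
  by rewrite /d !ge_min !lexx !orbT.
have [N1 h1] := h w Dw _ e4; have [N2 h2] := m'P _ d0.
pose n := maxn N1 N2.
have a1 := h1 n (leq_maxl _ _); have a2 := h2 n (leq_maxr _ _).
case: dd => dd1 dd2 dd3.
have tri (u v p : Z) : `|mdist u p - mdist v p| <= mdist u v.
  rewrite ler_norml; have := metric_triangle u v p.
  have := metric_triangle v u p; rewrite (metric_sym v u) => *.
  by apply/andP; split; lra.
have [] := hd2 (mdist w x) (mdist_ge0 _ _).
  by have := tri w z x; rewrite (metric_sym w z); lra.
have [] := hd3 (mdist w y) (mdist_ge0 _ _).
  by have := tri w z y; rewrite (metric_sym w z); lra.
have [] := hd1 (mdist w (m n)) (mdist_ge0 _ _).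
  have := tri w z (m n); have := tri (m n) m' z.
  rewrite (metric_sym w z) !(metric_sym _ z) !ler_norml.
  by move=> /andP[? ?] /andP[? ?]; apply/andP; split; lra.
move=> _ b1 b2 _ b3 _; case/andP: l01 => l0 l1.
have : (1 - l) * mdist w x ^+ 2 <= (1 - l) * (mdist z x ^+ 2 + e / 4).
  by rewrite ler_wpM2l//; lra.
have : l * mdist w y ^+ 2 <= l * (mdist z y ^+ 2 + e / 4) by rewrite ler_wpM2l.
lra.
Qed.

Lemma stewart_dense (D : set Z) : seq_complete Z ->
  (forall z (e : R), 0 < e -> exists2 w, D w & mdist z w < e) ->
  (forall x y l, D x -> D y -> 0 <= l <= 1 -> exists m, stewart_pt x y l m) ->
  stewart Z.
Proof.
move=> cZ dD h x y l l01.
have gt0 n : 0 < n.+1%:R^-1 :> R by rewrite invr_gt0.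
have dD' z (e : R) : 0 < e -> exists w, D w /\ mdist z w < e.
  by move=> /(dD z)[w]; exists w.
have [r /all_and2[rD hr]] := choice (fun n => dD' x _ (gt0 n)).
have [r' /all_and2[r'D hr']] := choice (fun n => dD' y _ (gt0 n)).
have [m hm] := choice (fun n => h _ _ l (rD n) (r'D n) l01).
apply: (@stewart_seq setT _ _ _ m) => //.
- by move=> z e e0; exists z => //; rewrite mdistxx.
move=> z _ e e0; have e4 : 0 < e / 4 by lra.
have [d1 d10 hd1] := sqr_cont (mdist_ge0 z x) e4.
have [d2 d20 hd2] := sqr_cont (mdist_ge0 z y) e4.
have [d3 d30 hd3] := sqr_cont (mdist_ge0 x y) e4.
pose d := Num.min d1 (Num.min d2 (d3 / 2)).
have d0 : 0 < d by rewrite !lt_min d10 d20 divr_gt0.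
have [dd1 dd2 dd3] : [/\ d <= d1, d <= d2 & d <= d3 / 2].
  by rewrite /d !ge_min !lexx !orbT.
exists (Num.truncn d^-1) => n hn.
have {hn} nd : n.+1%:R^-1 < d.
  rewrite invf_plt ?posrE//; apply: lt_le_trans (truncnS_gt _) _.
  by rewrite ler_nat.
have tri (u p q : Z) : `|mdist u p - mdist u q| <= mdist p q.
  by apply: le_trans (mdist_diff_le _ _ _ _) _; rewrite mdistxx add0r.
apply: le_trans (hm n z) _.
have xr : mdist x (r n) < d by apply: lt_trans nd.
have yr : mdist y (r' n) < d by apply: lt_trans nd.
have [|q1 _] := hd1 _ (mdist_ge0 z (r n)).
  by apply: le_trans (tri _ _ _) _; rewrite metric_sym; lra.
have [|q2 _] := hd2 _ (mdist_ge0 z (r' n)).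
  by apply: le_trans (tri _ _ _) _; rewrite metric_sym; lra.
have [|_ q3] := hd3 _ (mdist_ge0 (r n) (r' n)).
  have := tri (r n) (r' n) y.
  have := tri y (r n) x.
  rewrite (metric_sym (r n) y) (metric_sym y x).
  rewrite (metric_sym (r' n) y) (metric_sym (r n) x).
  rewrite !ler_norml => /andP[? ?] /andP[? ?].
  by apply/andP; split; lra.
case/andP: l01 => l0 l1; have l1' : 0 <= 1 - l by lra.
have := ler_wpM2l l1' q1; have := ler_wpM2l l0 q2.
have := ler_wpM2l (mulr_ge0 l0 l1') q3; nra.
Qed.

End stewart_limit.

Lemma close_trans {R : realType} (a b c x y e : R) : `|a - b| <= x + y ->
  x < e / 4 -> y < e / 4 -> b <= c -> c < b + e / 4 -> `|c - a| < e.
Proof.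
rewrite ler_norml ltr_norml => /andP[? ?] *; apply/andP; split; lra.
Qed.

Section transverse_facts.
Context {R : realType} (Y : metricType R) (catY : cat0 Y) (xi : boundary Y).
Implicit Types (rho sigma : rays_to xi).

Definition emb_ray rho : transverse catY xi :=
  to_completion (\pi_(ident (rays_to_pseudo_metric xi catY)) rho).

Lemma emb_ray_dist rho sigma :
  mdist (emb_ray rho) (emb_ray sigma) = rays_to_dist rho sigma.
Proof. by rewrite to_completion_dist; exact: ident_distE. Qed.

Lemma emb_ray_dense (p : transverse catY xi) (e : R) : 0 < e ->
  exists rho, mdist p (emb_ray rho) < e.
Proof.
move=> /(to_completion_dense p)[x hx]; exists (repr x).
by rewrite /emb_ray reprK.
Qed.

Lemma transverse_isometryE (f : isometry Y) (fxi : boundary_map f xi = xi) rho :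
  transverse_isometry catY fxi (emb_ray rho) = emb_ray (rays_to_map fxi rho).
Proof.
rewrite /transverse_isometry /emb_ray completion_isometry_to.
by congr to_completion; rewrite /= ident_map_pi//; exact: rays_to_map_dist.
Qed.

Lemma rays_to_asymptotic rho sigma : asymptotic (val rho) (val sigma).
Proof.
apply/endpointP.
by rewrite (set_valP rho : endpoint _ = _) (set_valP sigma : endpoint _ = _).
Qed.

Lemma rays_to_repr rho : asymptotic (val rho) (repr xi).
Proof.
by apply/endpointP; rewrite (set_valP rho : endpoint _ = _) /endpoint reprK.
Qed.

(* The point of rho on the horosphere of level -s at xi. *)
Definition level (s : R) rho : Y :=
  (val rho : ray Y) (s + busemann (repr xi) ((val rho : ray Y) 0)).

Lemma level_dist_shift rho sigma (u e : R) : 0 < e -> exists S, forall s,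
  S <= s -> [/\ 0 <= s + busemann (repr xi) ((val rho : ray Y) 0),
    0 <= s + u + busemann (repr xi) ((val sigma : ray Y) 0),
    rays_to_dist rho sigma ^+ 2 + u ^+ 2 <=
      mdist (level s rho) (level (s + u) sigma) ^+ 2 &
    mdist (level s rho) (level (s + u) sigma) <
      Num.sqrt (rays_to_dist rho sigma ^+ 2 + u ^+ 2) + e].
Proof.
move=> e0; have rt := rays_to_repr rho; have st := rays_to_repr sigma.
have [T hT] := aligned_dist catY (@busemann_lip _ _ (repr xi))
  (fun t t0 => busemann_ray catY rt t0) (fun t t0 => busemann_ray catY st t0)
  (rays_to_asymptotic rho sigma) u e0.
set a := busemann _ _ in hT; set b := busemann _ _ in hT.
exists (T - b) => s hs; have {}hs : T <= s + b by lra.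
have [h1 h2 h3 h4] := hT _ hs; rewrite /level -/a -/b.
have E : s + u + a = s + b + (a - b + u) by ring.
by rewrite E; split.
Qed.

Lemma level_dist rho sigma (e : R) : 0 < e -> exists S, forall s,
  S <= s -> [/\ 0 <= s + busemann (repr xi) ((val rho : ray Y) 0),
    rays_to_dist rho sigma <= mdist (level s rho) (level s sigma) &
    mdist (level s rho) (level s sigma) < rays_to_dist rho sigma + e].
Proof.
move=> /(level_dist_shift rho sigma 0)[S hS]; exists S => s /hS[h1 _].
rewrite addr0 expr0n addr0 sqrtr_sqr ger0_norm; last exact: ray_dist_ge0.
move=> h3 h4; split => //.
by apply: ler_of_sqr h3; exact: mdist_ge0.
Qed.

Lemma rays_to_dist_level rho (y : Y) sigma s : (val sigma : ray Y) 0 = y ->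
  0 <= s + busemann (repr xi) ((val rho : ray Y) 0) ->
  rays_to_dist sigma rho <= mdist y (level s rho).
Proof. by move=> <- s0; exact: ray_dist_le. Qed.

(** The choice of the representative is immaterial by [busemann_diff]. *)
Definition horo_invariant (f : Y -> Y) : Prop :=
  forall x, busemann (repr xi) (f x) = busemann (repr xi) x.

Lemma level_map (f : isometry Y) (fxi : boundary_map f xi = xi) s rho :
  horo_invariant f -> level s (rays_to_map fxi rho) = f (level s rho).
Proof. by move=> hf; rewrite /level /= /ray_fun /= hf. Qed.

Lemma transverse_complete : seq_complete (transverse catY xi).
Proof. exact: completion_complete. Qed.

(* Finitely many points of the transverse space and finitely many isometries
   preserving the horospheres at xi are seen, up to e, far away on the rays. *)
Lemma transverse_approx (I : choiceType) (s : seq I) (f : I -> isometry Y)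
    (f' : I -> transverse catY xi -> transverse catY xi)
    (ps : seq (transverse catY xi)) (e : R) : 0 < e ->
  (forall i, i \in s -> horo_invariant (f i) /\
     exists fxi : boundary_map (f i) xi = xi,
       forall p, f' i p = transverse_isometry catY fxi p) ->
  exists (r : transverse catY xi -> rays_to xi) (S : R), forall t, S <= t ->
    [/\ forall p, mdist p (emb_ray (r p)) < e,
        forall p, p \in ps ->
          0 <= t + busemann (repr xi) ((val (r p) : ray Y) 0),
        forall p p', p \in ps -> p' \in ps ->
          `|mdist (level t (r p)) (level t (r p')) - mdist p p'| < e,
        forall i p p', i \in s -> p \in ps -> p' \in ps ->
          `|mdist (f i (level t (r p))) (level t (r p')) - mdist (f' i p) p'| < e &
        forall p p', p \in ps -> p' \in ps ->
          rays_to_dist (r p) (r p') ^+ 2 + 1 <=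
          mdist (level t (r p)) (level (t + 1) (r p')) ^+ 2].
Proof.
move=> e0 hf; have e4 : 0 < e / 4 by lra.
have [r hr] := choice (fun p => @emb_ray_dense p _ e4).
exists r; have [S1 hS1] : exists T, forall t, T <= t -> forall w, w \in [seq (p, q) | p <- ps, q <- ps] ->
    [/\ 0 <= t + busemann (repr xi) ((val (r w.1) : ray Y) 0),
        `|mdist (level t (r w.1)) (level t (r w.2)) - mdist w.1 w.2| < e &
        rays_to_dist (r w.1) (r w.2) ^+ 2 + 1 <=
          mdist (level t (r w.1)) (level (t + 1) (r w.2)) ^+ 2].
  apply: eventually_all => -[p q] _ /=.
  have [T hT] := level_dist (r p) (r q) e4.
  have [T' hT'] := level_dist_shift (r p) (r q) 1 e4.
  exists (Num.max T T') => t; rewrite ge_max => /andP[/hT[h1 h2 h3] /hT'[_ _ h4 _]].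
  split => //; last by rewrite expr1n in h4.
  have := mdist_diff_le p (emb_ray (r p)) q (emb_ray (r q)).
  by rewrite (emb_ray_dist (r p) (r q)) => h5; exact: close_trans h5 (hr p) (hr q) h2 h3.
have [S2 hS2] : exists T, forall t, T <= t -> forall w,
    w \in [seq (i, q) | i <- s, q <- [seq (p, q) | p <- ps, q <- ps]] ->
    `|mdist (f w.1 (level t (r w.2.1))) (level t (r w.2.2))
       - mdist (f' w.1 w.2.1) w.2.2| < e.
  apply: eventually_all => -[i [p q]] /allpairsP[[i' w] [i's _ [-> _]]] /=.
  have {i's} [h0 [fxi fE]] := hf _ i's.
  have [T hT] := level_dist (rays_to_map fxi (r p)) (r q) e4.
  exists T => t /hT[h1 h2 h3].
  rewrite level_map// in h2 h3.
  have := mdist_diff_le (f' i' p) (emb_ray (rays_to_map fxi (r p))) q (emb_ray (r q)).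
  rewrite (emb_ray_dist (rays_to_map fxi (r p)) (r q)) -transverse_isometryE fE.
  rewrite (isom_dist (transverse_isometry catY fxi)) => h5.
  exact: close_trans h5 (hr p) (hr q) h2 h3.
exists (Num.max S1 S2) => t; rewrite ge_max => /andP[/hS1{}hS1 /hS2{}hS2].
split.
- by move=> p; apply: lt_trans (hr p) _; lra.
- move=> p pps; have [] // := hS1 (p, p).
  by apply/allpairsP; exists (p, p).
- move=> p q pps qps; have [] // := hS1 (p, q).
  by apply/allpairsP; exists (p, q).
- move=> i p q iis pps qps; apply: (hS2 (i, (p, q))).
  apply/allpairsP; exists (i, (p, q)); split=> //.
  by apply/allpairsP; exists (p, q).
- move=> p q pps qps; have [] // := hS1 (p, q).
  by apply/allpairsP; exists (p, q).
Qed.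

Hypothesis cY : seq_complete Y.

(** For two points given by rays, divide the segment between their points of level t and start a ray
    towards xi there. Transverse distances are at most distances of starting points, so the
    inequality in Y at high levels t yields the approximate one asked for by [stewart_seq]. *)
Lemma transverse_stewart : stewart (transverse catY xi).
Proof.
have emb (rho sigma : rays_to xi) (l : R) : 0 <= l <= 1 ->
    exists m, stewart_pt (emb_ray rho) (emb_ray sigma) l m.
  move=> l01.
  have [S0 hS0] := level_dist rho sigma ltr01.
  pose t n : R := `|S0| + n%:R.
  have tS0 n : S0 <= t n by rewrite /t; have := ler_norm S0; have := ler0n R n; lra.
  pose p n := conv (level (t n) rho) (level (t n) sigma) l.
  have ex n : exists tau : rays_to xi, (val tau : ray Y) 0 = p n.
    have [tau [tau0 as_tau]] := ray_from catY (p n) (val rho : ray Y) cY.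
    have h : tau \in [set r | endpoint r = xi].
      apply/mem_set => /=; rewrite -(set_valP rho : endpoint _ = _).
      exact/endpointP.
    by exists (SigSub h).
  have [tau htau] := choice ex.
  apply: (@stewart_seq _ _ [set z | exists rho, z = emb_ray rho] _ _ _
    (fun n => emb_ray (tau n))) => //.
  - exact: transverse_complete.
  - move=> z e /(emb_ray_dense z)[r hr]; exists (emb_ray r) => //.
    by exists r.
  - by exists rho.
  - by exists sigma.
  - by move=> n; exists (tau n).
  move=> _ [zeta ->] e e0.
  rewrite (emb_ray_dist zeta rho) (emb_ray_dist zeta sigma) (emb_ray_dist rho sigma).
  have rd0 (a b : rays_to xi) : 0 <= rays_to_dist a b by exact: ray_dist_ge0.
  have e4 : 0 < e / 4 by lra.
  have [d1 d10 hd1] := sqr_cont (rd0 zeta rho) e4.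
  have [d2 d20 hd2] := sqr_cont (rd0 zeta sigma) e4.
  have [S1 hS1] := level_dist zeta rho d10.
  have [S2 hS2] := level_dist zeta sigma d20.
  exists (Num.truncn (`|S1| + `|S2|)).+1 => n hn.
  have {hn} : `|S1| + `|S2| < n%:R.
    by apply: lt_le_trans (truncnS_gt _) _; rewrite ler_nat.
  have := ler_norm S1; have := ler_norm S2.
  have := normr_ge0 S1; have := normr_ge0 S2; have := normr_ge0 S0 => *.
  have tS1 : S1 <= t n by rewrite /t; lra.
  have tS2 : S2 <= t n by rewrite /t; lra.
  have [a1 a2 a3] := hS1 _ tS1; have [_ b2 b3] := hS2 _ tS2.
  have [_ c2 _] := hS0 _ (tS0 n).
  have := rays_to_dist_level (htau n) a1.
  rewrite {1}/rays_to_dist ray_distC -/(rays_to_dist zeta (tau n)).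
  rewrite metric_sym => h.
  have {}h : rays_to_dist zeta (tau n) ^+ 2 <= mdist (level (t n) zeta) (p n) ^+ 2.
    by rewrite lerXn2r ?nnegrE ?mdist_ge0.
  rewrite (emb_ray_dist zeta (tau n)).
  apply: (le_trans h); apply: le_trans (convP catY _ _ l01 _) _.
  have [|q1 _] := hd1 _ (mdist_ge0 (level (t n) zeta) (level (t n) rho)).
    by rewrite ger0_norm; lra.
  have [|q2 _] := hd2 _ (mdist_ge0 (level (t n) zeta) (level (t n) sigma)).
    by rewrite ger0_norm; lra.
  have q3 : rays_to_dist rho sigma ^+ 2 <=
      mdist (level (t n) rho) (level (t n) sigma) ^+ 2.
    by rewrite lerXn2r ?nnegrE ?mdist_ge0.
  case/andP: l01 => l0 l1; have l1' : 0 <= 1 - l by lra.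
  have := ler_wpM2l l1' q1; have := ler_wpM2l l0 q2.
  have := ler_wpM2l (mulr_ge0 l0 l1') q3; nra.
apply: (@stewart_dense _ _ [set z | exists rho, z = emb_ray rho]).
- exact: transverse_complete.
- move=> z e /(emb_ray_dense z)[r hr]; exists (emb_ray r) => //.
  by exists r.
- by move=> _ _ l [r ->] [s ->]; exact: emb.
Qed.

End transverse_facts.

(** * Bounded geometry and isometries *)

Section bounded_geometry.
Context {R : realType}.
Implicit Type Y : metricType R.

Definition bounded_geometry Y : Prop := forall K r : R, 0 < r ->
  exists N, forall (c : Y) (s : seq Y), all (fun x => mdist c x <= K) s ->
    pairwise (fun x y => r <= mdist x y) s -> (size s <= N)%N.

(* Approximate copies of m pairwise orthogonal unit vectors. *)
Definition orthoframe Y (m : nat) : Prop := forall e : R, 0 < e ->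
  exists (c : Y) (s : seq Y), [/\ size s = m,
    all (fun x => `|mdist c x - 1| < e) s &
    pairwise (fun x y => 2 - e < mdist x y ^+ 2) s].

Lemma orthoframe0 Y : Y -> orthoframe Y 0.
Proof. by move=> y e e0; exists y, [::]. Qed.

(** With error 1/2 the points of an orthoframe lie within 2 of the centre and are at least 1
    apart. *)
Lemma orthoframe_bound Y : bounded_geometry Y -> exists M, ~ orthoframe Y M.
Proof.
move=> /(_ 2 1 ltr01)[N hN]; exists N.+1 => /(_ 2^-1)[|c [s [ss sc sp]]]; first by lra.
suff : (N.+1 <= N)%N by rewrite ltnn.
rewrite -{1}ss; apply: (hN c s).
  by apply: sub_all sc => x; rewrite ltr_norml => /andP[_]; lra.
apply: sub_pairwise sp => x y h; apply: ler_of_sqr; first exact: mdist_ge0.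
by rewrite expr1n; lra.
Qed.

Lemma sub_pairwise_in (T : eqType) (r r' : rel T) (s : seq T) :
  (forall x y, x \in s -> y \in s -> r x y -> r' x y) ->
  pairwise r s -> pairwise r' s.
Proof.
elim: s => //= x s IHs h /andP[/allP xs ps]; apply/andP; split.
  apply/allP => y ys; apply: h; rewrite ?inE ?eqxx ?ys ?orbT//.
  exact: xs.
by apply: IHs => // y z ys zs; apply: h; rewrite inE ?ys ?zs orbT.
Qed.

Section transverse.
Variables (Y : metricType R) (catY : cat0 Y) (xi : boundary Y).

Lemma transverse_bounded_geometry : bounded_geometry Y ->
  bounded_geometry (transverse catY xi).
Proof.
move=> bg K r r0; have r2 : 0 < r / 2 by lra.
have [N hN] := bg (K + 1) _ r2; exists N => c s sc sp.
pose e := Num.min 1 (r / 2).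
have e0 : 0 < e by rewrite lt_min ltr01.
have [e1 er] : e <= 1 /\ e <= r / 2 by rewrite /e !ge_min !lexx orbT.
(* Only points are approximated here: the list of isometries is empty and the family over [unit] is
   a placeholder. *)
have [//|q [S /(_ S (lexx _))[_ _ hq _ _]]] := @transverse_approx _ _ catY xi unit [::]
  (fun=> Isometry (fun x y => erefl) (fun y => ex_intro _ y erefl)) (fun _ => id) (c :: s) e e0.
rewrite -(size_map (fun p => level S (q p))).
apply: (hN (level S (q c))).
  rewrite all_map; apply/allP => x xs /=.
  have := hq c x (mem_head _ _); rewrite inE xs orbT => /(_ isT).
  have := allP sc _ xs; rewrite ltr_norml.
  move: (mdist c x) (mdist _ _) => u v ? /andP[_ ?]; lra.
rewrite pairwise_map; apply: sub_pairwise_in sp => x y xs ys /= h.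
have := hq x y; rewrite !inE xs ys !orbT => /(_ isT isT).
move: h; rewrite ltr_norml; move: (mdist x y) (mdist _ _) => u v ? /andP[? _].
lra.
Qed.

(** The direction towards xi is orthogonal to all transverse ones: the new vector is one unit step
    along the ray of the centre, and Pythagoras between the levels S and S + 1 gives the distance
    sqrt 2. So each passage to a transverse space uses up one dimension. *)
Lemma transverse_orthoframe m : orthoframe (transverse catY xi) m ->
  orthoframe Y m.+1.
Proof.
move=> fr e' e'0; pose e := Num.min 1 e'.
have e0 : 0 < e by rewrite lt_min ltr01.
have [e1 ee'] : e <= 1 /\ e <= e' by rewrite /e !ge_min !lexx orbT.
have e8 : 0 < e / 8 by lra.
have [c [s [ss sc sp]]] := fr _ e8.
have [//|q [S /(_ S (lexx _))[q1 q2 q3 _ q4]]] := @transverse_approx _ _ catY xi unit [::]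
  (fun=> Isometry (fun x y => erefl) (fun y => ex_intro _ y erefl)) (fun _ => id) (c :: s) _ e8.
have cin : c \in c :: s by exact: mem_head.
have sin x : x \in s -> x \in c :: s by move=> xs; rewrite inE xs orbT.
have b0 := q2 _ cin.
exists (level S (q c)), (level (S + 1) (q c) :: [seq level S (q x) | x <- s]).
split; first by rewrite /= size_map ss.
  rewrite /= /level rayP//; last by lra.
  rewrite opprD addrACA subrr addr0 opprD addNKr normrN1 subrr normr0 e'0/=.
  rewrite all_map; apply/allP => x xs /=.
  have := q3 c x cin (sin x xs); have := allP sc _ xs; rewrite /level.
  move: (mdist c x) (mdist _ _) => u v; rewrite !ltr_norml => /andP[? ?] /andP[? ?].
  by apply/andP; split; lra.
rewrite /=; apply/andP; split.
  rewrite all_map; apply/allP => x xs /=.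
  have := q4 x c (sin x xs) cin; rewrite (metric_sym (level S _)).
  have := mdist_diff_le x (emb_ray catY (q x)) c (emb_ray catY (q c)).
  rewrite (emb_ray_dist catY (q x) (q c)) (metric_sym x c).
  have := q1 x; have := q1 c; have := allP sc _ xs.
  move: (mdist c x) (mdist c _) (mdist x _) (mdist _ _) (rays_to_dist _ _).
  move=> u v w t z; rewrite ltr_norml ler_norml => /andP[? ?] ? ? /andP[? ?] ?.
  have : 1 - 3 * (e / 8) <= z by lra.
  by nra.
rewrite pairwise_map; apply: sub_pairwise_in sp => x y xs ys /= h.
have := q3 x y (sin x xs) (sin y ys).
have := allP sc _ xs; have := allP sc _ ys.
have := metric_triangle x c y; rewrite (metric_sym x c).
have := mdist_ge0 x y; have := mdist_ge0 (level S (q x)) (level S (q y)).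
move: h; move: (mdist x y) (mdist c x) (mdist c y)
  (mdist (level S (q x)) (level S (q y))) => u v w t.
rewrite !ltr_norml => ? ? ? ? /andP[? ?] /andP[? ?] /andP[? ?].
have u3 : u <= 3 by lra.
have t1 : u - e / 8 <= t by lra.
by nra.
Qed.

End transverse.

End bounded_geometry.

(** * Isometries of transverse spaces and of refined points *)

Section isometry_group.
Context {R : realType}.
Implicit Type Y : metricType R.

Lemma isometry_ext Y (f g : isometry Y) : (forall x, f x = g x) -> f = g.
Proof.
case: f g => f fd fs [g gd gs] /= /funext h; subst g.
by congr Isometry; exact: Prop_irrelevance.
Qed.

Definition isom_id Y : isometry Y :=
  Isometry (fun x y : Y => erefl (mdist x y)) (fun y => ex_intro _ y erefl).

Section ops.
Variables (Y : metricType R) (f g : isometry Y).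

Lemma isom_comp_dist x y : mdist (f (g x)) (f (g y)) = mdist x y.
Proof. by rewrite !isom_dist. Qed.

Lemma isom_comp_surj y : exists x, f (g x) = y.
Proof.
by have [z <-] := isom_surj f y; have [x <-] := isom_surj g z; exists x.
Qed.

Definition isom_comp : isometry Y := Isometry isom_comp_dist isom_comp_surj.

Definition isom_inv_fun (y : Y) : Y := projT1 (cid (isom_surj f y)).

Lemma isom_invK y : f (isom_inv_fun y) = y.
Proof. by rewrite /isom_inv_fun; case: cid. Qed.

Lemma isom_inj x y : f x = f y -> x = y.
Proof.
by move=> fxy; apply: mdist_positivity; rewrite -(isom_dist f) fxy mdistxx.
Qed.

Lemma isom_inv_dist x y : mdist (isom_inv_fun x) (isom_inv_fun y) = mdist x y.
Proof. by rewrite -(isom_dist f) !isom_invK. Qed.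

Lemma isom_inv_surj y : exists x, isom_inv_fun x = y.
Proof. by exists (f y); apply: isom_inj; rewrite isom_invK. Qed.

Definition isom_inv : isometry Y := Isometry isom_inv_dist isom_inv_surj.

End ops.

Lemma boundary_map_comp Y (f g : isometry Y) xi :
  boundary_map (isom_comp f g) xi = boundary_map f (boundary_map g xi).
Proof.
have -> : xi = endpoint (repr xi) by rewrite /endpoint reprK.
by rewrite !boundary_map_endpoint; congr endpoint; apply/val_inj.
Qed.

Lemma boundary_map_id Y xi : boundary_map (isom_id Y) xi = xi.
Proof.
have -> : xi = endpoint (repr xi) by rewrite /endpoint reprK.
by rewrite boundary_map_endpoint; congr endpoint; apply/val_inj.
Qed.

Lemma boundary_map_inv Y (f : isometry Y) xi :
  boundary_map f xi = xi -> boundary_map (isom_inv f) xi = xi.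
Proof.
move=> fxi; rewrite -{1}fxi -boundary_map_comp.
rewrite (_ : isom_comp _ _ = isom_id Y) ?boundary_map_id//.
by apply: isometry_ext => x /=; apply: (@isom_inj _ f); rewrite isom_invK.
Qed.

Section transverse.
Variables (Y : metricType R) (catY : cat0 Y) (xi : boundary Y).

Lemma transverse_isometry_ext (f : isometry Y) (fxi : boundary_map f xi = xi)
    (h : isometry (transverse catY xi)) :
  (forall rho, h (emb_ray catY rho) = emb_ray catY (rays_to_map fxi rho)) ->
  h = transverse_isometry catY fxi.
Proof.
move=> hE; apply: isometry_ext => p; apply: mdist_positivity.
apply/eqP; rewrite eq_le mdist_ge0 andbT; apply: ler_eps => e e0.
have e2 : 0 < e / 2 by lra.
have [r hr] := emb_ray_dense p e2.
apply: le_trans (metric_triangle _ (h (emb_ray catY r)) _) _.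
rewrite (isom_dist h) hE -transverse_isometryE.
rewrite (isom_dist (transverse_isometry catY fxi)).
rewrite (metric_sym (emb_ray catY r)).
by move: (mdist _ _) hr => u ?; lra.
Qed.

Lemma transverse_isometry_comp (f g : isometry Y)
    (fxi : boundary_map f xi = xi) (gxi : boundary_map g xi = xi)
    (fgxi : boundary_map (isom_comp f g) xi = xi) :
  transverse_isometry catY fgxi =
  isom_comp (transverse_isometry catY fxi) (transverse_isometry catY gxi).
Proof.
apply/esym/transverse_isometry_ext => // rho.
rewrite [LHS]/= -[LHS]/((transverse_isometry catY fxi) (transverse_isometry catY gxi (emb_ray catY rho))).
rewrite !transverse_isometryE; congr emb_ray.
by apply/val_inj/val_inj.
Qed.

Lemma transverse_isometry_id (f : isometry Y)
    (fxi : boundary_map f xi = xi) : f = isom_id Y ->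
  transverse_isometry catY fxi = isom_id _.
Proof.
move=> f1; apply/esym/transverse_isometry_ext => // rho; congr emb_ray.
by apply/val_inj/val_inj; rewrite /= f1.
Qed.

Lemma transverse_isometry_inv (f : isometry Y)
    (fxi : boundary_map f xi = xi) (f'xi : boundary_map (isom_inv f) xi = xi) :
  transverse_isometry catY f'xi = isom_inv (transverse_isometry catY fxi).
Proof.
apply: isometry_ext => p; apply: (@isom_inj _ (transverse_isometry catY fxi)).
rewrite [RHS]isom_invK.
have h : isom_comp f (isom_inv f) = isom_id Y.
  by apply: isometry_ext => x /=; rewrite isom_invK.
have idxi : boundary_map (isom_comp f (isom_inv f)) xi = xi.
  by rewrite h boundary_map_id.
have E : isom_comp (transverse_isometry catY fxi) (transverse_isometry catY f'xi) =
    isom_id _.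
  by rewrite -(transverse_isometry_comp _ _ idxi); exact: transverse_isometry_id.
by rewrite -[LHS]/(isom_comp (transverse_isometry catY fxi)
  (transverse_isometry catY f'xi) p) E.
Qed.

(** f carries the Busemann function of [repr xi] to that of another ray towards xi, which differs by
    a constant. This constant is the Busemann character of f. *)
Lemma horo_shift (f : isometry Y) (fxi : boundary_map f xi = xi) (x y : Y) :
  busemann (repr xi) (f x) - busemann (repr xi) x =
  busemann (repr xi) (f y) - busemann (repr xi) y.
Proof.
have bf (z : Y) : busemann (ray_map f (repr xi)) (f z) = busemann (repr xi) z.
  rewrite /busemann; congr inf; apply/seteqP; split=> _ [t t0 ->]; exists t => //.
    by rewrite [ray_map f _ t]/ray_fun /= isom_dist.
  by rewrite [ray_map f _ t]/ray_fun /= isom_dist.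
have asy : asymptotic (repr xi) (ray_map f (repr xi)).
  apply/endpointP; rewrite -boundary_map_endpoint.
  by rewrite {2}/endpoint reprK fxi /endpoint reprK.
by have := busemann_diff catY asy (f x) (f y); rewrite !bf.
Qed.

End transverse.

Lemma fixes_id Y (p : refined_point Y) : fixes (isom_id Y) p.
Proof.
elim: p => {}Y //= catY xi q IHq; exists (boundary_map_id xi).
by rewrite (transverse_isometry_id _ (boundary_map_id xi)).
Qed.

Lemma fixes_comp Y (f g : isometry Y) (p : refined_point Y) :
  fixes f p -> fixes g p -> fixes (isom_comp f g) p.
Proof.
elim: p f g => {Y}[Y x f g /= fx gx|Y catY xi q IHq f g /= [fxi fq] [gxi gq]].
  by rewrite gx.
have fgxi : boundary_map (isom_comp f g) xi = xi.
  by rewrite boundary_map_comp gxi.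
by exists fgxi; rewrite (transverse_isometry_comp catY fxi gxi); exact: IHq.
Qed.

Lemma fixes_inv Y (f : isometry Y) (p : refined_point Y) :
  fixes f p -> fixes (isom_inv f) p.
Proof.
elim: p f => {Y}[Y x f /= fx|Y catY xi q IHq f /= [fxi fq]].
  by apply: (@isom_inj _ f); rewrite isom_invK.
exists (boundary_map_inv fxi).
by rewrite (transverse_isometry_inv catY fxi); exact: IHq.
Qed.

(* The kernel of all the Busemann characters on the stabilizer of p. *)
Fixpoint horo_fixes Y (f : isometry Y) (p : refined_point Y) : Prop :=
  match p with
  | here x => f x = x
  | toward catY xi q => horo_invariant xi f /\
      exists fxi : boundary_map f xi = xi,
        horo_fixes (transverse_isometry catY fxi) q
  end.

Lemma horo_fixes_fixes Y (f : isometry Y) (p : refined_point Y) :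
  horo_fixes f p -> fixes f p.
Proof.
by elim: p f => {}Y //= catY xi q IHq f [_ [fxi h]]; exists fxi; exact: IHq.
Qed.

Lemma horo_fixes_id Y (p : refined_point Y) : horo_fixes (isom_id Y) p.
Proof.
elim: p => {}Y //= catY xi q IHq; split=> //; exists (boundary_map_id xi).
by rewrite (transverse_isometry_id _ (boundary_map_id xi)).
Qed.

Lemma horo_fixes_comp Y (f g : isometry Y) (p : refined_point Y) :
  horo_fixes f p -> horo_fixes g p -> horo_fixes (isom_comp f g) p.
Proof.
elim: p f g => {Y}[Y x f g /= fx gx|Y catY xi q IHq f g /= [hf [fxi fq]] [hg [gxi gq]]].
  by rewrite gx.
have fgxi : boundary_map (isom_comp f g) xi = xi.
  by rewrite boundary_map_comp gxi.
split; first by move=> x /=; rewrite hf hg.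
by exists fgxi; rewrite (transverse_isometry_comp catY fxi gxi); exact: IHq.
Qed.

Lemma horo_fixes_inv Y (f : isometry Y) (p : refined_point Y) :
  horo_fixes f p -> horo_fixes (isom_inv f) p.
Proof.
elim: p f => {Y}[Y x f /= fx|Y catY xi q IHq f /= [hf [fxi fq]]].
  by apply: (@isom_inj _ f); rewrite isom_invK.
split; first by move=> x /=; rewrite -hf isom_invK.
exists (boundary_map_inv fxi).
by rewrite (transverse_isometry_inv catY fxi); exact: IHq.
Qed.

Definition isom_comm Y (f g : isometry Y) : isometry Y :=
  isom_comp (isom_comp f g) (isom_comp (isom_inv f) (isom_inv g)).

(** The Busemann character takes values in an abelian group. *)
Lemma horo_invariant_comm Y (catY : cat0 Y) xi (f g : isometry Y) :
  boundary_map f xi = xi -> boundary_map g xi = xi ->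
  horo_invariant xi (isom_comm f g).
Proof.
move=> fxi gxi x /=.
set y := isom_inv_fun f _.
have := horo_shift catY fxi (g y) y; have := horo_shift catY gxi y (isom_inv_fun g x).
rewrite isom_invK; have : f y = isom_inv_fun g x by exact: isom_invK.
by move=> ->; lra.
Qed.

Lemma horo_fixes_comm Y (f g : isometry Y) (p : refined_point Y) :
  fixes f p -> fixes g p -> horo_fixes (isom_comm f g) p.
Proof.
elim: p f g => {Y}[Y x f g /= fx gx|Y catY xi q IHq f g /= [fxi fq] [gxi gq]].
  have -> : isom_inv_fun g x = x by apply: (@isom_inj _ g); rewrite isom_invK.
  have -> : isom_inv_fun f x = x by apply: (@isom_inj _ f); rewrite isom_invK.
  by rewrite gx.
split; first exact: horo_invariant_comm.
have fgxi : boundary_map (isom_comp f g) xi = xi.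
  by rewrite boundary_map_comp gxi.
have f'xi := boundary_map_inv fxi; have g'xi := boundary_map_inv gxi.
have fg'xi : boundary_map (isom_comp (isom_inv f) (isom_inv g)) xi = xi.
  by rewrite boundary_map_comp g'xi.
have cxi : boundary_map (isom_comm f g) xi = xi.
  by rewrite boundary_map_comp fg'xi.
exists cxi; rewrite (transverse_isometry_comp catY fgxi fg'xi).
rewrite (transverse_isometry_comp catY fxi gxi).
rewrite (transverse_isometry_comp catY f'xi g'xi).
rewrite (transverse_isometry_inv catY fxi) (transverse_isometry_inv catY gxi).
exact: IHq.
Qed.

(** Total in f, with the identity as default, so that a family of isometries can be transported
    without its proofs of fixing xi. *)
Definition induced_isometry Y (catY : cat0 Y) (xi : boundary Y)
    (f : isometry Y) : isometry (transverse catY xi) :=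
  if pselect (boundary_map f xi = xi) is left fxi then
    transverse_isometry catY fxi else isom_id _.

Lemma induced_isometryE Y (catY : cat0 Y) (xi : boundary Y) (f : isometry Y)
    (fxi : boundary_map f xi = xi) :
  induced_isometry catY xi f = transverse_isometry catY fxi.
Proof.
rewrite /induced_isometry; case: pselect => // h.
by congr transverse_isometry; exact: Prop_irrelevance.
Qed.

(** Induction along p: a point of the transverse space that is moved little is replaced by a far
    point of a ray. Isometries preserving the horospheres move that point by nearly the same amount,
    since they preserve levels. *)
Lemma horo_fixes_displacement Y (p : refined_point Y) (I : choiceType)
    (s : seq I) (f : I -> isometry Y) (e : R) : 0 < e ->
  (forall i, i \in s -> horo_fixes (f i) p) ->
  exists y, forall i, i \in s -> mdist (f i y) y < e.
Proof.
elim: p f e => {Y}[Y x f e /= e0 h|Y catY xi q IHq f e /= e0 h].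
  by exists x => i /h ->; rewrite mdistxx.
have e2 : 0 < e / 2 by lra.
have [|z hz] := IHq (fun i => induced_isometry catY xi (f i)) _ e2.
  by move=> i /h[_ [fxi hq]]; rewrite (induced_isometryE catY fxi).
have [|r [S /(_ S (lexx _))[_ _ _ h4 _]]] := @transverse_approx _ _ catY xi I s f
  (fun i => induced_isometry catY xi (f i)) [:: z] _ e2.
  move=> i /h[hf [fxi _]]; split=> //; exists fxi => w.
  by rewrite (induced_isometryE catY fxi).
exists (level S (r z)) => i si.
have := h4 i z z si (mem_head _ _) (mem_head _ _); have := hz i si.
move: (mdist (induced_isometry catY xi (f i) z) z)
  (mdist (f i (level S (r z))) (level S (r z))) => u v.
by rewrite ltr_norml => ? /andP[? ?]; lra.
Qed.

End isometry_group.

(** * Totally disconnected locally compact groups *)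

(** The finite intersection property for families directed downwards. *)
Lemma compact_directed {T : topologicalType} (K : set T) (D : set (set T)) :
  compact K -> D !=set0 -> (forall A, D A -> closed A) ->
  (forall A B, D A -> D B -> exists2 C, D C & C `<=` A `&` B) ->
  (forall A, D A -> A `&` K !=set0) ->
  exists2 x, K x & forall A, D A -> A x.
Proof.
move=> cK [A0 DA0] Dcl Ddir DK.
pose F : set_system T := filter_from D (fun A => A `&` K).
have FF : Filter F.
  apply: filter_from_filter; first by exists A0.
  move=> A B DA DB; have [C DC CAB] := Ddir A B DA DB; exists C => //.
  by move=> x [/CAB[Ax Bx] Kx].
have PF : ProperFilter F by apply: filter_from_proper => A /DK.
have [|x [Kx Fx]] := cK F PF; first by exists A0 => // x [].
exists x => // A DA; apply: Dcl => // B xB.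
have [|y [[Ay Ky] By]] := Fx (A `&` K) B _ xB; first by exists A.
by exists y.
Qed.

Section topological_group.
Context {G : topologicalGroupType}.
Local Open Scope group_scope.
Implicit Types (A B U V W : set G) (g h x y : G).

Lemma cvgMg {T} {F : set_system T} {FF : Filter F} (f f' : T -> G) x y :
  f @ F --> x -> f' @ F --> y -> (fun t => f t * f' t) @ F --> x * y.
Proof.
move=> fx fy; apply: (@cvg_comp _ _ _ (fun t => (f t, f' t))
  (fun p : G * G => p.1 * p.2) F (nbhs (x, y))).
  exact: cvg_pair.
exact: (mulg_continuous (x, y)).
Qed.

Lemma cvgVg {T} {F : set_system T} {FF : Filter F} (f : T -> G) x :
  f @ F --> x -> (fun t => (f t)^-1) @ F --> x^-1.
Proof. by move=> fx; apply: cvg_comp fx _; exact: invg_continuous. Qed.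

Lemma lmul_continuous g : continuous (fun x => g * x).
Proof. by move=> x; apply: cvgMg; [exact: cvg_cst|exact: cvg_id]. Qed.

Lemma open_ltranslate g A : open A -> open [set x | A (g * x)].
Proof. by move=> oA; apply: (open_comp (f := fun x => g * x)) => // x _; exact: lmul_continuous. Qed.

Lemma nbhs_ltranslate g A : nbhs 1 A -> nbhs g [set x | A (g^-1 * x)].
Proof.
move=> A1; apply: (@lmul_continuous g^-1 g); by rewrite mulVg.
Qed.

Lemma subgroup_open U : is_subgroup U -> nbhs 1 U -> open U.
Proof.
move=> [U1 UM UV] nU; rewrite openE => g Ug.
apply: filterS (nbhs_ltranslate g nU) => x /= h.
by rewrite -(mulVKg g x); exact: UM.
Qed.

Lemma subgroup_closed U : is_subgroup U -> nbhs 1 U -> closed U.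
Proof.
move=> sU nU g clg; have [U1 UM UV] := sU.
have [h [Uh /= Ugh]] := clg _ (nbhs_ltranslate g nU).
have -> : g = h * (g^-1 * h)^-1 by rewrite invgM invgK mulVKg.
by apply: UM => //; exact: UV.
Qed.

Hypothesis tdG : totally_disconnected [set: G].

Lemma td_closed1 x : closed [set x].
Proof. by rewrite -(tdG I); exact: component_closed closedT. Qed.

Lemma td_hausdorff : hausdorff_space G.
Proof.
move=> p q pq; apply: contrapT => neq.
have n1 : p^-1 * q <> 1.
  by move=> h; apply: neq; rewrite -(mulVKg p q) h mulg1.
have h : (fun z : G * G => z.1^-1 * z.2) @ (nbhs (p, q)) --> p^-1 * q.
  by apply: cvgMg; [apply: cvgVg; exact: cvg_fst|exact: cvg_snd].
have /h : nbhs (p^-1 * q) (~` [set 1]).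
  by apply: open_nbhs_nbhs; split=> //; apply: closed_openC; exact: td_closed1.
move=> [[A B] [/= Ap Bq] AB].
have [z [Az Bz]] := pq _ _ Ap Bq.
by have := AB (z, z) (conj Az Bz); rewrite /= mulVg.
Qed.

Section quasicomponent.
Variables (C : set G).
Hypothesis cC : compact C.
Hypothesis C1 : C 1.

Let clC : closed C. Proof. exact: compact_closed td_hausdorff cC. Qed.

(** The relatively clopen subsets of C containing 1; their intersection Q is the quasi-component of
    1 in C. *)
Let D : set (set G) :=
  [set A | [/\ A `<=` C, closed A, closed (C `\` A) & A 1]].

Let DC : D C.
Proof. by split => //; rewrite setDv; exact: closed0. Qed.

Let DI A B : D A -> D B -> D (A `&` B).
Proof.
move=> [AC cA cA' A1] [BC cB cB' B1]; split => //.
- by move=> x [/AC].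
- exact: closedI.
- by rewrite setDIr; exact: closedU.
Qed.

Let Q : set G := \bigcap_(A in D) A.

Let D_small W : open W -> Q `<=` W -> exists2 A, D A & A `<=` W.
Proof.
move=> oW QW; apply: contrapT => h.
have [|||A B DA DB|A DA|x] := @compact_directed _ (C `\` W) D.
- rewrite setDE; apply: compact_closedI => //; exact: open_closedC.
- by exists C.
- by move=> A [].
- by exists (A `&` B) => //; exact: DI.
- apply: contrapT => AW; apply: h; exists A => // x Ax; apply: contrapT => Wx.
  by apply: AW; exists x; split=> //; split=> //; case: DA => /(_ x Ax).
- by move=> [Cx Wx] /QW.
Qed.

Let compact_separate E0 E1 : compact E0 -> compact E1 ->
  E0 `&` E1 = set0 -> exists U0 U1, [/\ open U0, open U1, E0 `<=` U0,
    E1 `<=` U1 & U0 `&` U1 = set0].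
Proof.
move=> c0 c1 E01.
have /compact_near_coveringP/(_ _ (nbhs (1 : G, 1 : G))
  (fun gh xy => xy.1 * gh.1 <> xy.2 * gh.2)) := compact_setX c0 c1.
move=> /(_ _ _)[].
  move=> [x y] [/= E0x E1y].
  have h : (fun z : (G * G) * (G * G) => (z.1.1 * z.2.1)^-1 * (z.1.2 * z.2.2))
      @ (nbhs ((x, y), (1 : G, 1 : G))) --> (x * 1)^-1 * (y * 1).
    by apply: cvgMg; [apply: cvgVg|]; apply: cvgMg;
      apply: cvg_comp; (exact: cvg_fst || exact: cvg_snd).
  have xy : (x * 1)^-1 * (y * 1) <> 1.
    rewrite !mulg1 => e; have : (E0 `&` E1) x.
      by split => //; rewrite -(mulg1 x) -e mulVKg.
    by rewrite E01.
  have : nbhs ((x * 1)^-1 * (y * 1)) (~` [set 1]).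
    by apply: open_nbhs_nbhs; split=> //; apply: closed_openC; exact: td_closed1.
  move=> /h [[A B] [/= Axy B11] AB]; exists (A, B) => //.
  by move=> [z w] zw /= e; apply: (AB (z, w) zw); rewrite /= e mulVg.
move=> [V0 V1] [/= nV0 nV1] V01.
have op E V : open [set z | exists2 x, E x & V° (x^-1 * z)].
  rewrite (_ : mkset _ = \bigcup_(x in E) [set z | V° (x^-1 * z)]).
    by apply: bigcup_open => x _; apply: open_ltranslate; exact: open_interior.
  by apply/seteqP; split.
exists [set z | exists2 x, E0 x & V0° (x^-1 * z)],
  [set z | exists2 x, E1 x & V1° (x^-1 * z)]; split; try exact: op.
- by move=> x Ex; exists x => //; rewrite mulVg.
- by move=> x Ex; exists x => //; rewrite mulVg.
- rewrite -subset0 => z [[x Ex /interior_subset Vx] [y Ey /interior_subset Vy]].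
  by apply: (V01 (x^-1 * z, y^-1 * z) (conj Vx Vy) (x, y) (conj Ex Ey));
    rewrite /= !mulVKg.
Qed.

Let Q1 : Q 1. Proof. by move=> A []. Qed.

Let Q_closed : closed Q. Proof. by apply: closed_bigI => A []. Qed.

Let Q_sub A : D A -> Q `<=` A. Proof. by move=> DA x; exact. Qed.

Let Q_compact : compact Q.
Proof. by apply: (subclosed_compact Q_closed cC); exact: Q_sub. Qed.

Let Q_split U0 U1 : open U0 -> open U1 -> U0 `&` U1 = set0 ->
  Q `<=` U0 `|` U1 -> U0 1 -> Q `<=` U0.
Proof.
move=> o0 o1 U01 QU U01'; have [A DA AU] := D_small (openU o0 o1) QU.
have [AC cA cA' A1] := DA.
have d z : U0 z -> U1 z -> False.
  by move=> a b; have : (U0 `&` U1) z by []; rewrite U01.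
have e0 : A `&` U0 = A `&` ~` U1.
  apply/seteqP; split => z [Az h]; split => //; first by move=> /(d _ h).
  by case: (AU z Az) => // /h.
have e1 : C `\` (A `&` U0) = (C `\` A) `|` (A `&` ~` U0).
  apply/seteqP; split => z.
    move=> [Cz h]; have [Az|Az] := pselect (A z); [right|by left].
    by split=> // Uz; apply: h.
  by move=> [[Cz nAz]|[Az nUz]]; split; [|by move=> []|exact: AC|by move=> []].
have DAU : D (A `&` U0).
  split; first by move=> z [/AC].
  - by rewrite e0; apply: closedI => //; exact: open_closedC.
  - rewrite e1; apply: closedU => //; apply: closedI => //.
    exact: open_closedC.
  - by split.
by move=> z /(_ _ DAU)[].
Qed.

(** Quasi-components of a compact Hausdorff space are connected: a separation of Q extends to
    disjoint open sets of G, one of which cuts a smaller clopen set out of a member of D. *)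
Let Q_connected : connected Q.
Proof.
move=> B [b Bb] [O oO BO] [F cF BF].
have cB : compact B by rewrite BF; exact: compact_closedI.
have cB' : compact (Q `&` ~` O) by apply: compact_closedI => //; exact: open_closedC.
have disj : B `&` (Q `&` ~` O) = set0.
  by rewrite -subset0 => z [+ [_ Oz]]; rewrite BO => -[_ /Oz].
have [U0 [U1 [o0 o1 BU0 BU1 U01]]] := compact_separate cB cB' disj.
have QU : Q `<=` U0 `|` U1.
  move=> z Qz; have [Oz|Oz] := pselect (O z); [left|right].
    by apply: BU0; rewrite BO.
  by apply: BU1.
have dis z : U0 z -> U1 z -> False.
  by move=> a c; have : (U0 `&` U1) z by []; rewrite U01.
have BQ : B `<=` Q by rewrite BO => z [].
have [O1|O1] := pselect (O 1).
  have B1 : B 1 by rewrite BO; split.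
  apply/seteqP; split => // z Qz.
  have U0z := Q_split o0 o1 U01 QU (BU0 _ B1) Qz.
  rewrite BO; split=> //; apply: contrapT => Oz.
  by apply: (dis z U0z); apply: BU1.
have U11 : U1 1 by apply: BU1.
have U10 : U1 `&` U0 = set0 by rewrite setIC.
have QU' : Q `<=` U1 `|` U0 by rewrite setUC.
have := Q_split o1 o0 U10 QU' U11 (BQ _ Bb).
by move=> /(dis b (BU0 _ Bb)).
Qed.

Let Q_eq1 : Q `<=` [set 1].
Proof.
by rewrite -(@tdG 1 I) => z Qz; exists Q.
Qed.

Lemma compact_open_basis W : W `<=` C -> nbhs 1 W ->
  exists A, [/\ open A, compact A, A 1 & A `<=` W].
Proof.
move=> WC nW.
have [|A [AC cA cA' A1] AW] := D_small (open_interior W).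
  by move=> z /Q_eq1 ->.
exists A; split => //; last by move=> z /AW /interior_subset.
  rewrite (_ : A = W° `&` ~` (C `\` A)).
    by apply: openI; [exact: open_interior|exact: closed_openC].
  apply/seteqP; split => z.
    by move=> Az; split; [exact: AW|move=> []].
  move=> [/interior_subset/WC Cz h]; apply: contrapT => nA.
  exact: h.
exact: subclosed_compact cA cC AC.
Qed.

End quasicomponent.

Hypothesis lcG : exists2 C : set G, compact C & nbhs 1 C.

(* van Dantzig's theorem *)
Lemma compact_open_subgroup W : nbhs 1 W ->
  exists U, [/\ is_subgroup U, open U, compact U & U `<=` W].
Proof.
move=> nW; have [C cC nC] := lcG.
have [|A [oA cA A1 AW]] := @compact_open_basis C cC (nbhs_singleton nC) (C `&` W)
  (fun z => fst).
  exact: filterI.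
(* The elements with A g = A. They lie in A because 1 does, and they contain a neighbourhood of 1
   because A is compact and open. *)
pose U : set G := [set g | forall x, A x -> A (x * g) /\ A (x * g^-1)].
have sU : is_subgroup U.
  split.
  - by move=> x Ax; rewrite invg1 mulg1.
  - move=> g h Ug Uh x Ax; split.
      by rewrite mulgA; apply: (Uh _ _).1; apply: (Ug _ _).1.
    by rewrite invgM mulgA; apply: (Ug _ _).2; apply: (Uh _ _).2.
  - by move=> g Ug x Ax; rewrite invgK; split; [exact: (Ug _ Ax).2|exact: (Ug _ Ax).1].
have nU : nbhs 1 U.
  have /compact_near_coveringP/(_ _ (nbhs (1 : G))
    (fun g x => A (x * g) /\ A (x * g^-1))) := cA.
  apply => x Ax.
  have h1 : (fun z : G * G => z.1 * z.2) @ (nbhs (x, 1 : G)) --> x * 1.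
    by apply: cvgMg; [exact: cvg_fst|exact: cvg_snd].
  have h2 : (fun z : G * G => z.1 * z.2^-1) @ (nbhs (x, 1 : G)) --> x * 1^-1.
    by apply: cvgMg; [exact: cvg_fst|apply: cvgVg; exact: cvg_snd].
  rewrite invg1 mulg1 in h2; rewrite mulg1 in h1.
  have nA : nbhs x A by apply: open_nbhs_nbhs.
  exact: (@filterI _ _ (nbhs_filter (x, 1 : G)) _ _ (h1 _ nA) (h2 _ nA)).
have UA : U `<=` A by move=> g /(_ 1 A1)[]; rewrite mul1g.
exists U; split => //.
- exact: subgroup_open.
- by apply: subclosed_compact cA UA; exact: subgroup_closed.
- by move=> g /UA/AW[].
Qed.

(** V is the intersection of the conjugates under Q of a small compact open subgroup; compactness of
    Q keeps it a neighbourhood of 1. *)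
Lemma normalized_subgroup (Q W : set G) : is_subgroup Q -> compact Q ->
  nbhs 1 W -> exists V, [/\ is_subgroup V, open V, compact V, V `<=` W &
    forall q g, Q q -> V g -> V (q^-1 * g * q)].
Proof.
move=> sQ cQ nW; have [Q1 QM QV] := sQ.
have [W0 [[W1 WM WV] oW0 cW0 W0W]] := compact_open_subgroup nW.
pose V : set G := [set w | forall q, Q q -> W0 (q^-1 * w * q)].
have V1 : V 1 by move=> q Qq; rewrite mulg1 mulVg.
have VM g h : V g -> V h -> V (g * h).
  move=> Vg Vh q Qq; have -> : q^-1 * (g * h) * q = (q^-1 * g * q) * (q^-1 * h * q).
    by rewrite !mulgA mulgK.
  by apply: WM; [exact: Vg|exact: Vh].
have VV g : V g -> V g^-1.
  move=> Vg q Qq; have -> : q^-1 * g^-1 * q = (q^-1 * g * q)^-1.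
    by rewrite !invgM invgK mulgA.
  by apply: WV; exact: Vg.
have VJ q g : Q q -> V g -> V (q^-1 * g * q).
  move=> Qq Vg r Qr; have -> : r^-1 * (q^-1 * g * q) * r = (q * r)^-1 * g * (q * r).
    by rewrite invgM !mulgA.
  by apply: Vg; exact: QM.
have nV : nbhs 1 V.
  have /compact_near_coveringP/(_ _ (nbhs (1 : G))
    (fun g q => W0 (q^-1 * g * q))) := cQ.
  apply => q Qq.
  have h : (fun z : G * G => z.1^-1 * z.2 * z.1) @ (nbhs (q, 1 : G)) --> q^-1 * 1 * q.
    apply: cvgMg; last exact: cvg_fst.
    by apply: cvgMg; [apply: cvgVg; exact: cvg_fst|exact: cvg_snd].
  by apply: h; rewrite mulg1 mulVg; apply: open_nbhs_nbhs.
have VW0 : V `<=` W0 by move=> g /(_ 1 Q1); rewrite invg1 mul1g mulg1.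
have sV : is_subgroup V by [].
exists V; split => //; [exact: subgroup_open| |by move=> g /VW0/W0W].
by apply: subclosed_compact cW0 VW0; exact: subgroup_closed.
Qed.

(** U is the product of Q with a small open subgroup normalized by Q. *)
Lemma compact_in_open_subgroup (Q W : set G) : is_subgroup Q -> compact Q ->
  nbhs 1 W -> exists U, [/\ is_subgroup U, open U, compact U, Q `<=` U &
    forall u, U u -> exists q w, [/\ Q q, W w & u = q * w]].
Proof.
move=> sQ cQ nW; have [Q1 QM QV] := sQ.
have [V [sV oV cV VW VJ]] := normalized_subgroup sQ cQ nW.
have [V1 VM VV] := sV.
have nV : nbhs 1 V by apply: open_nbhs_nbhs.
pose U : set G := [set u | exists q w, [/\ Q q, V w & u = q * w]].
have sU : is_subgroup U.
  split; first by exists 1, 1; rewrite mulg1.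
  - move=> _ _ [q [w [Qq Vw ->]]] [r [v [Qr Vv ->]]].
    exists (q * r), (r^-1 * w * r * v); split; [exact: QM| |].
      by apply: VM => //; exact: VJ.
    by rewrite !mulgA mulgK.
  - move=> _ [q [w [Qq Vw ->]]]; exists q^-1, (q * w^-1 * q^-1); split.
    + exact: QV.
    + by have := VJ q^-1 w^-1 (QV _ Qq) (VV _ Vw); rewrite invgK.
    + by rewrite invgM !mulgA mulVg mul1g.
have VU : V `<=` U by move=> w Vw; exists 1, w; rewrite mul1g.
exists U; split => //.
- by apply: subgroup_open => //; exact: filterS nV.
- have -> : U = (fun p : G * G => p.1 * p.2) @` (Q `*` V).
    apply/seteqP; split => u.
      by move=> [q [w [Qq Vw ->]]]; exists (q, w).
    by move=> [[q w] [/= Qq Vw] <-]; exists q, w.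
  apply: continuous_compact; last exact: compact_setX.
  by apply: continuous_subspaceT; exact: mulg_continuous.
- by move=> q Qq; exists q, 1; rewrite mulg1.
- by move=> u [q [w [Qq Vw ->]]]; exists q, w; split=> //; exact: VW.
Qed.

End topological_group.

(** * Proper cocompact actions *)

Lemma filter_forall_ord {T : Type} (F : set_system T) {FF : Filter F} n
    (A : 'I_n -> set T) :
  (forall i, F (A i)) -> F [set x | forall i, A i x].
Proof.
move=> h; suff H (s : seq 'I_n) : F [set x | forall i, i \in s -> A i x].
  by apply: filterS (H (enum 'I_n)) => x Ax i; apply: Ax; rewrite mem_enum.
elim: s => [|i s IHs]; first by apply: filterS filterT.
apply: filterS (filterI (h i) IHs) => x [Ai As] j.
by rewrite inE => /predU1P[->|/As].
Qed.

Section metric_compactness.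
Context {R : realType} (Y : metricType R).
Implicit Types (x y z c : Y) (A C : set Y) (r K : R).

Lemma nbhs_mdistE x A :
  nbhs x A <-> exists2 e : R, 0 < e & forall y, mdist x y < e -> A y.
Proof.
rewrite -metricType_numDomainType.filter_from_mdist_nbhs.
by split=> -[e e0 h]; exists e => // y; exact: h.
Qed.

Lemma openE_mdist A : open A <->
  forall x, A x -> exists2 e : R, 0 < e & forall y, mdist x y < e -> A y.
Proof.
rewrite openE; split=> h x Ax; first exact/nbhs_mdistE/h.
exact/nbhs_mdistE/h.
Qed.

Lemma closedE_mdist A : closed A <->
  forall x, (forall e, 0 < e -> exists2 y, A y & mdist x y < e) -> A x.
Proof.
split=> h x hx.
  apply: h => B /nbhs_mdistE[e /hx[y Ay xy] eB]; exists y; split => //.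
  exact: eB.
apply: h => e e0.
have [|y [Ay xy]] := hx [set y | mdist x y < e]; last by exists y.
by apply/nbhs_mdistE; exists e.
Qed.

Definition cball x r : set Y := [set y | mdist x y <= r].

Lemma cball_closed x r : closed (cball x r).
Proof.
apply/closedE_mdist => y h; rewrite /cball /=; apply: ler_eps => e /h[z xz yz].
have := metric_triangle x z y; rewrite (metric_sym z y).
by move: xz; rewrite /cball /=; lra.
Qed.

Lemma compact_net C r : compact C -> 0 < r ->
  exists t : seq Y, forall x, C x -> exists2 c, c \in t & mdist c x < r.
Proof.
move=> cC r0; apply: contrapT => h.
pose D := [set A : set Y | exists t : seq Y,
  A = [set x | forall c, c \in t -> r <= mdist c x]].
have [|_ [t ->]|_ _ [t ->] [t' ->]|_ [t ->]|x Cx] := compact_directed (D := D) cC.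
- by exists [set x | forall c, c \in [::] -> r <= mdist c x], [::].
- apply/closedE_mdist => x hx c ct; apply: ler_eps => e /hx[y hy xy].
  have := hy c ct; have := metric_triangle c x y; lra.
- exists [set x | forall c, c \in t ++ t' -> r <= mdist c x]; first by exists (t ++ t').
  by move=> x hx; split=> c ct; apply: hx; rewrite mem_cat ct ?orbT.
- apply: contrapT => hA; apply: h; exists t => x Cx; apply: contrapT => hx.
  apply: hA; exists x; split=> // c ct; rewrite leNgt; apply/negP => cx.
  by apply: hx; exists c.
- move=> hx; have := hx [set z | forall c, c \in [:: x] -> r <= mdist c z].
  move=> /(_ (ex_intro _ [:: x] erefl) x (mem_head _ _)).
  by rewrite mdistxx leNgt r0.
Qed.

Lemma net_size (t s : seq Y) r : (forall x, x \in s -> exists2 c, c \in t & mdist c x < r) ->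
  pairwise (fun x y => 2 * r <= mdist x y) s -> (size s <= size t)%N.
Proof.
move=> ht sp; have [f hf] : exists f : Y -> Y, forall x, x \in s ->
    f x \in t /\ mdist (f x) x < r.
  have /choice[f hf] : forall x, exists c, x \in s -> c \in t /\ mdist c x < r.
    by move=> x; have [/ht[c ct cx]|] := boolP (x \in s); [exists c|exists x].
  by exists f.
rewrite -(size_map f); apply: uniq_leq_size; last first.
  by move=> _ /mapP[x xs ->]; case: (hf x xs).
rewrite uniq_pairwise pairwise_map; apply: sub_pairwise_in sp => x y xs ys /=.
apply: contraTneq => fxy; rewrite -ltNge.
have [_ h1] := hf x xs; have [_ h2] := hf y ys.
have := metric_triangle x (f x) y; rewrite (metric_sym x (f x)).
by move: h2; rewrite -fxy; lra.
Qed.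

Lemma compact_seqU (I : eqType) (t : seq I) (A : I -> set Y) :
  (forall i, i \in t -> compact (A i)) ->
  compact [set x | exists2 i, i \in t & A i x].
Proof.
elim: t => [|c t IHt] h.
  rewrite (_ : mkset _ = set0); first exact: compact0.
  by apply/seteqP; split => // x [].
rewrite (_ : mkset _ = A c `|` [set x | exists2 i, i \in t & A i x]).
  apply: compactU; first by apply: h; exact: mem_head.
  by apply: IHt => d dt; apply: h; rewrite inE dt orbT.
apply/seteqP; split => x.
  by move=> [d]; rewrite inE => /predU1P[->|dt] Ax; [left|right; exists d].
move=> [Ax|[d dt Ax]]; first by exists c; rewrite ?mem_head.
by exists d => //; rewrite inE dt orbT.
Qed.

(** Compactness spreads by steps of r / 2: moving back along a geodesic, the next ball is covered by
    the r-balls around a finite r / 2-net of the previous one. *)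
Lemma compact_cballs (r : R) : cat0 Y -> 0 < r ->
  (forall x, compact (cball x r)) -> forall x K, compact (cball x K).
Proof.
move=> catY r0 hr x K; have r2 : 0 < r / 2 by lra.
have H n : compact (cball x (n%:R * (r / 2))).
  elim: n => [|n IHn].
    apply: (subclosed_compact (@cball_closed _ _) (hr x)) => y.
    by rewrite /cball /= mul0r; lra.
  have [t ht] := compact_net IHn r2.
  apply: (subclosed_compact (@cball_closed _ _)
    (@compact_seqU _ t (fun c => cball c r) (fun c _ => hr c))).
  move=> y; rewrite /cball /= => xy.
  have [ny|ny] := lerP (mdist x y) (n%:R * (r / 2)).
    by have [c ct cy] := ht y ny; exists c => //; lra.
  have n0 : 0 <= n%:R * (r / 2) by rewrite mulr_ge0// ltW.
  pose l := n%:R * (r / 2) / mdist x y.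
  have xy0 : 0 < mdist x y by lra.
  have l01 : 0 <= l <= 1 by apply: ratio01 => //; exact: ltW.
  have le : l * mdist x y = n%:R * (r / 2) by rewrite divfK// gt_eqF.
  have [|c ct cy] := ht (conv x y l); first by rewrite /cball /= conv_distl// le.
  exists c => //; have := metric_triangle c (conv x y l) y.
  rewrite conv_distr//; move: xy; rewrite -natr1; lra.
pose n := (Num.truncn (`|K| / (r / 2))).+1.
apply: (subclosed_compact (@cball_closed _ _) (H n)) => y; rewrite /cball /=.
have : `|K| / (r / 2) < n%:R by exact: truncnS_gt.
rewrite ltr_pdivrMr//; have := ler_norm K; lra.
Qed.

Lemma bounded_geometry_net c K r : bounded_geometry Y -> 0 < r ->
  exists t : seq Y, forall x, mdist c x <= K -> exists2 y, y \in t & mdist y x < r.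
Proof.
move=> bg r0; have [N hN] := bg K r r0; apply: contrapT => h.
have sep n : exists s : seq Y, [/\ size s = n, all (fun x => mdist c x <= K) s &
    pairwise (fun x y => r <= mdist x y) s].
  elim: n => [|n [s [sn sc sp]]]; first by exists [::].
  have [x [xc xs]] : exists x, mdist c x <= K /\ forall y, y \in s -> r <= mdist y x.
    apply: contrapT => h'; apply: h; exists s => x xc; apply: contrapT => hx.
    apply: h'; exists x; split=> // y ys; rewrite leNgt; apply/negP => yx.
    by apply: hx; exists y.
  exists (x :: s); split; rewrite /= ?sn ?xc//.
  by rewrite sp andbT; apply/allP => y /xs; rewrite metric_sym.
have [s [sn sc sp]] := sep N.+1.
by have := hN c s sc sp; rewrite sn ltnn.
Qed.

Lemma ultra_seq (U : set_system Y) (I : eqType) (t : seq I) (A : I -> set Y) :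
  UltraFilter U -> U [set x | exists2 i, i \in t & A i x] ->
  exists2 i, i \in t & U (A i).
Proof.
move=> UU; elim: t => [|c t IHt] h.
  by have [x []] := @filter_ex _ U _ _ h.
have [UA|UA] := in_ultra_setVsetC (A c) UU; first by exists c; rewrite ?mem_head.
have [|d dt Ud] := IHt; last by exists d => //; rewrite inE dt orbT.
apply: filterS (filterI h UA) => x [[d]].
by rewrite inE => /predU1P[->|dt] Ax nA //; exists d.
Qed.

(** Bounded geometry makes the balls totally bounded. This is the source of compactness in
    transverse spaces and in invariant subsets. *)
Lemma compact_cball_complete c K :
  seq_complete Y -> bounded_geometry Y -> compact (cball c K).
Proof.
move=> cY bg; rewrite compact_ultra => U UU UB.
have ex n : exists y, U [set x | mdist y x < n.+1%:R^-1].
  have n0 : 0 < n.+1%:R^-1 :> R by rewrite invr_gt0.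
  have [t ht] := bounded_geometry_net c K bg n0.
  have [|y _ Uy] := @ultra_seq U _ t (fun y => [set x | mdist y x < n.+1%:R^-1]) UU.
    by apply: filterS UB => x /ht[y yt yx]; exists y.
  by exists y.
have [u hu] := choice ex.
have small (e : R) : 0 < e -> exists N, forall n, (N <= n)%N -> n.+1%:R^-1 < e.
  move=> e0; exists (Num.truncn e^-1) => n h.
  rewrite invf_plt ?posrE//; apply: lt_le_trans (truncnS_gt _) _.
  by rewrite ler_nat.
have uC : cauchy_seq u.
  move=> e e0; have e2 : 0 < e / 2 by lra.
  have [N hN] := small _ e2; exists N => m n Nm Nn.
  have [x [/= x1 x2]] := @filter_ex _ U _ _ (filterI (hu m) (hu n)).
  have := lt_trans x1 (hN m Nm); have := lt_trans x2 (hN n Nn).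
  by have := metric_triangle (u m) x (u n); rewrite (metric_sym x (u n)); lra.
have [p /cvg_mdistP hp] := cY _ uC.
have Up : U --> p.
  move=> A /nbhs_mdistE[e e0 eA]; have e2 : 0 < e / 2 by lra.
  have [N hN] := small _ e2; have [N' hN'] := hp _ e2.
  pose n := maxn N N'; apply: filterS (hu n) => x /= ux; apply: eA.
  have := lt_trans ux (hN n (leq_maxl _ _)); have := hN' n (leq_maxr _ _).
  have := metric_triangle p (u n) x; rewrite (metric_sym p (u n)); lra.
exists p; split=> //.
apply: (@cball_closed c K) => A /Up UA.
by have [x] := @filter_ex _ U _ _ (filterI UB UA); exists x.
Qed.

End metric_compactness.

Section action_facts.
Context {R : realType} (G : topologicalGroupType) (X : metricType R).
Variable a : isometric_action G X.
Local Notation inv := (fun g : G => g^-1%g).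

Lemma actK g x : a (inv g) (a g x) = x.
Proof. by rewrite -actM mulVg act1. Qed.

Lemma actVK g x : a g (a (inv g) x) = x.
Proof. by rewrite -actM mulgV act1. Qed.

Lemma act_distl g x y : mdist (a g x) y = mdist x (a (inv g) y).
Proof. by rewrite -{1}(actVK g y) act_dist. Qed.

Lemma act_cvg2 (g : G) x :
  (fun p : G * X => a p.1 p.2) @ (nbhs (g, x)) --> a g x.
Proof.
have h := @act_continuous R G X a (g, x); rewrite /continuous_at in h.
exact: h.
Qed.

Lemma act_cvg x (g : G) : (fun h => a h x) @ (nbhs g) --> a g x.
Proof.
apply: (@cvg_comp _ _ _ (fun h => (h, x)) (fun p : G * X => a p.1 p.2) _ (nbhs (g, x))).
  by apply: cvg_pair; [exact: cvg_id|exact: cvg_cst].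
exact: act_cvg2.
Qed.

Lemma act_nbhs (g : G) x (e : R) : 0 < e ->
  nbhs g [set h | mdist (a g x) (a h x) < e].
Proof.
move=> e0; apply: (@act_cvg x g [set y | mdist (a g x) y < e]).
by apply/nbhs_mdistE; exists e.
Qed.

Lemma displacement_closed x y (r : R) : closed [set g | mdist (a g x) y <= r].
Proof.
move=> g clg; rewrite /=; apply: ler_eps => e e0.
have [h [/= h1 h2]] := clg _ (act_nbhs g x e0).
have := metric_triangle (a g x) (a h x) y; lra.
Qed.

Lemma stab_closed x : closed [set g | a g x = x].
Proof.
rewrite (_ : mkset _ = [set g | mdist (a g x) x <= 0]).
  exact: displacement_closed.
apply/seteqP; split => g /=; first by move=> ->; rewrite mdistxx.
by move=> h; apply: mdist_positivity; apply/le_anti; rewrite h mdist_ge0.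
Qed.

(** The saturations of the [P n] define an increasing open cover of the compact orbit space. Applied
    to suitable P, this turns local properties of X into uniform ones. *)
Lemma cocompact_exhaust (P : nat -> set X) : cocompact_action a ->
  (forall n, open (P n)) -> (forall n, P n `<=` P n.+1) ->
  (forall x, exists n, P n x) -> exists n, forall x, exists g, P n (a g x).
Proof.
move=> coc oP PS Pcov; apply: contrapT => h.
have Pmono m n : (m <= n)%N -> P m `<=` P n.
  move=> /subnK <-; elim: (n - m)%N => [|k IHk] //=.
  by apply: subset_trans IHk _; exact: PS.
pose S n := [set x | exists g, P n (a g x)].
have Sinv n g x : S n (a g x) -> S n x.
  by move=> [k hk]; exists (k * g)%g; rewrite actM.
have Spi n (x : X) : S n (repr (\pi_(orbit_space a) x)) <-> S n x.
  have : \pi_(orbit_space a) (repr (\pi_(orbit_space a) x)) = \pi_(orbit_space a) x.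
    by rewrite reprK.
  move=> h1; have /eqP : \pi_({eq_quot (orbit_equiv a)}) (repr (\pi_(orbit_space a) x)) =
      \pi_({eq_quot (orbit_equiv a)}) x by exact: h1.
  rewrite eq_sym eqmodE => /asboolP[g <-].
  split; first exact: Sinv.
  by move=> h'; apply: (Sinv n g^-1%g); rewrite actK.
pose D := [set A : set (orbit_space a) | exists n, A = [set q | ~ S n (repr q)]].
have [|_ [n ->]|_ _ [m ->] [n ->]|_ [n ->]|q _] := compact_directed (D := D) coc.
- by exists [set q | ~ S 0%N (repr q)], 0%N.
- apply: open_closedC.
  rewrite /open /= /quotient_open /=.
  rewrite (_ : _ @^-1` _ = \bigcup_g (a g @^-1` P n)).
    apply: bigcup_open => g _; apply: open_comp => // x _.
    apply: (@cvg_comp _ _ _ (fun y => (g, y)) (fun p : G * X => a p.1 p.2) _ (nbhs (g, x))).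
      by apply: cvg_pair; [exact: cvg_cst|exact: cvg_id].
    exact: act_cvg2.
  apply/seteqP; split => x /=.
    by move=> /Spi[g hg]; exists g.
  by move=> [g _ hg]; apply/Spi; exists g.
- exists [set q | ~ S (maxn m n) (repr q)]; first by exists (maxn m n).
  move=> q /= hq; split=> -[g hg]; apply: hq; exists g.
    by apply: Pmono hg; exact: leq_maxl.
  by apply: Pmono hg; exact: leq_maxr.
- apply: contrapT => hn; apply: h; exists n => x.
  apply: contrapT => hx; apply: hn; exists (\pi_(orbit_space a) x); split=> //=.
  by move/Spi.
- move=> hq; have [n hn] := Pcov (repr q).
  have := hq [set q | ~ S n (repr q)] (ex_intro _ n erefl); apply.
  by exists 1%g; rewrite act1.
Qed.

Lemma act_cball_compact g x (r : R) : compact (cball x r) -> compact (cball (a g x) r).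
Proof.
move=> c; rewrite (_ : cball _ _ = a g @` cball x r).
  apply: continuous_compact c; apply: continuous_subspaceT => y.
  apply: (@cvg_comp _ _ _ (fun y => (g, y)) (fun p : G * X => a p.1 p.2) _ (nbhs (g, y))).
    by apply: cvg_pair; [exact: cvg_cst|exact: cvg_id].
  exact: act_cvg2.
apply/seteqP; split => y; rewrite /cball /=.
  by rewrite act_distl => h; exists (a g^-1%g y); rewrite ?actVK.
by move=> [z h <-]; rewrite act_dist.
Qed.

Hypothesis hX : hadamard X.
Hypothesis lcX : locally_compact [set: X].
Hypothesis propera : proper_action a.
Hypothesis coca : cocompact_action a.

Let catX : cat0 X. Proof. by case: hX. Qed.

Lemma cocompact_ball (o : X) : exists K : R, forall x, exists g, mdist o (a g x) <= K.
Proof.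
have [|n x|x|n hn] := cocompact_exhaust (P := fun n => [set x | mdist o x < n%:R]) coca.
- move=> n; apply/openE_mdist => x /= ox; exists (n%:R - mdist o x); first by lra.
  by move=> y xy; have := metric_triangle o x y; lra.
- by move=> /= ox; apply: lt_le_trans ox _; rewrite ler_nat.
- by exists (Num.truncn (mdist o x)).+1; rewrite /= truncnS_gt.
by exists n%:R => x; have [g hg] := hn x; exists g; exact: ltW.
Qed.

(** [P n] consists of the centres of a compact ball of radius greater than 1 / (n + 1); exhaustion
    gives one radius valid at every point, from which [compact_cballs] reaches all radii. *)
Lemma compact_cballX (x : X) (r : R) : compact (cball x r).
Proof.
pose P n := [set x : X | exists2 e : R, n.+1%:R^-1 < e & compact (cball x e)].
have [|n y|y|n hn] := cocompact_exhaust (P := P) coca.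
- move=> n; apply/openE_mdist => y [e en cy]; exists ((e - n.+1%:R^-1) / 2).
    by rewrite divr_gt0// subr_gt0.
  move=> z yz; exists (e - mdist y z).
    by move: (n.+1%:R^-1 : R) en yz => w en yz; lra.
  apply: (subclosed_compact (@cball_closed _ _ _ _) cy) => w; rewrite /cball /=.
  by have := metric_triangle y z w; lra.
- move=> [e en cy]; exists e => //; apply: lt_trans en.
  by rewrite ltf_pV2 ?posrE// ltr_nat.
- have [U nU' [cU clU]] := lcX (x := y) I.
  have nU : nbhs y U by move: nU'; rewrite /within /=; apply: filterS => z; exact.
  have [e e0 eU] := (nbhs_mdistE _ _).1 nU.
  exists (Num.truncn (e / 2)^-1); exists (e / 2).
    by rewrite invf_plt ?posrE ?divr_gt0//; exact: truncnS_gt.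
  apply: (subclosed_compact (@cball_closed _ _ _ _) cU) => z; rewrite /cball /= => h.
  by apply: eU; lra.
have n0 : 0 < n.+1%:R^-1 :> R by rewrite invr_gt0.
apply: (compact_cballs catX n0) => y; have [g [e en cy]] := hn y.
rewrite -(actK g y); apply: act_cball_compact.
apply: (subclosed_compact (@cball_closed _ _ _ _) cy) => w; rewrite /cball /=.
by move/le_trans; apply; exact: ltW.
Qed.

Lemma bounded_geometryX : bounded_geometry X.
Proof.
have [[o] _ _] := hX; have [K0 hK0] := cocompact_ball o.
move=> K r r0; have r2 : 0 < r / 2 by lra.
have [t ht] := compact_net (@compact_cballX o (K0 + K)) r2.
exists (size t) => c s sc sp; have [g hg] := hK0 c.
rewrite -(size_map (a g)); apply: (@net_size _ _ _ _ (r / 2)).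
  move=> _ /mapP[x xs ->]; apply: ht; rewrite /cball /=.
  have := metric_triangle o (a g c) (a g x); rewrite act_dist.
  by have := allP sc x xs; rewrite /=; lra.
rewrite pairwise_map; apply: sub_pairwise sp => x y /=.
by rewrite act_dist; lra.
Qed.

Lemma displacement_compact x (r : R) : compact [set g | mdist (a g x) x <= r].
Proof.
apply: subclosed_compact (propera (@compact_cballX x `|r|)) _.
  exact: displacement_closed.
move=> g /= h; exists (a g x); split.
  by exists x => //; rewrite /cball /= mdistxx.
by rewrite /cball /= metric_sym; apply: le_trans h (ler_norm _).
Qed.

Lemma locally_compact_group : exists2 C : set G, compact C & nbhs 1%g C.
Proof.
have [[o] _ _] := hX; exists [set g | mdist (a g o) o <= 1].
  exact: displacement_compact.
apply: filterS (act_nbhs 1%g o ltr01) => g /=.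
by rewrite act1 metric_sym => /ltW.
Qed.

Hypothesis tdG : totally_disconnected [set: G].

(* At c the subgroup is Q W with Q the pointwise stabilizer of the c i and W a
   small open subgroup normalised by Q. *)
Let almost_stabilizer_at n (c : 'I_n.+1 -> X) (eta : R) : 0 < eta ->
  exists2 e : R, 0 < e & exists U : set G,
  [/\ is_subgroup U, open U, compact U,
     forall g, (forall i, mdist (a g (c i)) (c i) <= e) -> U g &
     forall u i, U u -> mdist (a u (c i)) (c i) < eta].
Proof.
move=> eta0; pose Q := [set g | forall i, a g (c i) = c i].
have sQ : is_subgroup Q.
  split=> [i|g h Qg Qh i|g Qg i]; first by rewrite act1.
    by rewrite actM Qh.
  by rewrite -{1}(Qg i) actK.
have clQ : closed Q.
  rewrite (_ : Q = \bigcap_i [set g | a g (c i) = c i]).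
    by apply: closed_bigI => i _; exact: stab_closed.
  by apply/seteqP; split => [g Qg i _|g Qg i]; exact: Qg.
have cQ : compact Q.
  apply: (subclosed_compact clQ (@displacement_compact (c ord0) 0)) => g Qg.
  by rewrite /= Qg mdistxx.
have nW : nbhs 1%g [set g | forall i, mdist (a g (c i)) (c i) < eta].
  apply: filter_forall_ord => i.
  apply: filterS (act_nbhs 1%g (c i) eta0) => g /=.
  by rewrite act1 metric_sym.
have [U [sU oU cU QU Uqw]] := compact_in_open_subgroup tdG locally_compact_group sQ cQ nW.
have Usmall u i : U u -> mdist (a u (c i)) (c i) < eta.
  move=> /Uqw[q [w [Qq Ww ->]]]; rewrite actM act_distl.
  by have [_ _ /(_ q Qq)] := sQ => ->; exact: Ww.
suff [e e0 he] : exists2 e : R, 0 < e & forall g,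
    (forall i, mdist (a g (c i)) (c i) <= e) -> U g.
  by exists e => //; exists U.
(* Otherwise the elements outside U with small displacement, confined to a compact set, would
   accumulate at an element outside U that fixes every [c i] and so lies in Q. *)
apply: contrapT => hno.
pose D := [set A : set G | exists2 e : R, 0 < e &
  A = [set g | forall i, mdist (a g (c i)) (c i) <= e]].
have cK : compact ([set g | mdist (a g (c ord0)) (c ord0) <= 1] `&` ~` U).
  by apply: compact_closedI; [exact: displacement_compact|exact: open_closedC].
have [|_ [e e0 ->]|_ _ [e e0 ->] [f f0 ->]|_ [e e0 ->]|g [_ nUg] hg] :=
    compact_directed (D := D) cK.
- by exists [set g | forall i, mdist (a g (c i)) (c i) <= 1], 1.
- rewrite (_ : mkset _ = \bigcap_i [set g | mdist (a g (c i)) (c i) <= e]).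
    by apply: closed_bigI => i _; exact: displacement_closed.
  by apply/seteqP; split => [g Qg i _|g Qg i]; exact: Qg.
- exists [set g | forall i, mdist (a g (c i)) (c i) <= Num.min e f].
    by exists (Num.min e f) => //; rewrite lt_min e0.
  by move=> g h; split=> i; have := h i; rewrite le_min => /andP[].
- apply: contrapT => hA; apply: hno; exists (Num.min e 1).
    by rewrite lt_min e0 ltr01.
  move=> g hg; apply: contrapT => nU; apply: hA; exists g.
  split; first by move=> i; have := hg i; rewrite le_min => /andP[].
  by split=> //; have := hg ord0; rewrite le_min => /andP[].
- apply: nUg; apply: QU => i; apply: mdist_positivity.
  apply/le_anti; rewrite mdist_ge0 andbT; apply: ler_eps => e e0.
  rewrite add0r; apply: (hg [set g | forall i, mdist (a g (c i)) (c i) <= e]).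
  by exists e.
Qed.

(** The point is that e does not depend on x. Translated by G, the configurations of bounded size
    fill a compact product of balls; the e found at c still serves near c, up to a factor, so
    compactness leaves one e. The subgroup obtained for the translate is conjugated back. *)
Lemma almost_stabilizer n (K eta : R) : 0 < eta -> exists2 e : R, 0 < e &
  forall x : 'I_n.+1 -> X, (forall i, mdist (x ord0) (x i) <= K) ->
  exists U : set G, [/\ is_subgroup U, open U, compact U,
     forall g, (forall i, mdist (a g (x i)) (x i) < e) -> U g &
     forall u i, U u -> mdist (a u (x i)) (x i) < eta].
Proof.
move=> eta0; have [[o] _ _] := hX; have [K0 hK0] := cocompact_ball o.
pose good (e : R) (x : 'I_n.+1 -> X) := exists U : set G,
  [/\ is_subgroup U, open U, compact U,
     forall g, (forall i, mdist (a g (x i)) (x i) < e) -> U g &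
     forall u i, U u -> mdist (a u (x i)) (x i) < eta].
have cT := @tychonoff _ (fun _ : 'I_n.+1 => X) (fun=> cball o (K0 + K))
  (fun=> @compact_cballX o (K0 + K)).
have /compact_near_coveringP/(_ _ (0^'+ : set_system R) good) := cT.
move=> /(_ _ _)[].
  move=> c _; have eta3 : 0 < eta / 3 by lra.
  have [e e0 [U [sU oU cU he hU]]] := almost_stabilizer_at c eta3.
  pose d := Num.min (eta / 3) (e / 3).
  have d0 : 0 < d by rewrite lt_min eta3 divr_gt0.
  have [d1 d2] : d <= eta / 3 /\ d <= e / 3 by rewrite /d !ge_min !lexx orbT.
  exists ([set x | forall i, mdist (c i) (x i) < d], [set t | t < d]).
    split; last first.
      by rewrite /=; apply: nbhs_right_lt.
    apply: filter_forall_ord => i.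
    apply: (@proj_continuous _ (fun _ : 'I_n.+1 => X) i c [set y | mdist (c i) y < d]).
    by apply/nbhs_mdistE; exists d.
  move=> [x t] [/= hx ht]; exists U; split => //.
    move=> g hg; apply: he => i.
    have := metric_triangle (a g (c i)) (a g (x i)) (c i).
    have := metric_triangle (a g (x i)) (x i) (c i).
    rewrite act_dist (metric_sym (x i) (c i)); have := hx i; have := hg i; lra.
  move=> u i Uu; have := hU u i Uu.
  have := metric_triangle (a u (x i)) (a u (c i)) (x i).
  have := metric_triangle (a u (c i)) (c i) (x i).
  have := metric_sym (x i) (c i); have := metric_sym (a u (x i)) (a u (c i)).
  rewrite !act_dist; have := hx i; lra.
move=> d /= d0 hd; exists (d / 2); first by rewrite divr_gt0.
move=> x hx; have [h hh] := hK0 (x ord0).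
have d2 : 0 < d / 2 by rewrite divr_gt0.
have [||U [sU oU cU he hU]] := hd (d / 2) _ d2 (fun i => a h (x i)).
- by rewrite /= sub0r normrN gtr0_norm//; lra.
- move=> i; rewrite /cball /=.
  have := metric_triangle o (a h (x ord0)) (a h (x i)).
  by rewrite act_dist; have := hx i; lra.
have [U1 UM UV] := sU.
pose c (g : G) := (h * g * h^-1)%g.
have cM g k : c (g * k)%g = (c g * c k)%g by rewrite /c !mulgA mulgVK.
have cV g : c g^-1%g = (c g)^-1%g by rewrite /c !invgM invgK mulgA.
have cc : continuous c.
  by move=> g; apply: cvgMg; [apply: cvgMg; [exact: cvg_cst|exact: cvg_id]|exact: cvg_cst].
have cE g i : mdist (a (c g) (a h (x i))) (a h (x i)) = mdist (a g (x i)) (x i).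
  by rewrite /c !actM actK act_dist.
exists [set g | U (c g)]; split.
- split=> [|g k|g]; rewrite /= ?cM ?cV.
  + by rewrite /c mulg1 mulgV.
  + exact: UM.
  + exact: UV.
- by apply: (open_comp (f := c)) => // g _; exact: cc.
- have -> : [set g | U (c g)] = (fun g => h^-1 * g * h)%g @` U.
    apply/seteqP; split => g /=.
      move=> Ug; exists (c g) => //.
      by rewrite /c !mulgA mulVg mul1g mulgVK.
    move=> [k Uk <-]; rewrite /c.
    by rewrite !mulgA mulgV mul1g mulgK.
  apply: continuous_compact cU; apply: continuous_subspaceT => g.
  by apply: cvgMg; [apply: cvgMg; [exact: cvg_cst|exact: cvg_id]|exact: cvg_cst].
- by move=> g hg; apply: he => i; rewrite cE.
- by move=> u i Uu; have := hU _ i Uu; rewrite cE.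
Qed.

End action_facts.

(** * Fixed points of affine actions *)

Section convex_lmod.
Context {R : realType} {V : lmodType R}.
Implicit Types (A : set V) (s : seq V) (l : R).

Lemma convex_setE A : convex_set A <->
  forall x y l, A x -> A y -> 0 <= l <= 1 -> A (l *: x + (1 - l) *: y).
Proof.
split=> [cA x y l Ax Ay /andP[l0 l1]|h x y l /set_mem Ax /set_mem Ay].
  by have /set_mem := cA x y (Itv01 l0 l1) (mem_set Ax) (mem_set Ay).
by apply/mem_set; apply: h => //; apply/andP; split.
Qed.

Definition average s : V := (size s)%:R^-1 *: \sum_(x <- s) x.

Lemma average1 x : average [:: x] = x.
Proof. by rewrite /average big_seq1 invr1 scale1r. Qed.

Lemma average_cons x s : (0 < size s)%N ->
  average (x :: s) =
  (size s).+1%:R^-1 *: x + (1 - (size s).+1%:R^-1) *: average s.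
Proof.
move=> s0; rewrite /average big_cons scalerDr /=; congr (_ + _).
rewrite scalerA; congr (_ *: _).
have h : (size s)%:R != 0 :> R by rewrite pnatr_eq0 -lt0n.
by field; rewrite h /= addrC natr1 pnatr_eq0.
Qed.

Lemma average_perm s s' : perm_eq s s' -> average s = average s'.
Proof. by move=> h; rewrite /average (perm_size h) (perm_big _ h). Qed.

Lemma averageB {I : Type} (r : seq I) (f g : I -> V) :
  average (map f r) - average (map g r) = average (map (fun i => f i - g i) r).
Proof. by rewrite /average !size_map -scalerBr !big_map sumrB. Qed.

Let inv01 n : 0 <= (n.+1%:R^-1 : R) <= 1.
Proof. by rewrite invr_ge0 ler0n /= invf_le1 ?ltr0n// ler1n. Qed.

Lemma average_in A s : convex_set A -> (0 < size s)%N ->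
  (forall x, x \in s -> A x) -> A (average s).
Proof.
move=> /convex_setE cA; elim: s => [//|x [|y s] IHs] _ sA.
  by rewrite average1; apply: sA; rewrite mem_head.
rewrite average_cons//; apply: cA; [by apply: sA; rewrite mem_head| |exact: inv01].
by apply: IHs => // z zs; apply: sA; rewrite in_cons zs orbT.
Qed.

Lemma average_affine A (f : V -> V) s : convex_set A ->
  (forall x y l, A x -> A y -> 0 <= l <= 1 ->
     f (l *: x + (1 - l) *: y) = l *: f x + (1 - l) *: f y) ->
  (0 < size s)%N -> (forall x, x \in s -> A x) ->
  f (average s) = average (map f s).
Proof.
move=> cA fA; elim: s => [//|x [|y s] IHs] _ sA; first by rewrite !average1.
have sA' z : z \in y :: s -> A z by move=> zs; apply: sA; rewrite in_cons zs orbT.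
rewrite map_cons (@average_cons x (y :: s))//.
rewrite (@average_cons (f x) (map f (y :: s))) ?size_map// -IHs//.
apply: fA; [by apply: sA; rewrite mem_head| |exact: inv01].
exact: average_in.
Qed.

End convex_lmod.

Lemma continuous_withinP {T S : topologicalType} (A : set T) (f : T -> S) :
  {within A, continuous f} <->
  forall x O, A x -> nbhs (f x) O -> nbhs x [set y | A y -> O (f y)].
Proof.
split.
  by move=> /subspace_continuousP h x O Ax nO; exact: (h x Ax O nO).
by move=> h; apply/subspace_continuousP => x Ax O nO; exact: h.
Qed.

Section fixed_points.
Context {R : realType} {V : tvsType R}.
Implicit Types (K W A : set V) (v w x : V).

Lemma cvgBV {T} {F : set_system T} {FF : Filter F} (f g : T -> V) v w :
  f @ F --> v -> g @ F --> w -> (fun t => f t - g t) @ F --> v - w.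
Proof.
move=> fv gw; apply: (@cvg_comp _ _ _ (fun t => (f t, g t))
  (fun p : V * V => p.1 - p.2) F (nbhs (v, w))).
  exact: cvg_pair.
by move=> O; exact: (@sub_continuous V (v, w) O).
Qed.

Lemma convex_nbhs0 W : nbhs 0 W ->
  exists C, [/\ convex_set C, nbhs 0 C & C `<=` W].
Proof.
have [B Bc [Bo Bb]] := @locally_convex R V.
move=> nW; have [C [BC C0] CW] := Bb 0 W nW.
exists C; split=> //; last by apply: open_nbhs_nbhs; split => //; exact: Bo.
by move=> x y l xC yC; exact: Bc (mem_set BC) _ _ l xC yC.
Qed.

(** By compactness the closures of the sets of W-almost fixed points, for all W, have a common
    point. *)
Lemma approximate_fixed_point (I : Type) (H : set I) K (f : I -> V -> V) :
  hausdorff_space V -> compact K ->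
  (forall i, H i -> {within K, continuous (f i)}) ->
  (forall W, nbhs 0 W -> exists2 v, K v & forall i, H i -> W (f i v - v)) ->
  exists2 v, K v & forall i, H i -> f i v = v.
Proof.
move=> hV cK fc h.
pose S W := [set v | K v /\ forall i, H i -> W (f i v - v)].
pose D := [set A | exists2 W, nbhs 0 W & A = closure (S W)].
have [|_ [W _ ->]|_ _ [W nW ->] [W' nW' ->]|_ [W nW ->]|x Kx hx] :=
  compact_directed (D := D) cK.
- by exists (closure (S setT)), setT => //; exact: filterT.
- exact: closed_closure.
- exists (closure (S (W `&` W'))); first by exists (W `&` W') => //; exact: filterI.
  move=> x hx; split; apply: closure_subset hx => v [Kv hv];
    by split => // i /hv[].
- by have [v Kv hv] := h W nW; exists v; split => //; exact: subset_closure.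
exists x => // i Hi; apply/eqP; rewrite -subr_eq0; apply/eqP; apply: hV => A B nA nB.
have /(_ i Hi)/continuous_withinP fci := fc.
have /(_ A nA) : (fun v => f i v - v) @ (within K (nbhs x)) --> f i x - x.
  apply: cvgBV; last exact: cvg_within.
  by move=> O nO; exact: fci.
move=> nA'; have [|v [[Kv hv] Av]] := hx (closure (S B)) _ _ nA'; first by exists B.
by exists (f i v - v); split; [exact: Av|exact: hv].
Qed.

Lemma fixed_set_closed K (f : V -> V) : hausdorff_space V -> compact K ->
  {within K, continuous f} -> closed (K `&` [set v | f v = v]).
Proof.
move=> hV cK /continuous_withinP fc x hx; have Kx : K x.
  by apply: (compact_closed hV cK); apply: closure_subset hx => v [].
split => //=; apply/eqP; rewrite -subr_eq0; apply/eqP; apply: hV => A B nA nB.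
have /(_ A nA) nA' : (fun v => f v - v) @ (within K (nbhs x)) --> f x - x.
  apply: cvgBV; last exact: cvg_within.
  by move=> O nO; exact: fc.
have [v [[Kv fv] Av]] := hx _ nA'.
exists 0; split; last exact: nbhs_singleton.
by have := Av Kv; rewrite /= fv subrr.
Qed.

Lemma compact_bounded K W : compact K -> nbhs 0 W ->
  exists N, forall n x y, (N <= n)%N -> K x -> K y -> W (n%:R^-1 *: (x - y)).
Proof.
move=> cK nW.
have /compact_near_coveringP/(_ _ (nbhs (0 : R^o))
  (fun (t : R^o) (p : V * V) => W (t *: (p.1 - p.2)))) := compact_setX cK cK.
move=> /(_ _ _)[].
  move=> [x y] _.
  have h : (fun z : (V * V) * R^o => z.2 *: (z.1.1 - z.1.2)) @
      (nbhs ((x, y), (0 : R^o))) --> 0 *: (x - y).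
    apply: (@cvg_comp _ _ _ (fun z : (V * V) * R^o => (z.2, z.1.1 - z.1.2))
      (fun p : R^o * V => p.1 *: p.2) _ (nbhs ((0 : R^o), x - y))).
      have h1 : (fun z : (V * V) * R^o => z.1.1 - z.1.2) @
          (nbhs ((x, y), (0 : R^o))) --> x - y.
        by apply: cvgBV; apply: cvg_comp; (exact: cvg_fst || exact: cvg_snd).
      have h2 : (fun z : (V * V) * R^o => z.2) @ (nbhs ((x, y), (0 : R^o))) --> (0 : R^o).
        exact: cvg_snd.
      exact: (cvg_pair h2 h1).
    by move=> O; exact: (@scale_continuous R V ((0 : R^o), x - y) O).
  by rewrite scale0r in h; exact: h.
move=> e /= e0 he; exists (Num.truncn e^-1).+1 => n x y Nn Kx Ky.
have n0 : (0 < n)%N by apply: leq_trans Nn.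
apply: (he n%:R^-1 _ (x, y) (conj Kx Ky)).
rewrite /= sub0r normrN gtr0_norm ?invr_gt0 ?ltr0n//.
rewrite invf_plt ?posrE ?ltr0n//; apply: lt_le_trans (truncnS_gt _) _.
by rewrite ler_nat.
Qed.

(* Markov--Kakutani *)
Section commuting_family.
Variables (I : choiceType) (f : I -> V -> V).
Hypothesis hV : hausdorff_space V.

Let nice (H : set I) K := [/\ K !=set0, compact K, convex_set K &
  [/\ forall i, H i -> {within K, continuous (f i)},
   forall i v, H i -> K v -> K (f i v),
   forall i x y (l : R), H i -> K x -> K y -> 0 <= l <= 1 ->
     f i (l *: x + (1 - l) *: y) = l *: f i x + (1 - l) *: f i y &
   forall i j v, H i -> H j -> K v -> f i (f j v) = f j (f i v)]].

(** The average of the first N + 1 points of an orbit is moved by a telescoping difference divided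
    by N + 1, which is small since compact sets are bounded. *)
Let fixed1 H K i : nice H K -> H i -> K `&` [set v | f i v = v] !=set0.
Proof.
move=> [[v0 Kv0] cK cvK [fc fK fA _]] Hi.
suff [v Kv hv] : exists2 v, K v & forall i0, [set i] i0 -> f i0 v = v.
  by exists v; split => //; exact: hv.
apply: approximate_fixed_point => // [_ ->|W nW]; first exact: fc.
have [N hN] := compact_bounded cK nW.
pose s n := mkseq (fun k => iter k (f i) v0) n.
have Ki k : K (iter k (f i) v0) by elim: k => //= k; exact: fK.
have sK n x : x \in s n -> K x by move=> /mapP[k _ ->].
exists (average (s N.+1)); first by apply: average_in => //; exact: sK.
move=> _ ->; rewrite (@average_affine _ _ K)//; last 2 first.
- by move=> x y l; exact: fA.
- exact: sK.
rewrite (_ : _ - _ = N.+1%:R^-1 *: (iter N.+1 (f i) v0 - v0)).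
  by apply: hN.
rewrite /average size_map size_mkseq -scalerBr; congr (_ *: _).
rewrite /s /mkseq !big_map -[iota 0 N.+1]/(index_iota 0 N.+1) -sumrB.
rewrite (eq_bigr (fun k => iter k.+1 (f i) v0 - iter k (f i) v0))//.
by rewrite telescope_sumr.
Qed.

Let nice_fixed H K i : nice H K -> H i -> nice H (K `&` [set v | f i v = v]).
Proof.
move=> nK Hi; have [_ cK cvK [fc fK fA fC]] := nK.
have KK : compact (K `&` [set v | f i v = v]).
  apply: (subclosed_compact _ cK); last by move=> v [].
  exact: fixed_set_closed (fc i Hi).
split=> //; first exact: (fixed1 nK Hi).
  apply/convex_setE => x y l [Kx fx] [Ky fy] l01; split.
    by move/convex_setE: cvK; exact.
  by rewrite /= fA// fx fy.
split=> [j Hj|j v Hj [Kv fv]|j x y l Hj [Kx _] [Ky _]|j k v Hj Hk [Kv _]].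
- by apply: (continuous_subspaceW _ (fc j Hj)) => v [].
- by split; [exact: fK|rewrite /= fC// fv].
- exact: fA.
- exact: fC.
Qed.

Lemma commuting_fixed_point (H : set I) K : K !=set0 -> compact K -> convex_set K ->
  (forall i, H i -> {within K, continuous (f i)}) ->
  (forall i v, H i -> K v -> K (f i v)) ->
  (forall i x y (l : R), H i -> K x -> K y -> 0 <= l <= 1 ->
     f i (l *: x + (1 - l) *: y) = l *: f i x + (1 - l) *: f i y) ->
  (forall i j v, H i -> H j -> K v -> f i (f j v) = f j (f i v)) ->
  exists2 v, K v & forall i, H i -> f i v = v.
Proof.
move=> K0 cK cvK fc fK fA fC.
have nK : nice H K by [].
pose S (s : seq I) := [set v | K v /\ forall i, i \in s -> f i v = v].
(* Finite subfamilies are treated one map at a time: commutation keeps the fixed set of one map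
   invariant under the others. *)
have nS s : (forall i, i \in s -> H i) -> nice H (S s).
  elim: s => [|i s IHs] sH.
    rewrite (_ : S _ = K)//; apply/seteqP; split => [v []//|v Kv].
    by split.
  rewrite (_ : S _ = S s `&` [set v | f i v = v]).
    apply: nice_fixed; last by apply: sH; rewrite mem_head.
    by apply: IHs => j js; apply: sH; rewrite in_cons js orbT.
  apply/seteqP; split => v.
    move=> [Kv h]; split; last by apply: h; rewrite mem_head.
    by split=> // j js; apply: h; rewrite in_cons js orbT.
  move=> [[Kv h] /= fv]; split=> // j; rewrite in_cons => /predU1P[->//|].
  exact: h.
pose D := [set A | exists2 s : seq I, (forall i, i \in s -> H i) & A = S s].
have [|_ [s sH ->]|_ _ [s sH ->] [t tH ->]|_ [s sH ->]|v Kv hv] :=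
  compact_directed (D := D) cK.
- by exists (S [::]), [::].
- by apply: compact_closed => //; have [] := nS s sH.
- exists (S (s ++ t)).
    by exists (s ++ t) => // i; rewrite mem_cat => /orP[/sH|/tH].
  move=> v [Kv h]; split; split => // i si; apply: h; by rewrite mem_cat si ?orbT.
- by have [[v [Kv h]] _ _ _] := nS s sH; exists v.
exists v => // i Hi; have [|_ ->//] := hv (S [:: i]); last by rewrite mem_head.
by exists [:: i] => // j; rewrite inE => /eqP->.
Qed.

End commuting_family.

End fixed_points.

(** * Stabilizers of refined points are amenable *)

Section affine_actions.
Context {R : realType} {V : tvsType R} {G : topologicalGroupType}.
Implicit Types (H P U N : set G) (K W : set V) (al : G -> V -> V).
Local Open Scope group_scope.

(** P is not assumed closed, so the cosets of N covering the compact set U are used: those meeting P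
    are kept and represented by elements of P. *)
Lemma coset_representatives P U N : P `<=` U -> compact U ->
  is_subgroup N -> open N -> exists t : seq G, [/\ uniq t,
    forall l, l \in t -> P l, forall p, P p -> exists2 l, l \in t & N (l^-1 * p) &
    forall l l', l \in t -> l' \in t -> N (l^-1 * l') -> l = l'].
Proof.
move=> PU cU sN oN; have [N1 NM NV] := sN.
have nN : nbhs 1 N by apply: open_nbhs_nbhs.
have [t ht] : exists t : seq G, forall p, U p -> exists2 c, c \in t & N (c^-1 * p).
  apply: contrapT => h.
  pose D := [set A : set G | exists t : seq G,
    A = [set p | forall c, c \in t -> ~ N (c^-1 * p)]].
  have [|_ [t ->]|_ _ [t ->] [t' ->]|_ [t ->]|x Cx] := compact_directed (D := D) cU.
  - by exists [set p | forall c, c \in [::] -> ~ N (c^-1 * p)], [::].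
  - move=> p hp c ct Np.
    have [|q [/(_ c ct) hq]] := hp [set x | N (c^-1 * x)].
      by apply: open_nbhs_nbhs; split=> //; exact: open_ltranslate.
    exact: hq.
  - exists [set x | forall c, c \in t ++ t' -> ~ N (c^-1 * x)]; first by exists (t ++ t').
    by move=> x hx; split=> c ct; apply: hx; rewrite mem_cat ct ?orbT.
  - apply: contrapT => hA; apply: h; exists t => p Up; apply: contrapT => hp.
    apply: hA; exists p; split=> // c ct Np.
    by apply: hp; exists c.
  move/(_ _ (ex_intro _ [:: x] erefl) x (mem_head _ _)); rewrite mulVg; exact.
have trans c d e : N (c^-1 * d) -> N (d^-1 * e) -> N (c^-1 * e).
  by move=> h h'; have := NM _ _ h h'; rewrite mulgA mulgK.
have sym c d : N (c^-1 * d) -> N (d^-1 * c).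
  by move=> /NV; rewrite invgM invgK.
pose S (c : G) := [set p | P p /\ N (c^-1 * p)].
pose r (c : G) := xget 1 (S c).
have rP c : S c !=set0 -> S c (r c) by move=> [p Sp]; apply: xgetPex; exists p.
pose u := undup (map r [seq c <- t | `[< S c !=set0 >]]).
have uP l : l \in u -> exists c, [/\ c \in t, S c !=set0 & l = r c].
  rewrite mem_undup => /mapP[c]; rewrite mem_filter => /andP[/asboolP ? ?] ->.
  by exists c.
exists u; split; first exact: undup_uniq.
- by move=> l /uP[c [_ /rP[Pr _] ->]].
- move=> p Pp; have [d dt Nd] := ht p (PU p Pp).
  have Sd : S d !=set0 by exists p.
  exists (r d).
    rewrite mem_undup map_f// mem_filter dt andbT; exact/asboolP.
  by have [_ /sym Nr] := rP _ Sd; exact: trans Nr Nd.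
- move=> _ _ /uP[c [_ Sc ->]] /uP[d [_ Sd ->]] Ncd.
  have [[_ Nc] [_ Nd]] := (rP _ Sc, rP _ Sd).
  have Ncd' : N (c^-1 * d) := trans _ _ _ (trans _ _ _ Nc Ncd) (sym _ _ Nd).
  rewrite /r; congr xget; apply/seteqP; split => p [Pp Np]; split=> //.
    exact: trans (sym _ _ Ncd') Np.
  exact: trans Ncd' Np.
Qed.

Lemma affine_action_small H K al W : is_subgroup H -> affine_action (R := R) H K al ->
  compact K -> nbhs 0%R W ->
  nbhs 1 [set g | H g -> forall v, K v -> W (al g v - v)%R].
Proof.
move=> [H1 _ _] [alK al1 _ _ alc] cK nW.
have /compact_near_coveringP/(_ _ (nbhs (1 : G))
  (fun g v => H g -> K v -> W (al g v - v)%R)) := cK.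
move=> h; suff /h : forall v, K v ->
    \forall v' \near v & g \near (1 : G), H g -> K v' -> W (al g v' - v')%R.
  by apply: filterS => g hg Hg v Kv; exact: hg.
move=> v Kv; have /continuous_withinP hc := alc.
have hd : (fun p : G * V => al p.1 p.2 - p.2)%R @
    (within (H `*` K) (nbhs (1%g : G, v))) --> (al 1%g v - v)%R.
  apply: cvgBV.
    by move=> O nO; exact: (hc (1, v) O (conj H1 Kv) nO).
  by apply: cvg_trans; [apply: cvg_app; exact: cvg_within|exact: cvg_snd].
rewrite al1// subrr in hd.
have [[A B] [/= nA nB] AB] := hd _ nW.
exists (B, A); first by split.
by move=> [w g] [/= Bw Ag] Hg Kw; exact: (AB (g, w) (conj Ag Bw) (conj Hg Kw)).
Qed.

Hypothesis tdG : totally_disconnected [set: G].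
Hypothesis lcG : exists2 C : set G, compact C & nbhs 1 C.

(* Averages over the cosets of small open normal subgroups of U. *)
Lemma profinite_fixed_point H P U K al : hausdorff_space V -> is_subgroup H ->
  affine_action (R := R) H K al -> K !=set0 -> compact K -> convex_set K ->
  is_subgroup P -> P `<=` H -> is_subgroup U -> compact U -> P `<=` U ->
  exists2 v, K v & forall h, P h -> al h v = v.
Proof.
move=> hV sH aal [v0 Kv0] cK cvK sP PH sU cU PU.
have [P1 PM PV] := sP; have [H1 HM HV] := sH.
have [alK al1 alM alA alc] := aal.
apply: approximate_fixed_point => // [h /PH Hh|W' /convex_nbhs0[W [cvW nW WW']]].
  apply/continuous_withinP => v O Kv nO; have /continuous_withinP hc := alc.
  have [[A B] [/= nA nB] AB] := hc (h, v) O (conj Hh Kv) nO.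
  apply: filterS nB => w Bw Kw.
  by apply: (AB (h, w)) => //; split => //; exact: nbhs_singleton.
have [N [sN oN cN NW NJ]] := normalized_subgroup tdG lcG sU cU
  (affine_action_small sH aal cK nW).
have [N1 NM NV] := sN.
have [t [ut tP tN tinj]] := coset_representatives PU cU sN oN.
have t0 : (0 < size t)%N by have [l lt _] := tN 1 P1; case: (t) lt.
have tH l : l \in t -> H l by move/tP/PH.
pose w l := al l v0.
have Kw l : H l -> K (w l) by move=> Hl; exact: alK.
have Ks s : (forall l, l \in s -> H l) -> forall x, x \in map w s -> K x.
  by move=> sH' _ /mapP[l /sH' Hl ->]; exact: Kw.
exists (average (map w t)).
  by apply: average_in; rewrite ?size_map//; exact: Ks.
move=> h Ph; apply: WW'; have Hh := PH h Ph.
(* Left multiplication by h permutes the cosets of N; f is the permutation of their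
   representatives. *)
have [f hf] : exists f : G -> G, forall l, l \in t ->
    f l \in t /\ N ((f l)^-1 * (h * l)).
  suff /choice : forall l : G, exists m : G, l \in t -> m \in t /\ N (m^-1 * (h * l)).
    by move=> [f hf]; exists f.
  move=> l; have [lt|] := boolP (l \in t); last by exists 1.
  by have [m mt Nm] := tN (h * l) (PM _ _ Ph (tP l lt)); exists m.
have pf : perm_eq (map f t) t.
  have fu : uniq (map f t).
    rewrite map_inj_in_uniq// => l l' lt l't ff; apply: tinj => //.
    have [_ Nl] := hf l lt; have [_ Nl'] := hf l' l't.
    have -> : l^-1 * l' = ((f l)^-1 * (h * l))^-1 * ((f l)^-1 * (h * l')).
      by rewrite !invgM invgK !mulgA mulgK mulgVK.
    by apply: NM; [exact: NV|rewrite ff].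
  apply: uniq_perm => //.
  have ft : {subset map f t <= t} by move=> _ /mapP[l lt ->]; have [] := hf l lt.
  by have [|_] := uniq_min_size fu ft; first by rewrite size_map.
rewrite (@average_affine _ _ K)//; last 3 first.
- by move=> x y l; exact: alA.
- by rewrite size_map.
- exact: Ks.
rewrite -(average_perm (perm_map w pf)) -!map_comp averageB.
apply: average_in; rewrite ?size_map//.
move=> _ /mapP[l lt ->] /=; have [ft Nf] := hf l lt.
rewrite /w -alM//; last exact: tH.
(* The factor before [f l] is a conjugate under U of an element of N, hence in N, and so moves each
   point of K by an element of W. *)
have e : h * l = (f l * ((f l)^-1 * (h * l)) * (f l)^-1) * f l.
  by rewrite mulVKg mulgVK.
have PfN : P ((f l)^-1 * (h * l)).
  by apply: (PM); [exact/PV/tP|apply: (PM) => //; exact: tP].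
rewrite e alM; last 3 first.
- by apply: PH; apply: (PM); [apply: (PM) => //|apply: PV]; exact: tP.
- exact: tH.
- exact: Kv0.
apply: NW; last 2 first.
- by apply: PH; apply: (PM); [apply: (PM) => //|apply: PV]; exact: tP.
- exact/Kw/tH.
have := NJ _ _ (PU _ (PV _ (tP _ ft))) Nf; by rewrite invgK.
Qed.

End affine_actions.

Section stabilizers.
Context {R : realType} (G : topologicalGroupType) (X : metricType R).
Variable a : isometric_action G X.
Local Open Scope group_scope.
Implicit Types (p : refined_point X) (g h : G).

Lemma act_isometry1 : act_isometry a 1 = isom_id X.
Proof. by apply: isometry_ext => x /=; rewrite act1. Qed.

Lemma act_isometryM g h :
  act_isometry a (g * h) = isom_comp (act_isometry a g) (act_isometry a h).
Proof. by apply: isometry_ext => x /=; rewrite actM. Qed.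

Lemma act_isometryV g : act_isometry a g^-1 = isom_inv (act_isometry a g).
Proof.
apply: isometry_ext => x; apply: (@isom_inj _ _ (act_isometry a g)).
by rewrite isom_invK /= actVK.
Qed.

Lemma stabilizer_subgroup p : is_subgroup (stabilizer a p).
Proof.
split=> [|g h|g]; rewrite /stabilizer /=.
- by rewrite act_isometry1; exact: fixes_id.
- by rewrite act_isometryM; exact: fixes_comp.
- by rewrite act_isometryV; exact: fixes_inv.
Qed.

Definition horo_stabilizer p : set G := [set g | horo_fixes (act_isometry a g) p].

Lemma horo_stabilizer_subgroup p : is_subgroup (horo_stabilizer p).
Proof.
split=> [|g h|g]; rewrite /horo_stabilizer /=.
- by rewrite act_isometry1; exact: horo_fixes_id.
- by rewrite act_isometryM; exact: horo_fixes_comp.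
- by rewrite act_isometryV; exact: horo_fixes_inv.
Qed.

Lemma horo_stabilizer_comm p g h : stabilizer a p g -> stabilizer a p h ->
  exists2 c, horo_stabilizer p c & g * h = h * g * c.
Proof.
move=> Hg Hh; exists (g^-1 * h^-1 * (g * h)).
  rewrite /horo_stabilizer /= -{2}(invgK g) -{2}(invgK h) !act_isometryM.
  rewrite (act_isometryV g^-1) (act_isometryV h^-1).
  by apply: horo_fixes_comm; rewrite act_isometryV; exact: fixes_inv.
by rewrite !mulgA mulgK mulgV mul1g.
Qed.

Hypothesis hX : hadamard X.
Hypothesis lcX : locally_compact [set: X].
Hypothesis propera : proper_action a.
Hypothesis coca : cocompact_action a.
Hypothesis tdG : totally_disconnected [set: G].

(** All elements of s move one point y by less than e, so the almost stabilizer of the one-point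
    configuration y, with n = 0 and K = 0, contains them. *)
Lemma horo_stabilizer_locally_profinite p (s : seq G) :
  (forall g, g \in s -> horo_stabilizer p g) ->
  exists U, [/\ is_subgroup U, compact U & forall g, g \in s -> U g].
Proof.
move=> hs; have [e e0 he] :=
  almost_stabilizer hX lcX propera coca tdG 0 0 (@ltr01 R).
have [y hy] := horo_fixes_displacement e0 hs.
have [_|U [sU _ cU hU _]] := he (fun=> y); first by rewrite mdistxx.
by exists U; split=> // g gs; apply: hU => _; exact: hy.
Qed.

Lemma stabilizer_amenable p : amenable_subgroup R (stabilizer a p).
Proof.
split=> [|V K hV K0 cK cvK al aal]; first exact: stabilizer_subgroup.
set H := stabilizer a p; pose N := horo_stabilizer p.
have sH : is_subgroup H := stabilizer_subgroup p.
have sN : is_subgroup N := horo_stabilizer_subgroup p.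
have NH : N `<=` H by move=> g; exact: horo_fixes_fixes.
have [[H1 HM HV] [N1 NM NV]] := (sH, sN).
have [alK al1 alM alA alc] := aal.
have lcG := locally_compact_group hX lcX propera coca.
have alc1 h : H h -> {within K, continuous (al h)}.
  move=> Hh; apply/continuous_withinP => v O Kv nO; have /continuous_withinP hc := alc.
  have [[A B] [/= nA nB] AB] := hc (h, v) O (conj Hh Kv) nO.
  apply: filterS nB => w Bw Kw.
  by apply: (AB (h, w)) => //; split => //; exact: nbhs_singleton.
pose S (s : seq G) := [set v | K v /\ forall g, g \in s -> al g v = v].
have Scl s : (forall g, g \in s -> N g) -> closed (S s).
  move=> sN'.
  rewrite (_ : S s = K `&` \bigcap_(g in [set` s]) (K `&` [set v | al g v = v])).
    apply: closedI; first exact: compact_closed.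
    apply: closed_bigI => g /= gs; apply: fixed_set_closed => //.
    exact/alc1/NH/sN'.
  apply/seteqP; split => v [Kv h]; split=> // g gs; first by split=> //; exact: h.
  by have [] := h g gs.
pose D := [set A | exists2 s : seq G, (forall g, g \in s -> N g) & A = S s].
have [|_ [s sP ->]|_ _ [s sP ->] [t tP ->]|_ [s sP ->]|v Kv hv] :=
  compact_directed (D := D) cK.
- by exists (S [::]), [::].
- exact: Scl.
- exists (S (s ++ t)).
    by exists (s ++ t) => // i; rewrite mem_cat => /orP[/sP|/tP].
  move=> v [Kv h]; split; split => // i si; apply: h; by rewrite mem_cat si ?orbT.
- have [U [sU cU Us]] := horo_stabilizer_locally_profinite sP.
  have [U1 UM UV] := sU.
  have sNU : is_subgroup (N `&` U).
    split=> [|g h [Ng Ug] [Nh Uh]|g [Ng Ug]]; split => //.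
    - exact: NM.
    - exact: UM.
    - exact: NV.
    - exact: UV.
  have NUH : N `&` U `<=` H by move=> g [/NH].
  have [v Kv hv] := profinite_fixed_point tdG lcG hV sH aal K0 cK cvK sNU NUH sU cU
    (@subIsetr _ _ _).
  by exists v; split => //; split => // g gs; apply: hv; split; [exact: sP|exact: Us].
have fixN w : (forall A, D A -> A w) -> forall g, N g -> al g w = w.
  move=> hw g Ng; have [|_ ->//] := hw (S [:: g]); last by rewrite mem_head.
  by exists [:: g] => // _ /[!inE]/eqP->.
(* Commutators of H lie in N, so H acts on K' by commuting maps. *)
pose K' := [set w | K w /\ forall g, N g -> al g w = w].
have K'K w : K' w -> K w by move=> [].
have clK' : closed K'.
  rewrite (_ : K' = K `&` \bigcap_(g in N) (K `&` [set v | al g v = v])).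
    apply: closedI; first exact: compact_closed.
    by apply: closed_bigI => g /= Ng; apply: fixed_set_closed => //; exact/alc1/NH.
  apply/seteqP; split => w [Kw h]; split=> // g gs; first by split=> //; exact: h.
  by have [] := h g gs.
have comm g h w : H g -> H h -> K' w -> al g (al h w) = al h (al g w).
  move=> Hg Hh [Kw hw]; rewrite -!alM//.
  have [c Nc ->] := horo_stabilizer_comm Hg Hh.
  rewrite (alM (h * g) c w (HM _ _ Hh Hg) (NH _ Nc) Kw).
  by rewrite (hw c Nc).
have [|||||||w [Kw _] hw] := @commuting_fixed_point R V G al hV H K'.
- by exists v; split=> //; exact: fixN.
- by apply: subclosed_compact cK _ => // w /K'K.
- apply/convex_setE => x y l [Kx hx] [Ky hy] l01; split.
    by move/convex_setE: cvK; exact.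
  by move=> g Ng; rewrite alA ?hx ?hy//; exact: NH.
- by move=> h Hh; apply: continuous_subspaceW (alc1 h Hh) => w /K'K.
- move=> h w Hh [Kw hw]; split; first exact: alK.
  move=> g Ng; have Hg := NH g Ng.
  by rewrite (comm g h w Hg Hh (conj Kw hw)) hw.
- by move=> h x y l Hh /K'K Kx /K'K Ky; exact: alA.
- by move=> g h w Hg Hh; exact: comm.
by exists w.
Qed.

End stabilizers.

(** * Lipschitz functions with the topology of pointwise convergence *)

Section pointwise_topology.
Context {R : realType} {T : choiceType}.

Definition pointwise : Type := prod_topology (fun _ : T => R^o).
HB.instance Definition _ := Uniform.on pointwise.
HB.instance Definition _ := GRing.Lmodule.copy pointwise (T -> R^o).
Implicit Types (f g : pointwise) (s : seq T) (A : set pointwise).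

Definition pw_ball f s (e : R) : set pointwise :=
  [set g | forall x, x \in s -> `|f x - g x| < e].

Let pw_filter f : Filter (filter_from [set p : seq T * R | 0 < p.2]
  (fun p => pw_ball f p.1 p.2)).
Proof.
apply: filter_from_filter; first by exists ([::], 1) => /=.
move=> [s e] [s' e'] /= e0 e'0; exists (s ++ s', Num.min e e').
  by rewrite /= lt_min e0.
move=> g hg; split=> x xs; have := hg x; rewrite mem_cat xs ?orbT => /(_ isT);
  by rewrite lt_min => /andP[].
Qed.

Lemma nbhs_pointwise f A :
  nbhs f A <-> exists s (e : R), 0 < e /\ pw_ball f s e `<=` A.
Proof.
split.
  suff : filter_from [set p : seq T * R | 0 < p.2]
      (fun p => pw_ball f p.1 p.2) --> f.
    by move=> h /h[[s e] /= e0 sA]; exists s, e.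
  have FF := pw_filter f; apply/cvg_sup => x B.
  rewrite (@nbhsE (@initial_topology _ _ (fun f : T -> R^o => f x))).
  move=> -[C [[O oO <-] /= Of] CB].
  have /nbhs_ballP[e /= e0 he] : nbhs (f x) O by apply: open_nbhs_nbhs.
  exists ([:: x], e) => // g hg; apply: CB => /=; apply: he.
  exact: hg (mem_head _ _).
move=> [s [e [e0 sA]]]; apply: filterS sA _.
elim: s => [|x s IHs]; first by apply: filterS filterT.
have h : nbhs f [set g | `|f x - g x| < e].
  apply: (@proj_continuous _ (fun _ : T => R^o) x f [set y | `|f x - y| < e]).
  by apply/nbhs_ballP; exists e.
apply: filterS (filterI h IHs) => g [/= g1 g2] y.
by rewrite in_cons => /predU1P[->|]; [|exact: g2].
Qed.

Lemma cvg_pointwise {I : Type} (F : set_system I) {FF : Filter F}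
    (h : I -> pointwise) f :
  (forall x, (fun t => (h t x : R^o)) @ F --> (f x : R^o)) -> h @ F --> f.
Proof.
move=> hx A /nbhs_pointwise[s [e [e0 sA]]].
suff : F [set t | pw_ball f s e (h t)] by apply: filterS => t; exact: sA.
elim: s {sA} => [|x s IHs]; first by apply: filterS filterT.
have hF : F [set t | `|f x - h t x| < e].
  by apply: (hx x [set y | `|f x - y| < e]); apply/nbhs_ballP; exists e.
apply: filterS (filterI hF IHs) => t [/= g1 g2] y.
by rewrite in_cons => /predU1P[->|]; [|exact: g2].
Qed.

Lemma eval_cvg f (x : T) : (fun g : pointwise => (g x : R^o)) @ (nbhs f) --> (f x : R^o).
Proof. exact: (@proj_continuous _ (fun _ : T => R^o) x f). Qed.

Let pw_add_continuous : continuous (fun p : pointwise * pointwise => p.1 + p.2).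
Proof.
move=> [f g].
apply: (@cvg_pointwise _ (nbhs ((f, g) : pointwise * pointwise)) _
  (fun p => p.1 + p.2) (f + g)) => x.
have h1 : (fun t : pointwise * pointwise => (t.1 x : R^o)) @
    (nbhs ((f, g) : pointwise * pointwise)) --> (f x : R^o).
  apply: (@cvg_comp _ _ _ fst (fun g : pointwise => (g x : R^o)) _ (nbhs f)).
    exact: cvg_fst.
  exact: eval_cvg.
have h2 : (fun t : pointwise * pointwise => (t.2 x : R^o)) @
    (nbhs ((f, g) : pointwise * pointwise)) --> (g x : R^o).
  apply: (@cvg_comp _ _ _ snd (fun g : pointwise => (g x : R^o)) _ (nbhs g)).
    exact: cvg_snd.
  exact: eval_cvg.
exact: (cvgD h1 h2).
Qed.

Let pw_scale_continuous : continuous (fun p : R^o * pointwise => p.1 *: p.2).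
Proof.
move=> [k f].
apply: (@cvg_pointwise _ (nbhs ((k, f) : R^o * pointwise)) _
  (fun p => p.1 *: p.2) (k *: f)) => x.
apply: (@cvgZ R R^o).
  exact: cvg_fst.
apply: (@cvg_comp _ _ _ snd (fun g : pointwise => (g x : R^o)) _ (nbhs f)).
  exact: cvg_snd.
exact: eval_cvg.
Qed.

Let pw_ball_open f s (e : R) : open (pw_ball f s e).
Proof.
elim: s => [|x s IHs].
  by rewrite (_ : pw_ball f [::] e = setT); [exact: openT|apply/seteqP; split].
rewrite (_ : pw_ball _ _ _ = [set g | `|f x - g x| < e] `&` pw_ball f s e).
  apply: openI => //.
  rewrite openE => g /= hg; apply: (@eval_cvg g x [set y | `|f x - y| < e]).
  have : open (ball (f x : R^o) e) by exact: ball_open.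
  by rewrite openE; apply.
apply/seteqP; split => g.
  by move=> h; split; [exact: h (mem_head _ _)|move=> y ys; apply: h; rewrite in_cons ys orbT].
by move=> [h1 h2] y; rewrite in_cons => /predU1P[->//|]; exact: h2.
Qed.

Let pw_ball_convex f s (e : R) : convex_set (pw_ball f s e).
Proof.
apply/convex_setE => g h l hg hh /andP[l0 l1] x xs.
have -> : f x - (l *: g + (1 - l) *: h) x = l * (f x - g x) + (1 - l) * (f x - h x).
  by rewrite -[(l *: g + _) x]/(l * g x + (1 - l) * h x); ring.
have := hg x xs; have := hh x xs; rewrite !ltr_norml => /andP[a1 a2] /andP[b1 b2].
have [->|ln0] := eqVneq l 0; first by rewrite mul0r subr0 mul1r add0r a1.
have lpos : 0 < l by rewrite lt_neqAle eq_sym ln0.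
by apply/andP; split; nra.
Qed.

Let pw_locally_convex : exists2 B : set_system pointwise,
  (forall b, b \in B -> convex_set b) & basis B.
Proof.
exists [set B | exists f s e, B = pw_ball f s e].
  by move=> _ /set_mem[f [s [e ->]]]; exact: pw_ball_convex.
split; first by move=> _ [f [s [e ->]]]; exact: pw_ball_open.
move=> f A /nbhs_pointwise[s [e [e0 sA]]]; exists (pw_ball f s e) => //.
by split; [exists f, s, e|move=> x _; rewrite subrr normr0].
Qed.

HB.instance Definition _ :=
  PreTopologicalNmodule_isTopologicalNmodule.Build pointwise pw_add_continuous.
HB.instance Definition _ :=
  TopologicalNmodule_isTopologicalLmodule.Build R pointwise pw_scale_continuous.
HB.instance Definition _ :=
  Uniform_isTvs.Build R pointwise pw_locally_convex.

Lemma pointwise_hausdorff : hausdorff_space pointwise.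
Proof.
move=> f g fg; apply/funext => x; apply/eqP; rewrite -subr_eq0 -normr_eq0.
rewrite eq_le normr_ge0 andbT; apply: ler_eps => e e0; rewrite add0r.
have e2 : 0 < e / 2 by lra.
have n (k : pointwise) : nbhs k (pw_ball k [:: x] (e / 2)).
  by apply/nbhs_pointwise; exists [:: x], (e / 2); split.
have [k [/(_ x (mem_head _ _)) h1 /(_ x (mem_head _ _)) h2]] := fg _ _ (n f) (n g).
move: h1 h2; rewrite !ltr_norml ler_norml => /andP[? ?] /andP[? ?].
by apply/andP; split; lra.
Qed.

End pointwise_topology.
Arguments pointwise R T : clear implicits.

(** Closedness for pointwise convergence, phrased for plain functions. *)
Definition pw_closed {R : realType} {T : choiceType} (Z : set (T -> R)) : Prop :=
  forall f, (forall (s : seq T) (e : R), 0 < e ->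
    exists2 g, Z g & forall x, x \in s -> `|f x - g x| < e) -> Z f.

Section lipschitz_functions.
Context {R : realType} (Y : metricType R) (x0 : Y).
Implicit Types (f g : Y -> R) (Z : set (Y -> R)) (s : seq Y).

Definition normalized f : Prop := lip1 f /\ f x0 = 0.

Lemma lip1_abs f x y : lip1 f -> `|f x - f y| <= mdist x y.
Proof.
move=> h; rewrite ler_norml; have := h x y; have := h y x.
by rewrite (metric_sym y x) => *; apply/andP; split; lra.
Qed.

Lemma normalized_closed : pw_closed normalized.
Proof.
move=> f hf; split.
  move=> x y; apply: ler_eps => e e0; have e2 : 0 < e / 2 by lra.
  have [g [hg _] gf] := hf [:: x; y] _ e2.
  have := gf x (mem_head _ _); have := gf y _; rewrite in_cons mem_head orbT => /(_ isT).
  by rewrite !ltr_norml => /andP[? ?] /andP[? ?]; have := hg x y; lra.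
apply/eqP; rewrite -normr_eq0 eq_le normr_ge0 andbT; apply: ler_eps => e e0.
have [g [_ g0] /(_ x0 (mem_head _ _))] := hf [:: x0] _ e0.
by rewrite g0 subr0 add0r => /ltW.
Qed.

Lemma pw_closed_closed Z : pw_closed Z -> closed (Z : set (pointwise R Y)).
Proof.
move=> hZ f clf; apply: hZ => s e e0.
have [|g [Zg hg]] := clf (pw_ball (f : pointwise R Y) s e).
  by apply/nbhs_pointwise; exists s, e; split.
by exists g.
Qed.

Lemma normalized_compact Z : pw_closed Z -> Z `<=` normalized ->
  compact (Z : set (pointwise R Y)).
Proof.
move=> hZ ZN; have h (x : Y) : compact (`[- mdist x x0, mdist x x0]%classic : set R^o).
  exact: segment_compact.
have c := @tychonoff Y (fun=> R^o) _ h.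
apply: (subclosed_compact _ c); first exact: pw_closed_closed.
move=> f /ZN[fl f0] x; rewrite /= in_itv /=.
by have := lip1_abs x x0 fl; rewrite f0 subr0 ler_norml.
Qed.

(** Normalized 1-Lipschitz functions form a compact set by Tychonoff's theorem, so a directed family
    of sets of them has a cluster point. *)
Lemma lip1_cluster (D : set (set (Y -> R))) : D !=set0 ->
  (forall A, D A -> A !=set0 /\ A `<=` normalized) ->
  (forall A B, D A -> D B -> exists2 C, D C & C `<=` A `&` B) ->
  exists f, normalized f /\ forall A s (e : R), D A -> 0 < e ->
    exists2 g, A g & forall x, x \in s -> `|f x - g x| < e.
Proof.
move=> [A0 DA0] DN Ddir.
have cN := normalized_compact normalized_closed (fun f h => h).
pose D' := [set B : set (pointwise R Y) | exists2 A, D A & B = closure (A : set (pointwise R Y))].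
have [|_ [A _ ->]|_ _ [A DA ->] [B DB ->]|_ [A DA ->]|f Nf hf] :=
  compact_directed (D := D') cN.
- by exists (closure (A0 : set (pointwise R Y))), A0.
- exact: closed_closure.
- have [C DC CAB] := Ddir A B DA DB; exists (closure (C : set (pointwise R Y))).
    by exists C.
  move=> x hx; split; apply: closure_subset hx => y /CAB[]; exact.
- have [[g Ag] /(_ g Ag) Ng] := DN A DA; exists g; split=> //.
  exact: subset_closure.
exists f; split=> // A s e DA e0.
have [||g [Ag hg]] := hf (closure (A : set (pointwise R Y))) _ (pw_ball (f : pointwise R Y) s e).
- by exists A.
- by apply/nbhs_pointwise; exists s, e; split.
by exists g.
Qed.

End lipschitz_functions.

(** * Functions fixed by an amenable group *)

Section amenable_action.
Context {R : realType} {G : topologicalGroupType} (H : set G).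
Local Open Scope group_scope.

(** Continuity is asked of the orbit maps along H only, the form that transverse spaces and
    invariant subsets inherit. *)
Definition isom_action (Y : metricType R) (al : G -> isometry Y) : Prop :=
  [/\ forall x, al 1 x = x,
      forall g h x, H g -> H h -> al (g * h) x = al g (al h x) &
      forall g x (e : R), H g -> (0 < e)%R ->
        nbhs g [set h | H h -> (mdist (al g x) (al h x) < e)%R]].

Variables (Y : metricType R) (al : G -> isometry Y) (x0 : Y).
Hypothesis sH : is_subgroup H.
Hypothesis hal : isom_action al.

Lemma isom_actVK h x : H h -> al h (al h^-1 x) = x.
Proof.
move=> Hh; have [al1 alM _] := hal; have [_ _ HV] := sH.
by rewrite -alM ?mulgV//; exact: HV.
Qed.

Local Open Scope ring_scope.

(** Translation of functions followed by renormalization at x0 is an affine action on the compact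
    convex set Z; its fixed functions are invariant up to additive constants. The common Lipschitz
    bound makes the action jointly continuous. *)
Lemma amenable_fixed_function (Z : set (Y -> R)) : amenable_subgroup R H ->
  Z !=set0 -> Z `<=` normalized x0 -> pw_closed Z ->
  (forall f g (l : R), Z f -> Z g -> 0 <= l <= 1 ->
     Z (fun x => l * f x + (1 - l) * g x)) ->
  (forall f h, H h -> Z f -> Z (fun x => f (al h x) - f (al h x0))) ->
  exists2 f, Z f & forall h x, H h -> f (al h x) = f x + f (al h x0).
Proof.
move=> [_ am] Z0 ZN clZ cvZ invZ; have [al1 alM alc] := hal; have [H1 HM HV] := sH.
pose act (h : G) (f : pointwise R Y) : pointwise R Y :=
  fun x => f (al h^-1%g x) - f (al h^-1%g x0).
have [|||f Zf hf] := am (pointwise R Y) Z (@pointwise_hausdorff R Y) Z0 _ _ act.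
- exact: normalized_compact clZ ZN.
- by apply/convex_setE => f g l Zf Zg l01; exact: cvZ.
- split.
  + by move=> h f Hh Zf; apply: invZ => //; exact: HV.
  + by move=> f /ZN[_ f0]; apply/funext => x; rewrite /act invg1 !al1 f0 subr0.
  + move=> g h f Hg Hh Zf; apply/funext => x; rewrite /act invgM.
    have [Hg' Hh'] := (HV _ Hg, HV _ Hh).
    by rewrite !alM//; ring.
  + move=> h f g l Hh Zf Zg l01; apply/funext => x; rewrite /act.
    set u := al _ x; set v := al _ x0.
    rewrite -[LHS]/((l * f u + (1 - l) * g u) - (l * f v + (1 - l) * g v)).
    rewrite -[RHS]/(l * (f u - f v) + (1 - l) * (g u - g v)); ring.
  + apply/continuous_withinP => -[h f] O [/= Hh Zf].
    move=> /nbhs_pointwise[s [e [e0 sO]]].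
    have e4 : 0 < e / 4 by lra.
    have key (y : Y) : nbhs ((h, f) : G * pointwise R Y)
        [set p | H p.1 -> Z p.2 ->
           `|f (al h^-1%g y) - p.2 (al p.1^-1%g y)| < e / 2].
      have Hh' := HV _ Hh.
      have nh : nbhs h [set k | H k -> mdist (al h^-1%g y) (al k^-1%g y) < e / 4].
        have n1 : nbhs h ((fun k : G => k^-1%g) @^-1`
            [set k | H k -> mdist (al h^-1%g y) (al k y) < e / 4]).
          exact: (@invg_continuous G h _ (alc h^-1%g y _ Hh' e4)).
        by apply: filterS n1 => k /= hk Hk; apply: hk; exact: HV.
      exists ([set k | H k -> mdist (al h^-1%g y) (al k^-1%g y) < e / 4],
              pw_ball f [:: al h^-1%g y] (e / 4)) => /=.
        by split=> //; apply/nbhs_pointwise; exists [:: al h^-1%g y], (e / 4); split.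
      move=> [k g] [/= hk hg] Hk Zg; have := hk Hk; have := hg _ (mem_head _ _).
      have := lip1_abs (al h^-1%g y) (al k^-1%g y) (ZN _ Zg).1.
      move: (mdist _ _) (f _) (g (al h^-1%g y)) (g _) => d u v w.
      rewrite !ltr_norml ler_norml => /andP[? ?] /andP[? ?] ?.
      by apply/andP; split; lra.
    have keys : nbhs ((h, f) : G * pointwise R Y) [set p | forall y, y \in x0 :: s ->
         H p.1 -> Z p.2 -> `|f (al h^-1%g y) - p.2 (al p.1^-1%g y)| < e / 2].
      elim: (x0 :: s) => [|y t IHt]; first by apply: filterS filterT.
      apply: filterS (filterI (key y) IHt) => p [/= h1 h2] z.
      by rewrite in_cons => /predU1P[->|]; [|exact: h2].
    apply: filterS keys => -[k g] /= hkg [/= Hk Zg]; apply: sO => x xs.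
    have := hkg x _ Hk Zg; rewrite in_cons xs orbT => /(_ isT).
    have := hkg x0 (mem_head _ _) Hk Zg; rewrite /act.
    move: (f _) (f _) (g _) (g _) => u v w z.
    rewrite !ltr_norml => /andP[? ?] /andP[? ?]; apply/andP; split; lra.
exists f => // h x Hh; have := hf _ (HV _ Hh).
by move=> /(congr1 (fun g => g x)); rewrite /act invgK => <-; rewrite subrK.
Qed.

End amenable_action.

(** * Descent towards the boundary *)

Section descent.
Context {R : realType} (Y : metricType R) (hY : cat0 Y).
Implicit Types (x y w p q : Y) (F : Y -> R).

Definition convex_fun F : Prop := forall x y l, 0 <= l <= 1 ->
  F (conv x y l) <= (1 - l) * F x + l * F y.

Variables (F : Y -> R) (x0 : Y) (k0 : R).
Hypothesis cF : convex_fun F.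
Hypothesis lF : lip1 F.
Hypothesis k00 : 0 < k0.
Hypothesis descF : forall n : nat, exists y,
  mdist x0 y <= n%:R /\ F y <= F x0 - k0 * n%:R.

(** [M t] is the greatest descent of F within distance t of x0. By convexity M t / t is
    nonincreasing, and its infimum k is the asymptotic rate of descent, positive by [descF]. *)
Let S (t : R) := [set v | exists2 y, mdist x0 y <= t & v = F x0 - F y].
Let M t := sup (S t).

Let S_has_sup t : 0 <= t -> has_sup (S t).
Proof.
move=> t0; split; first by exists (F x0 - F x0), x0; rewrite ?mdistxx.
exists t => _ [y yt ->]; have := lF x0 y; lra.
Qed.

Let M_ub t y : mdist x0 y <= t -> F x0 - F y <= M t.
Proof.
move=> yt; apply: ub_le_sup; last by exists y.
by case: (S_has_sup (le_trans (mdist_ge0 _ _) yt)).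
Qed.

Let M_adherent t (e : R) : 0 <= t -> 0 < e ->
  exists2 y, mdist x0 y <= t & M t - e < F x0 - F y.
Proof.
by move=> t0 e0; have [_ [y yt ->] h] := sup_adherent e0 (S_has_sup t0); exists y.
Qed.

Let M_conv t l : 0 <= t -> 0 <= l <= 1 -> l * M t <= M (l * t).
Proof.
move=> t0 l01; have [l0 l1] := andP l01; apply: ler_eps => e e0.
have [y yt My] := M_adherent t0 e0.
have h : mdist x0 (conv x0 y l) <= l * t.
  by rewrite (conv_distl hY)//; exact: ler_wpM2l.
have := M_ub h; have := cF x0 y l01.
have : l * (M t - e) <= l * (F x0 - F y) by apply: ler_wpM2l => //; exact: ltW.
by have : l * e <= e by [rewrite ler_piMl// ltW]; lra.
Qed.

Let K := [set v | exists2 t : R, 0 < t & v = M t / t].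
Let k := inf K.

Let K_lb t : 0 < t -> k0 <= M t / t.
Proof.
move=> t0; rewrite ler_pdivlMr//.
pose n := (Num.truncn t).+1; have tn : t < n%:R := truncnS_gt t.
have n0 : 0 < n%:R :> R by rewrite ltr0n.
have tn01 := ratio01 (ltW t0) (ltW tn) n0.
have [y [yn Fy]] := descF n.
have h1 : k0 * n%:R <= M n%:R by have := M_ub yn; lra.
have := M_conv (ltW n0) tn01; rewrite (divfK (lt0r_neq0 n0)).
apply: le_trans; rewrite [k0 * t](_ : _ = t / n%:R * (k0 * n%:R)).
  by apply: ler_wpM2l => //; case/andP: tn01.
by field; exact: lt0r_neq0.
Qed.

Let K_has_inf : has_inf K.
Proof.
split; first by exists (M 1 / 1), 1.
by exists k0 => _ [t t0 ->]; exact: K_lb.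
Qed.

Let kpos : 0 < k.
Proof.
apply: lt_le_trans k00 _; apply: lb_le_inf; first by case: K_has_inf.
by move=> _ [t t0 ->]; exact: K_lb.
Qed.

Let M_ge t : 0 <= t -> k * t <= M t.
Proof.
rewrite le_eqVlt => /predU1P[<-|t0].
  by rewrite mulr0; have := @M_ub 0 x0; rewrite mdistxx subrr; exact.
rewrite -ler_pdivlMr//; apply: ge_inf; first by case: K_has_inf.
by exists t.
Qed.

(** Far out the rate of descent is at most k (1 + e / 2), so a descent of k m - D takes a distance
    greater than (1 - e) m. *)
Let far (e D : R) : 0 < e -> exists N : R, forall m, N <= m ->
  forall w, mdist x0 w <= (1 - e) * m -> F x0 - F w < k * m - D.
Proof.
move=> e0; have ke : 0 < k * e / 2 by rewrite divr_gt0// mulr_gt0.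
have [_ [t t0 ->] ht] := inf_adherent ke K_has_inf; rewrite -/k in ht.
rewrite ltr_pdivrMr// in ht.
have big s : t <= s -> M s <= (k + k * e / 2) * s.
  move=> ts; have s0 : 0 < s by exact: lt_le_trans ts.
  have := M_conv (ltW s0) (ratio01 (ltW t0) ts s0); rewrite (divfK (lt0r_neq0 s0)) => h.
  have : t / s * M s <= (k + k * e / 2) * t by exact: le_trans h (ltW ht).
  move: (k + _) => w hw; rewrite -(ler_pM2l t0).
  have -> : t * M s = t / s * M s * s by field; exact: lt0r_neq0.
  by rewrite mulrCA mulrA ler_pM2r.
pose N := Num.max (((k + k * e / 2) * t + D + 1) / k) (2 * (`|D| + 1) / (k * e)).
exists N => m; rewrite ge_max => /andP[]; rewrite !ler_pdivrMr ?mulr_gt0// => N1 N2.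
move=> w hw; have [mt|tm] := leP ((1 - e) * m) t.
  have := M_ub (le_trans hw mt); have := big t (lexx _); lra.
have := M_ub hw; have := big _ (ltW tm).
have : (k + k * e / 2) * ((1 - e) * m) <= k * m - m * (k * e) / 2.
  rewrite (_ : (k + k * e / 2) * ((1 - e) * m) =
    k * m - m * (k * e) / 2 - k * e * e * m / 2); last by field.
  have m0 : 0 <= m.
    have : 0 <= m * (k * e).
      by apply: le_trans N2; rewrite mulr_ge0// addr_ge0.
    by rewrite pmulr_lge0// mulr_gt0.
  by rewrite gerBl !mulr_ge0// ?ltW// mulr_gt0.
have := ler_norm D; lra.
Qed.

(** The midpoint of two almost optimal points is almost optimal by convexity, hence by [far] almost
    as distant from x0 as they are; the Bruhat-Tits inequality then forces p and q together. *)
Let pinch (e D : R) : 0 < e -> 0 <= D -> exists N : R, forall m p q, N <= m ->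
  mdist x0 p <= m + D -> mdist x0 q <= m + D ->
  k * m - D <= F x0 - F p -> k * m - D <= F x0 - F q -> mdist p q <= e * m.
Proof.
move=> e0 D0; have e16 : 0 < e ^+ 2 / 16 by rewrite divr_gt0// exprn_gt0.
have [N hN] := far D e16.
(* The inequality yields d(p, q)^2 <= e^2 m^2 / 2 + 8 D m + 4 D^2, and N' makes the last two terms
   at most e^2 m^2 / 2. *)
pose N' := Num.max (Num.max N 1) (2 * (8 * D + 4 * D ^+ 2) / e ^+ 2).
exists N' => m p q; rewrite !ge_max => /andP[/andP[Nm m1]].
rewrite ler_pdivrMr ?exprn_gt0// => hm xp xq Fp Fq.
have h01 : 0 <= (2^-1 : R) <= 1 by lra.
set w := conv p q 2^-1.
have Fw : k * m - D <= F x0 - F w by have := cF p q h01; rewrite -/w; lra.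
have hw : (1 - e ^+ 2 / 16) * m < mdist x0 w.
  by rewrite ltNge; apply/negP => /(hN _ Nm); rewrite ltNge Fw.
have := convP hY p q h01 x0; rewrite -/w => hs.
have m0 : 0 <= m by lra.
apply: ler_of_sqr; first by rewrite mulr_ge0// ltW.
have xp2 : mdist x0 p ^+ 2 <= (m + D) ^+ 2.
  by rewrite ler_sqr ?nnegrE ?mdist_ge0// addr_ge0.
have xq2 : mdist x0 q ^+ 2 <= (m + D) ^+ 2.
  by rewrite ler_sqr ?nnegrE ?mdist_ge0// addr_ge0.
have hw2 : m ^+ 2 * (1 - e ^+ 2 / 8) <= mdist x0 w ^+ 2.
  have [h|h] := leP 0 ((1 - e ^+ 2 / 16) * m).
    have : ((1 - e ^+ 2 / 16) * m) ^+ 2 <= mdist x0 w ^+ 2.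
      by rewrite ler_sqr ?nnegrE ?mdist_ge0// ltW.
    apply: le_trans; rewrite -subr_ge0.
    rewrite (_ : _ - _ = (e ^+ 2 / 16 * m) ^+ 2); last by field.
    exact: sqr_ge0.
  apply: le_trans (sqr_ge0 _); rewrite mulr_ge0_le0 ?sqr_ge0//.
  rewrite pmulr_llt0 in h; last by lra.
  by lra.
have hm2 : 2 * (8 * D + 4 * D ^+ 2) * m <= e ^+ 2 * m ^+ 2.
  rewrite (_ : e ^+ 2 * m ^+ 2 = m * e ^+ 2 * m); last by ring.
  exact: ler_wpM2r.
have hD : 4 * D ^+ 2 <= 4 * D ^+ 2 * m by rewrite ler_peMr// mulr_ge0// sqr_ge0.
rewrite exprMn; move: hs xp2 xq2 hw2 hm2 hD.
rewrite (_ : (m + D) ^+ 2 = m ^+ 2 + 2 * D * m + D ^+ 2); last by ring.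
move: (mdist x0 p ^+ 2) (mdist x0 q ^+ 2) (mdist p q ^+ 2) (mdist x0 w ^+ 2) => A B C E.
rewrite (_ : 2 * (8 * D + 4 * D ^+ 2) * m = 16 * (D * m) + 8 * (D ^+ 2 * m)); last by ring.
rewrite (_ : 4 * D ^+ 2 * m = 4 * (D ^+ 2 * m)); last by ring.
rewrite (_ : 2 * D * m = 2 * (D * m)); last by ring.
rewrite (_ : m ^+ 2 * (1 - e ^+ 2 / 8) = m ^+ 2 - e ^+ 2 * m ^+ 2 / 8); last by ring.
move: (D * m) (D ^+ 2 * m) (D ^+ 2) (e ^+ 2 * m ^+ 2) (m ^+ 2) => a b c d f.
lra.
Qed.

Hypothesis cY : seq_complete Y.

(** By [pinch] the segments to almost optimal points converge to a ray of steepest descent. An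
    isometry that changes F by a constant sends almost optimal points to almost optimal points, so
    the ray and its image are asymptotic. *)
Lemma descent_fixed_boundary : exists xi : boundary Y, forall (h : isometry Y) (c : R),
  (forall x, F (h x) = F x + c) -> boundary_map h xi = xi.
Proof.
have [y hy] : exists y : nat -> Y, forall n,
    mdist x0 (y n) <= n%:R /\ k * n%:R - 1 <= F x0 - F (y n).
  suff /choice : forall n : nat, exists z,
      mdist x0 z <= n%:R /\ k * n%:R - 1 <= F x0 - F z.
    by move=> [y hy]; exists y.
  move=> n.
  have [z zn Fz] := M_adherent (ler0n R n) ltr01.
  by exists z; split => //; have := M_ge (ler0n R n); lra.
have nat_large (N : R) : exists N' : nat, forall n, (N' <= n)%N -> N <= n%:R.
  exists (Num.truncn N).+1 => n hn; apply: le_trans (ltW (truncnS_gt N)) _.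
  by rewrite ler_nat.
have Fconv n (r : R) : 0 <= r -> (0 < n)%N -> r <= n%:R ->
    k * r - 1 <= F x0 - F (conv x0 (y n) (r / n%:R)).
  move=> r0 n0 rn; have n0' : 0 < n%:R :> R by rewrite ltr0n.
  have l01 := ratio01 r0 rn n0'; have [_ Fn] := hy n; have := cF x0 (y n) l01.
  have [l0 l1] := andP l01; have := ler_wpM2l l0 Fn.
  rewrite mulrBr mulr1 (_ : r / n%:R * (k * n%:R) = k * r); last first.
    by field; exact: lt0r_neq0.
  lra.
have [||rho [rho0 hrho]] := @ray_limit R Y hY x0 y cY.
- move=> e e0; have [N hN] := far 1 e0; have [N' hN'] := nat_large N.
  exists N' => n /hN' Nn; have [yn Fn] := hy n.
  have h : (1 - e) * n%:R < mdist x0 (y n).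
    by rewrite ltNge; apply/negP => /(hN _ Nn); rewrite ltNge Fn.
  have : 0 <= e * n%:R by rewrite mulr_ge0// ltW.
  by move=> ?; rewrite ler_norml; apply/andP; split; lra.
- move=> e e0; have [N hN] := pinch e0 ler01; have [N' hN'] := nat_large N.
  exists (maxn N' 1) => n m; rewrite geq_max => /andP[/hN' Nn n0] nm.
  have [yn Fn] := hy n; have [ym Fm] := hy m.
  have nm' : n%:R <= m%:R :> R by rewrite ler_nat.
  have m0 : 0 < m%:R :> R by rewrite ltr0n; exact: leq_trans nm.
  apply: hN => //; [lra| |].
    rewrite (conv_distl hY) ?ratio01//.
    apply: le_trans (ler_wpM2l _ ym) _; first by rewrite divr_ge0.
    by rewrite divfK ?lt0r_neq0//; lra.
  by apply: Fconv => //; rewrite ltr0n in m0.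
have Frho r : 0 <= r -> F (rho r) <= F x0 - k * r + 2.
  move=> r0; have [N hN] := hrho r 1 r0 ltr01.
  have [N' hN'] := nat_large r; pose n := maxn (maxn N N') 1.
  have n0 : (0 < n)%N by rewrite /n leq_max orbT.
  have Nn : (N <= n)%N by rewrite /n !leq_max leqnn.
  have rn : r <= n%:R by apply: hN'; rewrite /n !leq_max leqnn orbT.
  have := Fconv n r r0 n0 rn; have := hN n Nn.
  have := lF (rho r) (conv x0 (y n) (r / n%:R)); lra.
exists (endpoint rho) => h c hF; rewrite boundary_map_endpoint.
apply/endpointP; exists (mdist (h (rho 0)) (rho 0)) => r r0.
apply: ler_eps => e e0.
(* What [h (rho s)] loses against an optimal point: 2 along the ray, |c| in the value of F, and the
   displacement of x0 in the distance. *)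
pose D := 2 + `|c| + mdist x0 (h x0).
have D0 : 0 <= D by rewrite !addr_ge0 ?mdist_ge0.
have er : 0 < e / (r + 1) by rewrite divr_gt0//; lra.
have [N hN] := pinch er D0; pose s := Num.max N (r + 1).
have Ns : N <= s by rewrite /s le_max lexx.
have rs : r + 1 <= s by rewrite /s le_max lexx orbT.
have s0 : 0 < s by lra.
have rs01 : 0 <= r / s <= 1 by apply: ratio01 => //; lra.
have xr : mdist x0 (rho s) = s.
  by rewrite -rho0 rayP//; [rewrite sub0r normrN gtr0_norm|exact: ltW].
have /andP[c1 c2] : - `|c| <= c <= `|c| by rewrite -ler_norml.
have d0 := mdist_ge0 x0 (h x0).
have hs : mdist (h (rho s)) (rho s) <= e / (r + 1) * s.
  have Fs := Frho s (ltW s0); apply: hN => //.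
  - have := metric_triangle x0 (h x0) (h (rho s)).
    by rewrite isom_dist xr /D; lra.
  - by rewrite xr; lra.
  - by rewrite hF /D; lra.
  - by rewrite /D; lra.
have e1 (t : ray Y) : t r = conv (t 0) (t s) (r / s).
  by rewrite ray_conv//; [rewrite mulr0 add0r divfK ?lt0r_neq0|exact: ltW].
have := conv_convex hY (h (rho 0)) (h (rho s)) (rho 0) (rho s) rs01.
rewrite -e1 (_ : conv (h (rho 0)) (h (rho s)) (r / s) = ray_map h rho r); last first.
  by rewrite (e1 (ray_map h rho)).
move=> hc; apply: le_trans hc _; have [l0 l1] := andP rs01; apply: lerD.
  by rewrite ler_piMl ?mdist_ge0//; lra.
apply: le_trans (ler_wpM2l l0 hs) _.
have -> : r / s * (e / (r + 1) * s) = r / (r + 1) * e.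
  by field; apply/andP; split; apply: lt0r_neq0 => //; lra.
by rewrite ler_piMl ?ltW// ltr_pdivrMr; lra.
Qed.

End descent.

(** * Minimal invariant convex sets *)

Section convex_subsets.
Context {R : realType}.
Implicit Types Y Z : metricType R.

Lemma isom_conv Y Z (f : Y -> Z) x y l : cat0 Y -> cat0 Z ->
  (forall u v, mdist (f u) (f v) = mdist u v) -> 0 <= l <= 1 ->
  f (conv x y l) = conv (f x) (f y) l.
Proof.
move=> hY hZ fd l01; apply: (conv_uniq hZ) => //; rewrite !fd.
  by rewrite (conv_distl hY).
by rewrite (conv_distr hY).
Qed.

Definition conv_closed Y (C : set Y) : Prop := forall x y l, C x -> C y ->
  0 <= l <= 1 -> C (conv x y l).

Definition dist_to Y (C : set Y) (x : Y) : R :=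
  inf [set d | exists2 c, C c & d = mdist x c].

Section dist_to.
Variables (Y : metricType R) (hY : cat0 Y) (C : set Y).
Hypothesis C0 : C !=set0.

Let has_inf_dist x : has_inf [set d | exists2 c, C c & d = mdist x c].
Proof.
have [c Cc] := C0; split; first by exists (mdist x c), c.
by exists 0 => _ [d _ ->]; exact: mdist_ge0.
Qed.

Lemma dist_to_le x c : C c -> dist_to C x <= mdist x c.
Proof. by move=> Cc; apply: ge_inf; [case: (has_inf_dist x)|exists c]. Qed.

Lemma dist_to_adherent x (e : R) : 0 < e ->
  exists2 c, C c & mdist x c < dist_to C x + e.
Proof.
by move=> e0; have [_ [c Cc ->] h] := inf_adherent e0 (has_inf_dist x); exists c.
Qed.

Lemma dist_to_lip : lip1 (dist_to C).
Proof.
move=> x y; apply: ler_eps => e /(dist_to_adherent y)[c Cc h].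
have := dist_to_le x Cc; have := metric_triangle x y c; lra.
Qed.

Lemma dist_to_convex : conv_closed C -> convex_fun (dist_to C).
Proof.
move=> cC x y l l01; apply: ler_eps => e e0.
have [c Cc hc] := dist_to_adherent x e0; have [d Cd hd] := dist_to_adherent y e0.
have := dist_to_le (conv x y l) (cC c d l Cc Cd l01).
have := conv_convex hY x y c d l01; have [l0 l1] := andP l01.
have l1' : 0 <= 1 - l by lra.
have := ler_wpM2l l1' (ltW hc); have := ler_wpM2l l0 (ltW hd); lra.
Qed.

End dist_to.

Lemma dist_to_isom Y (C : set Y) (f : isometry Y) x :
  (forall c, C c -> C (f c)) -> (forall c, C c -> exists2 d, C d & f d = c) ->
  dist_to C (f x) = dist_to C x.
Proof.
move=> fC Cf; rewrite /dist_to; congr inf; apply/seteqP; split => _ [c Cc ->].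
  by have [d Cd <-] := Cf c Cc; exists d => //; rewrite isom_dist.
by exists (f c); [exact: fC|rewrite isom_dist].
Qed.

End convex_subsets.

Section no_fixed_boundary_point.
Context {R : realType} {G : topologicalGroupType} (H : set G).
Variables (Y : metricType R) (hY : cat0 Y) (cY : seq_complete Y) (x0 : Y).
Variable (al : G -> isometry Y).
Hypothesis sH : is_subgroup H.
Hypothesis hal : isom_action H al.
Hypothesis noxi : ~ exists xi, forall h, H h -> boundary_map (al h) xi = xi.

(** If c h < 0, which may be assumed by passing to the inverse, then F falls at a linear rate along
    the orbit of x0 under h, and by convexity along the segments from x0 to it;
    [descent_fixed_boundary] then contradicts [noxi]. *)
Lemma quasi_invariant (F : Y -> R) (c : G -> R) : convex_fun F -> lip1 F ->
  (forall h x, H h -> F (al h x) = F x + c h) -> forall h, H h -> c h = 0.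
Proof.
move=> cF lF hF h Hh; apply/eqP; apply: contrapT => /negP ch0; apply: noxi.
have [H1 HM HV] := sH.
have {h Hh ch0} [h [Hh ch]] : exists h, H h /\ c h < 0.
  have := ch0; rewrite neq_lt => /orP[chn|chp]; first by exists h.
  exists h^-1%g; split; first exact: HV.
  have := hF h (al h^-1%g x0) Hh; rewrite (isom_actVK sH hal)// => E.
  have := hF h^-1%g x0 (HV _ Hh); lra.
pose d := mdist x0 (al h x0); pose z k := iter k (al h) x0.
have cd : - c h <= d by have := lF x0 (al h x0); rewrite hF// -/d; lra.
have d0 : 0 < d by lra.
have Fz k : F (z k) = F x0 + k%:R * c h.
  by elim: k => [|k IHk]; rewrite /z /= ?mul0r ?addr0// hF// IHk -natr1; ring.
have dz k : mdist x0 (z k) <= k%:R * d.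
  elim: k => [|k IHk]; first by rewrite mdistxx mul0r.
  apply: le_trans (metric_triangle _ (al h x0) _) _.
  by rewrite [z k.+1]/= isom_dist -natr1 mulrDl mul1r addrC lerD2r.
have k00 : 0 < - c h / d by rewrite divr_gt0// oppr_gt0.
have [n|xi hxi] := descent_fixed_boundary hY (x0 := x0) cF lF k00 _ cY; last first.
  by exists xi => g Hg; apply: (hxi _ (c g)) => x; exact: hF.
pose k := (Num.truncn (n%:R / d)).+1.
have kd : n%:R <= k%:R * d.
  by rewrite -ler_pdivrMr//; apply/ltW; exact: truncnS_gt.
have k0 : 0 < k%:R * d by rewrite mulr_gt0// ltr0n.
have l01 := ratio01 (ler0n R n) kd k0; have [l0 l1] := andP l01.
exists (conv x0 (z k) (n%:R / (k%:R * d))); split.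
  rewrite (conv_distl hY)//; apply: le_trans (ler_wpM2l l0 (dz k)) _.
  by rewrite divfK// lt0r_neq0.
apply: le_trans (cF _ _ _ l01) _; rewrite Fz.
rewrite (_ : - c h / d * n%:R = - (n%:R / (k%:R * d) * (k%:R * c h))); last first.
  by field; rewrite pnatr_eq0 /= lt0r_neq0.
lra.
Qed.

Definition invariant_convex (C : set Y) : Prop :=
  [/\ C !=set0, closed C, conv_closed C & forall h x, H h -> C x -> C (al h x)].

Hypothesis bY : bounded_geometry Y.

(* The distances to the members of a chain with empty intersection, normalized
   at x0, accumulate at an invariant convex function without lower bound. *)
Lemma chain_meets (CC : set (set Y)) : CC !=set0 ->
  (forall C, CC C -> invariant_convex C) ->
  (forall C D, CC C -> CC D -> C `<=` D \/ D `<=` C) ->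
  exists x, forall C, CC C -> C x.
Proof.
move=> [C0 CC0] hCC tot; apply: contrapT => hno; apply: noxi.
have escape x (r : R) : exists2 C, CC C & forall y, C y -> r < mdist x y.
  apply: contrapT => hx.
  have [|A|A B /= CA CB|A /= CA|y _ hy] :=
      @compact_directed Y _ CC (compact_cball_complete (c := x) (K := r) cY bY).
  - by exists C0.
  - by move/hCC => [].
  - by have [AB|BA] := tot A B CA CB; [exists A|exists B] => // z Az; split=> //;
      [exact: AB|exact: BA].
  - apply: contrapT => hA; apply: hx; exists A => // z Az; rewrite ltNge.
    by apply/negP => xz; apply: hA; exists z.
  by apply: hno; exists y.
pose f (C : set Y) x := dist_to C x - dist_to C x0.
have fN C : CC C -> normalized x0 (f C).
  move=> /hCC[Cn _ _ _]; split; last by rewrite /f subrr.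
  by move=> x y; rewrite /f; have := dist_to_lip Cn x y; lra.
pose D := [set A | exists2 C, CC C & A = [set g | exists C', [/\ CC C', C' `<=` C & g = f C']]].
have [||_ _ [A CA ->] [B CB ->]|F [[lF F0] hF]] := @lip1_cluster R Y x0 D.
- by exists [set g | exists C', [/\ CC C', C' `<=` C0 & g = f C']], C0.
- move=> _ [C CCC ->]; split; first by exists (f C), C; split.
  by move=> _ [C' [CC' _ ->]]; exact: fN.
- have [AB|BA] := tot A B CA CB.
    exists [set g | exists C', [/\ CC C', C' `<=` A & g = f C']]; first by exists A.
    move=> _ [C' [CC' C'A ->]]; split; exists C'; split=> //.
    exact: subset_trans AB.
  exists [set g | exists C', [/\ CC C', C' `<=` B & g = f C']]; first by exists B.
  move=> _ [C' [CC' C'A ->]]; split; exists C'; split=> //.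
  exact: subset_trans BA.
have {}hF C (s : seq Y) (e : R) : CC C -> 0 < e -> exists C', [/\ CC C', C' `<=` C &
    forall x, x \in s -> `|F x - f C' x| < e].
  move=> CCC e0.
  have [|g [C' [h1 h2 gE]] h3] :=
      hF [set g | exists C', [/\ CC C', C' `<=` C & g = f C']] s e _ e0.
    by exists C.
  by exists C'; rewrite -gE.
have cF : convex_fun F.
  move=> x y l l01; apply: ler_eps => e e0; have e2 : 0 < e / 2 by lra.
  have [C [CCC _ hC]] := hF C0 [:: x; y; conv x y l] _ CC0 e2.
  have [Cn _ cC _] := hCC C CCC; have := dist_to_convex hY Cn cC x y l01.
  have [l0 l1] := andP l01; have l1' : 0 <= 1 - l by lra.
  have hx : `|F x - f C x| < e / 2 by apply: hC; rewrite !inE eqxx ?orbT.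
  have hy : `|F y - f C y| < e / 2 by apply: hC; rewrite !inE eqxx ?orbT.
  have : `|F (conv x y l) - f C (conv x y l)| < e / 2.
    by apply: hC; rewrite !inE eqxx ?orbT.
  move: hy hx; rewrite !ltr_norml /f => /andP[y1 y2] /andP[z1 z2] /andP[? ?].
  have := ler_wpM2l l1' (ltW z1); have := ler_wpM2l l0 (ltW y1).
  have := ler_wpM2l l1' (ltW z2); have := ler_wpM2l l0 (ltW y2); lra.
have iF h x : H h -> F (al h x) = F x + 0.
  move=> Hh; rewrite addr0; apply/eqP; rewrite -subr_eq0 -normr_eq0.
  rewrite eq_le normr_ge0 andbT; apply: ler_eps => e e0; rewrite add0r.
  have e2 : 0 < e / 2 by lra.
  have [C [CCC _ hC]] := hF C0 [:: x; al h x] _ CC0 e2.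
  have [Cn _ cC iC] := hCC C CCC; have [_ _ HV] := sH.
  have fE : f C (al h x) = f C x.
    rewrite /f dist_to_isom// => c Cc; first exact: iC.
    by exists (al h^-1%g c); [apply: iC => //; exact: HV|exact: isom_actVK sH hal _ _ _].
  have hx : `|F x - f C x| < e / 2 by apply: hC; rewrite !inE eqxx ?orbT.
  have : `|F (al h x) - f C (al h x)| < e / 2 by apply: hC; rewrite !inE eqxx ?orbT.
  move: hx; rewrite fE; move: (F _) (F _) (f C x) => u v w.
  by rewrite !ltr_norml ler_norml => /andP[? ?] /andP[? ?]; apply/andP; split; lra.
(* Half a unit is walked from x towards a set C disjoint from the unit ball, and a finite 1/8-net
   around x makes the convergence uniform. The loss is 1/16 for the choice of c, 1/8 for the net,
   1/32 at each end: -1/2 + 1/16 + 1/8 + 1/16 = -1/4. *)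
have step x : exists2 z, mdist x z <= 1 & F z <= F x - 4^-1.
  have e8 : 0 < 8^-1 :> R by lra.
  have e32 : 0 < 32^-1 :> R by lra.
  have [t ht] := bounded_geometry_net x 1 bY e8.
  have [C1 CC1 far1] := escape x 1.
  have [C [CCC C1C hC]] := hF C1 (x :: t) _ CC1 e32.
  have [Cn _ _ _] := hCC C CCC.
  have e16 : 0 < 16^-1 :> R by lra.
  have [c Cc hc] := dist_to_adherent Cn x e16.
  have xc : 1 < mdist x c by apply: far1; exact: C1C.
  have xc0 : 0 < mdist x c by lra.
  pose l := 2^-1 / mdist x c.
  have l01 : 0 <= l <= 1 by apply: ratio01; lra.
  pose z0 := conv x c l.
  have xz0 : mdist x z0 = 2^-1 by rewrite (conv_distl hY)// divfK// lt0r_neq0.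
  have z0c : mdist z0 c = mdist x c - 2^-1.
    by rewrite (conv_distr hY)// mulrBl mul1r divfK// lt0r_neq0.
  have [|z zt zz0] := ht z0; first by rewrite xz0; lra.
  exists z; first by have := metric_triangle x z0 z; rewrite (metric_sym z0 z); lra.
  have := hC x (mem_head _ _); have := hC z; rewrite in_cons zt orbT => /(_ isT).
  have := dist_to_lip Cn z z0; have := dist_to_le Cn z0 Cc.
  rewrite /f !ltr_norml => ? ? /andP[? ?] /andP[? ?].
  have : dist_to C z0 <= dist_to C x + 16^-1 - 2^-1 by lra.
  lra.
have k0 : 0 < 4^-1 :> R by lra.
have [n|xi hxi] := descent_fixed_boundary hY (x0 := x0) cF lF k0 _ cY; last first.
  by exists xi => g Hg; apply: (hxi _ 0) => x; exact: iF.
elim: n => [|n [y [yn Fy]]]; first by exists x0; rewrite mdistxx mulr0 subr0.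
have [z yz Fz] := step y; exists z; rewrite -natr1; split.
  by have := metric_triangle x0 y z; lra.
lra.
Qed.

Lemma minimal_invariant_convex : exists C, invariant_convex C /\
  forall D, invariant_convex D -> D `<=` C -> D = C.
Proof.
have iY : invariant_convex setT.
  by split => //; exists x0.
(* Zorn's lemma for unions, applied to complements. The empty chain gives the whole space and is
   treated apart. *)
have [F FP Ft|A [PA hA]] := @Zorn_bigcup Y (fun A => invariant_convex (~` A)).
  have [F0|F0] := pselect (F !=set0); last first.
    rewrite (_ : ~` _ = setT)//; apply/seteqP; split => // x _ [A FA _].
    by apply: F0; exists A.
  pose CC := [set C | F (~` C)].
  have CCE A : F A <-> CC (~` A) by rewrite /CC /= setCK.
  have hCC C : CC C -> invariant_convex C.
    by move=> /FP; rewrite setCK.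
  have [|C D /= FC FD|x hx] := chain_meets _ hCC.
  - by have [A /CCE CA] := F0; exists (~` A).
  - have [h|h] := Ft _ _ FC FD; [right|left] => x Ex; apply: contrapT => /h; exact.
  rewrite setC_bigcup; split.
  - by exists x => A /CCE; exact: hx.
  - by apply: closed_bigI => A /FP[].
  - by move=> y z l hy hz l01 A FA; have [_ _ h _] := FP A FA; apply: h => //;
      [exact: hy|exact: hz].
  - by move=> h y Hh hy A FA; have [_ _ _ i] := FP A FA; apply: i => //; exact: hy.
exists (~` A); split=> // D iD DA; apply: contrapT => neq.
apply: (hA (~` D)); last by rewrite setCK.
split; first by move=> x Ax /DA.
move=> h; apply: neq; apply/seteqP; split => // x nAx.
by apply: contrapT => nDx; apply: nAx; exact: h.
Qed.

End no_fixed_boundary_point.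

(** * Invariant convex subsets as metric spaces *)

Section isometric_embedding.
Context {R : realType} (Z Y : metricType R) (j : Z -> Y).
Hypothesis jd : forall x y, mdist (j x) (j y) = mdist x y.

Lemma embedding_bounded_geometry : bounded_geometry Y -> bounded_geometry Z.
Proof.
move=> bY K r r0; have [N hN] := bY K r r0; exists N => c s sc sp.
rewrite -(size_map j); apply: (hN (j c)).
  by rewrite all_map; apply: sub_all sc => x /=; rewrite jd.
by rewrite pairwise_map; apply: sub_pairwise sp => x y /=; rewrite jd.
Qed.

Lemma embedding_ray (rho : ray Z) : (fun t => j (rho t)) \in @is_ray _ Y.
Proof. by apply/mem_set => s t s0 t0; rewrite jd rayP. Qed.

Lemma embedding_fixed_boundary (I : Type) (D : set I) (f : I -> isometry Z)
    (g : I -> isometry Y) : (forall i z, D i -> j (f i z) = g i (j z)) ->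
  (exists xi, forall i, D i -> boundary_map (f i) xi = xi) ->
  exists xi, forall i, D i -> boundary_map (g i) xi = xi.
Proof.
move=> jfg [xi hxi]; pose rho : ray Y := SigSub (embedding_ray (repr xi)).
exists (endpoint rho) => i Di; rewrite boundary_map_endpoint; apply/endpointP.
have : endpoint (ray_map (f i) (repr xi)) = endpoint (repr xi).
  by rewrite -boundary_map_endpoint /endpoint reprK hxi.
move=> /endpointP[K hK]; exists K => t t0.
rewrite [ray_map _ _ _]/ray_fun /= [rho t]/ray_fun /= -jfg// jd.
exact: hK.
Qed.

End isometric_embedding.

Section subspace.
Context {R : realType} (Y : metricType R) (C : set Y).

Definition submetric : Type := C.
HB.instance Definition _ := Choice.on submetric.

Let d (x y : submetric) : R := mdist (val x) (val y).

Let dxx x : d x x = 0. Proof. exact: mdistxx. Qed.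
Let d_eq0 x y : d x y = 0 -> x = y.
Proof. by move=> /mdist_positivity/val_inj. Qed.
Let dC x y : d x y = d y x. Proof. exact: metric_sym. Qed.
Let dD y x z : d x z <= d x y + d y z. Proof. exact: metric_triangle. Qed.

HB.instance Definition _ := isMetric.Build R submetric dxx d_eq0 dC dD.

Lemma submetric_dist (x y : submetric) :
  mdist (val x : Y) (val y) = mdist x y.
Proof. by []. Qed.

Lemma submetric_in (x : submetric) : C (val x).
Proof. exact: (set_valP x). Qed.

Definition to_submetric (x : Y) (Cx : C x) : submetric := SigSub (mem_set Cx).

Hypothesis hY : cat0 Y.

Lemma submetric_cat0 : conv_closed C -> cat0 submetric.
Proof.
move=> cC; apply: stewart_cat0 => x y l l01.
have Cm := cC _ _ _ (submetric_in x) (submetric_in y) l01.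
by exists (to_submetric Cm) => z; have := convP hY (val x) (val y) l01 (val z).
Qed.

Lemma submetric_complete : closed C -> seq_complete Y -> seq_complete submetric.
Proof.
move=> clC cY u uC; have [x /cvg_mdistP hx] := cY (fun n => val (u n)) uC.
have Cx : C x.
  move/closedE_mdist : clC; apply => e /hx[N hN].
  by exists (val (u N)); [exact: submetric_in|rewrite metric_sym; exact: hN].
by exists (to_submetric Cx); apply/cvg_mdistP => e /hx.
Qed.

(* The restriction to C of an isometry that maps C onto C, and a junk value for
   the other isometries. *)
Definition preserves (f : isometry Y) : Prop :=
  (forall x, C x -> C (f x)) /\ (forall y, C y -> exists2 x, C x & f x = y).

Section restriction.
Variables (f : isometry Y) (hf : preserves f).

Definition sub_fun (x : submetric) : submetric :=
  to_submetric (hf.1 (val x) (submetric_in x)).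

Lemma sub_fun_dist x y : mdist (sub_fun x) (sub_fun y) = mdist x y.
Proof. by rewrite -!submetric_dist /= isom_dist. Qed.

Lemma sub_fun_surj y : exists x, sub_fun x = y.
Proof.
have [x Cx fx] := hf.2 _ (submetric_in y).
by exists (to_submetric Cx); apply/val_inj.
Qed.

End restriction.

Definition sub_isometry (f : isometry Y) : isometry submetric :=
  if pselect (preserves f) is left hf then
    Isometry (sub_fun_dist hf) (sub_fun_surj hf)
  else isom_id _.

Lemma sub_isometryE f (x : submetric) : preserves f ->
  val (sub_isometry f x) = f (val x).
Proof. by rewrite /sub_isometry; case: pselect. Qed.

End subspace.

Section invariant_subspace.
Context {R : realType} {G : topologicalGroupType} (H : set G).
Variables (Y : metricType R) (al : G -> isometry Y) (C : set Y).
Hypothesis sH : is_subgroup H.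
Hypothesis hal : isom_action H al.
Hypothesis iC : forall h x, H h -> C x -> C (al h x).

Lemma invariant_preserves h : H h -> preserves C (al h).
Proof.
move=> Hh; split=> [x|y Cy]; first exact: iC.
exists (al h^-1%g y); last exact: isom_actVK sH hal _ _ _.
by apply: iC => //; case: sH => _ _; exact.
Qed.

Lemma sub_isom_action : isom_action H (fun h => sub_isometry C (al h)).
Proof.
have [al1 alM alc] := hal; have [H1 HM HV] := sH; split.
- by move=> x; apply/val_inj; rewrite sub_isometryE ?al1//; exact: invariant_preserves.
- move=> g h x Hg Hh; apply/val_inj; rewrite !sub_isometryE ?alM//;
    apply: invariant_preserves => //; exact: HM.
- move=> g x e Hg e0; apply: filterS (alc g (val x) e Hg e0) => h /= hh Hh.
  by rewrite -submetric_dist !sub_isometryE; [exact: hh|exact: invariant_preserves..].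
Qed.

End invariant_subspace.

(** * Horofunctions *)

Section horofunctions.
Context {R : realType} (Y : metricType R) (hY : cat0 Y) (cY : seq_complete Y).
Hypothesis bY : bounded_geometry Y.
Variable x0 : Y.
Implicit Types (b F : Y -> R) (S : set Y) (x y p : Y).

Definition horo_approx b (s : seq Y) (e : R) p : Prop :=
  forall x, x \in s -> `|b x - (mdist x p - mdist x0 p)| < e.

(* Limits of normalized distance functions to points of S tending to infinity. *)
Definition horofunction S b : Prop := normalized x0 b /\
  forall s (e K : R), 0 < e -> exists p, [/\ S p, K <= mdist x0 p & horo_approx b s e p].

Definition affine_fun b : Prop := forall x y l, 0 <= l <= 1 ->
  b (conv x y l) = (1 - l) * b x + l * b y.

Lemma horofunction_exists S : (forall K : R, exists2 p, S p & K <= mdist x0 p) ->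
  exists b, horofunction S b.
Proof.
move=> hS; pose f p x := mdist x p - mdist x0 p.
have fN p : normalized x0 (f p).
  split; last by rewrite /f subrr.
  by move=> x y; rewrite /f; have := metric_triangle x y p; lra.
pose A (K : R) := [set g | exists p, [/\ S p, K <= mdist x0 p & g = f p]].
pose D := [set B | exists K, B = A K].
have [|_ [K ->]|_ _ [K ->] [L ->]|b [Nb hb]] := @lip1_cluster R Y x0 D.
- by exists (A 0), 0.
- split; last by move=> _ [p [_ _ ->]]; exact: fN.
  by have [p Sp Kp] := hS K; exists (f p), p.
- exists (A (Num.max K L)); first by exists (Num.max K L).
  by move=> _ [p [Sp + ->]]; rewrite ge_max => /andP[Kp Lp]; split; exists p.
exists b; split=> // s e K e0.
have [|g [p [Sp Kp gE]] hg] := hb (A K) s e _ e0; first by exists K.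
by exists p; split=> // x xs; have := hg x xs; rewrite gE.
Qed.

Lemma horofunction_convex S b : horofunction S b -> convex_fun b.
Proof.
move=> [_ hb] x y l l01; apply: ler_eps => e e0; have e2 : 0 < e / 2 by lra.
have [p [_ _ hp]] := hb [:: x; y; conv x y l] _ 0 e2.
have hx : `|b x - (mdist x p - mdist x0 p)| < e / 2 by apply: hp; rewrite !inE eqxx ?orbT.
have hy : `|b y - (mdist y p - mdist x0 p)| < e / 2 by apply: hp; rewrite !inE eqxx ?orbT.
have hm : `|b (conv x y l) - (mdist (conv x y l) p - mdist x0 p)| < e / 2.
  by apply: hp; rewrite !inE eqxx ?orbT.
move: hx hy hm; rewrite !ltr_norml => /andP[x1 x2] /andP[y1 y2] /andP[m1 m2].
have := dist_conv_le hY x y p l01; rewrite !(metric_sym p).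
have [l0 l1] := andP l01; have l1' : 0 <= 1 - l by lra.
have := ler_wpM2l l1' (ltW x1); have := ler_wpM2l l0 (ltW y1); lra.
Qed.

Lemma horofunction_closed S : pw_closed (horofunction S).
Proof.
move=> b hb; split.
  by apply: normalized_closed => s e /(hb s)[g [Ng _] hg]; exists g.
move=> s e K e0; have e2 : 0 < e / 2 by lra.
have [g [_ hg] gb] := hb s _ e2; have [p [Sp Kp hp]] := hg s _ K e2.
exists p; split=> // x xs; have := gb x xs; have := hp x xs.
by rewrite !ltr_norml => /andP[? ?] /andP[? ?]; apply/andP; split; lra.
Qed.

Lemma horofunction_isom S b (f : isometry Y) : horofunction S b ->
  horofunction [set p | S (f p)] (fun x => b (f x) - b (f x0)).
Proof.
move=> [[lb b0] hb]; split.
  split; last by rewrite subrr.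
  by move=> x y; have := lb (f x) (f y); rewrite isom_dist; lra.
move=> s e K e0; have e2 : 0 < e / 2 by lra.
have [p [Sp Kp hp]] := hb (f x0 :: map f s) _ (K + mdist x0 (f x0)) e2.
have [q qp] := isom_surj f p; rewrite -qp in Sp Kp hp.
exists q; split => //.
  by have := metric_triangle x0 (f x0) (f q); rewrite isom_dist; lra.
move=> x xs; have := hp (f x0) (mem_head _ _); have := hp (f x).
rewrite in_cons map_f ?orbT// => /(_ isT); rewrite !isom_dist.
by rewrite !ltr_norml => /andP[? ?] /andP[? ?]; apply/andP; split; lra.
Qed.

Section flow.
Variables (S : set Y) (b : Y -> R).
Hypothesis hb : horofunction S b.

Let lb : lip1 b. Proof. by case: hb => -[]. Qed.

(** y' is a cluster point, in a compact ball, of the points at distance T from y on the segments to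
    p, as p escapes and its distance function tends to b. *)
Let flow_cluster y (T : R) : 0 <= T -> exists y', forall s (e K : R), 0 < e ->
  exists p, [/\ K <= mdist y p, horo_approx b s e p &
    mdist y' (conv y p (T / mdist y p)) < e].
Proof.
move=> T0; pose L := T + 1 + mdist x0 y.
pose A s (e K : R) := [set z | exists p, [/\ K <= mdist y p, horo_approx b s e p &
  z = conv y p (T / mdist y p)]].
pose D := [set B | exists s (e K : R), [/\ 0 < e, T + 1 <= K & B = closure (A s e K)]].
have [|_ [s [e [K [_ _ ->]]]]|_ _ [s [e [K [e0 TK ->]]]] [t [d [M [d0 _ ->]]]]
  |_ [s [e [K [e0 TK ->]]]]|y' _ hy'] := @compact_directed Y _ D
    (compact_cball_complete (c := y) (K := T) cY bY).
- by exists (closure (A [::] 1 (T + 1))), [::], 1, (T + 1).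
- exact: closed_closure.
- exists (closure (A (s ++ t) (Num.min e d) (Num.max K M))).
    by exists (s ++ t), (Num.min e d), (Num.max K M); rewrite lt_min e0 le_max TK.
  move=> z hz; split; apply: closure_subset hz => _ [p [+ hp ->]];
    rewrite ge_max => /andP[h1 h2]; exists p; split => // x xs;
    by have := hp x; rewrite mem_cat xs ?orbT lt_min => /(_ isT)/andP[].
- have [_ hb2] := hb; have [p [_ Kp hp]] := hb2 s e (K + mdist x0 y) e0.
  have Kp' : K <= mdist y p.
    have := metric_triangle x0 y p; lra.
  exists (conv y p (T / mdist y p)); split; first by apply: subset_closure; exists p.
  by rewrite /cball /= (conv_distl hY) ?ratio01 ?divfK//; [apply: lt0r_neq0|..]; lra.
exists y' => s e K e0.
have ny : nbhs y' [set z | mdist y' z < e] by apply/nbhs_mdistE; exists e.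
have [|_ [[p [Kp hp ->]] hz]] := hy' (closure (A s e (Num.max K (T + 1)))) _ _ ny.
  by exists s, e, (Num.max K (T + 1)); rewrite le_max lexx orbT.
by exists p; split => //; apply: le_trans Kp; rewrite le_max lexx.
Qed.

(** The Bruhat-Tits inequality at x for the segment [y, p], in ratio T / d(y, p). With q = d(x, p) -
    d(y, p), which tends to b x - b y, its right-hand side is d(x, y)^2 + T^2 + 2 T q plus a
    nonpositive term. *)
Lemma horo_flow y (T : R) : 0 <= T -> exists y', b y' <= b y - T /\
  forall x, mdist x y' ^+ 2 <= mdist x y ^+ 2 + T ^+ 2 + 2 * T * (b x - b y).
Proof.
move=> T0; have [y' hy'] := flow_cluster y T0; exists y'; split.
  apply: ler_eps => e e0; have e4 : 0 < e / 4 by lra.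
  have [p [Tp hp h]] := hy' [:: y; y'] _ (T + 1) e4.
  have : `|b y - (mdist y p - mdist x0 p)| < e / 4 by apply: hp; rewrite !inE eqxx.
  have : `|b y' - (mdist y' p - mdist x0 p)| < e / 4.
    by apply: hp; rewrite !inE eqxx orbT.
  rewrite !ltr_norml => /andP[_ h1] /andP[h2 _].
  have := metric_triangle y' (conv y p (T / mdist y p)) p.
  rewrite (conv_distr hY) ?ratio01//; try lra.
  by rewrite mulrBl mul1r divfK ?lt0r_neq0//; lra.
move=> x; apply: ler_eps => e e0; have e2 : 0 < e / 2 by lra.
have [d d0 hd] := sqr_cont (mdist_ge0 x y') e2.
pose d' := Num.min d (e / (8 * (T + 1))).
have d'0 : 0 < d' by rewrite lt_min d0 divr_gt0//; lra.
have [p [Tp hp h]] := hy' [:: y; x] _ (T + 1) d'0.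
have : `|b y - (mdist y p - mdist x0 p)| < d' by apply: hp; rewrite !inE eqxx.
have : `|b x - (mdist x p - mdist x0 p)| < d' by apply: hp; rewrite !inE eqxx orbT.
rewrite !ltr_norml => /andP[h1 _] /andP[_ h2].
pose z := conv y p (T / mdist y p); have L0 : 0 < mdist y p by lra.
have l01 : 0 <= T / mdist y p <= 1 by apply: ratio01; lra.
have [_ hz] : mdist x z ^+ 2 <= mdist x y' ^+ 2 + e / 2 /\
    mdist x y' ^+ 2 <= mdist x z ^+ 2 + e / 2.
  apply: hd; first exact: mdist_ge0.
  have := mdist_diff_le x x z y'; rewrite mdistxx add0r (metric_sym z y').
  by move/le_trans; apply; apply: le_trans (ltW h) _; rewrite ge_min lexx.
have := convP hY y p l01 x; rewrite -/z.
have hd' : d' * (8 * (T + 1)) <= e.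
  by rewrite -ler_pdivlMr; [rewrite ge_min lexx orbT|lra].
have hx := metric_triangle x y p; have hx' := metric_triangle y x p.
rewrite (metric_sym y x) in hx'.
have {}h1 : mdist x p - mdist y p <= b x - b y + 2 * d' by lra.
pose q := mdist x p - mdist y p.
have q2 : q ^+ 2 <= mdist x y ^+ 2.
  rewrite -(ger0_norm (mdist_ge0 x y)) -[q ^+ 2]real_normK ?num_real//.
  rewrite ler_sqr ?nnegrE ?normr_ge0// (ger0_norm (mdist_ge0 x y)) ler_norml.
  by apply/andP; split; rewrite /q; lra.
have -> : mdist x p = mdist y p + q by rewrite /q; ring.
rewrite -/q in h1; move: l01 => /andP[l0 l1].
set l := T / mdist y p in l0 l1 *.
have lL : l * mdist y p = T by rewrite divfK// lt0r_neq0.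
have e1 : (1 - l) * mdist x y ^+ 2 + l * (mdist y p + q) ^+ 2 -
    l * (1 - l) * mdist y p ^+ 2 =
    mdist x y ^+ 2 + l * (q ^+ 2 - mdist x y ^+ 2) + 2 * (l * mdist y p) * q +
    (l * mdist y p) ^+ 2 by ring.
rewrite e1 lL => hs.
have h3 : l * (q ^+ 2 - mdist x y ^+ 2) <= 0 by rewrite mulr_ge0_le0// subr_le0.
have h4 : T * q <= T * (b x - b y + 2 * d') by exact: ler_wpM2l.
lra.
Qed.

Hypothesis ab : affine_fun b.

(* A point q in the interior of a geodesic segment is moved by the flow at equal
   angles from both ends, which turns the inequality of horo_flow into an
   equality; the general case follows by moving q to an end of the segment. *)
Lemma affine_horo_flow y (T : R) : 0 <= T -> exists y', forall x,
  mdist x y' ^+ 2 = mdist x y ^+ 2 + T ^+ 2 + 2 * T * (b x - b y).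
Proof.
move=> T0; have [f hf] : exists f : Y -> Y, forall y, b (f y) <= b y - T /\
    forall x, mdist x (f y) ^+ 2 <= mdist x y ^+ 2 + T ^+ 2 + 2 * T * (b x - b y).
  suff /choice : forall y, exists y', b y' <= b y - T /\
    forall x, mdist x y' ^+ 2 <= mdist x y ^+ 2 + T ^+ 2 + 2 * T * (b x - b y).
    by move=> [f hf]; exists f.
  by move=> z; exact: horo_flow.
exists (f y) => x; apply/eqP; rewrite eq_le (hf y).2 /=.
have fT q : T ^+ 2 <= mdist (f q) q ^+ 2.
  rewrite ler_sqr ?nnegrE ?mdist_ge0//; have := lb q (f q); have := (hf q).1.
  by rewrite metric_sym; lra.
have f1 p q : mdist (f p) (f q) <= mdist p q.
  apply: ler_of_sqr; first exact: mdist_ge0.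
  have := (hf q).2 (f p); have := (hf p).2 q; have := (hf p).1.
  rewrite (metric_sym q (f p)) (metric_sym q p) => h1 h2 h3.
  have := ler_wpM2l T0 h1; lra.
have mid (l : R) : 0 <= l -> l < 1 -> mdist x (conv x y l) ^+ 2 + T ^+ 2 +
    2 * T * (b x - b (conv x y l)) <= mdist x (f (conv x y l)) ^+ 2.
  move=> l0 l1; have l01 : 0 <= l <= 1 by rewrite l0 ltW.
  set q := conv x y l; have := convP hY x y l01 (f q); rewrite -/q.
  have := fT q; have := (hf q).2 y; rewrite !(metric_sym (f q)).
  have := ab x y l01; rewrite -/q (metric_sym y q) /q (conv_distr hY)// (conv_distl hY)//.
  rewrite -/q => -> hy hT hs; have := ler_wpM2l l0 hy.
  rewrite (metric_sym q (f q)) in hT; rewrite (metric_sym (f q) q) in hT.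
  move: hT hs; move: (mdist x (f q) ^+ 2) (mdist y (f q) ^+ 2) (mdist q (f q) ^+ 2).
  move: (mdist x y) (b x) (b y) (T ^+ 2) {hy} => d u v T2 A B C hT hs hl.
  rewrite -(ler_pM2l (_ : 0 < 1 - l)); last by lra.
  have : l * ((1 - l) * d) ^+ 2 + (1 - l) * (l * d) ^+ 2 = l * (1 - l) * d ^+ 2 by ring.
  have : (1 - l) * (2 * T * (u - ((1 - l) * u + l * v))) +
     l * (2 * T * (v - ((1 - l) * u + l * v))) = 0 by ring.
  lra.
apply: ler_eps => e e0; pose d := mdist x y; have d0 : 0 <= d by exact: mdist_ge0.
(* The estimate at an interior point of [x, y], n d away from y, is moved to y at a total cost of at
   most n C. *)
pose C := 5 * d ^+ 2 + 4 * T * d + 1; have C0 : 0 < C.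
  by rewrite /C; have := sqr_ge0 d; have := mulr_ge0 T0 d0; lra.
pose n := Num.min 1 (e / C).
have n0 : 0 < n by rewrite lt_min ltr01 divr_gt0.
have n1 : n <= 1 by rewrite ge_min lexx.
have nC : n * C <= e by rewrite -ler_pdivlMr// ge_min lexx orbT.
have l1 : 1 - n < 1 by lra.
have l0 : 0 <= 1 - n by lra.
have l01 : 0 <= 1 - n <= 1 by rewrite l0 ltW.
have := mid _ l0 l1; set q := conv x y (1 - n) => hq.
have qy : mdist q y = n * d by rewrite (conv_distr hY)// opprB addrCA subrr addr0.
have xq : mdist x q = (1 - n) * d by rewrite (conv_distl hY).
have bq : b q <= b y + n * d by rewrite -qy; exact: lb.
have fq : mdist x (f q) <= mdist x (f y) + n * d.
  have := metric_triangle x (f y) (f q); have := f1 q y.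
  by rewrite (metric_sym (f y)) qy; lra.
have dT : mdist x (f y) <= d + T.
  apply: ler_of_sqr; first exact: addr_ge0.
  apply: le_trans ((hf y).2 x) _; have := ler_wpM2l T0 (lb x y); rewrite -/d.
  by rewrite sqrrD mulr2n; lra.
have fq2 : mdist x (f q) ^+ 2 <= (mdist x (f y) + n * d) ^+ 2.
  by rewrite ler_sqr ?nnegrE ?addr_ge0 ?mulr_ge0 ?mdist_ge0// ltW.
rewrite xq in hq; move: hq fq2 dT; rewrite -/d.
have := mdist_ge0 x (f y); move: (mdist x (f y)) (mdist x (f q)) => u v u0 hq fq2 dT.
have nd0 : 0 <= n * d by rewrite mulr_ge0// ltW.
have h1 := ler_wpM2l T0 bq.
have h2 := ler_wpM2l nd0 dT.
have h3 : n * n * d ^+ 2 <= n * d ^+ 2.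
  by rewrite ler_wpM2r ?sqr_ge0// ler_piMl// ltW.
have E1 : ((1 - n) * d) ^+ 2 = d ^+ 2 - 2 * (n * d ^+ 2) + n * n * d ^+ 2 by ring.
have E2 : (u + n * d) ^+ 2 = u ^+ 2 + 2 * (n * d * u) + n * n * d ^+ 2 by ring.
have E3 : n * C = 5 * (n * d ^+ 2) + 4 * (n * (T * d)) + n by rewrite /C; ring.
have E4 : n * d * (d + T) = n * d ^+ 2 + n * (T * d) by ring.
have E5 : T * (b y + n * d) = T * b y + n * (T * d) by ring.
have E6 : 0 <= n * (T * d) by rewrite !mulr_ge0// ltW.
have E7 : 0 <= n * d ^+ 2 by rewrite mulr_ge0 ?sqr_ge0// ltW.
rewrite E1 in hq; rewrite E2 in fq2; rewrite E3 in nC; rewrite E4 in h2.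
rewrite E5 in h1; lra.
Qed.

End flow.
End horofunctions.

(** * Affine functions on a minimal set *)

Section minimal_action.
Context {R : realType} {G : topologicalGroupType} (H : set G).
Variables (Y : metricType R) (hY : cat0 Y) (cY : seq_complete Y) (x0 : Y).
Variable (al : G -> isometry Y).
Hypothesis amH : amenable_subgroup R H.
Hypothesis hal : isom_action H al.
Hypothesis noxi : ~ exists xi, forall h, H h -> boundary_map (al h) xi = xi.
Hypothesis minY : forall D, invariant_convex H al D -> D = setT.

Let sH : is_subgroup H. Proof. by case: amH. Qed.

(** Sublevel sets of F are closed, convex and invariant, so a nonempty one is everything. *)
Lemma invariant_const (F : Y -> R) : convex_fun F -> lip1 F ->
  (forall h x, H h -> F (al h x) = F x) -> forall x y, F x = F y.
Proof.
move=> cF lF iF; suff le x y : F x <= F y by move=> x y; apply/le_anti; rewrite !le.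
suff /minY E : invariant_convex H al [set z | F z <= F y].
  by have : [set z | F z <= F y] x by rewrite E.
split.
- by exists y => /=.
- apply/closedE_mdist => z hz /=; apply: ler_eps => e /hz[w /= Fw zw].
  by have := lF z w; lra.
- move=> u v l /= Fu Fv l01; apply: le_trans (cF _ _ _ l01) _.
  have [l0 l1] := andP l01; have l1' : 0 <= 1 - l by lra.
  have := ler_wpM2l l1' Fu; have := ler_wpM2l l0 Fv; lra.
- by move=> h z Hh /=; rewrite iF.
Qed.

Lemma quasi_invariant_const (F : Y -> R) (c : G -> R) : convex_fun F -> lip1 F ->
  (forall h x, H h -> F (al h x) = F x + c h) -> forall x y, F x = F y.
Proof.
move=> cF lF iF; apply: invariant_const => // h x Hh; rewrite iF//.
by rewrite (quasi_invariant hY cY x0 sH hal noxi cF lF iF)// addr0.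
Qed.

Let lin (t : seq (R * Y)) (F : Y -> R) : R := \sum_(p <- t) p.1 * F p.2.

Let lin_close t (F g : Y -> R) (e : R) :
  (forall x, x \in map snd t -> `|F x - g x| <= e) ->
  lin t g <= lin t F + (\sum_(p <- t) `|p.1|) * e.
Proof.
elim: t => [|p t IHt] h; first by rewrite /lin !big_nil mul0r addr0.
have {}IHt := IHt (fun x xt => h x (mem_behead (s := p.2 :: map snd t) xt)).
rewrite /lin !big_cons in IHt *; have := h p.2 (mem_head _ _).
rewrite ler_norml => /andP[h1 h2].
have : p.1 * (g p.2 - F p.2) <= `|p.1| * e.
  apply: le_trans (ler_norm _) _; rewrite normrM; apply: ler_wpM2l => //.
  by rewrite ler_norml; apply/andP; split; lra.
lra.
Qed.

(* The weak closed convex hull of B contains a constant function, by amenability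
   and minimality; a convexity defect common to all members of B would persist
   in it. *)
Lemma affine_member (B : set (Y -> R)) : B !=set0 -> pw_closed B ->
  (forall b, B b -> normalized x0 b /\ convex_fun b) ->
  (forall b h, H h -> B b -> B (fun x => b (al h x) - b (al h x0))) ->
  exists2 b, B b & affine_fun b.
Proof.
move=> B0 clB NB iB.
(* The last clause describes the closed convex hull by half-spaces: a lower bound valid on B for a
   finite combination of values persists on Z. *)
pose Z : set (Y -> R) := [set F | [/\ normalized x0 F, convex_fun F &
  forall t (c : R), (forall b, B b -> c <= lin t b) -> c <= lin t F]].
have ZF0 : Z (fun=> 0).
  have [|||||F [[lF F0] cF hF] iF] := @amenable_fixed_function R G H Y al x0 sH hal Z amH.
  - have [b Bb] := B0; exists b; have [Nb cb] := NB b Bb; split => // t c; exact.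
  - by move=> F [].
  - move=> F hF; split.
    + by apply: normalized_closed => s e /(hF s)[g [Ng _ _] hg]; exists g.
    + move=> x y l l01; apply: ler_eps => e e0; have e2 : 0 < e / 2 by lra.
      have [g [_ cg _] hg] := hF [:: x; y; conv x y l] _ e2.
      have hx : `|F x - g x| < e / 2 by apply: hg; rewrite !inE eqxx ?orbT.
      have hy : `|F y - g y| < e / 2 by apply: hg; rewrite !inE eqxx ?orbT.
      have : `|F (conv x y l) - g (conv x y l)| < e / 2.
        by apply: hg; rewrite !inE eqxx ?orbT.
      move: hy hx; rewrite !ltr_norml => /andP[y1 y2] /andP[z1 z2] /andP[m1 m2].
      have [l0 l1] := andP l01; have l1' : 0 <= 1 - l by lra.
      have := cg x y l l01; have := ler_wpM2l l1' (ltW z1); have := ler_wpM2l l0 (ltW y1).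
      lra.
    + move=> t c hc; apply: ler_eps => e e0.
      have m0 : 0 <= \sum_(p <- t) `|p.1| by exact: sumr_ge0.
      have m1 : 0 < 1 + \sum_(p <- t) `|p.1| by lra.
      have [g [_ _ hg] gF] := hF (map snd t) _ (divr_gt0 e0 m1).
      apply: le_trans (hg t c hc) _; apply: le_trans (lin_close (F := F) _) _.
        by move=> x xt; apply/ltW; exact: gF x xt.
      rewrite lerD2l mulrCA ler_piMr ?ltW//.
      by rewrite ltr_pdivrMr; lra.
  - move=> F g l [[lF F0] cF hF] [[lg g0] cg hg] l01.
    have [l0 l1] := andP l01; have l1' : 0 <= 1 - l by lra.
    split; first split.
    + move=> x y; have := ler_wpM2l l0 (lF x y); have := ler_wpM2l l1' (lg x y); lra.
    + by rewrite F0 g0; lra.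
    + move=> x y m m01; have := ler_wpM2l l0 (cF x y m m01).
      have := ler_wpM2l l1' (cg x y m m01); lra.
    + move=> t c hc; rewrite (_ : lin t _ = l * lin t F + (1 - l) * lin t g).
        have := ler_wpM2l l0 (hF t c hc); have := ler_wpM2l l1' (hg t c hc); lra.
      rewrite /lin !mulr_sumr -big_split; apply: eq_bigr => p _ /=; ring.
  - move=> F h Hh [[lF F0] cF hF]; split; first split.
    + by move=> x y; have := lF (al h x) (al h y); rewrite isom_dist; lra.
    + by rewrite subrr.
    + move=> x y l l01; rewrite (isom_conv x y hY hY (isom_dist (al h)) l01).
      have := cF (al h x) (al h y) l l01; lra.
    + move=> t c hc.
      (* A combination of values of the renormalized translate is again one of values of g, with the
         point [al h x0] counted negatively. *)
      have E g : lin t (fun x => g (al h x) - g (al h x0)) =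
          lin ((- \sum_(p <- t) p.1, al h x0) :: [seq (p.1, al h p.2) | p <- t]) g.
        rewrite /lin big_cons big_map /= mulNr mulr_suml -sumrN -big_split.
        apply: eq_bigr => p _ /=; ring.
      rewrite E; apply: hF => b Bb; rewrite -E; apply: hc; exact: iB.
  have F00 x : F x = 0 by rewrite -F0; exact: (quasi_invariant_const cF lF iF).
  by rewrite -(_ : F = fun=> 0)//; exact/funext.
have {ZF0} [_ _ Z0] := ZF0.
pose dfct (b : Y -> R) (p : Y * Y * R) :=
  (1 - p.2) * b p.1.1 + p.2 * b p.1.2 - b (conv p.1.1 p.1.2 p.2).
pose A (t : seq (Y * Y * R)) (e : R) := [set b | B b /\
  forall p, p \in t -> 0 <= p.2 <= 1 -> dfct b p <= e].
have A0 t e : 0 < e -> A t e !=set0.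
  move=> e0; apply: contrapT => hA.
  pose u := [seq p <- t | 0 <= p.2 <= 1].
  (* The sum of the convexity defects over u as one combination of values. If no member of B had
     small defects, this sum would be at least e on B, hence on Z, yet it vanishes at 0. *)
  pose f := [seq [:: (1 - p.2, p.1.1); (p.2, p.1.2); (- 1, conv p.1.1 p.1.2 p.2)] | p <- u].
  have linE b : lin (flatten f) b = \sum_(p <- u) dfct b p.
    rewrite /lin big_flatten big_map; apply: eq_bigr => p _.
    by rewrite !big_cons big_nil /dfct /= addr0 mulN1r addrA.
  have : e <= lin (flatten f) (fun=> 0).
    apply: Z0 => b Bb; have [_ cb] := NB b Bb; rewrite leNgt; apply/negP => hb.
    apply: hA; exists b; split=> // p pt p01; apply: le_trans (ltW hb).
    have pu : p \in u by rewrite mem_filter p01.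
    have d0 q : q \in u -> 0 <= dfct b q.
      by rewrite mem_filter => /andP[/(cb q.1.1 q.1.2) + _]; rewrite subr_ge0.
    rewrite linE (big_rem p pu) /= lerDl big_seq; apply: sumr_ge0 => q /mem_rem; exact: d0.
  rewrite linE big1 => [|p _]; first by move/(lt_le_trans e0); rewrite ltxx.
  by rewrite /dfct !mulr0 addr0 subrr.
pose D := [set C | exists t e, 0 < e /\ C = A t e].
have [|_ [t [e [e0 ->]]]|_ _ [t [e [e0 ->]]] [s [d [d0 ->]]]|b [Nb hb]] :=
  @lip1_cluster R Y x0 D.
- by exists (A [::] 1), [::], 1.
- by split; [exact: A0|move=> b [/NB[]]].
- exists (A (t ++ s) (Num.min e d)).
    by exists (t ++ s), (Num.min e d); rewrite lt_min e0.
  move=> b [Bb hb]; split; split => // p pt p01; have := hb p;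
    by rewrite mem_cat pt ?orbT => /(_ isT p01); rewrite le_min => /andP[].
have Bb : B b.
  apply: clB => s e e0; have [|g [Bg _] hg] := hb (A [::] 1) s e _ e0; last by exists g.
  by exists [::], 1.
exists b => // x y l l01; apply/eqP; rewrite eq_le (NB b Bb).2//=.
apply: ler_eps => e e0; have e4 : 0 < e / 4 by lra.
have [|g [_ hg] gb] := hb (A [:: (x, y, l)] (e / 4)) [:: x; y; conv x y l] _ _ e4.
  by exists [:: (x, y, l)], (e / 4).
have := hg _ (mem_head _ _) l01; rewrite /dfct /=.
have hx : `|b x - g x| < e / 4 by apply: gb; rewrite !inE eqxx ?orbT.
have hy : `|b y - g y| < e / 4 by apply: gb; rewrite !inE eqxx ?orbT.
have : `|b (conv x y l) - g (conv x y l)| < e / 4.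
  by apply: gb; rewrite !inE eqxx ?orbT.
move: hy hx; rewrite !ltr_norml => /andP[y1 y2] /andP[z1 z2] /andP[m1 m2].
have [l0 l1] := andP l01; have l1' : 0 <= 1 - l by lra.
have := ler_wpM2l l1' (ltW z2); have := ler_wpM2l l0 (ltW y2); lra.
Qed.

End minimal_action.

(** * Flows of affine functions *)

Section flows.
Context {R : realType} (Y : metricType R).
Implicit Types (c : Y -> R) (f g : Y -> Y) (x y : Y).

(* f is the time one map of the gradient flow of the affine function -c, and s
   is the squared slope of c. *)
Definition flows c (s : R) f : Prop := forall x y,
  mdist x (f y) ^+ 2 = mdist x y ^+ 2 + s + 2 * (c x - c y).

Lemma flows_dist c s f y : flows c s f -> mdist y (f y) ^+ 2 = s.
Proof. by move=> h; rewrite h mdistxx expr0n /= subrr mulr0 add0r addr0. Qed.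

Lemma flows_shift c s f y : flows c s f -> c (f y) = c y - s.
Proof.
move=> h; have := h (f y) y; rewrite mdistxx expr0n /= metric_sym (flows_dist _ h); lra.
Qed.

Lemma flows_isom c s f x y : flows c s f -> mdist (f x) (f y) = mdist x y.
Proof.
move=> h; apply/eqP; rewrite -(eqrXn2 (n := 2)) ?mdist_ge0//; apply/eqP.
rewrite (h (f x) y) metric_sym (h y x) (flows_shift _ h) (metric_sym y x); lra.
Qed.

(** Polarization: d(f y, f' x)^2 is computed in two ways. As x and y are unrelated, both sides are
    constant; up to sign this is the symmetric inner product of the gradients. *)
Lemma flows_cross c s f c' s' f' x y : flows c s f -> flows c' s' f' ->
  c (f' x) - c x = c' (f y) - c' y.
Proof.
move=> h h'; have := h (f' x) y; have := h' (f y) x.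
rewrite (metric_sym (f y) (f' x)) (metric_sym (f y)) (metric_sym (f' x) y).
by rewrite (h x y) (h' y x) (metric_sym y x); lra.
Qed.

Lemma flows_dist2 c s f c' s' f' x y : flows c s f -> flows c' s' f' ->
  mdist (f x) (f' x) = mdist (f y) (f' y).
Proof.
move=> h h'; apply/eqP; rewrite -(eqrXn2 (n := 2)) ?mdist_ge0//; apply/eqP.
rewrite (h' (f x) x) (h' (f y) y) !(metric_sym (f _)) (flows_dist x h) (flows_dist y h).
have := flows_cross x y h' h; have := flows_cross y y h' h; lra.
Qed.

Lemma flows0 : flows (fun=> 0) 0 id.
Proof. by move=> x y; rewrite subrr mulr0 !addr0. Qed.

Variable x0 : Y.

(** The new squared slope is that of a sum of gradients, the last term being twice their inner
    product. *)
Lemma flows_comp c s f c' s' f' : flows c s f -> flows c' s' f' ->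
  flows (fun x => c x + c' x) (s + s' - 2 * (c (f' x0) - c x0)) (f \o f').
Proof.
move=> h h' x y /=; rewrite h h'.
have := flows_cross y y h h'; have := flows_cross x0 y h h'; lra.
Qed.

Lemma flows_uniq c s f s' f' : flows c s f -> flows c s' f' -> s = s' /\ f = f'.
Proof.
move=> h h'; have e : s = s'.
  have := flows_cross x0 x0 h h'; rewrite (flows_shift x0 h) (flows_shift x0 h'); lra.
split=> //; apply/funext => y; apply: mdist_positivity; apply/eqP.
rewrite -sqrf_eq0 h' -e; have := h (f y) y; rewrite mdistxx expr0n /= => <-.
by rewrite eqxx.
Qed.

(** Both composites are flows of c + c'. *)
Lemma flows_comm c s f c' s' f' : flows c s f -> flows c' s' f' -> f \o f' = f' \o f.
Proof.
move=> h h'; have := flows_comp h' h.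
rewrite (_ : (fun x => c' x + c x) = fun x => c x + c' x); last first.
  by apply/funext => x; rewrite addrC.
by move=> h2; have [_] := flows_uniq (flows_comp h h') h2.
Qed.

Lemma flows_conj c s f (g g' : isometry Y) : (forall x, g (g' x) = x) ->
  flows c s f -> flows (fun x => c (g x)) s (fun x => g' (f (g x))).
Proof. by move=> gg' h x y; rewrite -(isom_dist g) gg' h isom_dist. Qed.

Lemma flows_inv c s f g : (forall y, f (g y) = y) -> flows c s f ->
  flows (fun x => - c x) s g.
Proof.
move=> fg h x y; have := h x (g y); rewrite fg; have := flows_shift (g y) h.
rewrite fg; lra.
Qed.

Hypothesis hY : cat0 Y.

(** All real multiples are included, negative ones too, so that flowable functions form a vector
    space of affine functions. *)
Definition flowable c : Prop := forall t : R, exists s f, flows (fun x => t * c x) s f.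

(** The Bruhat-Tits inequality for m on [x, y], tested at the image of m under the flow, loses all
    its quadratic terms and becomes convexity of t c; the cases t = 1 and t = -1 give equality. *)
Lemma flowable_affine c : flowable c -> affine_fun c.
Proof.
move=> hc; suff le (t : R) x y l : 0 <= l <= 1 ->
    t * c (conv x y l) <= t * ((1 - l) * c x + l * c y).
  move=> x y l l01; apply/le_anti; have := le 1 x y l l01; have := le (- 1) x y l l01.
  by rewrite !mulN1r !mul1r lerN2 => -> ->.
move=> l01; have [s [f h]] := hc t; set m := conv x y l.
have := convP hY x y l01 (f m); rewrite -/m !(metric_sym (f m)).
rewrite (flows_dist m h) (h x m) (h y m) (conv_distl hY)// (metric_sym y m).
rewrite (conv_distr hY)// => hs.
have : (1 - l) * (l * mdist x y) ^+ 2 + l * ((1 - l) * mdist x y) ^+ 2 =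
  l * (1 - l) * mdist x y ^+ 2 by ring.
lra.
Qed.

Lemma flowableD c c' : flowable c -> flowable c' -> flowable (fun x => c x + c' x).
Proof.
move=> h h' t; have [s [f hf]] := h t; have [s' [f' hf']] := h' t.
exists (s + s' - 2 * (t * c (f' x0) - t * c x0)), (f \o f').
by under eq_fun do rewrite mulrDr; exact: flows_comp.
Qed.

Lemma flowableZ (k : R) c : flowable c -> flowable (fun x => k * c x).
Proof.
by move=> h t; have [s [f hf]] := h (t * k); exists s, f; under eq_fun do rewrite mulrA.
Qed.

Lemma flowable0 : flowable (fun=> 0).
Proof. by move=> t; exists 0, id; under eq_fun do rewrite mulr0; exact: flows0. Qed.

Lemma flowable_sum n (v : 'I_n -> R) (b : 'I_n -> Y -> R) :
  (forall i, flowable (b i)) -> flowable (fun x => \sum_i v i * b i x).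
Proof.
move=> hb; pose S (s : seq 'I_n) x := \sum_(i <- s) v i * b i x.
suff h s : flowable (S s).
  by have := h (index_enum 'I_n); rewrite /S.
elim: s => [|i s IHs].
  by rewrite (_ : S [::] = fun=> 0); [exact: flowable0|apply/funext => x; rewrite /S big_nil].
rewrite (_ : S _ = fun x => v i * b i x + S s x); last first.
  by apply/funext => x; rewrite /S big_cons.
by apply: flowableD => //; apply: flowableZ.
Qed.

Lemma flowable_isom c (g : isometry Y) : flowable c -> flowable (fun x => c (g x)).
Proof.
move=> h t; have [s [f hf]] := h t; exists s, (fun x => isom_inv g (f (g x))).
by apply: (flows_conj (g' := isom_inv g) _ hf) => x; exact: isom_invK.
Qed.

Definition flow c : Y -> Y :=
  xget (fun x : Y => x) [set f : Y -> Y | exists s, flows c s f].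

(** The inner product of the gradients of c and c'. On flowable functions it is symmetric and does
    not depend on the base point. *)
Definition slope c c' : R := c x0 - c (flow c' x0).

Lemma flow_flows c : flowable c -> flows c (slope c c) (flow c).
Proof.
move=> h; have [s [f]] := h 1; under eq_fun do rewrite mul1r; move=> hf.
have : [set f : Y -> Y | exists s, flows c s f] (flow c).
  by apply: xgetPex; exists f, s.
move=> [s' hs']; suff -> : slope c c = s' by [].
by rewrite /slope (flows_shift x0 hs'); lra.
Qed.

Lemma flowP c x y : flowable c ->
  mdist x (flow c y) ^+ 2 = mdist x y ^+ 2 + slope c c + 2 * (c x - c y).
Proof. by move=> /flow_flows; apply. Qed.

Lemma flow_shift c c' x : flowable c -> flowable c' -> c (flow c' x) = c x - slope c c'.
Proof.
move=> /flow_flows h /flow_flows h'; rewrite /slope.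
have := flows_cross x x0 h h'; have := flows_cross x0 x0 h h'; lra.
Qed.

Lemma slopeC c c' : flowable c -> flowable c' -> slope c c' = slope c' c.
Proof.
move=> /flow_flows h /flow_flows h'; rewrite /slope.
have := flows_cross x0 x0 h h'; lra.
Qed.

Lemma slope_ge0 c : flowable c -> 0 <= slope c c.
Proof. by move=> /flow_flows/(flows_dist x0) <-; exact: sqr_ge0. Qed.

Lemma slope_eq0 c : flowable c -> slope c c = 0 -> forall x y, c x = c y.
Proof.
move=> h h0; have fy y : flow c y = y.
  apply/esym/mdist_positivity/eqP; rewrite -sqrf_eq0.
  by rewrite (flows_dist y (flow_flows h)) h0.
by move=> x y; have := flowP x y h; rewrite fy h0; lra.
Qed.

Lemma slopeD c c' d : slope (fun x => c x + c' x) d = slope c d + slope c' d.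
Proof. by rewrite /slope; ring. Qed.

Lemma slopeZ (k : R) c d : slope (fun x => k * c x) d = k * slope c d.
Proof. by rewrite /slope; ring. Qed.

Lemma slope_sum n (v : 'I_n -> R) (b : 'I_n -> Y -> R) d :
  slope (fun x => \sum_i v i * b i x) d = \sum_i v i * slope (b i) d.
Proof. by rewrite /slope -sumrB; apply: eq_bigr => i _; rewrite mulrBr. Qed.

Lemma flow_isom c (g : isometry Y) x : flowable c ->
  g (flow (fun x => c (g x)) x) = flow c (g x).
Proof.
move=> h; have hg := flowable_isom g h.
have h2 := flows_conj (g' := isom_inv g) (@isom_invK _ _ g) (flow_flows h).
have [_ ->] := flows_uniq (flow_flows hg) h2.
by rewrite isom_invK.
Qed.

Lemma slope_isom c c' (g : isometry Y) : flowable c -> flowable c' ->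
  slope (fun x => c (g x)) (fun x => c' (g x)) = slope c c'.
Proof. by move=> h h'; rewrite {1}/slope flow_isom// flow_shift//; ring. Qed.

End flows.

(** * Surjectivity of flows on a minimal set *)

Section flows_surjective.
Context {R : realType} {G : topologicalGroupType} (H : set G).
Variables (Y : metricType R) (hY : cat0 Y) (cY : seq_complete Y) (x0 : Y).
Hypothesis bY : bounded_geometry Y.
Variable (al : G -> isometry Y).
Hypothesis sH : is_subgroup H.
Hypothesis hal : isom_action H al.
Hypothesis minY : forall D, invariant_convex H al D -> D = setT.

Let is_flow (M : R) (f : Y -> Y) : Prop := exists c s, flows c s f /\ s <= M.

Let is_flow_id M : 0 <= M -> is_flow M id.
Proof. by move=> M0; exists (fun=> 0), 0; split=> //; exact: flows0. Qed.

(* The composite of a finite net of flows maps x0 into the image of each of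
   them. *)
Let common_image M (e : R) : 0 <= M -> 0 < e ->
  exists y, forall f, is_flow M f -> exists z, mdist y (f z) < e.
Proof.
move=> M0 e0; have e2 : 0 < e / 2 by lra.
have [t ht] := bounded_geometry_net x0 (M + 1) bY e2.
pose F p : Y -> Y := xget (fun x : Y => x) [set f : Y -> Y | is_flow M f /\ mdist p (f x0) < e / 2].
have Ff p : is_flow M (F p).
  by rewrite /F; case: xgetP => [f _ [] //|_]; exact: is_flow_id.
have Fd p f : is_flow M f -> mdist p (f x0) < e / 2 ->
    mdist p (F p x0) < e / 2.
  move=> hf pf; suff [] : [set f : Y -> Y | is_flow M f /\ mdist p (f x0) < e / 2] (F p) by [].
  by apply: xgetPex; exists f.
pose y := foldr (fun p z => F p z) x0 t.
have yF p : p \in t -> exists z, y = F p z.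
  rewrite /y; elim: (t) => [//|q u IHu]; rewrite inE => /predU1P[->|/IHu[z hz]] /=.
    by exists (foldr (fun p z => F p z) x0 u).
  exists (F q z); rewrite hz.
  have [c [s [hp _]]] := Ff p; have [c' [s' [hq _]]] := Ff q.
  exact: (congr1 (fun k => k z) (flows_comm x0 hq hp)).
exists y => f ff; have [c [s [hf sM]]] := ff.
have xf : mdist x0 (f x0) <= M + 1.
  apply: ler_of_sqr; first by lra.
  rewrite (flows_dist _ hf) sqrrD expr1n mulr1; have := sqr_ge0 M; lra.
have [p pt pf] := ht _ xf; have [z yz] := yF p pt; exists z.
have [c' [s' [hp _]]] := Ff p.
rewrite yz (flows_dist2 z x0 hp hf); have := Fd p f ff pf.
have := metric_triangle (F p x0) p (f x0); rewrite (metric_sym (F p x0) p); lra.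
Qed.

Lemma flows_surj (c : Y -> R) (s : R) (f : Y -> Y) y : flows c s f -> exists z, f z = y.
Proof.
move=> hf; have s0 : 0 <= s by rewrite -(flows_dist y hf) sqr_ge0.
(* The points within e of the images of all flows of squared slope at most s: a single f would not
   give an invariant set, since H conjugates flows into one another. Asking for every e' > e makes
   the set closed. By minimality each image is dense, and it is complete because flows are
   isometric. *)
pose D (e : R) := [set y | forall f, is_flow s f -> forall e', e < e' ->
  exists z, mdist y (f z) < e'].
have DT e : 0 < e -> D e = setT.
  move=> e0; apply: minY; split.
  - have [u hu] := common_image s0 e0; exists u => g hg e' ee'.
    by have [z hz] := hu g hg; exists z; exact: lt_trans ee'.
  - apply/closedE_mdist => u hu g hg e' ee'; have d0 : 0 < (e' - e) / 2 by lra.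
    have [v Dv uv] := hu _ d0; have [|z hz] := Dv g hg ((e + e') / 2); first by lra.
    exists z; have := metric_triangle u v (g z); lra.
  - move=> u v l Du Dv l01 g hg e' ee'; have [z hz] := Du g hg e' ee'.
    have [w hw] := Dv g hg e' ee'; exists (conv z w l).
    have [c' [s' [hg' _]]] := hg.
    rewrite (isom_conv z w hY hY (fun x y => flows_isom x y hg') l01).
    apply: le_lt_trans (conv_convex hY _ _ _ _ l01) _.
    have [l0 l1] := andP l01; have [->|l1'] := eqVneq l 1.
      by rewrite subrr mul0r mul1r add0r.
    have l2 : 0 < 1 - l by rewrite subr_gt0 lt_neqAle l1'.
    have := ltr_pM2l l2 (mdist u (g z)) e'; rewrite hz.
    have := ler_wpM2l l0 (ltW hw); move=> ? /idP; lra.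
  - move=> h u Hh Du g [c' [s' [hg s's]]] e' ee'.
    have [|z hz] := Du (fun x => al h^-1%g (g (al h x))) _ e' ee'.
      exists (fun x => c' (al h x)), s'; split=> //.
      by apply: flows_conj hg => x; exact: isom_actVK sH hal _ _ _.
    exists (al h z); move: hz; rewrite -(isom_dist (al h)).
    by rewrite (isom_actVK sH hal).
have hz e : 0 < e -> exists z, mdist y (f z) < e.
  move=> e0; have e2 : 0 < e / 2 by lra.
  have : D (e / 2) y by rewrite DT.
  apply; [by exists c, s|lra].
have [u hu] : exists u : nat -> Y, forall n, mdist y (f (u n)) < n.+1%:R^-1.
  suff /choice : forall n : nat, exists z, mdist y (f z) < n.+1%:R^-1.
    by move=> [u hu]; exists u.
  by move=> n; apply: hz; rewrite invr_gt0.
have small (e : R) : 0 < e -> exists N, forall n, (N <= n)%N -> n.+1%:R^-1 < e.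
  move=> e0; exists (Num.truncn e^-1) => n h.
  rewrite invf_plt ?posrE//; apply: lt_le_trans (truncnS_gt _) _.
  by rewrite ler_nat.
have uC : cauchy_seq u.
  move=> e e0; have e2 : 0 < e / 2 by lra.
  have [N hN] := small _ e2; exists N => m n Nm Nn.
  rewrite -(flows_isom _ _ hf); have := lt_trans (hu m) (hN m Nm).
  have := lt_trans (hu n) (hN n Nn).
  by have := metric_triangle (f (u m)) y (f (u n)); rewrite (metric_sym (f (u m)) y); lra.
have [z /cvg_mdistP uz] := cY uC; exists z; apply: mdist_positivity.
apply/le_anti; rewrite mdist_ge0 andbT; apply: ler_eps => e e0; rewrite add0r.
have e2 : 0 < e / 2 by lra.
have [N hN] := small _ e2; have [N' hN'] := uz _ e2; pose n := maxn N N'.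
have := hN' n (leq_maxr _ _); rewrite -(flows_isom _ _ hf) => h1.
have := lt_trans (hu n) (hN n (leq_maxl _ _)) => h2.
have := metric_triangle (f z) (f (u n)) y.
by rewrite (metric_sym (f z) (f (u n))) (metric_sym (f (u n)) y); lra.
Qed.

(** Nonnegative times come from [affine_horo_flow]; negative times invert these flows, which
    requires their surjectivity. *)
Lemma affine_horofunction_flowable S (b : Y -> R) : horofunction x0 S b -> affine_fun b ->
  flowable b /\ slope x0 b b = 1.
Proof.
move=> hb ab.
have pos (t : R) : 0 <= t -> exists f, flows (fun x => t * b x) (t ^+ 2) f.
  move=> t0; have [f hf] : exists f : Y -> Y, forall y x,
      mdist x (f y) ^+ 2 = mdist x y ^+ 2 + t ^+ 2 + 2 * t * (b x - b y).
    suff /choice : forall y, exists y', forall x,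
        mdist x y' ^+ 2 = mdist x y ^+ 2 + t ^+ 2 + 2 * t * (b x - b y).
      by move=> [f hf]; exists f.
    by move=> y; exact: (affine_horo_flow hY cY bY hb ab y t0).
  by exists f => x y; rewrite hf; ring.
have fb : flowable b.
  move=> t; have [t0|t0] := leP 0 t; first by have [f] := pos t t0; exists (t ^+ 2), f.
  have [|f hf] := pos (- t); first by lra.
  have [g hg] : exists g : Y -> Y, forall y, f (g y) = y.
    suff /choice : forall y, exists z, f z = y by move=> [g hg]; exists g.
    by move=> y; exact: flows_surj hf.
  exists ((- t) ^+ 2), g; have := flows_inv hg hf.
  by under eq_fun do rewrite mulNr opprK.
split=> //; have [f hf] := pos 1 ler01.
have hf' : flows b (1 ^+ 2) f.
  by move: hf; under eq_fun do rewrite mul1r.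
by have [-> _] := flows_uniq x0 (flow_flows x0 fb) hf'; rewrite expr1n.
Qed.

End flows_surjective.

(** * The minimal set is Euclidean *)

Section euclidean_norm.
Context {R : realType} {n : nat}.
Implicit Types (u v : 'cV[R]_n) (A : 'M[R]_n).

Definition nsq u : R := \sum_i u i 0 ^+ 2.

Lemma nsqE u : nsq u = (u^T *m u) 0 0.
Proof. by rewrite mxE; apply: eq_bigr => i _; rewrite mxE expr2. Qed.

Lemma nsq_orthogonal A u : A^T *m A = 1%:M -> nsq (A *m u) = nsq u.
Proof.
by move=> h; rewrite !nsqE trmx_mul -mulmxA (mulmxA A^T) h mul1mx.
Qed.

End euclidean_norm.

Section flat.
Context {R : realType} {G : topologicalGroupType} (H : set G).
Variables (Y : metricType R) (hY : cat0 Y) (cY : seq_complete Y) (x0 : Y).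
Hypothesis bY : bounded_geometry Y.
Variable (al : G -> isometry Y).
Hypothesis amH : amenable_subgroup R H.
Hypothesis hal : isom_action H al.
Hypothesis noxi : ~ exists xi, forall h, H h -> boundary_map (al h) xi = xi.
Hypothesis minY : forall D, invariant_convex H al D -> D = setT.

Let sH : is_subgroup H. Proof. by case: amH. Qed.

Let ip := slope x0.

Definition orthonormal n (b : 'I_n -> Y -> R) : Prop :=
  (forall i, flowable (b i)) /\ forall i j, slope x0 (b i) (b j) = (i == j)%:R.

Let orthonormal_orthoframe n (b : 'I_n -> Y -> R) m : orthonormal b -> (m <= n)%N ->
  orthoframe Y m.
Proof.
move=> [fb ob] mn e e0; exists x0, [seq flow (b i) x0 | i <- take m (enum 'I_n)].
have d1 i : mdist x0 (flow (b i) x0) = 1.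
  apply/eqP; rewrite -(eqrXn2 (n := 2)) ?mdist_ge0 ?ler01//; apply/eqP.
  by rewrite (flows_dist x0 (flow_flows x0 (fb i))) ob eqxx expr1n.
split.
- by rewrite size_map size_take size_enum_ord; case: ltngtP mn.
- by rewrite all_map; apply/allP => i _ /=; rewrite d1 subrr normr0.
rewrite pairwise_map; have : uniq (take m (enum 'I_n)) by rewrite take_uniq ?enum_uniq.
rewrite uniq_pairwise; apply: sub_pairwise => i j /= ij.
rewrite (flowP x0 _ _ (fb j)) (metric_sym _ x0) d1 (flow_shift x0 _ (fb j) (fb i)).
by rewrite !ob eqxx (eq_sym j) (negbTE ij) expr1n /=; lra.
Qed.

Let max_orthonormal : exists n (b : 'I_n -> Y -> R), orthonormal b /\
  forall b' : 'I_n.+1 -> Y -> R, ~ orthonormal b'.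
Proof.
have [M hM] := orthoframe_bound bY.
pose P n := `[< exists b : 'I_n -> Y -> R, orthonormal b >].
have P0 : exists n, P n.
  exists 0%N; apply/asboolP; exists (fun=> fun=> 0).
  by split => -[].
have PM n : P n -> (n <= M)%N.
  move=> /asboolP[b ob]; rewrite leqNgt; apply/negP => Mn; apply: hM.
  exact: orthonormal_orthoframe ob (ltnW Mn).
case: (ex_maxnP P0 PM) => n /asboolP[b ob] hn; exists n, b; split => // b' ob'.
by have := hn n.+1 (asboolT (ex_intro _ b' ob')); rewrite ltnn.
Qed.

Section basis.
Variables (n : nat) (b : 'I_n -> Y -> R).
Hypothesis ob : orthonormal b.
Hypothesis mb : forall b' : 'I_n.+1 -> Y -> R, ~ orthonormal b'.

Let fb i : flowable (b i). Proof. by case: ob. Qed.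

(** Gram-Schmidt: a nonconstant component of c orthogonal to b could be normalized and added to b,
    against its maximality. *)
Let expand c x y : flowable c ->
  c x - c y = \sum_i ip c (b i) * (b i x - b i y).
Proof.
move=> fc; pose c' x := c x + \sum_i - ip c (b i) * b i x.
have fc' : flowable c' by apply: (flowableD x0) => //; exact: (flowable_sum x0).
have c'b j : ip c' (b j) = 0.
  rewrite /ip slopeD slope_sum (bigD1 j)//= big1 => [|i ij].
    by case: ob => _ ->; rewrite eqxx mulr1 addr0 subrr.
  by case: ob => _ ->; rewrite (negbTE ij) mulr0.
have [c'0|c'n0] := eqVneq (ip c' c') 0.
  have := slope_eq0 fc' c'0 x y; rewrite /c'.
  have -> : \sum_i ip c (b i) * (b i x - b i y) =
      \sum_i - ip c (b i) * b i y - \sum_i - ip c (b i) * b i x.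
    by rewrite -sumrB; apply: eq_bigr => i _; ring.
  lra.
have c'p : 0 < ip c' c' by rewrite lt_neqAle eq_sym c'n0; exact: slope_ge0.
pose k := (Num.sqrt (ip c' c'))^-1.
have kk : k * (k * ip c' c') = 1.
  rewrite /k -[X in _ * (_ * X)](sqr_sqrtr (ltW c'p)).
  have w0 : Num.sqrt (ip c' c') != 0 by rewrite sqrtr_eq0 -ltNge.
  by move: (Num.sqrt _) w0 => w w0; field.
pose b' (i : 'I_n.+1) : Y -> R :=
  if unlift ord0 i is Some j then b j else fun x => k * c' x.
have fk : flowable (fun x => k * c' x) by exact: flowableZ.
case: (mb (b' := b')); split.
  by move=> i; rewrite /b'; case: unliftP.
have skb j : slope x0 (fun x => k * c' x) (b j) = 0 by rewrite slopeZ -/ip c'b mulr0.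
move=> i j; rewrite /b'; case: unliftP => [i' ->|->]; case: unliftP => [j' ->|->].
- by case: ob => _ ->; rewrite (inj_eq lift_inj).
- by rewrite slopeC// skb eq_sym (negbTE (neq_lift _ _)).
- by rewrite skb (negbTE (neq_lift _ _)).
- by rewrite slopeZ slopeC// slopeZ kk eqxx.
Qed.

Let lin (v : 'I_n -> R) x := \sum_i v i * b i x.

Let flin v : flowable (lin v). Proof. exact: (flowable_sum x0). Qed.

Let ip_lin v i : ip (b i) (lin v) = v i.
Proof.
rewrite /ip slopeC// slope_sum (bigD1 i)//= big1 => [|j ji].
  by case: ob => _ ->; rewrite eqxx mulr1 addr0.
by case: ob => _ ->; rewrite (negbTE ji) mulr0.
Qed.

Let b_flow v i x : b i (flow (lin v) x) = b i x - v i.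
Proof. by rewrite (flow_shift x0 _ (fb i) (flin v)) -[slope x0 _ _]/(ip _ _) ip_lin. Qed.

Let d_flow v x y : mdist x (flow (lin v) y) ^+ 2 =
  mdist x y ^+ 2 + \sum_i (v i ^+ 2 + 2 * v i * (b i x - b i y)).
Proof.
rewrite (flowP x0 _ _ (flin v)) slope_sum -addrA; congr (_ + _).
under eq_bigr do rewrite [slope _ _ _]ip_lin.
rewrite /lin -sumrB mulr_sumr -big_split; apply: eq_bigr => i _ /=; ring.
Qed.

(* The squared distance between the projections to the fibre orthogonal to b. *)
Let dP x y : R := mdist x y ^+ 2 - \sum_i (b i x - b i y) ^+ 2.

Let dP_flow v x y : dP x (flow (lin v) y) = dP x y.
Proof.
rewrite /dP d_flow -addrA; congr (_ + _); rewrite -sumrB -sumrN; apply: eq_bigr => i _.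
by rewrite b_flow; ring.
Qed.

Let dPC x y : dP x y = dP y x.
Proof.
by rewrite /dP metric_sym; congr (_ - _); apply: eq_bigr => i _; ring.
Qed.

(** Flowing y into the fibre of x leaves [dP] unchanged, so [dP] is a squared distance between
    points of one fibre and in particular nonnegative. *)
Let fibre x y : exists2 y', forall i, b i y' = b i x &
  dP x y = mdist x y' ^+ 2 /\ forall z, dP z y' = dP z y.
Proof.
exists (flow (lin (fun i => b i y - b i x)) y) => [i|]; first by rewrite b_flow; ring.
split=> [|z]; last exact: dP_flow.
rewrite -(dP_flow (fun i => b i y - b i x)) /dP big1 ?subr0// => i _.
by rewrite b_flow; ring.
Qed.

Let dP_ge0 x y : 0 <= dP x y.
Proof. by have [y' _ [-> _]] := fibre x y; exact: sqr_ge0. Qed.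

Let coords_surj (v : 'I_n -> R) : exists y, forall i, b i y = v i.
Proof.
by exists (flow (lin (fun i => b i x0 - v i)) x0) => i; rewrite b_flow; ring.
Qed.

(** The composites of the b i with [al h] are flowable, so they expand in b; orthogonality holds
    because isometries preserve [slope]. *)
Let linear_part h : H h -> exists A : 'M[R]_n, A^T *m A = 1%:M /\
  forall x y i, b i (al h x) - b i (al h y) = \sum_j A i j * (b j x - b j y).
Proof.
move=> Hh; pose c i x := b i (al h x).
have fc i : flowable (c i) by exact: flowable_isom.
exists (\matrix_(i, j) ip (c i) (b j)); split; last first.
  move=> x y i; rewrite (expand x y (fc i)); apply: eq_bigr => j _.
  by rewrite mxE.
apply: mulmx1C; apply/matrixP => i k; rewrite !mxE.
have := slope_isom x0 (al h) (fb i) (fb k); case: ob => _ -> <-.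
have -> : slope x0 (fun x => b i (al h x)) (fun x => b k (al h x)) =
  \sum_j ip (c i) (b j) * ip (b j) (c k) by exact: (expand _ _ (fc i)).
apply: eq_bigr => j _; rewrite !mxE; congr (_ * _).
by rewrite /ip (slopeC x0 (fc k) (fb j)).
Qed.

Let dP_isom h x y : H h -> dP (al h x) (al h y) = dP x y.
Proof.
move=> Hh; have [A [oA hA]] := linear_part Hh; rewrite /dP isom_dist; congr (_ - _).
pose u : 'cV[R]_n := \col_j (b j x - b j y).
transitivity (nsq (A *m u)).
  apply: eq_bigr => i _; rewrite hA mxE; congr (_ ^+ 2).
  by apply: eq_bigr => j _; rewrite mxE.
by rewrite nsq_orthogonal//; apply: eq_bigr => i _; rewrite mxE.
Qed.

Let dP_mid x y z l : 0 <= l <= 1 ->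
  dP (conv x y l) z <= (1 - l) * dP x z + l * dP y z - l * (1 - l) * dP x y.
Proof.
move=> l01; have := convP hY x y l01 z; rewrite !(metric_sym z) /dP => hs.
have E : \sum_i (b i (conv x y l) - b i z) ^+ 2 =
    (1 - l) * (\sum_i (b i x - b i z) ^+ 2) + l * (\sum_i (b i y - b i z) ^+ 2)
    - l * (1 - l) * (\sum_i (b i x - b i y) ^+ 2).
  rewrite !mulr_sumr -sumrN -!big_split; apply: eq_bigr => i _ /=.
  by rewrite (flowable_affine hY (fb i) x y l01); ring.
by rewrite E; lra.
Qed.

(* Horofunctions centred in an unbounded fibre are invariant under all flows; an
   affine one among them would generate a flow that shifts it. *)
Let fibre_bounded : exists K : R, forall p, (forall i, b i p = b i x0) -> mdist x0 p < K.
Proof.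
pose S p := forall i, b i p = b i x0.
apply: contrapT => hS.
have {}hS (K : R) : exists2 p, S p & K <= mdist x0 p.
  apply: contrapT => h; apply: hS; exists K => p Sp; rewrite ltNge; apply/negP => Kp.
  by apply: h; exists p.
pose B : set (Y -> R) := [set f | horofunction x0 setT f /\ forall c x, flowable c -> f (flow c x) = f x].
have [||f [hf _]|f h Hh [hf fI]|f [hf fI] af] :=
  affine_member hY cY amH hal noxi minY (x0 := x0) (B := B).
- have [f [Nf hf]] := horofunction_exists hS; exists f; split.
    split=> // s e K e0; have [p [_ Kp hp]] := hf s e K e0; by exists p.
  move=> c x fc; apply/eqP; rewrite -subr_eq0 -normr_eq0 eq_le normr_ge0 andbT.
  apply: ler_eps => e e0; rewrite add0r; have e3 : 0 < e / 3 by lra.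
  pose D := ip c c + 2 * (c x0 - c x).
  have [p [Sp Kp hp]] := hf [:: x; flow c x] _ (`|D| * 3 / e + 1 + mdist x0 x) e3.
  have cp : c p = c x0.
    apply/eqP; rewrite -subr_eq0 (expand _ _ fc); apply/eqP; apply: big1 => i _.
    by rewrite Sp subrr mulr0.
  have hx : `|f x - (mdist x p - mdist x0 p)| < e / 3 by apply: hp; rewrite !inE eqxx.
  have : `|f (flow c x) - (mdist (flow c x) p - mdist x0 p)| < e / 3.
    by apply: hp; rewrite !inE eqxx orbT.
  have xp : `|D| * 3 / e + 1 <= mdist x p by have := metric_triangle x0 x p; lra.
  have De : `|D| * 3 / e * (e / 3) = `|D| by field; exact: lt0r_neq0.
  have D0 : 0 <= `|D| * 3 / e by rewrite divr_ge0 ?mulr_ge0// ltW.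
  have E := flowP x0 p x fc; rewrite cp -/D -/(ip c c) -addrA -/D in E.
  have : `|mdist (flow c x) p - mdist x p| <= e / 3.
    rewrite (metric_sym _ p) (metric_sym x p); rewrite (metric_sym x p) in xp.
    move: E xp (mdist_ge0 p (flow c x)); move: (mdist p x) (mdist p (flow c x)) => u v E xp v0.
    have uv : (v - u) * (v + u) = D by rewrite -subr_sqr E; ring.
    have uv0 : 0 < v + u by lra.
    rewrite -(ler_pM2r uv0) -{1}(gtr0_norm uv0) -normrM uv -De mulrC.
    by apply: ler_wpM2l; lra.
  move: hx; move: (f x) (f (flow c x)) (mdist x p) (mdist (flow c x) p) => u v w z.
  rewrite !ltr_norml !ler_norml => /andP[? ?] /andP[? ?] /andP[? ?].
  by apply/andP; split; lra.
- move=> f hf; split.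
    by apply: horofunction_closed => s e /(hf s)[g [hg _] gf]; exists g.
  move=> c x fc; apply/eqP; rewrite -subr_eq0 -normr_eq0 eq_le normr_ge0 andbT.
  apply: ler_eps => e e0; rewrite add0r; have e2 : 0 < e / 2 by lra.
  have [g [_ gI] gf] := hf [:: x; flow c x] _ e2.
  have hx : `|f x - g x| < e / 2 by apply: gf; rewrite !inE eqxx.
  have : `|f (flow c x) - g (flow c x)| < e / 2 by apply: gf; rewrite !inE eqxx orbT.
  rewrite gI//; move: hx; move: (f x) (f (flow c x)) (g x) => u v w.
  rewrite !ltr_norml !ler_norml => /andP[? ?] /andP[? ?].
  by apply/andP; split; lra.
- by split; [case: hf|exact: horofunction_convex hf].
- split; first exact: horofunction_isom (al h) hf.
  move=> c x fc; congr (_ - _).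
  have hK y : isom_inv (al h) (al h y) = y by apply: (@isom_inj _ _ (al h)); rewrite isom_invK.
  have := flow_isom x0 (al h) x (flowable_isom (isom_inv (al h)) fc).
  have -> : (fun y => c (isom_inv (al h) (al h y))) = c by apply/funext => y; rewrite hK.
  move=> ->; apply: fI; exact: flowable_isom.
- have [ff f1] := affine_horofunction_flowable hY cY bY sH hal minY hf af.
  have := flow_shift x0 x0 ff ff; rewrite fI// f1; lra.
Qed.

Let dP_bounded : exists2 K : R, 0 <= K & forall x y, dP x y <= K.
Proof.
have [K hK] := fibre_bounded; have K0 : 0 <= K.
  by have := hK x0 (fun=> erefl); rewrite mdistxx; exact: ltW.
exists ((2 * K) ^+ 2) => [|x y]; first exact: sqr_ge0.
have [x' x'b [_ hx']] := fibre x0 x; have [y' y'b [_ hy']] := fibre x0 y.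
rewrite -hy' dPC -hx' /dP lerBlDr.
apply: (@le_trans _ _ ((2 * K) ^+ 2)); last by rewrite lerDl sumr_ge0// => i _; exact: sqr_ge0.
rewrite ler_sqr ?nnegrE ?mdist_ge0 ?mulr_ge0//.
have := hK x' x'b; have := hK y' y'b; have := metric_triangle y' x0 x'.
rewrite (metric_sym y' x0); lra.
Qed.

(** If the supremum E of [dP] were positive, the midpoint of a pair with [dP] above E / 2 would have
    [dP] at most E - E / 8 to all points. Such points form a closed convex invariant set, which by
    minimality is Y, contradicting the choice of E. *)
Let dP_eq0 x y : dP x y = 0.
Proof.
have [K K0 hK] := dP_bounded.
pose E := [set r | exists x y, r = dP x y].
have hE : has_sup E.
  split; first by exists (dP x y), x, y.
  by exists K => _ [u [v ->]].
have ub u v : dP u v <= sup E by apply: ub_le_sup; [case: hE|exists u, v].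
suff : sup E <= 0 by move=> h; apply/le_anti; rewrite dP_ge0 andbT; exact: le_trans (ub x y) h.
rewrite leNgt; apply/negP => s0; have s2 : 0 < sup E / 2 by lra.
have [_ [u [v ->]] huv] := sup_adherent s2 hE.
pose D := [set z | forall w, dP z w <= 7 / 8 * sup E].
have DT : D = setT.
  apply: minY; split.
  - exists (conv u v 2^-1) => w; have h01 : 0 <= (2^-1 : R) <= 1 by lra.
    have := dP_mid u v w h01; have := ub u w; have := ub v w; lra.
  - rewrite (_ : D = \bigcap_w [set z | dP z w <= 7 / 8 * sup E]).
      apply: closed_bigI => w _; apply/closedE_mdist => z hz /=.
      apply: ler_eps => e e0; have e2 : 0 < e / 2 by lra.
      have [w' w'b [-> hw']] := fibre z w.
      have [d d0 hd] := sqr_cont (mdist_ge0 z w') e2.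
      pose d' := Num.min d (Num.min 1 (e / 2)).
      have d'0 : 0 < d' by rewrite !lt_min d0 ltr01.
      have [d1 d2 d3] : [/\ d' <= d, d' <= 1 & d' <= e / 2].
        by rewrite /d' !ge_min !lexx !orbT.
      have [z' /= hz' zz'] := hz _ d'0.
      have [|_ hzw] := hd (mdist z' w') (mdist_ge0 _ _).
        apply: le_trans (mdist_diff_le _ _ _ _) _.
        by rewrite mdistxx addr0 metric_sym; lra.
      have sq : mdist z z' ^+ 2 <= e / 2.
        apply: (@le_trans _ _ (d' ^+ 2)).
          by rewrite ler_sqr ?nnegrE ?mdist_ge0//; exact: ltW.
        rewrite expr2; apply: le_trans d3; rewrite ler_piMl//; exact: ltW.
      have E1 : mdist z' w' ^+ 2 = dP z' w + \sum_i (b i z - b i z') ^+ 2.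
        rewrite -hw' /dP (_ : \sum_i (b i z - b i z') ^+ 2 =
          \sum_i (b i z' - b i w') ^+ 2) ?subrK//.
        by apply: eq_bigr => i _; rewrite w'b; ring.
      have := dP_ge0 z z'; rewrite {1}/dP => E2.
      by move: E1 E2; set S := \sum_i _; lra.
    by apply/seteqP; split => [z Dz w _|z Dz w]; exact: Dz.
  - move=> p q l Dp Dq l01 w; have := dP_mid p q w l01.
    have [l0 l1] := andP l01; have l1' : 0 <= 1 - l by lra.
    have := ler_wpM2l l1' (Dp w); have := ler_wpM2l l0 (Dq w).
    have : 0 <= l * (1 - l) * dP p q by rewrite !mulr_ge0.
    lra.
  - move=> h p Hh Dp w; have [q <-] := isom_surj (al h) w.
    by rewrite dP_isom.
have : sup E <= 7 / 8 * sup E.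
  apply: ge_sup; first by exists (dP x y), x, y.
  by move=> _ [p [q ->]]; have : D p by rewrite DT.
lra.
Qed.

Lemma basis_flat : [/\ forall x y, mdist x y ^+ 2 = \sum_i (b i x - b i y) ^+ 2,
  forall v : 'I_n -> R, exists y, forall i, b i y = v i &
  forall h, H h -> exists A : 'M[R]_n, A^T *m A = 1%:M /\
  forall x y i, b i (al h x) - b i (al h y) = \sum_j A i j * (b j x - b j y)].
Proof.
split; [|exact: coords_surj|exact: linear_part].
by move=> x y; have /eqP := dP_eq0 x y; rewrite subr_eq0 => /eqP.
Qed.

End basis.

Lemma minimal_flat : exists n (b : 'I_n -> Y -> R),
  [/\ forall x y, mdist x y ^+ 2 = \sum_i (b i x - b i y) ^+ 2,
  forall v : 'I_n -> R, exists y, forall i, b i y = v i &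
  forall h, H h -> exists A : 'M[R]_n, A^T *m A = 1%:M /\
  forall x y i, b i (al h x) - b i (al h y) = \sum_j A i j * (b j x - b j y)].
Proof.
by have [n [b [ob mb]]] := max_orthonormal; exists n, b; exact: basis_flat.
Qed.

End flat.

(** * Matrices close to the identity *)

Section l1_norm.
Context {R : realType}.

Definition mxn {m n} (A : 'M[R]_(m, n)) : R := \sum_i \sum_j `|A i j|.

Lemma mxn_ge0 {m n} (A : 'M[R]_(m, n)) : 0 <= mxn A.
Proof. by apply: sumr_ge0 => i _; apply: sumr_ge0. Qed.

Lemma mxn_entry {m n} (A : 'M[R]_(m, n)) i j : `|A i j| <= mxn A.
Proof.
rewrite /mxn (bigD1 i)//= (bigD1 j)//= -addrA lerDl addr_ge0 ?sumr_ge0// => k _.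
by rewrite sumr_ge0.
Qed.

Lemma mxn_eq0 {m n} (A : 'M[R]_(m, n)) : mxn A <= 0 -> A = 0.
Proof.
move=> h; apply/matrixP => i j; rewrite mxE; apply/eqP; rewrite -normr_eq0.
by rewrite eq_le normr_ge0 andbT; exact: le_trans (mxn_entry A i j) h.
Qed.

Lemma mxnD {m n} (A B : 'M[R]_(m, n)) : mxn (A + B) <= mxn A + mxn B.
Proof.
rewrite /mxn -big_split; apply: ler_sum => i _; rewrite -big_split; apply: ler_sum => j _.
by rewrite mxE ler_normD.
Qed.

Lemma mxnN {m n} (A : 'M[R]_(m, n)) : mxn (- A) = mxn A.
Proof. by apply: eq_bigr => i _; apply: eq_bigr => j _; rewrite mxE normrN. Qed.

Lemma mxnB {m n} (A B : 'M[R]_(m, n)) : mxn (A - B) <= mxn A + mxn B.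
Proof. by rewrite -(mxnN B); exact: mxnD. Qed.

Lemma mxnM {m n p} (A : 'M[R]_(m, n)) (B : 'M[R]_(n, p)) :
  mxn (A *m B) <= mxn A * mxn B.
Proof.
rewrite /mxn mulr_suml; apply: ler_sum => i _.
apply: (@le_trans _ _ (\sum_j \sum_k `|A i k| * `|B k j|)).
  apply: ler_sum => j _; rewrite mxE; apply: le_trans (ler_norm_sum _ _ _) _.
  by apply: ler_sum => k _; rewrite normrM.
rewrite exchange_big mulr_suml; apply: ler_sum => k _; rewrite -mulr_sumr.
apply: ler_wpM2l => //; rewrite [leRHS](bigD1 k)//= lerDl.
by apply: sumr_ge0 => l _; apply: sumr_ge0.
Qed.

Lemma mxn_orthogonal n (A : 'M[R]_n) : A^T *m A = 1%:M -> mxn A <= n%:R * n%:R.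
Proof.
move=> h; have e i j : `|A i j| <= 1.
  have E : \sum_k A k j ^+ 2 = 1 :> R.
    have := congr1 (fun B : 'M[R]_n => B j j) h; rewrite !mxE eqxx /= => E.
    by apply: etrans E; apply: eq_bigr => k _; rewrite mxE expr2.
  apply: ler_of_sqr => //; rewrite real_normK ?num_real// expr1n -[leRHS]E.
  by rewrite (bigD1 i)//= lerDl; apply: sumr_ge0 => k _; exact: sqr_ge0.
apply: (@le_trans _ _ (\sum_(i < n) \sum_(j < n) 1)).
  by apply: ler_sum => i _; apply: ler_sum => j _; exact: e.
by rewrite !sumr_const !card_ord mulr_natr.
Qed.

Variable n : nat.
Implicit Types (A B C D : 'M[R]_n).

(* Doubling an element close to 1 moves it away from 1. *)
Lemma no_small_subgroup C : (forall j, mxn (C ^+ j - 1) <= 2^-1) -> C = 1.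
Proof.
move=> hC; have aux (V : zmodType) (a b c : V) : a + b + (b + c) - c = b + b + a.
  by rewrite addrA addrK -addrA addrC.
have dbl j : 3 / 2 * mxn (C ^+ j - 1) <= mxn (C ^+ (j * 2) - 1).
  set x := C ^+ j - 1; have -> : C ^+ (j * 2) - 1 = x + x + x * x.
    rewrite exprM -[C ^+ j](subrK 1) -/x expr2 mulrDl mulrDr mulr1 mul1r.
    exact: aux.
  have h1 : mxn (x + x) <= mxn (x + x + x * x) + mxn (x * x).
    by rewrite -{1}[x + x](addrK (x * x)); exact: mxnB.
  have h2 : mxn (x * x) <= mxn x * mxn x by exact: mxnM.
  have h3 : mxn (x + x) = 2 * mxn x.
    rewrite /mxn mulr_sumr; apply: eq_bigr => i _; rewrite mulr_sumr; apply: eq_bigr => k _.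
    by rewrite mxE -mulr2n normrMn mulr_natl.
  have h4 : mxn x * mxn x <= 2^-1 * mxn x by rewrite ler_wpM2r ?mxn_ge0//; exact: hC.
  lra.
have grow k : (1 + k%:R / 2) * mxn (C - 1) <= mxn (C ^+ (2 ^ k) - 1).
  elim: k => [|k IHk]; first by rewrite mul0r addr0 mul1r expn0 expr1.
  rewrite expnSr; apply: le_trans (dbl _); apply: le_trans (ler_wpM2l _ IHk) => //.
  rewrite mulrA ler_wpM2r ?mxn_ge0// -natr1; have : 0 <= k%:R :> R by []; lra.
apply/eqP; rewrite -subr_eq0; apply/eqP; apply: mxn_eq0; rewrite leNgt; apply/negP => h.
pose k := (Num.truncn (mxn (C - 1))^-1).+1.
have hk : 1 <= k%:R * mxn (C - 1).
  by rewrite -ler_pdivrMr// div1r; apply/ltW; exact: truncnS_gt.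
have := grow k; have := hC (2 ^ k)%N; lra.
Qed.

(** Since A commutes with the commutator C of A and B, the powers C^j are the commutators of A^j and
    B. These stay within 2 M^3 r <= 1/2 of 1, so [no_small_subgroup] applies. *)
Lemma commutator_trivial A A' B B' (M r : R) : A * A' = 1 ->
  B * B' = 1 -> B' * B = 1 -> 1 <= M -> 0 <= r ->
  (forall j, mxn (A ^+ j) <= M) -> (forall j, mxn (A' ^+ j) <= M) -> mxn B' <= M ->
  mxn (B - 1) <= r -> 4 * M ^+ 3 * r <= 1 ->
  A * (A * B * A' * B') = A * B * A' * B' * A -> A * B * A' * B' = 1.
Proof.
move=> AA' BB' B'B M1 r0 hA hA' hB' hB hr; set C := A * B * A' * B' => AC.
have AA'j j : A ^+ j * A' ^+ j = 1.
  elim: j => [|j IHj]; first by rewrite !expr0 mulr1.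
  by rewrite exprSr exprS -mulrA (mulrA A) AA' mul1r.
have ACj j : A * C ^+ j = C ^+ j * A by exact: commrX.
have CE j : C ^+ j = A ^+ j * B * A' ^+ j * B'.
  elim: j => [|j IHj]; first by rewrite !expr0 mul1r mulr1 BB'.
  rewrite exprSr {2}/C !mulrA -ACj IHj exprS exprSr !mulrA.
  by rewrite -(mulrA _ B' B) B'B mulr1.
apply: no_small_subgroup => j.
have -> : C ^+ j - 1 = (A ^+ j * (B - 1) * A' ^+ j - (B - 1)) * B'.
  have -> : A ^+ j * (B - 1) * A' ^+ j = A ^+ j * B * A' ^+ j - 1.
    by rewrite mulrBr mulr1 mulrBl AA'j.
  by rewrite !mulrBl BB' -CE !mul1r opprB addrA subrK.
have M0 : 0 <= M by lra.
have h1 : mxn (A ^+ j * (B - 1)) <= M * r.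
  by apply: le_trans (mxnM _ _) _; apply: ler_pM => //; exact: mxn_ge0.
have h2 : mxn (A ^+ j * (B - 1) * A' ^+ j) <= M * r * M.
  by apply: le_trans (mxnM _ _) _; apply: ler_pM => //; exact: mxn_ge0.
have h3 : mxn (A ^+ j * (B - 1) * A' ^+ j - (B - 1)) <= M * r * M + r.
  by apply: le_trans (mxnB _ _) _; exact: lerD.
have h4 : (M * r * M + r) * M <= 2 * M ^+ 3 * r.
  have : r * 1 <= r * M ^+ 2 by rewrite ler_wpM2l// expr_ge1.
  move=> h; have := ler_wpM2r M0 h; rewrite mulr1.
  have -> : r * M ^+ 2 * M = M ^+ 3 * r by ring.
  have -> : (M * r * M + r) * M = M ^+ 3 * r + r * M by ring.
  lra.
apply: le_trans (mxnM _ _) _; apply: (@le_trans _ _ ((M * r * M + r) * M)).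
  by apply: ler_pM => //; exact: mxn_ge0.
lra.
Qed.

Lemma nsq_eq0 m (x : 'cV[R]_m) : nsq x = 0 -> x = 0.
Proof.
move=> /eqP; rewrite psumr_eq0 => [|i _]; last exact: sqr_ge0.
move=> /allP h; apply/matrixP => i j; rewrite ord1 mxE.
by have := h i (mem_index_enum i); rewrite /= sqrf_eq0 => /eqP.
Qed.

(** The vectors fixed by an orthogonal A are orthogonal to the image of A - 1, and A x - x is in
    both spaces. *)
Lemma orthogonal_fix (A : 'M[R]_n) (x : 'cV[R]_n) : A^T *m A = 1%:M ->
  A *m (A *m x - x) = A *m x - x -> A *m x = x.
Proof.
move=> oA; set y := A *m x - x => Ay; apply/eqP; rewrite -subr_eq0 -/y; apply/eqP.
have A'y : A^T *m y = y by rewrite -{1}Ay mulmxA oA mul1mx.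
apply: nsq_eq0; rewrite nsqE {2}/y mulmxBr mulmxA.
by rewrite -[y^T *m A]trmxK trmx_mul trmxK A'y subrr mxE.
Qed.

Section gram.
Variables (I : Type) (D : I -> 'M[R]_n).

Definition gram (s : seq I) : 'M[R]_n := \sum_(i <- s) (D i)^T *m D i.

Lemma gram_sym s : (gram s)^T = gram s.
Proof.
rewrite /gram raddf_sum; apply: eq_bigr => i _ /=.
by rewrite trmx_mul trmxK.
Qed.

End gram.

Section gram_kernel.
Variables (I : eqType) (D : I -> 'M[R]_n).
Implicit Type s : seq I.

Lemma gram_ker s (x : 'cV[R]_n) :
  gram D s *m x = 0 <-> forall i, i \in s -> D i *m x = 0.
Proof.
split; last first.
  move=> h; rewrite /gram mulmx_suml big_seq big1// => i /h hi.
  by rewrite -mulmxA hi mulmx0.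
move=> h; have : \sum_(i <- s) nsq (D i *m x) = 0.
  transitivity ((x^T *m (gram D s *m x)) 0 0); last by rewrite h mulmx0 mxE.
  rewrite /gram mulmx_suml mulmx_sumr summxE; apply: eq_bigr => i _.
  by rewrite nsqE trmx_mul !mulmxA.
elim: s {h} => [//|i s IHs]; rewrite big_cons => h.
have s0 : 0 <= \sum_(j <- s) nsq (D j *m x).
  by apply: sumr_ge0 => j _; apply: sumr_ge0 => k _; exact: sqr_ge0.
have i0 : 0 <= nsq (D i *m x) by apply: sumr_ge0 => k _; exact: sqr_ge0.
move=> j; rewrite in_cons => /predU1P[->|]; last by apply: IHs; lra.
by apply: nsq_eq0; lra.
Qed.

(** The normal equations of a least squares problem are solvable: the right-hand side vanishes on
    the kernel of the symmetric matrix [gram D s]. *)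
Lemma gram_solve s (t : I -> 'cV[R]_n) :
  exists z, gram D s *m z + \sum_(i <- s) (D i)^T *m t i = 0.
Proof.
pose v : 'cV[R]_n := \sum_(i <- s) (D i)^T *m t i.
have : (v^T <= gram D s)%MS.
  rewrite submxE; apply/eqP/matrixP => k j.
  have /gram_ker h : gram D s *m col j (cokermx (gram D s)) = 0.
    by rewrite colE mulmxA mulmx_coker mul0mx.
  transitivity ((v^T *m col j (cokermx (gram D s))) k 0).
    by rewrite [LHS]mxE [RHS]mxE; apply: eq_bigr => p _; congr (_ * _); rewrite [RHS]mxE.
  rewrite /v raddf_sum mulmx_suml summxE mxE big_seq big1// => i /h hi /=.
  by rewrite trmx_mul trmxK -mulmxA hi mulmx0 mxE.
move=> /submxP[w hw]; exists (- w^T).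
rewrite mulmxN -[gram D s]gram_sym -trmx_mul -hw trmxK /v.
exact: addNr.
Qed.

(** A list s for which [gram D s] has maximal rank: appending one more index cannot shrink the
    kernel. *)
Lemma gram_finite (P : I -> Prop) : exists s, (forall i, i \in s -> P i) /\
  forall (x : 'cV[R]_n) i, P i -> gram D s *m x = 0 -> D i *m x = 0.
Proof.
pose Q k := `[< exists s, (forall i, i \in s -> P i) /\ \rank (gram D s) = k >].
have Q0 : exists k, Q k by exists (\rank (gram D [::])); apply/asboolP; exists [::].
have Qn k : Q k -> (k <= n)%N by move=> /asboolP[s [_ <-]]; exact: rank_leq_row.
case: (ex_maxnP Q0 Qn) => _ /asboolP[s [sP <-]] hmax; exists s; split=> // x i Pi hx.
have sub : (kermx (gram D (i :: s)) <= kermx (gram D s))%MS.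
  apply/rV_subP => u /sub_kermxP hu; apply/sub_kermxP.
  have : gram D (i :: s) *m u^T = 0.
    by rewrite -[gram D (i :: s)]gram_sym -trmx_mul hu trmx0.
  move=> /gram_ker h; have : gram D s *m u^T = 0.
    by apply/gram_ker => j js; apply: h; rewrite in_cons js orbT.
  by move=> /(congr1 trmx); rewrite trmx_mul trmxK gram_sym trmx0.
have : (kermx (gram D s) <= kermx (gram D (i :: s)))%MS.
  rewrite -(geq_leqif (mxrank_leqif_sup sub)) !mxrank_ker leq_sub2l//.
  apply: hmax; apply/asboolP; exists (i :: s); split => // j.
  by rewrite in_cons => /predU1P[->|/sP].
move=> /rV_subP/(_ x^T) h.
have /sub_kermxP : (x^T <= kermx (gram D (i :: s)))%MS.
  apply: h; apply/sub_kermxP.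
  by rewrite -[gram D s]gram_sym -trmx_mul hx trmx0.
move=> /(congr1 trmx); rewrite trmx_mul trmxK gram_sym trmx0 => /gram_ker; apply.
exact: mem_head.
Qed.

End gram_kernel.
End l1_norm.

(** * Discrete groups of Euclidean motions *)

Section discrete_motions.
Context {R : realType} {G : topologicalGroupType} (n : nat) (H N : set G).
Variables (A : G -> 'M[R]_n) (t : G -> 'cV[R]_n).
Local Notation "g ^V" := (g^-1)%g (at level 3).
Local Notation "g ** h" := (g * h)%g (at level 40, left associativity).
Hypothesis sH : is_subgroup H.
Hypothesis NH : N `<=` H.
Hypothesis AM : forall g h, H g -> H h -> A (g ** h) = A g *m A h.
Hypothesis tM : forall g h, H g -> H h -> t (g ** h) = A g *m t h + t g.
Hypothesis oA : forall g, H g -> (A g)^T *m A g = 1%:M.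

Definition ad (h c : G) : G := h ** c ** (h^V ** c^V).

Hypothesis adN : forall g h, H g -> H h -> N (ad g h).
Hypothesis gapN : exists2 e : R, 0 < e & forall g, N g -> mxn (A g - 1%:M) < e ->
  mxn (t g) < e -> A g = 1%:M /\ t g = 0.

Let H1 : H 1%g. Proof. by case: sH. Qed.
Let HM g h : H g -> H h -> H (g ** h). Proof. by case: sH => _ h' _; exact: h'. Qed.
Let HV g : H g -> H g^V. Proof. by case: sH => _ _; exact. Qed.
Let Had g h : H g -> H h -> H (ad g h). Proof. by move=> Hg Hh; exact/NH/adN. Qed.

Let A1 : A 1%g = 1.
Proof.
have := AM H1 H1; rewrite mulg1 => /(congr1 (mulmx (A 1%g)^T)).
by rewrite mulmxA oA// mul1mx => <-.
Qed.

Let t1 : t 1%g = 0.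
Proof.
have := tM H1 H1; rewrite mulg1 A1 mul1mx => /(congr1 (fun x => x - t 1%g)).
by rewrite addrK subrr.
Qed.

Let AVA g : H g -> A g^V * A g = 1.
Proof. by move=> Hg; rewrite -[_ * _]AM ?mulVg ?A1//; exact: HV. Qed.

Let AAV g : H g -> A g * A g^V = 1.
Proof. by move=> Hg; rewrite -[_ * _]AM ?mulgV ?A1//; exact: HV. Qed.

Let tV g : H g -> t g^V = - (A g^V *m t g).
Proof.
move=> Hg; apply/eqP; rewrite -addr_eq0 addrC -tM ?mulVg ?t1//; exact: HV.
Qed.

Let ATV g : H g -> (A g)^T = A g^V.
Proof.
move=> Hg; rewrite -[LHS]mulr1 -(AAV Hg) mulrA.
by rewrite -[(A g)^T * A g]/((A g)^T *m A g) oA// mul1r.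
Qed.

(** M bounds the norm of orthogonal matrices. The value of r gives M^3 r = 1/16, small enough for
    [contract] and for [commutator_trivial]. *)
Let M : R := n%:R * n%:R + 1.
Let r : R := (16 * M ^+ 3)^-1.
(** Only the linear part is required to be small; the translation part is unrestricted. *)
Let S := [set h | H h /\ mxn (A h - 1) <= r].

Let M1 : 1 <= M. Proof. by rewrite lerDr mulr_ge0. Qed.
Let M0 : 0 < M. Proof. by have := M1; lra. Qed.
Let r0 : 0 < r. Proof. by rewrite invr_gt0 mulr_gt0// exprn_gt0. Qed.
Let Mr : M ^+ 3 * r = 16^-1.
Proof. by rewrite /r; field; rewrite ?expf_neq0// ?lt0r_neq0. Qed.

Let AS g : H g -> mxn (A g) <= M.
Proof.
by move=> Hg; apply: le_trans (mxn_orthogonal (oA Hg)) _; rewrite lerDl.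
Qed.

Let AX g j : H g -> mxn (A g ^+ j) <= M.
Proof.
move=> Hg; have [] : H (g ^+ j)%g /\ A (g ^+ j)%g = A g ^+ j.
  elim: j => [|j [IH1 IH2]]; first by rewrite expg0 expr0 A1.
  by rewrite expgS exprS -IH2 AM//; split=> //; exact: HM.
by move=> Hj <-; exact: AS.
Qed.

Let A_ad h c : H h -> H c -> A (ad h c) = A h * A c * A h^V * A c^V.
Proof.
move=> Hh Hc; have [Hh' Hc'] := (HV Hh, HV Hc).
by rewrite /ad !AM//; [exact: mulrA|exact: HM|exact: HM].
Qed.

Let t_ad h c : H h -> H c -> t (ad h c) =
  (A h - 1) *m t c - (A (ad h c) - 1) *m t c - (A h * (A c - 1) * A h^V) *m t h.
Proof.
move=> Hh Hc; have [Hh' Hc'] := (HV Hh, HV Hc); have Hhc := HM Hh Hc.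
rewrite {1}/ad tM//; last exact: HM.
rewrite !tM// !tV// mulmxN !mulmxDr !mulmxN !mulmxA A_ad//.
rewrite AM// !mulmxBl !mul1mx.
have -> : A h * (A c - 1) * A h^V = A h * A c * A h^V - 1.
  by rewrite mulrBr mulr1 mulrBl AAV.
rewrite mulmxBl mul1mx.
rewrite -[A h *m A c *m A h^V *m A c^V]/(A h * A c * A h^V * A c^V).
rewrite -[A h *m A c *m A h^V]/(A h * A c * A h^V).
set p := _ *m t c; set q := _ *m t h; set u := A h *m t c.
by apply/matrixP => i j; rewrite !mxE; ring.
Qed.

(* (A h - 1)(A c - 1) - (A c - 1)(A h - 1) = A h A c - A c A h makes the linear part
   of [h, c] much closer to 1 than that of c. *)
Let contract h c : S h -> H c ->
  mxn (A (ad h c) - 1) <= 8^-1 * mxn (A c - 1) /\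
  mxn (t (ad h c)) <= 2^-1 * mxn (t c) + M ^+ 2 * mxn (t h) * mxn (A c - 1).
Proof.
move=> [Hh hr] Hc; have [Hh' Hc'] := (HV Hh, HV Hc).
have [u0 v0] := (mxn_ge0 (A c - 1), mxn_ge0 (t c)).
have E : A (ad h c) - 1 =
    ((A h - 1) * (A c - 1) - (A c - 1) * (A h - 1)) * A h^V * A c^V.
  have -> : (A h - 1) * (A c - 1) - (A c - 1) * (A h - 1) = A h * A c - A c * A h.
    rewrite !mulrBl !mulrBr !mul1r !mulr1.
    move: (A h * A c) (A c * A h) (A h) (A c) => p q u v.
    by apply/matrixP => i j; rewrite !mxE; ring.
  rewrite mulrBl mulrBl A_ad//; congr (_ - _).
  by rewrite -[A c * A h * A h^V]mulrA AAV// mulr1 AAV.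
have h0 : mxn (A (ad h c) - 1) <= 2 * r * mxn (A c - 1) * M * M.
  have e1 : mxn ((A h - 1) * (A c - 1)) <= r * mxn (A c - 1).
    by apply: le_trans (mxnM _ _) _; apply: ler_wpM2r.
  have e2 : mxn ((A c - 1) * (A h - 1)) <= r * mxn (A c - 1).
    by apply: le_trans (mxnM _ _) _; rewrite mulrC; apply: ler_wpM2r.
  set Q := (A h - 1) * (A c - 1) - (A c - 1) * (A h - 1) in E.
  have e3 : mxn Q <= 2 * r * mxn (A c - 1) by apply: le_trans (mxnB _ _) _; lra.
  have e4 : mxn (Q * A h^V) <= 2 * r * mxn (A c - 1) * M.
    by apply: le_trans (mxnM _ _) _; apply: ler_pM; rewrite ?mxn_ge0// AS.
  have e5 : mxn (Q * A h^V * A c^V) <= 2 * r * mxn (A c - 1) * M * M.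
    by apply: le_trans (mxnM _ _) _; apply: ler_pM; rewrite ?mxn_ge0// AS.
  by rewrite E.
have h1 : mxn (A (ad h c) - 1) <= 8^-1 * mxn (A c - 1).
  apply: le_trans h0 _.
  have rM : r * M ^+ 2 <= 16^-1.
    rewrite -Mr mulrC ler_wpM2r ?(ltW r0)// -[leLHS]mulr1 [leRHS]exprSr.
    by rewrite ler_wpM2l ?sqr_ge0.
  have -> : 2 * r * mxn (A c - 1) * M * M = 2 * (r * M ^+ 2 * mxn (A c - 1)) by ring.
  have := ler_wpM2r u0 rM; lra.
split=> //; rewrite t_ad//.
have r8 : r <= 16^-1.
  by rewrite -Mr mulrC ler_peMr ?(ltW r0)// exprn_ege1.
have c2 : mxn (A c - 1) <= 2 * M.
  apply: le_trans (mxnB _ _) _; have := AS Hc.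
  by have := AS H1; rewrite A1; lra.
have f1 : mxn ((A h - 1) *m t c) <= 16^-1 * mxn (t c).
  apply: le_trans (mxnM _ _) _; apply: ler_wpM2r => //; exact: le_trans hr r8.
have f2 : mxn ((A (ad h c) - 1) *m t c) <= 4^-1 * mxn (t c).
  apply: le_trans (mxnM _ _) _; apply: ler_wpM2r => //; apply: le_trans h0 _.
  have -> : 2 * r * mxn (A c - 1) * M * M = 2 * r * M * M * mxn (A c - 1) by ring.
  have p0 : 0 <= 2 * r * M * M by rewrite !mulr_ge0 ?(ltW r0) ?(ltW M0).
  apply: le_trans (ler_wpM2l p0 c2) _.
  have -> : 2 * r * M * M * (2 * M) = 4 * (M ^+ 3 * r) by ring.
  by rewrite Mr; lra.
have f3 : mxn ((A h * (A c - 1) * A h^V) *m t h) <= M ^+ 2 * mxn (t h) * mxn (A c - 1).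
  have g1 : mxn (A h * (A c - 1)) <= M * mxn (A c - 1).
    by apply: le_trans (mxnM _ _) _; apply: ler_wpM2r => //; exact: AS.
  have g2 : mxn (A h * (A c - 1) * A h^V) <= M * mxn (A c - 1) * M.
    by apply: le_trans (mxnM _ _) _; apply: ler_pM; rewrite ?mxn_ge0// AS.
  apply: le_trans (mxnM _ _) _; apply: le_trans (ler_wpM2r (mxn_ge0 _) g2) _.
  by rewrite le_eqVlt; apply/orP; left; apply/eqP; ring.
apply: le_trans (mxnB _ _) _; apply: le_trans (lerD (mxnB _ _) (lexx _)) _; lra.
Qed.

Let it h c i := iter i (ad h) c.

Let Hit h c i : H h -> H c -> H (it h c i).
Proof. by move=> Hh Hc; elim: i => //= i; exact: Had. Qed.

(* The commutators [h, [h, ... [h, c]]] shrink, and the gap kills them. *)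
Let dies h c : S h -> H c -> exists i, A (it h c i.+1) = 1 /\ t (it h c i.+1) = 0.
Proof.
move=> Sh Hc; have Hh : H h by case: Sh.
have [e e0 gap] := gapN.
pose D := M ^+ 2 * mxn (t h).
have D0 : 0 <= D by rewrite mulr_ge0 ?mxn_ge0// sqr_ge0.
pose u i := mxn (A (it h c i) - 1); pose v i := mxn (t (it h c i)).
have u0 i : 0 <= u i by exact: mxn_ge0.
have v0 i : 0 <= v i by exact: mxn_ge0.
(* The weight of u absorbs the term D u that [contract] adds to v, so w is halved at each step. *)
pose w i := v i + 4 * (D + 1) * u i.
have wS i : w i.+1 <= 2^-1 * w i.
  have [h1 h2] := contract Sh (Hit i Hh Hc).
  rewrite -/(u i) -[mxn _]/(u i.+1) in h1.
  rewrite -/(u i) -/(v i) -[mxn (t _)]/(v i.+1) -/D in h2.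
  rewrite /w; have := u0 i; nra.
have wn i : w i * 2 ^+ i <= w 0%N.
  elim: i => [|i]; first by rewrite expr0 mulr1.
  apply: le_trans; rewrite exprS mulrA ler_wpM2r ?exprn_ge0//.
  by have := wS i; lra.
have w0 : 0 <= w 0%N by rewrite /w addr_ge0// !mulr_ge0// addr_ge0.
pose k := Num.truncn (w 0%N / e).
have hk : w 0%N < e * k.+1%:R.
  rewrite mulrC -ltr_pdivrMr//; have /andP[] : (k%:R <= w 0%N / e < k.+1%:R).
    by apply: truncn_itv; rewrite divr_ge0// ltW.
  by [].
have wk : w k.+1 < e.
  rewrite -(ltr_pM2r (_ : 0 < 2 ^+ k.+1)) ?exprn_gt0//.
  apply: le_lt_trans (wn _) _; apply: lt_le_trans hk _.
  rewrite ler_wpM2l ?(ltW e0)// -natrX ler_nat; exact/ltnW/ltn_expl.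
(* The index is [k.+1] because the gap is available for commutators, and c itself may lie outside
   N. *)
exists k; apply: gap; first exact: adN (Hit k Hh Hc).
- apply: le_lt_trans wk; rewrite -[mxn _]/(u k.+1) /w.
  by have := u0 k.+1; have := v0 k.+1; nra.
- apply: le_lt_trans wk; rewrite -[mxn _]/(v k.+1) /w.
  by have := u0 k.+1; have := v0 k.+1; nra.
Qed.

(* Once an iterated commutator is trivial, commutator_trivial propagates this back to
   the first one. *)
Let A_ad1 h k : S h -> S k -> A (ad h k) = 1.
Proof.
move=> Sh [Hk kr]; have Hh : H h by case: Sh.
have Hc i := Hit i Hh Hk.
have ur i : mxn (A (it h k i) - 1) <= r.
  elim: i => // i IH; have [h1 _] := contract Sh (Hc i).
  by apply: le_trans h1 _; have := mxn_ge0 (A (it h k i) - 1); have := r0; lra.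
have [i [+ _]] := dies Sh Hk; elim: i => // i IH h1; apply: IH.
rewrite [it h k i.+1]/= A_ad//; apply: (@commutator_trivial _ _ _ _ _ _ M r) => //.
- exact: AAV.
- exact: AAV.
- exact: AVA.
- exact: ltW.
- by move=> j; exact: AX.
- by move=> j; apply: AX; exact: HV.
- by apply: AS; exact: HV.
- by rewrite -mulrA Mr; lra.
- rewrite -A_ad//; have := h1; rewrite [it h k i.+2]/= A_ad; [|exact: Hh|exact: Had].
  move=> /(congr1 (fun x => x * A (ad h (it h k i)) * A h)).
  rewrite mul1r -mulrA -mulrA (mulrA (A _^V) (A (ad _ _))) AVA ?mul1r; last exact: Had.
  by rewrite -mulrA AVA// mulr1.
Qed.

Let A_comm h k : S h -> S k -> A h *m A k = A k *m A h.
Proof.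
move=> Sh Sk; have [[Hh _] [Hk _]] := (Sh, Sk).
have := A_ad1 Sh Sk; rewrite A_ad// => /(congr1 (fun x => x * A k * A h)).
by rewrite mul1r -mulrA -mulrA (mulrA (A k^V)) AVA// mul1r -mulrA AVA// mulr1.
Qed.

(** [ad h k] is a translation, on which taking the commutator with l acts by A l - 1. Some iterate
    kills its vector, and by [orthogonal_fix] so does the first one. *)
Let t_ad_fixed h k l : S h -> S k -> S l -> A l *m t (ad h k) = t (ad h k).
Proof.
move=> Sh Sk Sl; have [[Hh _] [Hk _]] := (Sh, Sk); have [Hl _] := Sl.
have Hd : H (ad h k) by exact: Had.
have Ai i : A (it l (ad h k) i) = 1.
  elim: i => [|i IH]; first exact: A_ad1.
  rewrite [it _ _ _]/= A_ad//; last exact: Hit.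
  have := AVA (Hit i Hl Hd); rewrite IH mulr1 => ->.
  by rewrite !mulr1 AAV.
have ti i : t (it l (ad h k) i.+1) = A l *m t (it l (ad h k) i) - t (it l (ad h k) i).
  rewrite [it _ _ _]/= t_ad//; last exact: Hit.
  rewrite -[ad l _]/(it l (ad h k) i.+1) !Ai subrr mul0mx subr0 mulr0 mul0r.
  by rewrite mul0mx subr0 mulmxBl mul1mx.
have [i [_ +]] := dies Sl Hd; elim: i => [|i IH].
  by rewrite ti => /eqP; rewrite subr_eq0 => /eqP.
rewrite ti => /eqP; rewrite subr_eq0 ti => /eqP fx; apply: IH; rewrite ti.
by rewrite (orthogonal_fix (oA Hl) fx) subrr.
Qed.

(* K contains S: the linear parts of the elements of S commute, their commutators are
   translations fixed by S, and z solves the normal equations of a common fixed point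
   modulo the common kernel of the A h - 1. *)
Lemma discrete_translations : exists (T : 'M[R]_n) (z : 'cV[R]_n) (K : set G),
  [/\ is_subgroup K, K `<=` H, finite_index K H &
      forall k, K k -> (forall x : 'cV[R]_n, T *m x = 0 -> A k *m x = x) /\
        T *m (A k *m z + t k - z) = 0].
Proof.
pose D g : 'M[R]_n := A g - 1.
have [s [sS hs]] := gram_finite D S; pose T := gram D s.
have [z hz] := gram_solve D s t.
(* The elements of H acting by translations on the affine subspace z + ker T. *)
pose K := [set k | H k /\ ((forall x : 'cV[R]_n, T *m x = 0 -> A k *m x = x) /\
        T *m (A k *m z + t k - z) = 0)].
have sK : is_subgroup K.
  split.
  - split; [exact: H1|split; first by move=> x _; rewrite A1 mul1mx].
    by rewrite A1 t1 mul1mx addr0 subrr mulmx0.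
  - move=> g h [Hg [g1 g2]] [Hh [h1 h2]]; split; first exact: HM.
    rewrite AM// tM//; split; first by move=> x Tx; rewrite -mulmxA h1// g1.
    have := g1 _ h2; set w := A h *m z + t h - z => Aw.
    have -> : A g *m A h *m z + (A g *m t h + t g) - z = w + (A g *m z + t g - z).
      rewrite -Aw -mulmxA /w mulmxBr mulmxDr.
      move: (A g *m (A h *m z)) (A g *m t h) (A g *m z) => p q m.
      by apply/matrixP => i j; rewrite !mxE; ring.
    by rewrite mulmxDr h2 g2 addr0.
  - move=> g [Hg [g1 g2]]; have Hg' := HV Hg; split=> //.
    have V1 (x : 'cV[R]_n) : T *m x = 0 -> A g^V *m x = x.
      move=> Tx; rewrite -{1}(g1 _ Tx) mulmxA.
      by rewrite -[A g^V *m A g]/(A g^V * A g) AVA// mul1mx.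
    split=> //; have := V1 _ g2; set w := A g *m z + t g - z => Aw.
    have -> : A g^V *m z + t g^V - z = - w.
      rewrite -Aw tV// /w mulmxBr mulmxDr mulmxA.
      rewrite -[A g^V *m A g]/(A g^V * A g) AVA// mul1mx.
      move: (A g^V *m t g) (A g^V *m z) => p q.
      by apply/matrixP => i j; rewrite !mxE; ring.
    by rewrite mulmxN g2 oppr0.
have SK l : S l -> K l.
  move=> Sl; have [Hl _] := Sl; split=> //; split.
    move=> x /hs - /(_ l Sl); rewrite /D mulmxBl mul1mx => /eqP.
    by rewrite subr_eq0 => /eqP.
  have -> : A l *m z + t l - z = D l *m z + t l.
    by rewrite /D mulmxBl mul1mx addrAC.
  rewrite /T /gram mulmx_suml.
  (* The linear parts commute and (D h)^T kills t (ad h l), so D l can be moved out of the sum; what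
     remains are the normal equations solved by z. *)
  transitivity (D l *m (T *m z + \sum_(i <- s) (D i)^T *m t i)); last first.
    by rewrite hz mulmx0.
  rewrite /T /gram mulmxDr mulmx_suml !mulmx_sumr -big_split /=.
  rewrite big_seq [RHS]big_seq; apply: eq_bigr => h /sS Sh; have [Hh _] := Sh.
  have cD : D h *m D l = D l *m D h.
    rewrite /D !mulmxBl !mulmxBr !mul1mx !mulmx1 (A_comm Sh Sl).
    by move: (A l *m A h) (A l) (A h) => p q m; apply/matrixP => i j; rewrite !mxE; ring.
  have DT : (D h)^T = A h^V - 1 by rewrite /D raddfB /= trmx1 ATV.
  have cA : A h^V *m A l = A l *m A h^V.
    have := A_comm Sh Sl => /(congr1 (fun x => A h^V * x * A h^V)).
    rewrite -[A h *m A l]/(A h * A l) -[A l *m A h]/(A l * A h).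
    rewrite mulrA AVA// mul1r -!mulrA AAV// mulr1.
    by rewrite -[A l *m A h^V]/(A l * A h^V) => ->.
  have cDT : (D h)^T *m D l = D l *m (D h)^T.
    rewrite DT /D !mulmxBl !mulmxBr !mul1mx !mulmx1 cA.
    by move: (A l *m A h^V) (A l) (A h^V) => p q m; apply/matrixP => i j; rewrite !mxE; ring.
  have tt : D h *m t l = D l *m t h + t (ad h l).
    have E : ad h l ** (l ** h) = h ** l.
      by rewrite /ad -!mulgA (mulgA l^V) mulVg mul1g mulVg mulg1.
    have Hd := Had Hh Hl; have Hlh := HM Hl Hh.
    have := tM Hd Hlh; rewrite E (A_ad1 Sh Sl) mul1mx (tM Hh Hl) (tM Hl Hh).
    rewrite /D !mulmxBl !mul1mx.
    move=> /(congr1 (fun x => x - t l - t h)).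
    move: (t h) (t l) (t (ad h l)) (A l *m t h) (A h *m t l) => a b p q m e.
    apply/matrixP => i j; have := congr1 (fun x : 'cV[R]_n => x i j) e.
    by rewrite !mxE => e'; lra.
  have Dtau : (D h)^T *m t (ad h l) = 0.
    rewrite DT mulmxBl mul1mx -{1}(t_ad_fixed Sh Sl Sh) mulmxA.
    by rewrite -[A h^V *m A h]/(A h^V * A h) AVA// mul1mx subrr.
  rewrite -mulmxA mulmxDr mulmxDr tt mulmxDr Dtau addr0 !mulmxA cDT.
  by rewrite -(mulmxA _ (D h) (D l)) cD !mulmxA cDT.
exists T, z, K; split=> //; [by move=> k []| |by move=> k []].
(* Finite index by pigeonhole: the entries of the linear parts are rounded to multiples of 1 / (m +
   1). Two elements with the same rounded matrix differ by an element of S, hence of K. *)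
have [m hm] : exists m : nat, M * (M / m.+1%:R) <= r.
  exists (Num.truncn (M * M / r)); set k := Num.truncn _.
  have /andP[_ hk] : (k%:R <= M * M / r < k.+1%:R).
    by apply: truncn_itv; rewrite divr_ge0 ?mulr_ge0 ?(ltW M0) ?(ltW r0).
  rewrite mulrA ler_pdivrMr ?ltr0n// mulrC; rewrite ltr_pdivrMr// in hk.
  by rewrite mulrC ltW.
pose cd g i j := Num.truncn ((A g i j + M) * m.+1%:R).
pose B := Num.truncn (2 * M * m.+1%:R).
pose code g : 'M['I_B.+1]_n := \matrix_(i, j) inord (cd g i j).
have aM g i j : H g -> 0 <= A g i j + M <= 2 * M.
  move=> Hg; have := le_trans (mxn_entry (A g) i j) (AS Hg); rewrite ler_norml; lra.
have cdB g i j : H g -> (cd g i j < B.+1)%N.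
  move=> Hg; rewrite ltnS; apply: le_truncn; rewrite ler_wpM2r//.
  by case/andP: (aM g i j Hg).
have codeP g h : H g -> H h -> code g = code h -> K (g^V ** h).
  move=> Hg Hh e; apply: SK; have Hg' := HV Hg; split; first exact: HM.
  have E : A (g^V ** h) - 1 = A g^V *m (A h - A g).
    by rewrite AM// mulmxBr -[A g^V *m A g]/(A g^V * A g) AVA.
  rewrite E; apply: le_trans (mxnM _ _) _; apply: le_trans hm.
  apply: ler_pM; rewrite ?mxn_ge0 ?AS//.
  apply: (@le_trans _ _ (\sum_(i < n) \sum_(j < n) m.+1%:R^-1)); last first.
    rewrite !sumr_const !card_ord -!mulrnA -[leLHS]mulr_natl natrM ler_wpM2r ?invr_ge0//.
    by rewrite /M lerDl.
  apply: ler_sum => i _; apply: ler_sum => j _.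
  have := congr1 (fun x : 'M_n => val (x i j)) e; rewrite !mxE /= !inordK ?cdB// => ec.
  have tr g' : H g' -> (cd g' i j)%:R <= (A g' i j + M) * m.+1%:R < (cd g' i j).+1%:R.
    by move=> Hg2; apply: truncn_itv; rewrite mulr_ge0//; case/andP: (aM g' i j Hg2).
  have := tr _ Hg; have := tr _ Hh; rewrite ec -[(_ i j).+1%:R]natr1 => b1 b2.
  rewrite -[m.+1%:R^-1]mul1r ler_pdivlMr ?ltr0n//.
  rewrite -[X in _ * X](ger0_norm (_ : 0 <= m.+1%:R))// -normrM mulrBl ler_norml.
  move: b1 b2; set p := m.+1%:R; rewrite !mulrDl; set q := A h i j * p.
  by set q' := A g i j * p; set y := _%:R; lra.
rewrite /finite_index; pose F (c : 'M['I_B.+1]_n) : set G :=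
  [set g' | exists h, [/\ H h, code h = c & K (h^V ** g')]].
apply: (@sub_finite_set _ _ (F @` [set: 'M['I_B.+1]_n])); last first.
  exact/finite_image/finite_finset.
move=> _ [h Hh <-]; exists (code h) => //; apply/seteqP; split=> g /=.
  move=> [h' [Hh' e k]]; exists (h^V ** g); last by rewrite mulgA mulgV mul1g.
  have -> : h^V ** g = (h^V ** h') ** (h'^V ** g) by rewrite mulgA mulgK.
  by case: sK => _ KM _; apply: KM => //; exact: codeP.
by move=> [k Kk <-]; exists h; split=> //; rewrite mulKg.
Qed.

End discrete_motions.

(** * Approximation in X *)

Lemma isom_close {R : realType} (Z : metricType R) (f g : isometry Z) (p q : Z)
    (e : R) : mdist p q < e / 4 -> mdist (f q) (g q) < e / 4 ->
  mdist (f p) (g p) < e.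
Proof.
have := metric_triangle (f p) (f q) (g p).
have := metric_triangle (f q) (g q) (g p).
rewrite !isom_dist (metric_sym q p); have := mdist_ge0 p q; lra.
Qed.

Section approximation.
Context {R : realType} {G : topologicalGroupType} {X : metricType R}.
Variable a : isometric_action G X.

(* Every finite part of the action of N on Y is seen in X, up to any error. *)
Definition approximable (N : set G) (Y : metricType R) (al : G -> isometry Y) :
    Prop := forall (s : seq G) (ps : seq Y) (e : R),
  (forall g, g \in s -> N g) -> 0 < e ->
  exists r : Y -> X, forall g p q, g \in s -> p \in ps -> q \in ps ->
    `|mdist (a g (r p)) (r q) - mdist (al g p) q| < e.

Lemma approximable_self N : approximable N (act_isometry a).
Proof. by move=> s ps e _ e0; exists id => g p q _ _ _; rewrite subrr normr0. Qed.

Section transverse_level.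
Variables (H N : set G) (Y : metricType R) (catY : cat0 Y) (xi : boundary Y).
Variable al : G -> isometry Y.
Hypothesis sH : is_subgroup H.
Hypothesis hal : isom_action H al.
Hypothesis fixxi : forall h, H h -> boundary_map (al h) xi = xi.

Let al' g := induced_isometry catY xi (al g).

Lemma isom_actionM g h : H g -> H h -> al (g * h)%g = isom_comp (al g) (al h).
Proof. by case: hal => _ m _ Hg Hh; apply: isometry_ext => x; exact: m. Qed.

Lemma isom_actionV g : H g -> al g^-1%g = isom_inv (al g).
Proof.
move=> Hg; apply: isometry_ext => x; apply: (@isom_inj _ _ (al g)).
by rewrite (isom_actVK sH hal)// isom_invK.
Qed.

Lemma transverse_isom_action : isom_action H al'.
Proof.
have [h1 hM hC] := hal; have [H1 HM _] := sH.
have E g (Hg : H g) : al' g = transverse_isometry catY (fixxi Hg).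
  exact: induced_isometryE.
split.
- move=> x; rewrite (E _ H1) transverse_isometry_id//.
  by apply: isometry_ext => y; exact: h1.
- move=> g h x Hg Hh; rewrite (E _ (HM _ _ Hg Hh)) (E _ Hg) (E _ Hh).
  have e := isom_actionM Hg Hh; move: (fixxi _); rewrite e => fgh.
  by rewrite (transverse_isometry_comp catY (fixxi Hg) (fixxi Hh) fgh).
- move=> g p e Hg e0; have e4 : 0 < e / 4 by rewrite divr_gt0.
  have [rho hrho] := emb_ray_dense p e4.
  have := hC g ((val rho : ray Y) 0) _ Hg e4; apply: filterS => h hh Hh.
  have := hh Hh; rewrite (E _ Hg) (E _ Hh).
  set f := transverse_isometry _ _; set k := transverse_isometry _ _ => hd.
  have h2 : mdist (f (emb_ray catY rho)) (k (emb_ray catY rho)) < e / 4.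
    apply: le_lt_trans hd; rewrite /f /k !transverse_isometryE emb_ray_dist.
    exact: ray_dist_le.
  exact: isom_close hrho h2.
Qed.

(** The elements still seen in X one level further; commutators of H remain among them by
    [horo_part_comm]. *)
Definition horo_part : set G := [set g | N g /\ horo_invariant xi (al g)].

Hypothesis sN : is_subgroup N.
Hypothesis NH : N `<=` H.

Lemma horo_part_subgroup : is_subgroup horo_part.
Proof.
have [h1 hM _] := hal; case: (sN) => N1 NM NV; split.
- by split=> // x; rewrite h1.
- move=> g h [Ng ig] [Nh ih]; split; first exact: NM.
  by move=> x; rewrite hM ?ig ?ih//; exact: NH.
- move=> g [Ng ig]; split; first exact: NV.
  by move=> x; rewrite -ig (isom_actVK sH hal)//; exact: NH.
Qed.

Lemma horo_part_comm : (forall g h, H g -> H h -> N (ad g h)) ->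
  forall g h, H g -> H h -> horo_part (ad g h).
Proof.
move=> adN g h Hg Hh; split; first exact: adN.
have [_ HM HV] := sH; have [Hg' Hh'] := (HV _ Hg, HV _ Hh).
have -> : al (ad g h) = isom_comm (al g) (al h).
  rewrite /ad isom_actionM; [|exact: HM|exact: HM].
  by rewrite !isom_actionM// !isom_actionV.
by apply: horo_invariant_comm => //; exact: fixxi.
Qed.

Lemma transverse_approximable : approximable N al -> approximable horo_part al'.
Proof.
move=> apN s ps e sN' e0; have e2 : 0 < e / 2 by rewrite divr_gt0.
have [|r0 [S hS]] := @transverse_approx _ _ catY xi _ s al (fun g p => al' g p) ps _ e2.
  move=> g /sN'[Ng ig]; split=> //; exists (fixxi (NH Ng)) => p.
  by rewrite /al' (induced_isometryE catY (fixxi (NH Ng))).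
have [_ _ _ hd _] := hS S (lexx _).
pose l p := level S (r0 p).
have sN2 g : g \in s -> N g by move=> /sN'[].
have [r1 hr1] := apN s (map l ps) _ sN2 e2.
exists (r1 \o l) => g p q gs pp qp /=.
have := hr1 g _ _ gs (map_f l pp) (map_f l qp).
have := hd g p q gs pp qp; rewrite -/(l p) -/(l q).
generalize (mdist (a g (r1 (l p))) (r1 (l q))) (mdist (al g (l p)) (l q))
  (mdist (al' g p) q) => u v w; rewrite !ltr_norml; lra.
Qed.

End transverse_level.

End approximation.

(** * Fixed points of translations *)

Lemma nsq_pythagoras {R : realType} n (s : R) (e u : 'cV[R]_n) : e^T *m u = 0 ->
  nsq (s *: e + u) = s ^+ 2 * nsq e + nsq u.
Proof.
move=> eu.
have := congr1 (fun x : 'M[R]_1 => x 0 0) eu; rewrite !mxE => eu0.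
transitivity (s ^+ 2 * nsq e + 2 * s * (\sum_i e^T 0 i * u i 0) + nsq u); last first.
  by rewrite eu0; ring.
rewrite /nsq !mulr_sumr -!big_split /=; apply: eq_bigr => i _; rewrite !mxE; ring.
Qed.

Lemma exists_unit_kernel {R : realType} p n (T : 'M[R]_(p, n)) (e : 'cV[R]_n) :
  T *m e = 0 -> e != 0 -> exists2 u : 'cV[R]_n, T *m u = 0 & nsq u = 1.
Proof.
move=> Te e0; have c0 : 0 < nsq e.
  rewrite lt0r sumr_ge0 ?andbT => [|i _]; last exact: sqr_ge0.
  by apply: contra_neq e0; exact: nsq_eq0.
exists ((Num.sqrt (nsq e))^-1 *: e); first by rewrite -scalemxAr Te scaler0.
rewrite -[_ *: e]addr0 nsq_pythagoras ?mulmx0//.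
have -> : nsq (0 : 'cV[R]_n) = 0 by apply: big1 => i _; rewrite mxE expr0n.
by rewrite addr0 exprVn sqr_sqrtr ?(ltW c0)// mulVf ?gt_eqF.
Qed.

Section translations.
Context {R : realType} (Y : metricType R) (catY : cat0 Y).
Variables (p n : nat) (T : 'M[R]_(p, n)) (j : 'cV[R]_n -> Y).
Hypothesis jd : forall u v, T *m u = 0 -> T *m v = 0 ->
  mdist (j u) (j v) ^+ 2 = nsq (u - v).
Variable e : 'cV[R]_n.
Hypotheses (Te : T *m e = 0) (e1 : nsq e = 1).

Let line_kernel (t : R) w : T *m w = 0 -> T *m (t *: e + w) = 0.
Proof. by move=> Tw; rewrite mulmxDr -scalemxAr Te Tw scaler0 add0r. Qed.

Let jd' u v : T *m u = 0 -> T *m v = 0 -> mdist (j u) (j v) = Num.sqrt (nsq (u - v)).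
Proof. by move=> Tu Tv; rewrite -jd// sqrtr_sqr ger0_norm ?mdist_ge0. Qed.

Let line_ray (w : 'cV[R]_n) : T *m w = 0 -> is_ray (fun t => j (t *: e + w)).
Proof.
move=> Tw s t _ _; rewrite jd'; [|exact: line_kernel|exact: line_kernel].
have -> : s *: e + w - (t *: e + w) = (s - t) *: e + 0.
  by rewrite addr0 opprD addrACA subrr addr0 -scalerBl.
rewrite nsq_pythagoras ?mulmx0// e1 mulr1.
have -> : nsq (0 : 'cV[R]_n) = 0 by apply: big1 => i _; rewrite mxE expr0n.
by rewrite addr0 sqrtr_sqr.
Qed.

Let k0 : T *m 0 = 0 :> 'cV[R]_p. Proof. exact: mulmx0. Qed.

Let base_ray : ray Y := SigSub (mem_set (line_ray k0)).
Let xi : boundary Y := endpoint base_ray.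

Let line_asymptotic u v (ru rv : ray Y) : T *m u = 0 -> T *m v = 0 ->
  (forall t, ru t = j (t *: e + u)) -> (forall t, rv t = j (t *: e + v)) ->
  asymptotic ru rv.
Proof.
move=> Tu Tv hu hv; exists (mdist (j u) (j v)) => t _; rewrite hu hv.
rewrite !jd'; [|by []|by []|exact: line_kernel|exact: line_kernel].
by rewrite opprD addrACA subrr add0r.
Qed.

Let line_to (w : 'cV[R]_n) (Tw : T *m w = 0) :
  (SigSub (mem_set (line_ray Tw)) : ray Y) \in [set rho | endpoint rho = xi].
Proof.
apply/mem_set/endpointP; apply: (line_asymptotic Tw k0) => //.
Qed.

Let lray (w : 'cV[R]_n) : rays_to xi :=
  if pselect (T *m w = 0) is left Tw then SigSub (line_to Tw)
  else SigSub (line_to k0).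

Let lrayE w t : T *m w = 0 -> (val (lray w) : ray Y) t = j (t *: e + w).
Proof. by move=> Tw; rewrite /lray; case: pselect. Qed.

(* xi is the end of the line of direction e, and j' maps w to the parallel line
   through w. *)
Lemma project_flat : exists (xi : boundary Y) (j' : 'cV[R]_n -> transverse catY xi),
  let T' := col_mx T e^T in
  (forall u v, T' *m u = 0 -> T' *m v = 0 ->
    mdist (j' u) (j' v) ^+ 2 = nsq (u - v)) /\
  (forall (f : isometry Y) tau, T *m tau = 0 ->
    (forall w, T *m w = 0 -> f (j w) = j (w + tau)) ->
    boundary_map f xi = xi /\ exists2 tau', T' *m tau' = 0 &
      forall w, T' *m w = 0 -> induced_isometry catY xi f (j' w) = j' (w + tau')).
Proof.
have T'P (w : 'cV[R]_n) : col_mx T e^T *m w = 0 -> T *m w = 0 /\ e^T *m w = 0.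
  rewrite mul_col_mx => h; split.
    by rewrite -[LHS](col_mxKu _ (e^T *m w)) h; apply/matrixP => i k; rewrite !mxE.
  by rewrite -[LHS](col_mxKd (T *m w)) h; apply/matrixP => i k; rewrite !mxE.
exists xi, (fun w => emb_ray catY (lray w)); split.
  move=> u v /T'P[Tu eu] /T'P[Tv ev]; rewrite emb_ray_dist.
  suff -> : rays_to_dist (lray u) (lray v) = Num.sqrt (nsq (u - v)).
    by rewrite sqr_sqrtr// sumr_ge0// => i _; exact: sqr_ge0.
  apply/eqP; rewrite eq_le; apply/andP; split.
    rewrite -jd'//.
    have := @ray_dist_le _ _ (val (lray u)) (val (lray v)) 0 0 (lexx _) (lexx _).
    by rewrite !lrayE// !scale0r !add0r.
  apply: ler_eps => x x0.
  have [s [t [_ _]]] := ray_dist_adherent (val (lray u)) (val (lray v)) x0.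
  rewrite -/(rays_to_dist _ _) !lrayE// jd'; [|exact: line_kernel|exact: line_kernel].
  have -> : s *: e + u - (t *: e + v) = (s - t) *: e + (u - v).
    by rewrite opprD addrACA -scalerBl.
  rewrite nsq_pythagoras; last by rewrite mulmxBr eu ev subrr.
  rewrite e1 mulr1 => /ltW; apply: le_trans; rewrite ler_wsqrtr// lerDr.
  exact: sqr_ge0.
(* The component s of tau along e is absorbed by the time parameter of the rays; the rest tau' is
   the induced translation. *)
move=> f tau Ttau ft.
have Tw' w : T *m w = 0 -> T *m (w + tau) = 0 by move=> h; rewrite mulmxDr h Ttau addr0.
have fline w t : T *m w = 0 -> f (j (t *: e + w)) = j (t *: e + (w + tau)).
  by move=> Tw; rewrite ft ?addrA//; exact: line_kernel.
have fxi : boundary_map f xi = xi.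
  rewrite /xi boundary_map_endpoint; apply/endpointP.
  apply: (line_asymptotic (Tw' _ k0) k0) => // t.
  by rewrite -fline.
split=> //; pose s := (e^T *m tau) 0 0; pose tau' := tau - s *: e.
have esc : e^T *m tau = s%:M by rewrite [LHS]mx11_scalar.
have ee : e^T *m e = 1%:M by rewrite [LHS]mx11_scalar -nsqE e1.
have T'tau' : col_mx T e^T *m tau' = 0.
  rewrite mul_col_mx /tau' !mulmxBr -!scalemxAr Te Ttau scaler0 subr0 esc ee.
  by rewrite scalemx1 subrr col_mx0.
exists tau' => // w T'w; have [Tw ew] := T'P _ T'w; have [Tt et] := T'P _ T'tau'.
rewrite (induced_isometryE catY fxi) transverse_isometryE.
apply: mdist_positivity; rewrite emb_ray_dist; apply/eqP; rewrite eq_le ray_dist_ge0 andbT.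
have Twt : T *m (w + tau') = 0 by rewrite mulmxDr Tw Tt addr0.
(* Nonnegative times at which the image of the line through w and the line through w + tau' pass
   through the same point. *)
have [n0 [m0 ns]] : exists n0 m0 : R, [/\ 0 <= n0, 0 <= m0 & m0 = n0 + s].
  have [s0|s0] := lerP 0 s; [exists 0, s; split; lra|exists (- s), 0; split; lra].
have [n1 m1 E] := ns.
have := @ray_dist_le _ _ (val (rays_to_map fxi (lray w))) (val (lray (w + tau'))) n0 m0 n1 m1.
rewrite lrayE// /ray_fun /= -/(ray_fun _) -[val (lray w) n0]/((val (lray w) : ray Y) n0).
rewrite lrayE// fline//.
have -> : n0 *: e + (w + tau) = m0 *: e + (w + tau').
  rewrite E /tau'; apply/matrixP => i k; rewrite !mxE; ring.
by rewrite mdistxx.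
Qed.

End translations.

Lemma rank_kernel_row {R : realType} p n (T : 'M[R]_(p, n)) (e : 'cV[R]_n) :
  T *m e = 0 -> nsq e = 1 -> (\rank T < \rank (col_mx T e^T))%N.
Proof.
move=> Te e1; apply: rank_ltmx; rewrite ltmxE -addsmxE addsmxSl/=; apply/negP; rewrite -addsmxE => h.
have /submxP[D eD] := submx_trans (addsmxSr T e^T) h.
have := nsqE e; rewrite eD -mulmxA Te mulmx0 mxE e1 => /eqP.
by rewrite oner_eq0.
Qed.

(** The flat is parametrized by ker T, so that removing a direction appends a row to T and lowers n
    - rank T. When the kernel is 0, the translations are trivial and [j 0] is fixed. *)
Lemma translations_fix {R : realType} n m (I : Type) (D : set I) :
  forall (Y : metricType R) (catY : cat0 Y) p (T : 'M[R]_(p, n))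
    (j : 'cV[R]_n -> Y) (f : I -> isometry Y), seq_complete Y ->
  (forall u v, T *m u = 0 -> T *m v = 0 -> mdist (j u) (j v) ^+ 2 = nsq (u - v)) ->
  (forall i, D i -> exists2 tau, T *m tau = 0 &
    forall w, T *m w = 0 -> f i (j w) = j (w + tau)) ->
  (n - \rank T < m)%N -> exists q : refined_point Y, forall i, D i -> fixes (f i) q.
Proof.
elim: m => [//|m IH] Y catY p T j f cY jd ft nm.
have [[e [Te e0]]|noe] := pselect (exists e : 'cV[R]_n, T *m e = 0 /\ e != 0); last first.
  exists (here (j 0)) => i /ft[tau Ttau h]; rewrite /= h ?mulmx0// add0r.
  by congr j; apply: contrapT => tau0; apply: noe; exists tau; split=> //; apply/eqP.
have [u Tu u1] := exists_unit_kernel Te e0.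
have [xi [j' [j'd j'f]]] := project_flat catY jd Tu u1.
have catY' := stewart_cat0 (@transverse_stewart _ _ catY xi cY).
have [||||q hq] := IH _ catY' _
  (col_mx T u^T) j' (fun i => induced_isometry catY xi (f i)).
- exact: transverse_complete.
- exact: j'd.
- by move=> i Di; have [tau Tt ht] := ft i Di; have [_] := j'f _ _ Tt ht.
- have lt := rank_kernel_row Tu u1; have := rank_leq_col (col_mx T u^T).
  by move: lt nm; lia.
exists (toward q) => i Di /=; have [tau Tt ht] := ft i Di.
have [fxi _] := j'f _ _ Tt ht; exists fxi.
by rewrite -(induced_isometryE catY fxi); exact: hq.
Qed.

(** * The action on the minimal flat *)

Section invariant_flat.
Context {R : realType} {G : topologicalGroupType} (H : set G).
Variables (Y : metricType R) (hY : cat0 Y) (cY : seq_complete Y) (x0 : Y).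
Hypothesis bY : bounded_geometry Y.
Variable (al : G -> isometry Y).
Hypothesis amH : amenable_subgroup R H.
Hypothesis hal : isom_action H al.
Hypothesis noxi : ~ exists xi, forall h, H h -> boundary_map (al h) xi = xi.

(** [minimal_flat] is applied to a minimal invariant convex subset regarded as a space Z of its own;
    Q inverts the coordinates b. *)
Lemma invariant_flat : exists n (Q : 'cV[R]_n -> Y) (A : G -> 'M[R]_n)
    (t : G -> 'cV[R]_n),
  (forall u v, mdist (Q u) (Q v) ^+ 2 = nsq (u - v)) /\
  forall h, H h -> (A h)^T *m A h = 1%:M /\
    forall v, al h (Q v) = Q (A h *m v + t h).
Proof.
have sH : is_subgroup H by case: amH.
have [C [[[c Cc] clC cvC iC] minC]] := minimal_invariant_convex hY cY x0 sH hal noxi bY.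
pose Z := submetric C; pose be h := sub_isometry C (al h).
have catZ : cat0 Z := submetric_cat0 hY cvC.
have cZ : seq_complete Z := submetric_complete clC cY.
have iC' h x : H h -> C x -> C (al h x) by exact: iC.
have hbe : isom_action H be := sub_isom_action sH hal iC'.
have valE h (x : Z) : H h -> val (be h x) = al h (val x).
  by move=> Hh; apply: sub_isometryE; exact: invariant_preserves sH hal iC' _ Hh.
have vd (x y : Z) : mdist (val x : Y) (val y) = mdist x y by exact: submetric_dist.
have noxiZ : ~ exists xi, forall h, H h -> boundary_map (be h) xi = xi.
  move=> h; apply: noxi; apply: (embedding_fixed_boundary vd _ h) => g z Hg.
  exact: valE.
have minZ (D : set Z) : invariant_convex H be D -> D = setT.
  move=> [[d Dd] clD cvD iD].
  have e : [set val x | x in D] = C.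
    apply: minC; last by move=> _ [x _ <-]; exact: submetric_in.
    split.
    - by exists (val d), d.
    - apply/closedE_mdist => y hy.
      have Cy : C y.
        apply: ((closedE_mdist C).1 clC y) => e e0; have [_ [x _ <-] hx] := hy e e0.
        by exists (val x) => //; exact: submetric_in.
      exists (to_submetric Cy) => //; apply: ((closedE_mdist D).1 clD) => e e0.
      have [_ [x Dx <-] hx] := hy e e0; exists x => //.

    - move=> _ _ l [x Dx <-] [y Dy <-] l01; exists (conv x y l); first exact: cvD.
      exact: (isom_conv (f := fun x : Z => val x : Y)).
    - by move=> h _ Hh [x Dx <-]; exists (be h x); [exact: iD|exact: valE].
  apply/seteqP; split=> // x _.
  have [y Dy yx] : [set val x | x in D] (val x) by rewrite e; exact: submetric_in.
  by rewrite -(val_inj yx).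
have [n [b [bd bs bA]]] := minimal_flat catZ cZ (to_submetric Cc)
  (embedding_bounded_geometry vd bY) amH hbe noxiZ minZ.
have [Q hQ] : exists Q : 'cV[R]_n -> Z, forall v i, b i (Q v) = v i 0.
  suff /choice : forall v : 'cV[R]_n, exists y : Z, forall i, b i y = v i 0.
    by move=> [Q hQ]; exists Q.
  by move=> v; exact: bs (fun i => v i 0).
have [A hA] : exists A : G -> 'M[R]_n, forall h, H h -> (A h)^T *m A h = 1%:M /\
  forall x y i, b i (be h x) - b i (be h y) = \sum_j A h i j * (b j x - b j y).
  suff /choice : forall h, exists A : 'M[R]_n, H h -> A^T *m A = 1%:M /\
    forall x y i, b i (be h x) - b i (be h y) = \sum_j A i j * (b j x - b j y).
    by move=> [A hA]; exists A.
  move=> h; have [Hh|nH] := pselect (H h); last by exists 1%:M.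
  by have [A hA] := bA h Hh; exists A.
pose t h : 'cV[R]_n := \col_i b i (be h (Q 0)).
exists n, (fun v => val (Q v)), A, t; split.
  move=> u v; rewrite vd bd; apply: eq_bigr => i _; rewrite !hQ !mxE; ring.
move=> h Hh; have [oA bhA] := hA h Hh; split=> // v.
rewrite -valE//; apply: mdist_positivity; apply/eqP.
rewrite -sqrf_eq0; apply/eqP; rewrite vd bd big1// => i _; rewrite hQ.
have := bhA (Q v) (Q 0) i => /eqP; rewrite subr_eq => /eqP ->.
rewrite !mxE (_ : \sum_j _ = \sum_j A h i j * v j 0) ?subrr ?expr0n//.
by apply: eq_bigr => j _; rewrite !hQ mxE subr0.
Qed.

End invariant_flat.

Section discreteness.
Context {R : realType} {G : topologicalGroupType} {X : metricType R}.
Variable a : isometric_action G X.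
Hypothesis hX : hadamard X.
Hypothesis lcX : locally_compact [set: X].
Hypothesis propera : proper_action a.
Hypothesis coca : cocompact_action a.
Hypothesis tdG : totally_disconnected [set: G].
Variables (N : set G) (Y : metricType R) (al : G -> isometry Y).
Hypothesis sN : is_subgroup N.
Hypothesis apN : approximable a N al.
Variables (n : nat) (Q : 'cV[R]_n -> Y) (A : G -> 'M[R]_n) (t : G -> 'cV[R]_n).
Hypothesis al1 : forall x, al 1%g x = x.
Hypothesis Qd : forall u v, mdist (Q u) (Q v) ^+ 2 = nsq (u - v).
Hypothesis AM : forall g h, N g -> N h -> A (g * h)%g = A g *m A h.
Hypothesis tM : forall g h, N g -> N h -> t (g * h)%g = A g *m t h + t g.
Hypothesis A1 : A 1%g = 1%:M.
Hypothesis alQ : forall g v, N g -> al g (Q v) = Q (A g *m v + t g).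

Let NX g j : N g -> N (g ^+ j)%g.
Proof.
by case: sN => N1 NM _ Ng; elim: j => [|j IH]; rewrite ?expg0// expgS; exact: NM.
Qed.

Let AX g j : N g -> A (g ^+ j)%g = A g ^+ j.
Proof.
move=> Ng; elim: j => [|j IH]; first by rewrite expg0 A1.
by rewrite expgS AM ?IH ?exprS//; exact: NX.
Qed.

Let tX g j : N g -> A g = 1%:M -> t (g ^+ j)%g = j%:R *: t g.
Proof.
move=> Ng Ag; have t1 : t 1%g = 0.
  have N1 : N 1%g by case: sN.
  have := tM N1 N1; rewrite mulg1 A1 mul1mx => /(congr1 (fun x => x - t 1%g)).
  by rewrite addrK subrr.
elim: j => [|j IH]; first by rewrite expg0 t1 scale0r.
by rewrite expgS tM ?IH ?Ag ?mul1mx -?natr1 ?scalerDl ?scale1r//; exact: NX.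
Qed.

Let entry_le (u : 'cV[R]_n) i (x : R) : 0 <= x -> nsq u <= x ^+ 2 -> `|u i 0| <= x.
Proof.
move=> x0 h; apply: ler_of_sqr => //; rewrite real_normK ?num_real//.
apply: le_trans h; rewrite /nsq (bigD1 i)//= lerDl; apply: sumr_ge0 => k _.
exact: sqr_ge0.
Qed.

Let Q_le u v : mdist (Q u) (Q v) <= mxn (u - v).
Proof.
apply: ler_of_sqr; first exact: mxn_ge0.
rewrite Qd /nsq /mxn; set w := u - v.
have -> : \sum_i \sum_j `|w i j| = \sum_i `|w i 0|.
  by apply: eq_bigr => i _; rewrite big_ord1.
have [] // : 0 <= \sum_i `|w i 0| /\ \sum_i w i 0 ^+ 2 <= (\sum_i `|w i 0|) ^+ 2.
elim/big_ind2 : _ => [|x x' y y' [h1 h2] [h3 h4]|i _]; first by rewrite expr0n.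
  by split; [exact: addr_ge0|rewrite sqrrD; have := mulr_ge0 h1 h3; lra].
by rewrite real_normK ?num_real.
Qed.

(* If g moves the vertices of a simplex very little, then so do all its powers, by
   almost_stabilizer; hence A g = 1, and the multiples of t g stay bounded. *)
Lemma flat_discrete : exists2 e : R, 0 < e & forall g, N g ->
  mxn (A g - 1%:M) < e -> mxn (t g) < e -> A g = 1%:M /\ t g = 0.
Proof.
(* Entries of A (g ^+ j) - 1 will be at most 4 eta, so the sum of all n^2 of them stays below the
   1/2 of [no_small_subgroup]. *)
pose eta : R := (16 * (n%:R * n%:R + 1))^-1.
have eta0 : 0 < eta by rewrite invr_gt0 mulr_gt0// ltr_wpDl// mulr_ge0.
pose v (i : 'I_n.+1) : 'cV[R]_n := if unlift ord0 i is Some k then delta_mx k 0 else 0.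
have v0 : v ord0 = 0 by rewrite /v unlift_none.
have vk k : v (lift ord0 k) = delta_mx k 0 by rewrite /v liftK.
have v1 i : mxn (v i) <= 1.
  rewrite /v; case: unliftP => [k _|_].
    rewrite /mxn (bigD1 k)//= big_ord1 mxE eqxx normr1 big1 ?addr0// => j jk.
    by rewrite big_ord1 mxE (negPf jk) normr0.
  by rewrite /mxn big1// => j _; rewrite big1// => k _; rewrite mxE normr0.
have [e e0 he] := almost_stabilizer hX lcX propera coca tdG n 2 eta0.
exists (e / 4); first by rewrite divr_gt0.
move=> g Ng hA ht; have N1 : N 1%g by case: sN.
pose del := Num.min (e / 4) (Num.min eta 1).
have del0 : 0 < del by rewrite !lt_min divr_gt0//= eta0 ltr01.
(* The approximating points of X depend on j, but e does not, thanks to the uniformity of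
   [almost_stabilizer]. The unit is listed with g and its power so that these points have nearly the
   right mutual distances. *)
have disp j i : mdist (al (g ^+ j)%g (Q (v i))) (Q (v i)) < 2 * eta.
  have sN' h : h \in [:: 1%g; g; (g ^+ j)%g] -> N h.
    by rewrite !inE => /or3P[]/eqP ->//; exact: NX.
  have [r hr] := apN (map (fun i => Q (v i)) (enum 'I_n.+1)) sN' del0.
  have vin k : Q (v k) \in map (fun i => Q (v i)) (enum 'I_n.+1).
    by apply/mapP; exists k; rewrite ?mem_enum.
  pose x k := r (Q (v k)).
  have [dl1 [dl2 dl3]] : del <= e / 4 /\ del <= eta /\ del <= 1.
    by rewrite /del !ge_min !lexx !orbT.
  have xK k : mdist (x ord0) (x k) <= 2.
    have := hr 1%g _ _ (mem_head _ _) (vin ord0) (vin k).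
    rewrite act1 al1 -/(x _) -/(x k); have := Q_le (v ord0) (v k).
    rewrite v0 sub0r mxnN; have := v1 k.
    generalize (mdist (x ord0) (x k)) (mdist (Q 0) (Q (v k))) => p q.
    rewrite ltr_norml; lra.
  have [U [sU _ _ hU1 hU2]] := he x xK.
  have Ug : U g.
    apply: hU1 => k.
    have gin : g \in [:: 1%g; g; (g ^+ j)%g] by rewrite !inE eqxx orbT.
    have := hr g _ _ gin (vin k) (vin k); rewrite -/(x k).
    have := Q_le (A g *m v k + t g) (v k); rewrite -alQ//.
    have -> : A g *m v k + t g - v k = (A g - 1%:M) *m v k + t g.
      by rewrite mulmxBl mul1mx addrAC.
    move=> /le_trans - /(_ _ (mxnD _ _)).
    have := mxnM (A g - 1%:M) (v k); have := v1 k; have := mxn_ge0 (A g - 1%:M).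
    have := mxn_ge0 (v k).
    move: hA ht; generalize (mxn (A g - 1%:M)) (mxn (v k)) (mxn (t g))
      (mxn ((A g - 1%:M) *m v k))
      (mdist (a g (x k)) (x k)) (mdist (al g (Q (v k))) (Q (v k))).
    move=> p1 p2 p3 p4 p6 p7 h1 h2 h3 h4 h5 h6 h7.
    have : p1 * p2 <= p1 by rewrite ler_piMr.
    rewrite ltr_norml; lra.
  have Ugj : U (g ^+ j)%g.
    by case: sU => U1 UM _; elim: (j) => [|j' IH]; rewrite ?expg0// expgS; exact: UM.
  have := hU2 _ i Ugj.
  have gjn : (g ^+ j)%g \in [:: 1%g; g; (g ^+ j)%g] by rewrite !inE eqxx !orbT.
  have := hr _ _ _ gjn (vin i) (vin i); rewrite -/(x i).
  generalize (mdist (a (g ^+ j)%g (x i)) (x i)) (mdist (al (g ^+ j)%g (Q (v i))) (Q (v i))).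
  by move=> p q; rewrite ltr_norml; lra.
have disp' j i k : `|(A (g ^+ j)%g *m v i + t (g ^+ j)%g - v i) k 0| <= 2 * eta.
  apply: entry_le; first by rewrite mulr_ge0// ltW.
  rewrite -Qd -alQ; last exact: NX.
  by rewrite lerXn2r ?nnegrE ?mdist_ge0 ?mulr_ge0 ?(ltW eta0)// ltW.
have tk j k : `|t (g ^+ j)%g k 0| <= 2 * eta.
  by have := disp' j ord0 k; rewrite v0 mulmx0 add0r subr0.
have tri (x y z : R) : `|y + z| <= x -> `|z| <= x -> `|y| <= 2 * x.
  by rewrite !ler_norml; lra.
have Ag : A g = 1%:M.
  apply: no_small_subgroup => j; rewrite -AX//; set C := A (g ^+ j)%g.
  apply: (@le_trans _ _ (\sum_(i < n) \sum_(k < n) 4 * eta)).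
    apply: ler_sum => i _; apply: ler_sum => k _.
    have := tk j i; have := disp' j (lift ord0 k) i.
    have -> : (A (g ^+ j)%g *m v (lift ord0 k) + t (g ^+ j)%g - v (lift ord0 k)) i 0 =
        (C - 1) i k + t (g ^+ j)%g i 0.
      by rewrite vk -colE !mxE eqxx andbT -/C addrAC.
    move=> h1 h2; apply: le_trans (tri _ _ _ h1 h2) _.
    by rewrite mulrA -natrM.
  rewrite !sumr_const !card_ord -mulrnA -[leLHS]mulr_natl natrM /eta.
  set m := n%:R * n%:R; have m0 : 0 <= m by rewrite mulr_ge0.
  rewrite mulrA ler_pdivrMr ?mulr_gt0//; lra.
split=> //; apply/matrixP => i k; rewrite ord1 mxE; apply/eqP; rewrite -normr_eq0.
rewrite eq_le normr_ge0 andbT leNgt; apply/negP => ti0.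
pose j := (Num.truncn (2 * eta / `|t g i 0|)).+1.
have := tk j i; rewrite tX// mxE normrM ger0_norm// leNgt => /negP; apply.
by rewrite -ltr_pdivrMr//; exact: truncnS_gt.
Qed.

End discreteness.

(** * Amenable subgroups virtually fix a refined point *)

Section amenable_subgroups.
Context {R : realType} {G : topologicalGroupType} {X : metricType R}.
Variable a : isometric_action G X.
Hypothesis hX : hadamard X.
Hypothesis lcX : locally_compact [set: X].
Hypothesis propera : proper_action a.
Hypothesis coca : cocompact_action a.
Hypothesis tdG : totally_disconnected [set: G].
Variable H : set G.
Hypothesis amH : amenable_subgroup R H.

Let sH : is_subgroup H. Proof. by case: amH. Qed.

Definition virtually_fixes (Y : metricType R) (al : G -> isometry Y) : Prop :=
  exists K : set G, [/\ is_subgroup K, K `<=` H, finite_index K H &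
    exists p : refined_point Y, forall k, K k -> fixes (al k) p].

Lemma flat_virtually_fixes (N : set G) (Y : metricType R) (al : G -> isometry Y) :
  cat0 Y -> seq_complete Y -> Y -> bounded_geometry Y -> isom_action H al ->
  is_subgroup N -> N `<=` H -> (forall g h, H g -> H h -> N (ad g h)) ->
  approximable a N al ->
  ~ (exists xi, forall h, H h -> boundary_map (al h) xi = xi) ->
  virtually_fixes al.
Proof.
move=> catY cY y0 bY hal sN NH adN apN noxi.
have [n [Q [A [t [Qd hA]]]]] := invariant_flat catY cY y0 bY amH hal noxi.
have [al1 alM _] := hal.
have Qinj u v : Q u = Q v -> u = v.
  move=> e; have := Qd u v; rewrite e mdistxx expr0n /= => /esym/nsq_eq0/eqP.
  by rewrite subr_eq0 => /eqP.
have mext (B C : 'M[R]_n) : (forall v : 'cV[R]_n, B *m v = C *m v) -> B = C.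
  move=> h; apply/matrixP => i k; have := h (delta_mx k 0); rewrite -!colE.
  by move=> /(congr1 (fun x : 'cV[R]_n => x i 0)); rewrite !mxE.
have HM g h : H g -> H h -> H (g * h)%g by case: sH => _ h' _; exact: h'.
have E g h v : H g -> H h -> A (g * h)%g *m v + t (g * h)%g =
    A g *m (A h *m v + t h) + t g.
  move=> Hg Hh; apply: Qinj; have [_ <-] := hA _ (HM _ _ Hg Hh); rewrite alM//.
  by have [_ ->] := hA _ Hh; have [_ ->] := hA _ Hg.
have tM g h : H g -> H h -> t (g * h)%g = A g *m t h + t g.
  by move=> Hg Hh; have := E g h 0 Hg Hh; rewrite !mulmx0 !add0r.
have AM g h : H g -> H h -> A (g * h)%g = A g *m A h.
  move=> Hg Hh; apply: mext => v; have := E g h v Hg Hh.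
  by rewrite mulmxDr -addrA -tM// mulmxA => /addIr.
have oA h : H h -> (A h)^T *m A h = 1%:M by move=> /hA[].
have A1 : A 1%g = 1%:M.
  have H1 : H 1%g by case: sH.
  have := AM _ _ H1 H1; rewrite mulg1 => /(congr1 (mulmx (A 1%g)^T)).
  by rewrite mulmxA oA// mul1mx => <-.
have gap := flat_discrete hX lcX propera coca tdG sN apN al1 Qd
  (fun g h Ng Nh => AM g h (NH _ Ng) (NH _ Nh))
  (fun g h Ng Nh => tM g h (NH _ Ng) (NH _ Nh)) A1
  (fun g v Ng => (hA g (NH _ Ng)).2 v).
have [T [z [K [sK KH fK hK]]]] := discrete_translations sH NH AM tM oA adN gap.
exists K; split=> //.
apply: (@translations_fix _ n (n - \rank T).+1 _ K _ catY _ T (fun w => Q (z + w))) => //.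
- by move=> u v _ _; rewrite Qd opprD addrACA subrr add0r.
move=> k Kk; have [k1 k2] := hK k Kk; exists (A k *m z + t k - z) => // w Tw.
have [_ ->] := hA _ (KH _ Kk); rewrite mulmxDr (k1 w Tw); congr (Q _).
by move: (A k *m z) => u; apply/matrixP => i j; rewrite !mxE; ring.
Qed.

(** Induction on a bound d for orthoframes, which [transverse_orthoframe] lowers by one at each
    fixed boundary point. K fixes the boundary points met on the way because all of H does; a
    subgroup of finite index is taken only at the flat. *)
Lemma amenable_virtually_fixes d : forall (N : set G) (Y : metricType R)
    (al : G -> isometry Y),
  cat0 Y -> seq_complete Y -> Y -> bounded_geometry Y -> isom_action H al ->
  is_subgroup N -> N `<=` H -> (forall g h, H g -> H h -> N (ad g h)) ->
  approximable a N al -> ~ orthoframe Y d -> virtually_fixes al.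
Proof.
elim: d => [|d IH] N Y al catY cY y0 bY hal sN NH adN apN od.
  by case: od; exact: orthoframe0.
have [[xi fixxi]|noxi] := pselect (exists xi, forall h, H h -> boundary_map (al h) xi = xi);
  last exact: flat_virtually_fixes catY cY y0 bY hal sN NH adN apN noxi.
have rho0 : rays_to xi by exists (repr xi); apply/mem_set; exact: reprK.
have [||||||||||K [sK KH fK [q hq]]] := IH (horo_part N xi al) _
  (fun g => induced_isometry catY xi (al g)).
- exact/stewart_cat0/transverse_stewart.
- exact: transverse_complete.
- exact: emb_ray rho0.
- exact: transverse_bounded_geometry.
- exact: transverse_isom_action.
- exact: horo_part_subgroup hal _ _.
- by move=> g [Ng _]; exact: NH.
- exact: horo_part_comm.
- exact: (transverse_approximable fixxi NH apN).
- by move=> /transverse_orthoframe.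
exists K; split=> //; exists (toward q) => k Kk /=.
by exists (fixxi k (KH _ Kk)); rewrite -induced_isometryE; exact: hq.
Qed.

End amenable_subgroups.

Theorem theorem1p4 (R : realType) (X : metricType R) (G : topologicalGroupType)
    (a : isometric_action G X) :
  hadamard X -> locally_compact [set: X] ->
  totally_disconnected [set: G] ->
  proper_action a -> cocompact_action a ->
  (forall H : set G, amenable_subgroup R H ->
     exists K : set G, [/\ is_subgroup K, K `<=` H, finite_index K H &
       exists p : refined_point X, K `<=` stabilizer a p]) /\
  (forall p : refined_point X, amenable_subgroup R (stabilizer a p)).
Proof.
move=> hX lcX tdG propera coca; split; last exact: stabilizer_amenable.
move=> H amH; have [[x0] catX cX] := hX; have sH : is_subgroup H by case: amH.
have bX : bounded_geometry X by exact: bounded_geometryX coca.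
have [d od] := orthoframe_bound bX.
have hal : isom_action H (act_isometry a).
  split=> [x|g h x _ _|g x e _ e0]; [exact: act1|exact: actM|].
  by apply: filterS (act_nbhs a g x e0) => h hh _.
have adH g h : H g -> H h -> H (ad g h).
  by case: sH => _ HM HV Hg Hh; apply: (HM); apply: (HM) => //; exact: HV.
have [K [sK KH fK [p hp]]] := amenable_virtually_fixes hX lcX propera coca tdG amH
  catX cX x0 bX hal sH (fun _ => id) adH (@approximable_self _ _ _ a H) od.
by exists K; split=> //; exists p.
Qed.
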